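(* Let $\Phi\in L^\infty(\mathbb{M}_{n,n})$ satisfy $\|H_\Phi\|\le1$ and $\|H_\Phi\|_{\mathrm e}<1$, and let $r$ be the number of superoptimal singular values of $\Phi$ equal to $1$. Then for any integers $d_r,\dots,d_{n-1}$ with $0\le d_r\le d_{r+1}\le\cdots\le d_{n-1}$ there exists a unitary interpolant $U$ of $\Phi$ such that $\|H_{U^*}\|_{\mathrm e}<1$ and the nonnegative Wiener–Hopf indices of $U$ are exactly $d_r,d_{r+1},\dots,d_{n-1}$.
   Context: Notation: $\mathbb{T}$ unit circle, $z$ the identity function, $\mathbb{M}_{m,n}$ complex $m\times n$ matrices. $H^2_-(\mathbb{C}^m)=L^2(\mathbb{C}^m)\ominus H^2(\mathbb{C}^m)$, $\mathbb{P}_\pm$ orthogonal projections onto $H^2$, $H^2_-$. Hankel operator $H_\Phi f=\mathbb{P}_-\Phi f$, Toeplitz operator $T_\Phi f=\mathbb{P}_+\Phi f$, on $H^2(\mathbb{C}^n)$; $\|\cdot\|_{\mathrm e}$ the essential norm. A unitary interpolant of $\Phi$ is a unitary-valued $U\in L^\infty(\mathbb{M}_{n,n})$ with $\Phi-U\in H^\infty(\mathbb{M}_{n,n})$. If $U$ is unitary-valued with $\|H_U\|_{\mathrm e}<1$ and $\|H_{U^*}\|_{\mathrm e}<1$, then $T_U$ is Fredholm and $U=Q_2^*\,\mathrm{diag}(z^{d_0},\dots,z^{d_{n-1}})\,Q_1$ with $Q_i,Q_i^{-1}\in H^2(\mathbb{M}_{n,n})$ and integers $d_0\le\cdots\le d_{n-1}$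 uniquely determined by $U$ (the Wiener–Hopf indices). Superoptimal singular values: let $\Omega_0$ be the set of $F\in H^\infty(\mathbb{M}_{n,n})$ minimizing $t_0=\operatorname{ess\,sup}_\zeta\|\Phi(\zeta)-F(\zeta)\|$, and for $j\ge1$ let $\Omega_j$ be the set of $F\in\Omega_{j-1}$ minimizing $t_j=\operatorname{ess\,sup}_\zeta s_j(\Phi(\zeta)-F(\zeta))$, where $s_j(A)=\inf\{\|A-R\|:\operatorname{rank}R\le j\}$; $t_0,\dots,t_{n-1}$ are the superoptimal singular values of $\Phi$. *)

(* Defs.v *)
From HB Require Import structures.
From mathcomp Require Import all_boot all_order all_algebra.
From mathcomp Require Import all_classical all_reals all_analysis.
From mathcomp Require Import complex.
Set Implicit Arguments. Unset Strict Implicit. Unset Printing Implicit Defensive.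
Import Order.TTheory GRing.Theory Num.Theory.
Import numFieldNormedType.Exports.
Local Open Scope classical_set_scope.
Local Open Scope ring_scope.

Section Defs.
Variable R : realType.
Local Notation C := (complex.complex R).
Local Notation mu := (@lebesgue_measure R).

(* The unit circle T is parametrized by t in [0,1] via t |-> exp(2 pi i t);
   normalized Lebesgue measure on T corresponds to Lebesgue measure on [0,1]. *)
Definition I01 : set R := `[0%R, 1%R].

Definition aeT (P : R -> Prop) : Prop :=
  mu.-negligible [set t | I01 t /\ ~ P t].

Definition zeta (t : R) : C := complex.Complex (cos (2 * pi * t)) (sin (2 * pi * t)).

Definition cmeas (g : R -> C) : Prop :=
  measurable_fun I01 (fun t => complex.Re (g t)) /\ measurable_fun I01 (fun t => complex.Im (g t)).
Definition cint (g : R -> C) : C :=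
  complex.Complex (Rintegral mu I01 (fun t => complex.Re (g t)))
          (Rintegral mu I01 (fun t => complex.Im (g t))).

Definition cabs (z : C) : R := Num.sqrt (complex.Re z ^+ 2 + complex.Im z ^+ 2).

Definition vnorm m (v : 'cV[C]_m) : R :=
  Num.sqrt (\sum_(i < m) cabs (v i 0) ^+ 2).

Definition l2sq m (f : R -> 'cV[C]_m) : \bar R :=
  (\int[mu]_(t in I01) ((vnorm (f t)) ^+ 2)%:E)%E.
Definition isL2 m (f : R -> 'cV[C]_m) : Prop :=
  (forall i, cmeas (fun t => f t i 0)) /\ (l2sq f < +oo)%E.
Definition l2norm m (f : R -> 'cV[C]_m) : R := Num.sqrt (fine (l2sq f)).

Definition fcoef m (f : R -> 'cV[C]_m) (k : int) : 'cV[C]_m :=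
  \col_i cint (fun t => f t i 0 * zeta t ^ (- k)).
Definition mcoef m n (F : R -> 'M[C]_(m, n)) (k : int) : 'M[C]_(m, n) :=
  \matrix_(i, j) cint (fun t => F t i j * zeta t ^ (- k)).

Definition H2 m (f : R -> 'cV[C]_m) : Prop :=
  isL2 f /\ forall k : int, k < 0 -> fcoef f k = 0.
Definition H2minus m (f : R -> 'cV[C]_m) : Prop :=
  isL2 f /\ forall k : int, 0 <= k -> fcoef f k = 0.

Definition Pminus m (g h : R -> 'cV[C]_m) : Prop :=
  H2minus h /\ forall k : int, k < 0 -> fcoef h k = fcoef g k.

Definition Linfty m n (F : R -> 'M[C]_(m, n)) : Prop :=
  (forall i j, cmeas (fun t => F t i j)) /\
  exists M : R, aeT (fun t => forall i j, cabs (F t i j) <= M).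
Definition Hinf m n (F : R -> 'M[C]_(m, n)) : Prop :=
  Linfty F /\ forall k : int, k < 0 -> mcoef F k = 0.
Definition H2mx m n (F : R -> 'M[C]_(m, n)) : Prop :=
  forall j, H2 (fun t => col j (F t)).

Definition mulf m n (F : R -> 'M[C]_(m, n)) (f : R -> 'cV[C]_n) : R -> 'cV[C]_m :=
  fun t => F t *m f t.

Definition ctr m n (A : 'M[C]_(m, n)) : 'M[C]_(n, m) := map_mx (@complex.conjc R) A^T.
Definition ctrf m n (F : R -> 'M[C]_(m, n)) : R -> 'M[C]_(n, m) := fun t => ctr (F t).

Definition hankel_norm_le n (Phi : R -> 'M[C]_n) (c : R) : Prop :=
  forall f, H2 f -> forall h, Pminus (mulf Phi f) h -> l2norm h <= c * l2norm f.

(* compact linear operators H^2(C^n) -> H^2_-(C^n), acting on representatives *)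
Definition compact_op n (K : (R -> 'cV[C]_n) -> (R -> 'cV[C]_n)) : Prop :=
  [/\ (forall f, H2 f -> H2minus (K f)),
      (forall f g, H2 f -> H2 g -> aeT (fun t => f t = g t) ->
                   aeT (fun t => K f t = K g t)),
      (forall (a b : C) f g, H2 f -> H2 g ->
         aeT (fun t => K (fun s => a *: f s + b *: g s) t = a *: K f t + b *: K g t)) &
      (forall u : nat -> (R -> 'cV[C]_n), (forall k, H2 (u k)) ->
         (exists M : R, forall k, l2norm (u k) <= M) ->
         exists phi : nat -> nat, (forall k, (phi k < phi k.+1)%N) /\
           forall e : R, 0 < e -> exists N : nat, forall p q : nat, (N <= p)%N -> (N <= q)%N ->
             l2norm (fun t => K (u (phi p)) t - K (u (phi q)) t) < e)].

Definition ess_hankel_lt1 n (Phi : R -> 'M[C]_n) : Prop :=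
  exists K, compact_op K /\ exists c : R, c < 1 /\
    forall f, H2 f -> forall h, Pminus (mulf Phi f) h ->
      l2norm (fun t => h t - K f t) <= c * l2norm f.

Definition unitary_valued n (U : R -> 'M[C]_n) : Prop :=
  (forall i j, cmeas (fun t => U t i j)) /\ aeT (fun t => ctr (U t) *m U t = 1%:M).
Definition unitary_interpolant n (Phi U : R -> 'M[C]_n) : Prop :=
  unitary_valued U /\ Hinf (fun t => Phi t - U t).

Definition WH_factorization n (U : R -> 'M[C]_n) (k : 'I_n -> int) : Prop :=
  (forall i j : 'I_n, (i <= j)%N -> k i <= k j) /\
  exists Q1 Q2 Q1i Q2i : R -> 'M[C]_n,
    [/\ H2mx Q1, H2mx Q2, H2mx Q1i & H2mx Q2i] /\
    [/\ aeT (fun t => Q1 t *m Q1i t = 1%:M /\ Q1i t *m Q1 t = 1%:M),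
        aeT (fun t => Q2 t *m Q2i t = 1%:M /\ Q2i t *m Q2 t = 1%:M) &
        aeT (fun t => U t = ctr (Q2 t) *m diag_mx (\row_j (zeta t ^ k j)) *m Q1 t)].

Definition mxnorm n (A : 'M[C]_n) : R :=
  inf [set M : R | 0 <= M /\ forall x : 'cV[C]_n, vnorm (A *m x) <= M * vnorm x].
Definition sval n (j : nat) (A : 'M[C]_n) : R :=
  inf [set mxnorm (A - B) | B in [set B : 'M[C]_n | (\rank B <= j)%N]].
Definition esssupT (g : R -> R) : \bar R :=
  ereal_inf [set y : \bar R | aeT (fun t => ((g t)%:E <= y)%E)].

Definition tval n (Phi : R -> 'M[C]_n) (j : nat) (Om : set (R -> 'M[C]_n)) : \bar R :=
  ereal_inf [set esssupT (fun t => sval j (Phi t - F t)) | F in Om].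

(* OmegaP 0 = H^infty, OmegaP (j+1) = Omega_j *)
Fixpoint OmegaP n (Phi : R -> 'M[C]_n) (j : nat) : set (R -> 'M[C]_n) :=
  match j with
  | 0%N => [set F | Hinf F]
  | j'.+1 => [set F | OmegaP Phi j' F /\
               esssupT (fun t => sval j' (Phi t - F t)) = tval Phi j' (OmegaP Phi j')]
  end.

Definition superopt_sv n (Phi : R -> 'M[C]_n) (j : nat) : \bar R :=
  tval Phi j (OmegaP Phi j).

Definition nb_sv_one n (Phi : R -> 'M[C]_n) : nat :=
  count (fun j => superopt_sv Phi j == 1%E) (iota 0 n).

End Defs.

(* Main.v *)
Require Import Defs.
From HB Require Import structures.
From mathcomp Require Import all_boot all_order all_algebra.
From mathcomp Require Import all_classical all_reals all_analysis.
From mathcomp Require Import complex ring lra zify spectral measurable_realfun perm.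
Set Implicit Arguments. Unset Strict Implicit. Unset Printing Implicit Defensive.
Import Order.TTheory GRing.Theory Num.Theory.
Import numFieldNormedType.Exports.
Local Open Scope classical_set_scope.
Local Open Scope ring_scope.

(* Write [H f = P_-(Phi f)]. The form [q(f) = |f|^2 - |H f|^2] on [H^2] is nonnegative, and since the
   essential norm of [H] is below 1 it is complete with a finite-dimensional null space; let [r] be
   the dimension of the space of values [f(0)] of null functions [f].

   One-step extension: [H] lifts to Hankel operators [H'] with [H' z = H] for which the form is still
   nonnegative, and the corresponding dimension can be given any value between that of [H] and [n].
   Iterating, the operators [H_i] come from a single contractive [U] with [Phi - U] in [H^infty] and
   [H_i f = P_-(z^-i U f)], the dimensions being any prescribed nondecreasing sequence [s_i] with
   [s_0 = r]. Taking [s_i] to be the number of [j] with [j < r] or [d_j < i], one has [s_N = n] for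
   large [N]; null functions are mapped isometrically, so that [U] is unitary. The Toeplitz operator
   of [z^-N U] is then onto, which yields the bound on the Hankel operator of [U^*] and a
   Wiener-Hopf factorization, built by splitting off one degree of the kernel at a time. In such a
   factorization [s_i] counts the indices below [i], hence the indices are the prescribed ones.

   Finally [r] is the number of superoptimal singular values equal to 1: every contractive
   [Phi - F] is isometric on the null functions, which span an [r]-dimensional space at almost every
   point; and the extension theorem for the norm weighted by [c < 1] on the orthogonal complement of
   these spaces gives an interpolant whose [r]-th singular value is at most [c]. *)

(** The freedom in one extension step is a matrix. Every [f] splits as [z g + u(x)] with [x = f(0)]
    and [u(x)] orthogonal to [z H^2] for [q]; a lift is forced on [z H^2] and free on the [u(x)].
    Completing a square, the new form is [q(g - p(B x)) + S(x) - A(B x)] with nonnegative quadratic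
    forms [S], [A] on [C^n] and an arbitrary matrix [B]. So [B^* A B <= S] is the constraint, and
    the new dimension is the nullity of [S - B^* A B]. Reaching every dimension up to [n] requires
    the rank of [A] to be at least that of [S]. This is the crux; it comes from the finite dimension
    of the null space, by comparing the ranks of evaluation at 0 and of the coefficient map by means
    of the backward shift.

    The step is used twice: unweighted, to construct [U], and with the weight [P + c(1 - P)], where
    [P(t)] projects onto the values of the null functions, to bound a singular value. The weight is
    admissible because [q] controls [|(1 - P) f|^2].

    Functions are representatives, not classes, so even [|f|^2] is degenerate; the theory of forms
    is developed with null vectors. *)

Local Notation Re := complex.Re.
Local Notation Im := complex.Im.
Local Notation conjc := complex.conjc.
Local Notation mulf := Defs.mulf.

(** * Sesquilinear forms and the Riesz theorem *)

Section ComplexModulus.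
Variable R : realType.
Local Notation C := (complex.complex R).
Implicit Types x y : C.

Lemma ReD x y : Re (x + y) = Re x + Re y. Proof. by case: x; case: y. Qed.
Lemma ImD x y : Im (x + y) = Im x + Im y. Proof. by case: x; case: y. Qed.
Lemma ReN x : Re (- x) = - Re x. Proof. by case: x. Qed.
Lemma ImN x : Im (- x) = - Im x. Proof. by case: x. Qed.
Lemma ReM x y : Re (x * y) = Re x * Re y - Im x * Im y.
Proof. by case: x; case: y. Qed.
Lemma ImM x y : Im (x * y) = Re x * Im y + Im x * Re y.
Proof. by case: x; case: y. Qed.
Lemma ReJ x : Re (conjc x) = Re x. Proof. by case: x. Qed.
Lemma ImJ x : Im (conjc x) = - Im x. Proof. by case: x. Qed.
Lemma Re_real (r : R) : Re (real_complex R r) = r. Proof. by []. Qed.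
Lemma Im_real (r : R) : Im (real_complex R r) = 0. Proof. by []. Qed.
Lemma complexP x y : Re x = Re y -> Im x = Im y -> x = y.
Proof. by case: x => a b; case: y => c d /= -> ->. Qed.
Definition cE := (ReD, ImD, ReN, ImN, ReM, ImM, ReJ, ImJ, Re_real, Im_real).
Lemma Re_sum (I : Type) (r : seq I) (P : pred I) (F : I -> C) :
  Re (\sum_(i <- r | P i) F i) = \sum_(i <- r | P i) Re (F i).
Proof. by elim/big_rec2: _ => // i a b _ <-; rewrite ReD. Qed.

Lemma conjcD x y : conjc (x + y) = conjc x + conjc y.
Proof. by apply: complexP; rewrite !cE//; ring. Qed.
Lemma conjcM x y : conjc (x * y) = conjc x * conjc y.
Proof. by apply: complexP; rewrite !cE//; ring. Qed.
Lemma conjcN x : conjc (- x) = - conjc x.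
Proof. by apply: complexP; rewrite !cE//; ring. Qed.
Lemma conjc_sum (I : Type) (r : seq I) (P : pred I) (F : I -> C) :
  conjc (\sum_(i <- r | P i) F i) = \sum_(i <- r | P i) conjc (F i).
Proof. by elim/big_rec2: _ => [|i a b _ <-]; rewrite ?conjcD ?conjc0. Qed.

Lemma cabs_ge0 x : 0 <= cabs x. Proof. exact: sqrtr_ge0. Qed.
Lemma cabs2 x : cabs x ^+ 2 = Re x ^+ 2 + Im x ^+ 2.
Proof. by rewrite sqr_sqrtr// addr_ge0// sqr_ge0. Qed.
Lemma cabs0 : cabs (0 : C) = 0.
Proof. by rewrite /cabs/= expr0n/= addr0 sqrtr0. Qed.
Lemma cabs1 : cabs (1 : C) = 1.
Proof. by rewrite /cabs/= expr0n/= addr0 expr1n sqrtr1. Qed.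
Lemma eq_sqr_ge0 (a b : R) : 0 <= a -> 0 <= b -> a ^+ 2 = b ^+ 2 -> a = b.
Proof. by move=> a0 b0 /eqP; rewrite eqrXn2// => /eqP. Qed.
Lemma cabsM x y : cabs (x * y) = cabs x * cabs y.
Proof.
apply: eq_sqr_ge0; rewrite ?mulr_ge0 ?cabs_ge0// exprMn !cabs2 !cE; ring.
Qed.
Lemma cabsX x k : cabs (x ^+ k) = cabs x ^+ k.
Proof. by elim: k => [|k IH]; rewrite ?expr0 ?cabs1// !exprS cabsM IH. Qed.
Lemma cabsN x : cabs (- x) = cabs x.
Proof. by rewrite /cabs !cE !sqrrN. Qed.
Lemma cabsJ x : cabs (conjc x) = cabs x.
Proof. by rewrite /cabs !cE !sqrrN. Qed.
Lemma cabs_real (r : R) : cabs (real_complex R r) = `|r|.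
Proof. by rewrite /cabs/= expr0n/= addr0 sqrtr_sqr. Qed.
Lemma cabs_eq0 x : (cabs x == 0) = (x == 0).
Proof.
apply/eqP/eqP => [h|->]; last exact: cabs0.
have := cabs2 x; rewrite h expr0n/=; move=> /esym/eqP.
by rewrite paddr_eq0 ?sqr_ge0// !sqrf_eq0 => /andP[/eqP a /eqP b]; apply: complexP.
Qed.
Lemma Re_le_cabs x : `|Re x| <= cabs x.
Proof.
by rewrite -sqrtr_sqr ler_sqrt ?lerDl ?sqr_ge0// addr_ge0// sqr_ge0.
Qed.
Lemma Im_le_cabs x : `|Im x| <= cabs x.
Proof.
by rewrite -sqrtr_sqr ler_sqrt ?lerDr ?sqr_ge0// addr_ge0// sqr_ge0.
Qed.
Lemma cabsD x y : cabs (x + y) <= cabs x + cabs y.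
Proof.
rewrite -(@ler_pXn2r _ 2)// ?nnegrE ?addr_ge0 ?cabs_ge0//.
have h : Re x * Re y + Im x * Im y <= cabs x * cabs y.
  rewrite -cabsJ -cabsM; apply: le_trans (le_trans (ler_norm _) (Re_le_cabs _)).
  by rewrite !cE; lra.
have e1 := cabs2 x; have e2 := cabs2 y; rewrite (cabs2 (x + y)) !cE sqrrD -mulr_natr; lra.
Qed.
Lemma cabs_sum (I : Type) (r : seq I) (P : pred I) (F : I -> C) :
  cabs (\sum_(i <- r | P i) F i) <= \sum_(i <- r | P i) cabs (F i).
Proof.
elim/big_rec2: _ => [|i a b _ h]; first by rewrite cabs0.
by apply: le_trans (cabsD _ _) _; rewrite lerD2l.
Qed.
Lemma cabs_le_ReIm x : cabs x <= `|Re x| + `|Im x|.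
Proof.
rewrite -(@ler_pXn2r _ 2)// ?nnegrE ?addr_ge0 ?cabs_ge0//.
rewrite cabs2 sqrrD !real_normK ?num_real// lerD2r lerDl.
by rewrite mulrn_wge0 ?mulr_ge0.
Qed.
Lemma mulcJ x : x * conjc x = real_complex R (cabs x ^+ 2).
Proof. by apply: complexP; rewrite ?cabs2 !cE//; ring. Qed.
Lemma rotation x : exists u : C, cabs u = 1 /\ u * x = real_complex R (cabs x).
Proof.
have [->|x0] := eqVneq x 0; first by exists 1; rewrite cabs1 cabs0 mulr0.
have c0 : cabs x != 0 by rewrite cabs_eq0.
exists (real_complex R (cabs x)^-1 * conjc x); split.
  by rewrite cabsM cabsJ cabs_real ger0_norm ?invr_ge0 ?cabs_ge0// mulVf.
rewrite -mulrA (mulrC _ x) mulcJ -rmorphM/=; congr (real_complex _ _).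
by rewrite expr2 mulrA mulVf ?mul1r.
Qed.
End ComplexModulus.

Lemma inv_small (R : realType) (e : R) : 0 < e ->
  exists N, forall k, (N <= k)%N -> k.+1%:R^-1 < e.
Proof.
move=> /ltr_add_invr[N]; rewrite add0r => hN; exists N => k Nk.
by apply: le_lt_trans hN; rewrite lef_pV2 ?posrE// ler_nat.
Qed.

Section HermitianForm.
Variable R : realType.
Local Notation C := (complex.complex R).
Variable V : lmodType C.
Implicit Types (D Z : V -> Prop) (q : V -> V -> C) (f g h : V).

Definition linsub D := D 0 /\ forall (a : C) f g, D f -> D g -> D (a *: f + g).

(** Only semidefinite, and relative to a domain: the vectors will be representatives of functions,
    so even the norm has null vectors, and the later forms have genuine ones. *)
Record hform D q : Prop := HForm {
  hform_sub : linsub D;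
  hformL : forall (a : C) f g h, D f -> D g -> D h ->
     q (a *: f + g) h = a * q f h + q g h;
  hformC : forall f g, D f -> D g -> q g f = conjc (q f g);
  hform_ge0 : forall f, D f -> 0 <= Re (q f f) }.

Definition nq q f : R := Re (q f f).

(** Limits exist but are not unique, since the null vectors of [q] are not factored out. *)
Definition qcomplete D q := forall u : nat -> V, (forall k, D (u k)) ->
  (forall e, 0 < e -> exists N, forall k l, (N <= k)%N -> (N <= l)%N ->
     nq q (u k - u l) < e) ->
  exists2 f, D f & forall e, 0 < e -> exists N, forall k, (N <= k)%N ->
     nq q (u k - f) < e.

Lemma subspD D f g : linsub D -> D f -> D g -> D (f + g).
Proof. by move=> [_ h] hf hg; rewrite -[f]scale1r; exact: h. Qed.
Lemma subspZ D a f : linsub D -> D f -> D (a *: f).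
Proof. by move=> [h0 h] hf; rewrite -[a *: f]addr0; exact: h. Qed.
Lemma subspB D f g : linsub D -> D f -> D g -> D (f - g).
Proof.
by move=> hD hf hg; apply: subspD => //; rewrite -scaleN1r; exact: subspZ.
Qed.
Lemma subspN D f : linsub D -> D f -> D (- f).
Proof. by move=> hD hf; rewrite -scaleN1r; exact: subspZ. Qed.
Lemma subsp_sum D (I : Type) (r : seq I) (P : pred I) (F : I -> V) :
  linsub D -> (forall i, P i -> D (F i)) -> D (\sum_(i <- r | P i) F i).
Proof.
move=> hD hF; elim/big_rec: _ => [|i x Pi hx]; first by case: hD.
exact: subspD (hF i Pi) hx.
Qed.

Lemma sub_hform D Z q : hform D q -> linsub Z -> (forall f, Z f -> D f) ->
  hform Z q.
Proof.
move=> [hD hL hC hP] hZ ZD; split => // *.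
- by apply: hL; exact: ZD.
- by apply: hC; exact: ZD.
- by apply: hP; exact: ZD.
Qed.

Section Theory.
Variables (D : V -> Prop) (q : V -> V -> C).
Hypothesis hq : hform D q.
Let hD : linsub D := hform_sub hq.

Lemma hformDl f g h : D f -> D g -> D h -> q (f + g) h = q f h + q g h.
Proof. by move=> *; rewrite -{1}[f]scale1r (hformL hq)// mul1r. Qed.
Lemma hform0l h : D h -> q 0 h = 0.
Proof.
move=> hh; have h0 : D 0 by case: hD.
by apply: (@addrI _ (q 0 h)); rewrite -hformDl// !addr0.
Qed.
Lemma hformZl a f h : D f -> D h -> q (a *: f) h = a * q f h.
Proof.
move=> hf hh; have h0 : D 0 by case: hD.
by rewrite -[a *: f]addr0 (hformL hq)// hform0l// addr0.
Qed.
Lemma hformNl f h : D f -> D h -> q (- f) h = - q f h.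
Proof. by move=> *; rewrite -scaleN1r hformZl// mulN1r. Qed.
Lemma hformBl f g h : D f -> D g -> D h -> q (f - g) h = q f h - q g h.
Proof. by move=> *; rewrite hformDl// ?hformNl//; exact: subspN. Qed.
Lemma hformDr f g h : D f -> D g -> D h -> q f (g + h) = q f g + q f h.
Proof.
move=> hf hg hh; rewrite (hformC hq (subspD hD hg hh) hf) hformDl// conjcD.
by rewrite -!(hformC hq).
Qed.
Lemma hformZr a f h : D f -> D h -> q f (a *: h) = conjc a * q f h.
Proof.
move=> hf hh; rewrite (hformC hq (subspZ a hD hh) hf) hformZl// conjcM.
by rewrite -(hformC hq).
Qed.
Lemma hformNr f h : D f -> D h -> q f (- h) = - q f h.
Proof.
by move=> hf hh; rewrite -scaleN1r hformZr// conjcN conjc1 mulN1r.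
Qed.
Lemma hformBr f g h : D f -> D g -> D h -> q f (g - h) = q f g - q f h.
Proof. by move=> *; rewrite hformDr// ?hformNr//; exact: subspN. Qed.
Lemma hform_suml (I : Type) (r : seq I) (P : pred I) (F : I -> V) h :
  (forall i, D (F i)) -> D h ->
  q (\sum_(i <- r | P i) F i) h = \sum_(i <- r | P i) q (F i) h.
Proof.
move=> hF hh; elim: r => [|x r IH]; first by rewrite !big_nil hform0l.
rewrite !big_cons; case: ifP => // _; rewrite hformDl// ?IH//.
exact: subsp_sum.
Qed.
Lemma hform_sumr (I : Type) (r : seq I) (P : pred I) (F : I -> V) h :
  (forall i, D (F i)) -> D h ->
  q h (\sum_(i <- r | P i) F i) = \sum_(i <- r | P i) q h (F i).
Proof.
move=> hF hh; rewrite (hformC hq) ?hform_suml// ?conjc_sum; last exact: subsp_sum.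
by apply: eq_bigr => i _; rewrite -(hformC hq).
Qed.

Lemma nq_ge0 f : D f -> 0 <= nq q f. Proof. exact: hform_ge0. Qed.
Lemma hform_diag f : D f -> q f f = real_complex R (nq q f).
Proof.
move=> hf; have /(congr1 (@complex.Im R)) := hformC hq hf hf; rewrite !cE => e.
by apply: complexP; rewrite ?cE//; lra.
Qed.
Lemma nqD f g : D f -> D g -> nq q (f + g) = nq q f + nq q g + 2 * Re (q f g).
Proof.
move=> hf hg; have hfg := subspD hD hf hg.
rewrite /nq hformDl// !hformDr// (hformC hq hf hg) !cE; ring.
Qed.
Lemma nqZ a f : D f -> nq q (a *: f) = cabs a ^+ 2 * nq q f.
Proof.
move=> hf; rewrite /nq hformZl ?hformZr//; last exact: subspZ.
by rewrite mulrA mulcJ (hform_diag hf) !cE mul0r subr0.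
Qed.
Lemma nqN f : D f -> nq q (- f) = nq q f.
Proof. by move=> hf; rewrite -scaleN1r nqZ// cabsN cabs1 expr1n mul1r. Qed.
Lemma nq0 : nq q 0 = 0.
Proof. by rewrite /nq hform0l//; case: hD. Qed.
Lemma nqB f g : D f -> D g -> nq q (f - g) = nq q f + nq q g - 2 * Re (q f g).
Proof.
move=> hf hg; rewrite nqD// ?nqN// ?hformNr// ?cE; first ring.
exact: subspN.
Qed.
Lemma nqBC f g : D f -> D g -> nq q (f - g) = nq q (g - f).
Proof. by move=> hf hg; rewrite -nqN ?opprB//; exact: subspB. Qed.
Lemma nqD_le2 f g : D f -> D g -> nq q (f + g) <= 2 * nq q f + 2 * nq q g.
Proof.
move=> hf hg; have := nq_ge0 (subspB hD hf hg); rewrite nqB// nqD//; lra.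
Qed.
Lemma nqB_le2 f g : D f -> D g -> nq q (f - g) <= 2 * nq q f + 2 * nq q g.
Proof.
move=> hf hg; have := nq_ge0 (subspD hD hf hg); rewrite nqB// nqD//; lra.
Qed.

Lemma quad_disc (a b c : R) : 0 <= a -> 0 <= c ->
  (forall t, 0 <= a - 2 * t * b + t ^+ 2 * c) -> b ^+ 2 <= a * c.
Proof.
(* For [c = 0] the polynomial is affine, and a nonzero [b] would give it the value [-1] at
   [(a + 1) / (2 b)]. Otherwise it is evaluated at its minimum [b / c]. *)
move=> a0 c0 h; have [c0'|c0'] := eqVneq c 0.
  suff -> : b = 0 by rewrite c0' mulr0 expr0n.
  apply/eqP; apply: contraT => b0.
  have := h ((a + 1) / (2 * b)); rewrite c0' mulr0 addr0.
  by rewrite (_ : 2 * _ * b = a + 1) ?opprD ?addrA ?subrr; [lra|field].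
have {}c0 : 0 < c by rewrite lt_def c0' c0.
have := h (b / c); rewrite (_ : _ - _ + _ = (a * c - b ^+ 2) / c); last by field.
by rewrite pmulr_lge0 ?invr_gt0// subr_ge0.
Qed.

Lemma hform_CS f g : D f -> D g -> cabs (q f g) ^+ 2 <= nq q f * nq q g.
Proof.
(* A unimodular factor makes the cross term real, so that the discriminant criterion bounds its
   modulus. *)
move=> hf hg; have [u [u1 hu]] := rotation (q f g).
apply: quad_disc; rewrite ?nq_ge0// => t.
have hug := subspZ (real_complex R t) hD hg.
have huf := subspZ u hD hf.
have := nq_ge0 (subspB hD huf hug); rewrite nqB// !nqZ// u1 cabs_real.
rewrite hformZr ?hformZl// hu !cE real_normK ?num_real// expr1n mul1r.
by rewrite !mulr0 !subr0; lra.
Qed.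
Lemma hform_null f g : D f -> D g -> nq q f = 0 -> q f g = 0.
Proof.
move=> hf hg f0; have := hform_CS hf hg; rewrite f0 mul0r => h.
have : cabs (q f g) ^+ 2 = 0 by apply/eqP; rewrite eq_le h sqr_ge0.
by move/eqP; rewrite sqrf_eq0 cabs_eq0 => /eqP.
Qed.
Lemma hform_nullr f g : D f -> D g -> nq q g = 0 -> q f g = 0.
Proof. by move=> hf hg g0; rewrite (hformC hq)// hform_null// conjc0. Qed.
Lemma nqD_null f g : D f -> D g -> nq q g = 0 -> nq q (f + g) = nq q f.
Proof. by move=> hf hg g0; rewrite nqD// g0 hform_nullr// !addr0 mulr0 addr0. Qed.
Lemma nqB_null f g : D f -> D g -> nq q g = 0 -> nq q (f - g) = nq q f.
Proof.
by move=> hf hg g0; rewrite nqD_null// ?nqN//; exact: subspN.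
Qed.

Definition nrm f := Num.sqrt (nq q f).
Lemma nrm_ge0 f : 0 <= nrm f. Proof. exact: sqrtr_ge0. Qed.
Lemma nrm2 f : D f -> nrm f ^+ 2 = nq q f.
Proof. by move=> hf; rewrite sqr_sqrtr// nq_ge0. Qed.
Lemma nrmCS f g : D f -> D g -> cabs (q f g) <= nrm f * nrm g.
Proof.
move=> hf hg; rewrite -(@ler_pXn2r _ 2)// ?nnegrE ?mulr_ge0 ?nrm_ge0 ?cabs_ge0//.
by rewrite exprMn !nrm2// hform_CS.
Qed.
Lemma nrmD f g : D f -> D g -> nrm (f + g) <= nrm f + nrm g.
Proof.
move=> hf hg.
rewrite -(@ler_pXn2r _ 2)// ?nnegrE ?addr_ge0 ?nrm_ge0//.
rewrite nrm2 ?nqD//; last exact: subspD.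
have h1 := le_trans (ler_norm _) (le_trans (Re_le_cabs _) (nrmCS hf hg)).
by rewrite sqrrD !nrm2// -mulr_natl; lra.
Qed.
Lemma nrmB f g : D f -> D g -> nrm (f - g) <= nrm f + nrm g.
Proof.
move=> hf hg; apply: le_trans (nrmD hf (subspN hD hg)) _.
by rewrite /nrm nqN.
Qed.
Lemma nrmZ a f : D f -> nrm (a *: f) = cabs a * nrm f.
Proof.
by move=> hf; rewrite /nrm nqZ// sqrtrM ?sqr_ge0// sqrtr_sqr ger0_norm ?cabs_ge0.
Qed.

(* Minimising [nq g - 2 Re (l g)] instead of the distance to a hyperplane also covers degenerate forms. *)
Lemma riesz_form (l : V -> C) (K : R) : qcomplete D q ->
  (forall a f g, D f -> D g -> l (a *: f + g) = a * l f + l g) ->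
  (forall f, D f -> cabs (l f) ^+ 2 <= K * nq q f) ->
  exists2 p, D p & forall f, D f -> l f = q f p.
Proof.
move=> cplt lin bnd.
have D0 : D 0 by case: hD.
have l0 : l 0 = 0.
  by have := lin 1 0 0 D0 D0; rewrite scaler0 addr0 mul1r => e; apply: (@addrI _ (l 0)); rewrite -e addr0.
have lZ a f : D f -> l (a *: f) = a * l f.
  by move=> hf; have := lin a f 0 hf D0; rewrite !addr0 l0 addr0.
pose J g := nq q g - 2 * Re (l g).
(* From [(Re (l g))^2 <= |K| nq q g] and the arithmetic-geometric inequality. *)
have Jb g : D g -> - `|K| <= J g.
  move=> hg; have := bnd g hg; have := nq_ge0 hg => n0 b.
  have r2 : Re (l g) ^+ 2 <= `|K| * nq q g.
    apply: le_trans (le_trans _ b) _; first by rewrite cabs2 lerDl sqr_ge0.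
    by rewrite ler_wpM2r// ler_norm.
  have k0 : 0 <= `|K| by [].
  rewrite /J; have [h|h] := leP (Re (l g)) 0; first lra.
  move: r2 n0 k0 h; move: (Re (l g)) (nq q g) `|K| => x y k r2 n0 k0 h.
  suff : 2 * x <= y + k by lra.
  rewrite -(@ler_pXn2r _ 2)// ?nnegrE; [|lra|lra].
  by have := sqr_ge0 (y - k); nra.
pose E : set R := [set J g | g in [set g | D g]].
have Eh : has_inf E.
  split; first by exists (J 0); exists 0.
  by exists (- `|K|) => _ [g hg <-]; exact: Jb.
pose m := inf E.
have mJ g : D g -> m <= J g by move=> hg; apply: ge_inf; [case: Eh|exists g].
(* Parallelogram law: [J] is at least [m] at the midpoint too, so two near minimizers are close. *)
have mid g h : D g -> D h -> nq q (g - h) <= 2 * (J g - m) + 2 * (J h - m).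
  move=> hg hh; have gh := subspD hD hg hh.
  have := mJ _ (subspZ (real_complex R (2^-1)) hD gh).
  rewrite /J nqZ// cabs_real lZ// -[g in l (g + h)]scale1r lin// mul1r.
  rewrite nqB// nqD// !cE mul0r subr0 ger0_norm; last by rewrite invr_ge0.
  by lra.
have appr (k : nat) : exists g, D g /\ J g < m + k.+1%:R^-1.
  have [|_ [g hg <-] ?] := @inf_adherent _ E k.+1%:R^-1 _ Eh; first by rewrite invr_gt0.
  by exists g.
have [u hu] := choice appr.
have small e : 0 < e -> exists N, forall k, (N <= k)%N -> J (u k) - m < e.
  move=> /inv_small[N hN]; exists N => k /hN; case: (hu k) => _.
  by move: (k.+1%:R^-1) => x; lra.
have [||p hp cvp] := cplt u.
- by move=> k; case: (hu k).
- move=> e e0; have [|N hN] := small (e / 4); first by lra.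
  exists N => k l' hk hl; have [hk1 _] := hu k; have [hl1 _] := hu l'.
  by have := mid _ _ hk1 hl1; have := hN k hk; have := hN l' hl; lra.
exists p => //.
have Jp : J p <= m.
  apply/ler_addgt0Pl => e e0.
  have [|N1 h1] := small (Num.min 1 (e / 4)); first by rewrite lt_min; apply/andP; split; lra.
  (* [s] is a Lipschitz constant: for [v] within distance 1 of [p], [J p - J v] is at most [s] times
     the distance. *)
  pose s := 2 * Num.sqrt (nq q p) + 2 * Num.sqrt `|K| + 1.
  have s0 : 0 < s.
    by rewrite /s ltr_pwDr// addr_ge0// mulr_ge0// sqrtr_ge0.
  have [|N2 h2] := cvp (Num.min 1 (e / 4 / s) ^+ 2).
    by apply: exprn_gt0; rewrite lt_min ltr01 divr_gt0//; lra.
  have := h2 (maxn N1 N2) (leq_maxr _ _); have := h1 (maxn N1 N2) (leq_maxl _ _).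
  set v := u _; have [hv _] : D v /\ J v < m + (maxn N1 N2).+1%:R^-1 by exact: hu.
  rewrite lt_min => /andP[_ a1] a2.
  have hvp := subspB hD hv hp.
  have a3 : nrm (v - p) < Num.min 1 (e / 4 / s).
    rewrite -(@ltr_pXn2r _ 2)// ?nnegrE ?nrm_ge0 ?nrm2//.
    by rewrite le_min ler01 divr_ge0 ?divr_ge0 ?ltW//; lra.
  have a4 : nrm (v - p) * s <= e / 4.
    by rewrite -ler_pdivlMr//; move: a3; rewrite lt_min => /andP[_ /ltW].
  have a5 : nrm p <= nrm v + nrm (v - p).
    by rewrite -{1}(subKr v p); exact: nrmB.
  have a6 : nrm v <= nrm p + nrm (v - p).
    by have := nrmD hp hvp; rewrite addrC subrK.
  have a7 : `|Re (l (v - p))| <= Num.sqrt `|K| * nrm (v - p).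
    apply: le_trans (Re_le_cabs _) _.
    rewrite -(@ler_pXn2r _ 2)// ?nnegrE ?mulr_ge0 ?cabs_ge0 ?nrm_ge0 ?sqrtr_ge0//.
    rewrite exprMn nrm2// (sqr_sqrtr (normr_ge0 K)); apply: le_trans (bnd _ hvp) _.
    by rewrite ler_wpM2r ?nq_ge0// ler_norm.
  have a8 : Re (l (v - p)) = Re (l v) - Re (l p).
    by rewrite addrC -scaleN1r lin// mulN1r !cE addrC.
  have a9 := nrm_ge0 (v - p).
  have a10 := nrm_ge0 p.
  have a11 : nrm (v - p) < 1 by move: a3; rewrite lt_min => /andP[].
  have a12 : 0 <= Num.sqrt `|K| by exact: sqrtr_ge0.
  have a13 : nq q p <= nq q v + nrm (v - p) * (2 * nrm p + 1).
    rewrite -nrm2// -nrm2//; have := nrm_ge0 v; nra.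
  rewrite a8 in a7.
  have a14 := le_trans (ler_norm _) a7.
  move: a1 a4 a13; rewrite /J /s -/(nrm p); lra.
move=> f hf.
(* First-order condition at the minimum in the real direction [g]; the imaginary part follows by
   applying it to [i f]. *)
have key (g : V) : D g -> Re (q g p) = Re (l g).
  move=> hg; apply/eqP; rewrite -subr_eq0 -sqrf_eq0 eq_le sqr_ge0 andbT.
  have -> : 0 = 0 * nq q g by rewrite mul0r.
  apply: quad_disc; rewrite ?nq_ge0// => t.
  have htg := subspZ (real_complex R t) hD hg.
  have := mJ _ (subspB hD hp htg); rewrite /J.
  rewrite nqB// nqZ// cabs_real real_normK ?num_real// hformZr//.
  rewrite (hformC hq hg hp) (addrC p) -scaleNr lin// !cE.
  by move: Jp; rewrite /J; lra.
apply: complexP; first by rewrite key.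
by have := key _ (subspZ (complex.Complex 0 1) hD hf); rewrite hformZl// lZ// !cE/= !mul0r !mul1r !sub0r => /oppr_inj ->.
Qed.
End Theory.

(** [p] is the Riesz vector of the functional [g |-> q g f] restricted to [Z]. *)
Lemma projection D q Z f : hform D q -> linsub Z -> (forall g, Z g -> D g) ->
  qcomplete Z q -> D f -> exists2 p, Z p & forall g, Z g -> q (f - p) g = 0.
Proof.
move=> hq hZ ZD cplt hf; have hqZ := sub_hform hq hZ ZD.
have [||p hp h] := @riesz_form Z q hqZ (fun g => q g f) (nq q f) cplt.
- by move=> a g h /ZD hg /ZD hh; exact: hformL hq _ _ _ _ hg hh hf.
- by move=> g /ZD hg; rewrite [leRHS]mulrC; have := hform_CS hq hg hf.
exists p => // g hg.
rewrite (hformBl hq)//; [|exact: ZD..].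
rewrite (hformC hq (ZD _ hg) hf) h// -(hformC hq); [|exact: ZD..].
by rewrite subrr.
Qed.
End HermitianForm.

(** * Integration on the circle *)

Section CircleIntegral.
Variable R : realType.
Local Notation C := (complex.complex R).
Local Notation mu := (@lebesgue_measure R).
Local Notation I := (@I01 R).

Lemma measurable_I01 : measurable (I : set (measurableTypeR R)).
Proof. exact: measurable_itv. Qed.
Local Hint Resolve measurable_I01 : core.
Lemma mu_I01 : mu I = 1%E.
Proof. by rewrite /I01 lebesgue_measure_itv/= lte_fin ltr01 oppr0 adde0. Qed.

Lemma mu_I01_lty : (mu I < +oo)%E. Proof. by rewrite mu_I01 ltry. Qed.

Lemma aeT_ae (P : R -> Prop) : aeT P <-> (\forall x \ae mu, I x -> P x).
Proof.
suff -> : aeT P = mu.-negligible (~` [set x | I x -> P x]) by [].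
rewrite /aeT; congr (mu.-negligible _); apply/seteqP; split => t /=.
  by move=> [h1 h2] h3; apply: h2; exact: h3.
by move=> /not_implyP.
Qed.
Lemma aeT_sub (P Q : R -> Prop) : (forall t, I t -> P t -> Q t) -> aeT P -> aeT Q.
Proof.
by move=> PQ; apply: negligibleS => t [It nQ]; split=> // /(PQ _ It).
Qed.
Lemma aeT_all (P : R -> Prop) : (forall t, I t -> P t) -> aeT P.
Proof.
move=> h; rewrite /aeT (_ : [set t | _] = set0); first exact: negligible_set0.
by rewrite -subset0 => t [It nP]; apply: nP; exact: h.
Qed.
Lemma aeT_and (P Q : R -> Prop) : aeT P -> aeT Q -> aeT (fun t => P t /\ Q t).
Proof.
move=> hP hQ; apply: negligibleS (negligibleU hP hQ) => t [It /not_andP[h|h]].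
- by left.
- by right.
Qed.
Lemma aeT_sub2 (P Q S : R -> Prop) : (forall t, I t -> P t -> Q t -> S t) ->
  aeT P -> aeT Q -> aeT S.
Proof.
by move=> h hP hQ; apply: aeT_sub (aeT_and hP hQ) => t It [? ?]; exact: h.
Qed.
Lemma aeT_sub3 (P Q P' S : R -> Prop) :
  (forall t, I t -> P t -> Q t -> P' t -> S t) -> aeT P -> aeT Q -> aeT P' -> aeT S.
Proof.
move=> h hP hQ; apply: aeT_sub2 (aeT_and hP hQ) => t It [? ?] ?; exact: h.
Qed.
Lemma aeT_nat (P : nat -> R -> Prop) :
  (forall k, aeT (P k)) -> aeT (fun t => forall k, P k t).
Proof.
move=> h; apply: negligibleS (negligible_bigcup h).
by move=> t [It /existsNP[k hk]]; exists k.
Qed.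
Lemma aeT_cnt (T : countType) (P : T -> R -> Prop) :
  (forall k, aeT (P k)) -> aeT (fun t => forall k, P k t).
Proof.
move=> h; apply: (@aeT_sub (fun t => forall k (x : T), pickle x = k -> P x t)).
  by move=> t It H k; exact: H.
apply: aeT_nat => k; case hk : (@unpickle T k) => [x|].
  apply: aeT_sub (h x) => t _ Px y yk; have := @pickleK T y.
  by rewrite yk hk => -[<-].
by apply: aeT_all => t _ y yk; have := @pickleK T y; rewrite yk hk.
Qed.
Lemma aeT_ex (P : R -> Prop) : aeT P -> exists2 t, I t & P t.
Proof.
move=> hP; apply: contrapT => /forall2NP h.
have : mu.-negligible I.
  by apply: negligibleS hP => t It; split => //; case: (h t).
move=> /(negligibleP mu measurable_I01) e; have {e} : mu I = 0%E by exact: e.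
by rewrite mu_I01 => -[] /eqP; rewrite oner_eq0.
Qed.

(* [lebesgue_measure] lives on [measurableTypeR R], whose display differs from the one of [R]. *)
Definition rmeas (g : R -> R) : Prop := measurable_fun (I : set (measurableTypeR R)) g.
Lemma cmeasE (g : R -> C) :
  cmeas g <-> rmeas (fun t => Re (g t)) /\ rmeas (fun t => Im (g t)).
Proof. by []. Qed.

Definition rI (g : R -> R) := mu.-integrable I (EFin \o g).
Definition rint (g : R -> R) : R := Rintegral mu I g.

Lemma rI_meas g : rI g -> rmeas g.
Proof. by move=> /integrableP[/measurable_EFinP]. Qed.
Lemma rID f g : rI f -> rI g -> rI (fun t => f t + g t).
Proof.
move=> hf hg; have := integrableD measurable_I01 hf hg.
by apply: eq_integrable => // t _; rewrite /= EFinD.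
Qed.
Lemma rIZ a f : rI f -> rI (fun t => a * f t).
Proof.
move=> hf; have := integrableZl measurable_I01 a hf.
by apply: eq_integrable => // t _; rewrite /= EFinM.
Qed.
Lemma rIN f : rI f -> rI (fun t => - f t).
Proof.
move=> hf; have := integrableN hf.
by apply: eq_integrable => // t _; rewrite /= EFinN.
Qed.
Lemma rIB f g : rI f -> rI g -> rI (fun t => f t - g t).
Proof. by move=> hf /rIN; exact: rID. Qed.
Lemma rI_dom f g : rmeas f -> rI g -> aeT (fun t => `|f t| <= g t) -> rI f.
Proof.
move=> mf /integrableP[mg ig] fg; apply/integrableP; split.
  exact/measurable_EFinP.
apply: le_lt_trans ig; apply: ae_ge0_le_integral => //.
- exact/measurableT_comp/measurable_EFinP.
- exact/measurableT_comp.
apply/aeT_ae; apply: aeT_sub fg => t It /= h; rewrite lee_fin.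
by apply: le_trans h _; exact: ler_norm.
Qed.
Lemma rI_norm f : rI f -> rI (fun t => `|f t|).
Proof.
move=> /integrableP[mf lf]; apply/integrableP; split.
  exact/measurable_EFinP/measurableT_comp/measurable_EFinP.
by under eq_integral do rewrite /= normr_id.
Qed.
Lemma rI_cst a : rI (fun=> a).
Proof.
apply: measurable_bounded_integrable => //.
- exact: mu_I01_lty.
- by exists `|a|; split; rewrite ?num_real// => x ax t _ /=; exact: ltW.
Qed.
Lemma rintD f g : rI f -> rI g -> rint (fun t => f t + g t) = rint f + rint g.
Proof. by move=> *; exact: RintegralD. Qed.
Lemma rintZ a f : rI f -> rint (fun t => a * f t) = a * rint f.
Proof. by move=> *; exact: RintegralZl. Qed.
Lemma rintN f : rI f -> rint (fun t => - f t) = - rint f.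
Proof.
move=> hf; rewrite -mulN1r -rintZ//; congr rint; apply/funext => t.
by rewrite mulN1r.
Qed.
Lemma rintB f g : rI f -> rI g -> rint (fun t => f t - g t) = rint f - rint g.
Proof. by move=> *; exact: RintegralB. Qed.
Lemma rint_cst a : rint (fun=> a) = a.
Proof.
rewrite /rint Rintegral_cst//; have -> : fine (mu I) = 1 by rewrite mu_I01.
by rewrite mulr1.
Qed.
Lemma rint_ae f g : rmeas f -> rmeas g ->
  aeT (fun t => f t = g t) -> rint f = rint g.
Proof.
move=> mf mg h; congr fine; apply: ae_eq_integral => //.
- exact/measurable_EFinP.
- exact/measurable_EFinP.
- by apply/aeT_ae; apply: aeT_sub h => t _ ->.
Qed.
End CircleIntegral.

Section ComplexIntegral.
Variable R : realType.
Local Notation C := (complex.complex R).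
Local Notation mu := (@lebesgue_measure R).
Local Notation I := (@I01 R).
Local Notation zeta := (@zeta R).
Local Hint Resolve measurable_I01 : core.

Lemma rmeasD f g : @rmeas R f -> rmeas g -> rmeas (fun t => f t + g t).
Proof. exact: measurable_funD. Qed.
Lemma rmeasM f g : @rmeas R f -> rmeas g -> rmeas (fun t => f t * g t).
Proof. exact: measurable_funM. Qed.
Lemma rmeasN f : @rmeas R f -> rmeas (fun t => - f t).
Proof. exact: measurable_funN. Qed.
Lemma rmeas_cst a : @rmeas R (fun=> a). Proof. exact: measurable_cst. Qed.
Lemma rmeas_sum (J : Type) (r : seq J) (F : J -> R -> R) :
  (forall j, rmeas (F j)) -> rmeas (fun t => \sum_(j <- r) F j t).
Proof.
move=> h; elim: r => [|j r IH]; first by under eq_fun do rewrite big_nil; exact: rmeas_cst.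
by under eq_fun do rewrite big_cons; exact: rmeasD.
Qed.

Lemma rint_ge0 (f : R -> R) : rI f -> aeT (fun t => 0 <= f t) -> 0 <= rint f.
Proof.
move=> hf h; rewrite (@rint_ae _ f (fun t => `|f t|)).
- by apply: Rintegral_ge0 => t _; exact: normr_ge0.
- exact: rI_meas.
- exact: rI_meas (rI_norm hf).
- by apply: aeT_sub h => t _ h; rewrite ger0_norm.
Qed.
Lemma rint_le (f g : R -> R) : rI f -> rI g -> aeT (fun t => f t <= g t) ->
  rint f <= rint g.
Proof.
move=> hf hg h; rewrite -subr_ge0 -rintB//; apply: rint_ge0; first exact: rIB.
by apply: aeT_sub h => t _; rewrite subr_ge0.
Qed.
Lemma rint_eq0 (f : R -> R) : rI f -> aeT (fun t => 0 <= f t) -> rint f = 0 ->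
  aeT (fun t => f t = 0).
Proof.
move=> hf h f0.
have e : (\int[mu]_(x in I) `|(EFin \o f) x|)%E = 0%E.
  have : rint (fun t => `|f t|) = 0.
    rewrite -f0; apply: rint_ae; [exact: rI_meas (rI_norm hf)|exact: rI_meas|].
    by apply: aeT_sub h => t _ h; rewrite ger0_norm.
  rewrite /rint /Rintegral => e; rewrite -[RHS]/(0%:E) -e fineK//.
  have /integrableP[_] := hf; rewrite ge0_fin_numE//.
  by apply: integral_ge0 => t _; rewrite lee_fin.
have mf : measurable_fun (I : set (measurableTypeR R)) (EFin \o f).
  by apply/measurable_EFinP; exact: rI_meas hf.
have /aeT_ae h2 := (ae_eq_integral_abs mu (@measurable_I01 R) mf).1 e.
by apply: aeT_sub h2 => t _ [].
Qed.

Lemma cmeasD f g : @cmeas R f -> cmeas g -> cmeas (fun t => f t + g t).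
Proof.
move=> /cmeasE[a b] /cmeasE[c d]; apply/cmeasE; split.
  by under eq_fun do rewrite ReD; exact: rmeasD.
by under eq_fun do rewrite ImD; exact: rmeasD.
Qed.
Lemma cmeasN f : @cmeas R f -> cmeas (fun t => - f t).
Proof.
move=> /cmeasE[a b]; apply/cmeasE; split.
  by under eq_fun do rewrite ReN; exact: rmeasN.
by under eq_fun do rewrite ImN; exact: rmeasN.
Qed.
Lemma cmeasB f g : @cmeas R f -> cmeas g -> cmeas (fun t => f t - g t).
Proof. by move=> hf /cmeasN; exact: cmeasD. Qed.
Lemma cmeasM f g : @cmeas R f -> cmeas g -> cmeas (fun t => f t * g t).
Proof.
move=> /cmeasE[a b] /cmeasE[c d]; apply/cmeasE; split.
  under eq_fun do rewrite ReM; apply: rmeasD; first exact: rmeasM.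
  by apply: rmeasN; exact: rmeasM.
by under eq_fun do rewrite ImM; apply: rmeasD; exact: rmeasM.
Qed.
Lemma cmeasJ f : @cmeas R f -> cmeas (fun t => conjc (f t)).
Proof.
move=> /cmeasE[a b]; apply/cmeasE; split; first by under eq_fun do rewrite ReJ.
by under eq_fun do rewrite ImJ; exact: rmeasN.
Qed.
Lemma cmeas_cst a : @cmeas R (fun=> a).
Proof. by apply/cmeasE; split; exact: rmeas_cst. Qed.
Lemma cmeas_sum (J : Type) (r : seq J) (F : J -> R -> C) :
  (forall j, cmeas (F j)) -> cmeas (fun t => \sum_(j <- r) F j t).
Proof.
move=> h; elim: r => [|j r IH]; first by under eq_fun do rewrite big_nil; exact: cmeas_cst.
by under eq_fun do rewrite big_cons; exact: cmeasD.
Qed.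
Lemma cmeasX f k : @cmeas R f -> cmeas (fun t => f t ^+ k).
Proof.
move=> hf; elim: k => [|k IH]; first by under eq_fun do rewrite expr0; exact: cmeas_cst.
by under eq_fun do rewrite exprS; exact: cmeasM.
Qed.
Lemma rmeas_cabs2 f : @cmeas R f -> rmeas (fun t => cabs (f t) ^+ 2).
Proof.
move=> /cmeasE[a b]; under eq_fun do rewrite cabs2 !expr2.
by apply: rmeasD; exact: rmeasM.
Qed.

Definition cI (g : R -> C) := rI (fun t => Re (g t)) /\ rI (fun t => Im (g t)).
Lemma cI_meas g : cI g -> cmeas g.
Proof. by move=> [/rI_meas a /rI_meas b]; apply/cmeasE. Qed.
Lemma cI_dom g h : cmeas g -> rI h -> aeT (fun t => cabs (g t) <= h t) -> cI g.
Proof.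
move=> /cmeasE[a b] hh le; split.
- apply: rI_dom a hh _; apply: aeT_sub le => t _; exact/le_trans/Re_le_cabs.
- apply: rI_dom b hh _; apply: aeT_sub le => t _; exact/le_trans/Im_le_cabs.
Qed.
Lemma cI_bnd g M : cmeas g -> aeT (fun t => cabs (g t) <= M) -> cI g.
Proof. by move=> mg; apply: cI_dom mg (rI_cst M). Qed.
Lemma cID f g : cI f -> cI g -> cI (fun t => f t + g t).
Proof.
by move=> [a b] [c d]; split; under eq_fun do rewrite ?ReD ?ImD; exact: rID.
Qed.
Lemma cIZ z f : cI f -> cI (fun t => z * f t).
Proof.
move=> [a b]; split; under eq_fun do rewrite ?ReM ?ImM.
  by apply: rIB; exact: rIZ.
by apply: rID; exact: rIZ.
Qed.
Lemma cIN f : cI f -> cI (fun t => - f t).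
Proof. by move=> [a b]; split; under eq_fun do rewrite ?ReN ?ImN; exact: rIN. Qed.
Lemma cIB f g : cI f -> cI g -> cI (fun t => f t - g t).
Proof. by move=> hf /cIN; exact: cID. Qed.
Lemma cI_cst z : cI (fun=> z). Proof. by split; exact: rI_cst. Qed.
Lemma cI_sum (J : Type) (r : seq J) (F : J -> R -> C) :
  (forall j, cI (F j)) -> cI (fun t => \sum_(j <- r) F j t).
Proof.
move=> h; elim: r => [|j r IH]; first by under eq_fun do rewrite big_nil; exact: cI_cst.
by under eq_fun do rewrite big_cons; exact: cID.
Qed.
Lemma cI_unit f u : cI f -> cmeas u -> (forall t, cabs (u t) = 1) -> cI (fun t => f t * u t).
Proof.
move=> hf mu1 u1; apply: (@cI_dom _ (fun t => `|Re (f t)| + `|Im (f t)|)).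
- exact: cmeasM (cI_meas hf) mu1.
- by case: hf => a b; apply: rID; exact: rI_norm.
- by apply: aeT_all => t _; rewrite cabsM u1 mulr1 cabs_le_ReIm.
Qed.

Lemma cintE (g : R -> C) :
  cint g = complex.Complex (rint (fun t => Re (g t))) (rint (fun t => Im (g t))).
Proof. by []. Qed.
Lemma cintD f g : cI f -> cI g -> cint (fun t => f t + g t) = cint f + cint g.
Proof.
move=> [a b] [c d]; rewrite !cintE; apply: complexP => /=.
  by under eq_fun do rewrite ReD; exact: rintD.
by under eq_fun do rewrite ImD; exact: rintD.
Qed.
Lemma cintZ z f : cI f -> cint (fun t => z * f t) = z * cint f.
Proof.
move=> [a b]; apply: complexP; rewrite !cE !cintE /=.
  rewrite -!rintZ// -(rintB (rIZ _ a) (rIZ _ b)); congr rint.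
  by apply/funext => t; rewrite ReM.
rewrite -!rintZ// -(rintD (rIZ _ b) (rIZ _ a)); congr rint.
by apply/funext => t; rewrite ImM.
Qed.
Lemma cintN f : cI f -> cint (fun t => - f t) = - cint f.
Proof.
by move=> hf; rewrite -mulN1r -cintZ//; congr cint; apply/funext => t; rewrite mulN1r.
Qed.
Lemma cintB f g : cI f -> cI g -> cint (fun t => f t - g t) = cint f - cint g.
Proof. by move=> hf hg; rewrite cintD ?cintN//; exact: cIN. Qed.
Lemma cintJ f : cI f -> cint (fun t => conjc (f t)) = conjc (cint f).
Proof.
move=> [a b]; apply: complexP; rewrite ?ReJ ?ImJ /=.
  by under eq_fun do rewrite ReJ.
by under eq_fun do rewrite ImJ; exact: rintN.
Qed.
Lemma cint_cst z : cint (fun=> z : C) = z.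
Proof. by rewrite cintE !rint_cst; case: z. Qed.
Lemma cint_sum (J : Type) (r : seq J) (F : J -> R -> C) :
  (forall j, cI (F j)) -> cint (fun t => \sum_(j <- r) F j t) = \sum_(j <- r) cint (F j).
Proof.
move=> h; elim: r => [|j r IH].
  by rewrite big_nil; under eq_fun do rewrite big_nil; exact: cint_cst.
rewrite big_cons -IH -cintD//; last exact: cI_sum.
by congr cint; apply/funext => t; rewrite big_cons.
Qed.
Lemma cint_ae f g : @cmeas R f -> cmeas g -> aeT (fun t => f t = g t) -> cint f = cint g.
Proof.
move=> /cmeasE[a b] /cmeasE[c d] h; rewrite !cintE.
by congr complex.Complex; apply: rint_ae => //; apply: aeT_sub h => t _ ->.
Qed.

Lemma zetaD s t : zeta (s + t) = zeta s * zeta t.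
Proof.
rewrite /Defs.zeta mulrDr; apply: complexP; rewrite !cE/= ?cosD ?sinD//.
by rewrite addrC mulrC (mulrC (sin _)).
Qed.
Lemma zeta0 : zeta 0 = 1.
Proof. by rewrite /Defs.zeta mulr0 cos0 sin0. Qed.
Lemma cabs_zeta t : cabs (zeta t) = 1.
Proof. by rewrite /cabs/= cos2Dsin2 sqrtr1. Qed.
Lemma zeta_neq0 t : zeta t != 0.
Proof. by rewrite -cabs_eq0 cabs_zeta oner_eq0. Qed.
Lemma zetaJ t : conjc (zeta t) = (zeta t)^-1.
Proof.
have h : zeta t * conjc (zeta t) = 1 by rewrite mulcJ cabs_zeta expr1n.
by apply: (mulfI (zeta_neq0 t)); rewrite h mulfV ?zeta_neq0.
Qed.
Lemma zetaXJ t k : conjc (zeta t ^+ k) = (zeta t ^+ k)^-1.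
Proof. by rewrite -exprVn -zetaJ rmorphXn. Qed.
Lemma zetazJ t (k : int) : conjc (zeta t ^ k) = zeta t ^ (- k).
Proof.
case: k => k; first by rewrite -exprnP zetaXJ exprnN.
by rewrite NegzE opprK -exprnN -exprnP -zetaXJ complex.conjcK.
Qed.
Lemma zetazM t (k l : int) : zeta t ^ (k + l) = zeta t ^ k * zeta t ^ l.
Proof. by rewrite expfzDr// zeta_neq0. Qed.
Lemma cabs_zetaz t (k : int) : cabs (zeta t ^ k) = 1.
Proof.
have hX m : cabs (zeta t ^+ m) = 1 by rewrite cabsX cabs_zeta expr1n.
case: k => k; first exact: hX.
by rewrite NegzE -exprnN -zetaXJ cabsJ hX.
Qed.
Lemma cmeas_zeta : cmeas zeta.
Proof.
have ct : continuous (fun t : R => 2 * pi * t) by move=> x; exact: mulrl_continuous.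
apply/cmeasE; split.
- apply: (@measurable_funS _ _ _ _ setT) => //.
  apply: (@continuous_measurable_fun R (cos \o (fun t => 2 * pi * t))) => x.
  by apply: continuous_comp; [exact: ct|exact: continuous_cos].
- apply: (@measurable_funS _ _ _ _ setT) => //.
  apply: (@continuous_measurable_fun R (sin \o (fun t => 2 * pi * t))) => x.
  by apply: continuous_comp; [exact: ct|exact: continuous_sin].
Qed.
Lemma cmeas_zetaz (k : int) : cmeas (fun t => zeta t ^ k).
Proof.
case: k => k; first exact: cmeasX cmeas_zeta.
under eq_fun do rewrite NegzE -exprnN -zetaXJ.
exact/cmeasJ/cmeasX/cmeas_zeta.
Qed.
Lemma cI_zetaz (k : int) : cI (fun t => zeta t ^ k).
Proof.
apply: (cI_bnd (cmeas_zetaz k) (M := 1)).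
by apply: aeT_all => t _; rewrite cabs_zetaz.
Qed.
Lemma zetaX t k : zeta t ^+ k = zeta (k%:R * t).
Proof.
elim: k => [|k IH]; first by rewrite mul0r expr0 zeta0.
by rewrite exprS IH -zetaD; congr zeta; rewrite mulrS mulrDl mul1r.
Qed.

Lemma rint_trig (f F : R -> R) : continuous f ->
  (forall x : R, is_derive x (1 : R) F (f x)) -> rint f = F 1 - F 0.
Proof.
move=> cf dF; rewrite /rint /Rintegral /I01 (continuous_FTC2 (F := F))//.
- exact: continuous_subspaceT.
- split.
  + by move=> x _; case: (dF x).
  + apply: cvg_at_right_filter; apply: differentiable_continuous.
    by apply/derivable1_diffP; case: (dF 0).
  + apply: cvg_at_left_filter; apply: differentiable_continuous.
    by apply/derivable1_diffP; case: (dF 1).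
- by move=> x _; rewrite derive1E; case: (dF x).
Qed.
Lemma cint_zetaX k : cint (fun t => zeta t ^+ k.+1) = 0.
Proof.
pose a : R := k.+1%:R * (2 * pi).
have a0 : a != 0 by rewrite mulf_neq0 ?pnatr_eq0// mulf_neq0 ?pnatr_eq0// gt_eqF ?pi_gt0.
have e t : zeta t ^+ k.+1 = complex.Complex (cos (a * t)) (sin (a * t)).
  by rewrite zetaX /Defs.zeta mulrA /a [_ * (2 * pi)]mulrC.
have ct : continuous (fun t : R => a * t) by move=> x; exact: mulrl_continuous.
have cper : cos (a * 1) = 1 /\ sin (a * 1) = 0.
  have : zeta 1 ^+ k.+1 = 1.
    by rewrite /Defs.zeta mulr1 mulr_natl cos2pi sin2pi expr1n.
  by rewrite e => -[].
have d1 (x : R) : is_derive x (1 : R) (fun t => a^-1 * sin (a * t)) (cos (a * x)).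
  apply: is_derive_eq.
  by rewrite /GRing.scale/= mulr1 [X in _ * X]mulrC mulKf.
have d2 (x : R) : is_derive x (1 : R) (fun t => - a^-1 * cos (a * t)) (sin (a * x)).
  apply: is_derive_eq.
  by rewrite /GRing.scale/= mulr1 !mulNr mulrN opprK [X in _ * X]mulrC mulKf.
rewrite cintE; apply: complexP => /=.
- under eq_fun do rewrite e/=.
  rewrite (rint_trig _ d1); first by rewrite cper.2 !mulr0 sin0 mulr0 subrr.
  by move=> x; apply: (@continuous_comp _ _ _ ( *%R a) cos); [exact: ct|exact: continuous_cos].
- under eq_fun do rewrite e/=.
  rewrite (rint_trig _ d2); first by rewrite cper.1 !mulr0 cos0 subrr.
  by move=> x; apply: (@continuous_comp _ _ _ ( *%R a) sin); [exact: ct|exact: continuous_sin].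
Qed.
Lemma cint_zetaz (k : int) : cint (fun t => zeta t ^ k) = (k == 0)%:R.
Proof.
case: k => [[|k]|k].
- by under eq_fun do rewrite expr0z; exact: cint_cst.
- exact: cint_zetaX.
- under eq_fun do rewrite NegzE -exprnN -zetaXJ.
  rewrite (cintJ (cI_zetaz k.+1)) cint_zetaX.
  exact: conjc0.
Qed.
End ComplexIntegral.

(** * Positivity tested against squared moduli of polynomials *)

Section TrigonometricPositivity.
Variable R : realType.
Local Notation C := (complex.complex R).
Local Notation mu := (@lebesgue_measure R).
Local Notation I := (@I01 R).
Local Notation zeta := (@zeta R).
Local Hint Resolve measurable_I01 : core.

(** A real trigonometric polynomial becomes an analytic one after multiplication by a power of
    [zeta]. As [zeta] is unimodular, [r^2] is then some [|P(zeta)|^2], so squares of such functions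
    are admissible test weights. *)
Definition rtrig (r : R -> R) :=
  exists (K : nat) (P : {poly C}), forall t, real_complex R (r t) * zeta t ^+ K = P.[zeta t].

Lemma rtrig_cst a : rtrig (fun=> a).
Proof. by exists 0%N, (real_complex R a)%:P => t; rewrite expr0 mulr1 hornerC. Qed.
Lemma rtrigD r s : rtrig r -> rtrig s -> rtrig (fun t => r t + s t).
Proof.
move=> [K [P hP]] [L [Q hQ]]; exists (K + L)%N, (P * 'X^L + Q * 'X^K) => t.
by rewrite !hornerE/= -hP -hQ rmorphD/= exprD; ring.
Qed.
Lemma rtrigM r s : rtrig r -> rtrig s -> rtrig (fun t => r t * s t).
Proof.
move=> [K [P hP]] [L [Q hQ]]; exists (K + L)%N, (P * Q) => t.
by rewrite !hornerE/= -hP -hQ rmorphM/= exprD; ring.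
Qed.
Lemma rtrigX r k : rtrig r -> rtrig (fun t => r t ^+ k).
Proof.
move=> hr; elim: k => [|k IH]; first by under eq_fun do rewrite expr0; exact: rtrig_cst.
by under eq_fun do rewrite exprS; exact: rtrigM.
Qed.
Lemma rtrig_cos c : rtrig (fun t => cos (2 * pi * (t - c))).
Proof.
exists 1%N, ((real_complex R 2^-1 * conjc (zeta c)) *: 'X^2 + (real_complex R 2^-1 * zeta c)%:P) => t.
rewrite hornerD hornerZ hornerXn hornerC expr1.
have -> : real_complex R (cos (2 * pi * (t - c))) =
    real_complex R 2^-1 * (zeta t * conjc (zeta c) + conjc (zeta t) * zeta c).
  rewrite /Defs.zeta mulrBr cosB; apply: complexP; rewrite !cE/=; first by field.
  by ring.
have z1 : conjc (zeta t) * zeta t = 1 by rewrite mulrC mulcJ cabs_zeta expr1n.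
move: (conjc (zeta c)) (conjc (zeta t)) z1 => w y z1.
by rewrite -[zeta c in RHS]mulr1 -z1; ring.
Qed.
Lemma rtrig_meas r : rtrig r -> rmeas r.
Proof.
move=> [K [P hP]].
have -> : r = fun t => Re (P.[zeta t] * zeta t ^ (- K%:Z)).
  apply/funext => t; rewrite -hP -exprnN mulfK ?Re_real// expf_neq0 ?zeta_neq0//.
suff /cmeasE[] : cmeas (fun t => P.[zeta t] * zeta t ^ (- K%:Z)) by [].
apply: cmeasM; last exact: cmeas_zetaz.
under eq_fun do rewrite horner_coef.
by apply: cmeas_sum => j; apply: cmeasM; [exact: cmeas_cst|exact/cmeasX/cmeas_zeta].
Qed.

Lemma bernoulli_ge (x : R) k : -1 <= x -> 1 + k%:R * x <= (1 + x) ^+ k.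
Proof.
move=> x1; elim: k => [|k IH]; first by rewrite mul0r addr0 expr0.
rewrite exprS; apply: le_trans (ler_wpM2l _ IH); last by lra.
by rewrite -natr1; have := sqr_ge0 x; have : 0 <= k%:R :> R by []; move: (k%:R) => z; nra.
Qed.

(* Tends to the indicator function of [u < 1/2]. *)
Definition step_pow (u : R) m := ((1 - u ^+ m) ^+ (2 ^ m)) ^+ 2.
Lemma step_pow_ge0 u m : 0 <= step_pow u m. Proof. exact: sqr_ge0. Qed.
Lemma step_pow_le1 u m : 0 <= u <= 1 -> step_pow u m <= 1.
Proof.
move=> /andP[u0 u1]; have um : 0 <= 1 - u ^+ m <= 1.
  by rewrite subr_ge0 exprn_ile1//= lerBlDr lerDl exprn_ge0.
rewrite /step_pow -exprM; apply: exprn_ile1; by case/andP: um.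
Qed.
(** By Bernoulli's inequality the inner power is at least [1 - (2 u)^m]. *)
Lemma step_pow_cvg1 u : 0 <= u -> u < 2^-1 -> step_pow u m @[m --> \oo] --> (1 : R).
Proof.
move=> u0 u1.
have h : (1 - (2 * u) ^+ m) ^+ 2 @[m --> \oo] --> ((1 - 0) ^+ 2 : R).
  have g : (1 - (2 * u) ^+ m) @[m --> \oo] --> (1 - 0 : R).
    apply: cvgB; first exact: cvg_cst.
    by apply: cvg_expr; rewrite ger0_norm; lra.
  exact: (cvgM g g).
rewrite subr0 expr1n in h.
apply: squeeze_cvgr h _; [|exact: cvg_cst]; near=> m.
have u2 : u ^+ m <= 1 by apply: exprn_ile1 => //; lra.
have um : 0 <= u ^+ m by exact: exprn_ge0.
have u3 : (2 * u) ^+ m <= 1 by apply: exprn_ile1; lra.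
apply/andP; split; last by apply: step_pow_le1; lra.
rewrite ler_pXn2r ?nnegrE ?subr_ge0// ?exprn_ge0 ?subr_ge0//.
have b := @bernoulli_ge (- u ^+ m) (2 ^ m)%N; rewrite natrX mulrN -exprMn in b.
by apply: b; lra.
Unshelve. all: by end_near. Qed.
(** With [v = u^m] and [N = 2^m], the product of [(1 - v)^N] and [(1 + v)^N] is at most 1, while
    [(1 + v)^N >= N v = (2 u)^m] by Bernoulli's inequality. *)
Lemma step_pow_cvg0 u : 2^-1 < u -> u <= 1 -> step_pow u m @[m --> \oo] --> (0 : R).
Proof.
move=> u0 u1.
have h : ((2 * u)^-1 ^+ m) ^+ 2 @[m --> \oo] --> (0 ^+ 2 : R).
  have g : (2 * u)^-1 ^+ m @[m --> \oo] --> (0 : R).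
    apply: cvg_expr; rewrite ger0_norm ?invr_ge0; last by lra.
    by rewrite invf_lt1; lra.
  exact: (cvgM g g).
rewrite expr0n /= in h.
apply: squeeze_cvgr _ h; [|exact: cvg_cst]; near=> m.
have u2 : u ^+ m <= 1 by apply: exprn_ile1 => //; lra.
have um : 0 <= u ^+ m by apply: exprn_ge0; lra.
rewrite step_pow_ge0 /step_pow.
rewrite ler_pXn2r ?nnegrE ?exprn_ge0 ?invr_ge0 ?subr_ge0//; last by lra.
rewrite exprVn -div1r ler_pdivlMr; last by apply: exprn_gt0; lra.
have b1 : (2 * u) ^+ m <= (1 + u ^+ m) ^+ (2 ^ m).
  apply: le_trans (bernoulli_ge (2 ^ m) _); last by lra.
  by rewrite natrX exprMn lerDr.
apply: (@le_trans _ _ ((1 - u ^+ m) ^+ (2 ^ m) * (1 + u ^+ m) ^+ (2 ^ m))).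
  by rewrite ler_wpM2l// exprn_ge0// subr_ge0.
by rewrite -exprMn; apply: exprn_ile1; nra.
Unshelve. all: by end_near. Qed.

Lemma itv_2pi (s : R) : 0 <= s -> s <= 2^-1 -> 2 * pi * s \in `[0, pi].
Proof.
move=> s0 s1; have p0 := ltW (@pi_gt0 R).
by rewrite in_itv/= mulr_ge0 ?mulr_ge0//=; nra.
Qed.
Lemma cos_cmp_in (w s : R) : w <= 2^-1 -> `|s| < w -> cos (2 * pi * w) < cos (2 * pi * s).
Proof.
move=> w1 sw; have p0 := @pi_gt0 R.
have -> : cos (2 * pi * s) = cos (2 * pi * `|s|).
  by case: (ger0P s) => // _; rewrite mulrN cosN.
have s0 : 0 <= `|s| by [].
by rewrite ltr_cos ?itv_2pi//; [rewrite ltr_pM2l// mulr_gt0|lra|lra].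
Qed.
Lemma cos_cmp_out (w s : R) : 0 <= w -> w < `|s| -> `|s| < 1 - w ->
  cos (2 * pi * s) < cos (2 * pi * w).
Proof.
move=> w0 ws sw; have p0 := @pi_gt0 R.
have -> : cos (2 * pi * s) = cos (2 * pi * `|s|).
  by case: (ger0P s) => // _; rewrite mulrN cosN.
have [h|h] := leP `|s| 2^-1.
  by rewrite ltr_cos ?itv_2pi//; [rewrite ltr_pM2l// mulr_gt0|lra].
have -> : cos (2 * pi * `|s|) = cos (2 * pi * (1 - `|s|)).
  by rewrite mulrBr mulr1 mulr_natl cosB cos2pi sin2pi mul1r mul0r addr0.
by rewrite ltr_cos ?itv_2pi//; [rewrite ltr_pM2l ?mulr_gt0//; lra|lra..].
Qed.

Lemma aeT_neq (x : R) : aeT (fun t => t <> x).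
Proof.
have h : mu.-negligible [set x].
  by apply/negligibleP; [exact: measurable_set1|exact: lebesgue_measure_set1].
by apply: negligibleS h => t [_ /contrapT].
Qed.
(** Squares of real trigonometric polynomials tend boundedly to the indicator of the interval, and
    each of them has a nonnegative integral against [phi]. *)
Lemma rint_itv_ge0 (phi : R -> R) (a b : R) : rI phi ->
  (forall P : {poly C}, 0 <= rint (fun t => cabs P.[zeta t] ^+ 2 * phi t)) ->
  0 <= a -> a <= b -> b <= 1 -> 0 <= Rintegral mu `]a, b] phi.
Proof.
move=> hphi hpos a0 ab b1.
pose c := (a + b) / 2; pose w := (b - a) / 2.
(* [u] takes values in [0, 1] and lies below 1/2 exactly on the open arc of half-width [w] about
   [c]. *)
pose u t := 2^-1 + (cos (2 * pi * w) - cos (2 * pi * (t - c))) / 4.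
have u01 t : 0 <= u t <= 1.
  have := cos_le1 (2 * pi * w); have := cos_geN1 (2 * pi * w).
  have := cos_le1 (2 * pi * (t - c)); have := cos_geN1 (2 * pi * (t - c)).
  by rewrite /u; move: (cos _) (cos _) => x y *; apply/andP; split; lra.
have ru : rtrig u.
  apply: rtrigD; first exact: rtrig_cst.
  under eq_fun do rewrite mulrDl.
  apply: rtrigD; first exact: rtrig_cst.
  under eq_fun do rewrite mulNr -mulrN mulrC.
  by apply: rtrigM; [exact: rtrig_cst|exact: rtrig_cos].
have rv m : rtrig (fun t => (1 - u t ^+ m) ^+ (2 ^ m)).
  apply: rtrigX; apply: rtrigD; first exact: rtrig_cst.
  under eq_fun do rewrite -mulN1r.
  by apply: rtrigM; [exact: rtrig_cst|exact: rtrigX].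
have rw m : rmeas (fun t => step_pow (u t) m).
  by apply: rmeasM; exact: rtrig_meas (rv m).
have posm m : 0 <= rint (fun t => step_pow (u t) m * phi t).
  have [K [P hP]] := rv m; have := hpos P.
  congr (_ <= _); congr rint; apply/funext => t; rewrite -hP cabsM cabs_real cabsX.
  by rewrite cabs_zeta expr1n mulr1 real_normK ?num_real.
pose g t := \1_(`]a, b] : set R) t * phi t.
have mg : rmeas g.
  apply: rmeasM; last exact: rI_meas.
  by apply: measurable_indic; exact: measurable_itv.
have gE : Rintegral mu `]a, b] phi = rint g.
  have -> : `]a, b]%classic = I `&` `]a, b]%classic.
    by apply/seteqP; split => t /=; rewrite /I01/= !in_itv/=; lra.
  rewrite Rintegral_mkcondr; congr Rintegral; apply/funext => t.
  rewrite /g indicE patchE; case: ifPn => _; by rewrite ?mul1r ?mul0r.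
have [||||| _ _ cv] := @dominated_convergence _ _ R mu I (@measurable_I01 R)
  (fun m t => (step_pow (u t) m * phi t)%:E) (EFin \o g) (fun t => `|phi t|%:E).
- by move=> m; apply/measurable_EFinP; apply: rmeasM; [exact: rw|exact: rI_meas].
- exact/measurable_EFinP.
- apply/aeT_ae.
  apply: aeT_sub (aeT_and (aeT_and (aeT_neq a) (aeT_neq b)) (aeT_and (aeT_neq 0) (aeT_neq 1))).
  move=> t; rewrite /I01/= in_itv/= => /andP[t0 t1] [[ta tb] [tz to]].
  have /andP[ut0 ut1] := u01 t.
  have {}t0 : 0 < t by rewrite lt_def t0 andbT; apply/eqP.
  have {}t1 : t < 1 by rewrite lt_def t1 andbT; apply/eqP => /esym.
  apply: cvg_EFin; first by near=> m.
  rewrite /g indicE mem_setE in_itv/=.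
  have [h|h] := boolP (a < t < b).
    have -> : a < t <= b by case/andP: h => -> /ltW ->.
    apply: cvgM; last exact: cvg_cst.
    apply: step_pow_cvg1 => //.
    have : cos (2 * pi * w) < cos (2 * pi * (t - c)).
      apply: cos_cmp_in; first by rewrite /w; lra.
      by rewrite ltr_norml /w /c; case/andP: h; lra.
    by rewrite /u; lra.
  have /negPf -> : ~~ (a < t <= b).
    apply: contra h => /andP[-> tb']; rewrite lt_def tb' andbT.
    by apply/eqP => /esym.
  apply: cvgM; last exact: cvg_cst.
  apply: step_pow_cvg0 => //.
  have : cos (2 * pi * (t - c)) < cos (2 * pi * w).
    have h' : t < a \/ b < t.
      have [?|?] := ltP t a; first by left.
      right; rewrite ltNge; apply: contra h => tb'.
      by rewrite !lt_def tb' andbT; apply/andP; split; [apply/andP; split => //; exact/eqP|apply/eqP => /esym].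
    apply: cos_cmp_out; first by rewrite /w; lra.
      by rewrite lter_normr /w /c; case: h' => h'; apply/orP; [right|left]; lra.
    by rewrite ltr_norml /w /c; apply/andP; split; lra.
  by rewrite /u; lra.
- by have := rI_norm hphi.
- apply: aeW => t m _; rewrite /= lee_fin normrM.
  rewrite ger0_norm ?step_pow_ge0// -[leRHS]mul1r ler_wpM2r//.
  exact: step_pow_le1.
rewrite gE /rint /Rintegral fine_ge0//.
have -> : (\int[mu]_(x in I) (g x)%:E)%E = limn (fun m => \int[mu]_(x in I) (step_pow (u x) m * phi x)%:E)%E.
  by apply/esym/cvg_lim.
apply: lime_ge; first by apply/cvg_ex; eexists; exact: cv.
near=> m.
have im : rI (fun t => step_pow (u t) m * phi t).
  apply: (@rI_dom _ _ (fun t => `|phi t|)); [|exact: rI_norm|].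
    by apply: rmeasM; [exact: rw|exact: rI_meas].
  apply: aeT_all => t _; rewrite normrM ger0_norm ?step_pow_ge0//.
  by rewrite -[leRHS]mul1r ler_wpM2r//; exact: step_pow_le1.
have := posm m; rewrite /rint /Rintegral -lee_fin fineK//.
exact: integrable_fin_num.
Unshelve. all: by end_near. Qed.

(** Positivity on intervals makes the primitive of [phi] nondecreasing, and by Lebesgue
    differentiation [phi] is its derivative almost everywhere. *)
Lemma poly_positivity (phi : R -> R) : rI phi ->
  (forall P : {poly C}, 0 <= rint (fun t => cabs P.[zeta t] ^+ 2 * phi t)) ->
  aeT (fun t => 0 <= phi t).
Proof.
move=> hphi hpos; pose f := phi \_ I.
have fT : mu.-integrable (setT : set (measurableTypeR R)) (EFin \o f).
  have := (@integrable_mkcond _ (measurableTypeR R) R mu I (EFin \o phi) (@measurable_I01 R)).1 hphi.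
  apply: eq_integrable => // t _; rewrite /f /= !patchE; by case: ifP.
have fi y : mu.-integrable (`]-oo, y] : set (measurableTypeR R)) (EFin \o f).
  by apply: integrableS fT => //; exact: measurable_itv.
have lf : locally_integrable setT f by apply: integrable_locally => //; exact: measurable_I01.
have := FTC1Ny fi lf; set F := fun x => _.
have mono x y : 0 <= x -> x <= y -> y <= 1 -> F x <= F y.
  move=> x0 xy y1; rewrite -subr_ge0 /F Rintegral_itvB//.
  have -> : (\int[mu]_(t in `]x, y]) f t)%R = (\int[mu]_(t in `]x, y]) phi t)%R.
    apply: eq_Rintegral => t; rewrite inE/= in_itv/= => /andP[xt ty].
    rewrite /f patchE mem_set// /I01/= in_itv/=; lra.
  exact: rint_itv_ge0.
move=> h.
have {}h : aeT (fun t => derivable F t 1 /\ F^`()%classic t = f t).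
  by apply: negligibleS h => t [_ nP] hP; exact: nP.
apply: aeT_sub3 h (aeT_neq 0) (aeT_neq 1) => t It [dF dFt] tz to.
have -> : phi t = f t by rewrite /f patchE mem_set.
move: It; rewrite /I01/= in_itv/= => /andP[t0 t1].
have {}t1 : t < 1 by rewrite lt_def t1 andbT; apply/eqP => /esym.
rewrite -dFt leNgt; apply/negP => neg.
have cv : h^-1 *: (F (h + t) - F t) @[h --> 0^'] --> F^`()%classic t.
  have -> : (fun h : R => h^-1 *: (F (h + t) - F t)) = (fun h => h^-1 *: ((F \o shift t) (h *: (1 : R)) - F t)).
    by apply/funext => h; rewrite /= /GRing.scale/= mulr1.
  by rewrite derive1E; exact: dF.
have [e /= e0 he] := cvgr_lt _ cv _ neg.
pose k := Num.min (e / 2) (1 - t).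
have k0 : 0 < k by rewrite lt_min; lra.
have ke : k < e by rewrite /k gt_min; apply/orP; left; lra.
have kt : k <= 1 - t by rewrite /k ge_min lexx orbT.
have := he k; rewrite /ball_ /= sub0r normrN gtr0_norm// => /(_ ke (lt0r_neq0 k0)).
apply/negP; rewrite -leNgt /GRing.scale/= mulr_ge0 ?invr_ge0 ?(ltW k0)//.
by rewrite subr_ge0; apply: mono; lra.
Qed.
End TrigonometricPositivity.

(** * Vector-valued [L^2], [H^2] and their projections *)

Section VectorProduct.
Variable R : realType.
Local Notation C := (complex.complex R).

Definition dp m (x y : 'cV[C]_m) : C := \sum_i x i 0 * conjc (y i 0).

Lemma vnorm_ge0 m (x : 'cV[C]_m) : 0 <= vnorm x. Proof. exact: sqrtr_ge0. Qed.
Lemma vnorm2 m (x : 'cV[C]_m) : vnorm x ^+ 2 = \sum_i cabs (x i 0) ^+ 2.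
Proof. by rewrite sqr_sqrtr// sumr_ge0// => i _; rewrite sqr_ge0. Qed.
Lemma dp_diag m (x : 'cV[C]_m) : dp x x = real_complex R (vnorm x ^+ 2).
Proof. by rewrite vnorm2 rmorph_sum/=; apply: eq_bigr => i _; rewrite mulcJ. Qed.
Lemma linsubT (V : lmodType C) : linsub (fun _ : V => True). Proof. by []. Qed.
Lemma dp_hform m : hform (fun _ : 'cV[C]_m => True) (@dp m).
Proof.
split => // [a x y z _ _ _|x y _ _|x _].
- rewrite mulr_sumr -big_split; apply: eq_bigr => i _ /=.
  by rewrite !mxE mulrDl mulrA.
- by rewrite conjc_sum; apply: eq_bigr => i _; rewrite conjcM complex.conjcK mulrC.
- by rewrite dp_diag sqr_ge0.
Qed.
Lemma nq_dp m (x : 'cV[C]_m) : nq (@dp m) x = vnorm x ^+ 2.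
Proof. by rewrite /nq dp_diag. Qed.
Lemma nrm_dp m (x : 'cV[C]_m) : nrm (@dp m) x = vnorm x.
Proof. by rewrite /nrm nq_dp sqrtr_sqr ger0_norm ?vnorm_ge0. Qed.
Lemma dp_CS m (x y : 'cV[C]_m) : cabs (dp x y) <= vnorm x * vnorm y.
Proof. by rewrite -!nrm_dp; exact: (nrmCS (dp_hform m)). Qed.
Lemma vnormD m (x y : 'cV[C]_m) : vnorm (x + y) <= vnorm x + vnorm y.
Proof. by rewrite -!nrm_dp; exact: (nrmD (dp_hform m)). Qed.
Lemma vnormZ m a (x : 'cV[C]_m) : vnorm (a *: x) = cabs a * vnorm x.
Proof. by rewrite -!nrm_dp; exact: (nrmZ (dp_hform m)). Qed.
Lemma vnormN m (x : 'cV[C]_m) : vnorm (- x) = vnorm x.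
Proof. by rewrite -scaleN1r vnormZ cabsN cabs1 mul1r. Qed.
Lemma vnorm0 m : vnorm (0 : 'cV[C]_m) = 0.
Proof. by rewrite -[0](scale0r 0) vnormZ cabs0 mul0r. Qed.
Lemma vnorm_eq0 m (x : 'cV[C]_m) : vnorm x = 0 -> x = 0.
Proof.
move=> h; have /eqP := vnorm2 x; rewrite h expr0n/= eq_sym psumr_eq0 => [|i _]; last exact: sqr_ge0.
move=> /allP hx; apply/matrixP => i j; rewrite ord1 mxE.
have := hx i (mem_index_enum _).
by rewrite sqrf_eq0 cabs_eq0 => /eqP.
Qed.
Lemma cabs_le_vnorm m (x : 'cV[C]_m) i : cabs (x i 0) <= vnorm x.
Proof.
rewrite -(@ler_pXn2r _ 2)// ?nnegrE ?cabs_ge0 ?vnorm_ge0// vnorm2 (bigD1 i)//=.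
by rewrite lerDl sumr_ge0// => j _; rewrite sqr_ge0.
Qed.
Lemma dp_delta m (x : 'cV[C]_m) i : dp x (delta_mx i 0) = x i 0.
Proof.
rewrite /dp (bigD1 i)//= big1 => [|j ji].
  have -> : (delta_mx i 0 : 'cV[C]_m) i 0 = 1 by rewrite mxE !eqxx.
  by rewrite conjc1 mulr1 addr0.
have -> : (delta_mx i 0 : 'cV[C]_m) j 0 = 0 by rewrite mxE (negPf ji).
by rewrite conjc0 mulr0.
Qed.
Lemma dp_eqP m (x y : 'cV[C]_m) : (forall z, dp x z = dp y z) -> x = y.
Proof. by move=> h; apply/matrixP => i j; rewrite ord1 -!dp_delta h. Qed.
Lemma vnorm_le_sum m (x : 'cV[C]_m) : vnorm x <= \sum_i cabs (x i 0).
Proof.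
have s0 : 0 <= \sum_i cabs (x i 0) by apply: sumr_ge0 => i _; exact: cabs_ge0.
rewrite -(@ler_pXn2r _ 2)// ?nnegrE ?vnorm_ge0// vnorm2 expr2 mulr_suml.
apply: ler_sum => i _; rewrite expr2 ler_wpM2l ?cabs_ge0//.
by rewrite (bigD1 i)//= lerDl sumr_ge0// => j _; exact: cabs_ge0.
Qed.
End VectorProduct.

HB.lock Definition ip (R : realType) (m : nat) (f g : R -> 'cV[complex.complex R]_m) :=
  cint (fun t => dp (f t) (g t)).

Section L2.
Variables (R : realType) (m : nat).
Local Notation C := (complex.complex R).
Local Notation I := (@I01 R).
Local Notation V := (R -> 'cV[C]_m).
Local Notation ip := (@ip R m).
Implicit Types f g h : V.

Lemma cmeas_dp f g : (forall i, cmeas (fun t => f t i 0)) ->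
  (forall i, cmeas (fun t => g t i 0)) -> cmeas (fun t => dp (f t) (g t)).
Proof. by move=> hf hg; apply: cmeas_sum => i; apply: cmeasM => //; exact: cmeasJ. Qed.
Lemma rmeas_vnorm2 f : (forall i, cmeas (fun t => f t i 0)) ->
  rmeas (fun t => vnorm (f t) ^+ 2).
Proof.
move=> hf; under eq_fun do rewrite vnorm2.
by apply: rmeas_sum => i; exact: rmeas_cabs2.
Qed.
Lemma isL2P f : isL2 f <->
  (forall i, cmeas (fun t => f t i 0)) /\ rI (fun t => vnorm (f t) ^+ 2).
Proof.
split => -[mf h]; split => //.
  apply/integrableP; split; first by apply/measurable_EFinP; exact: rmeas_vnorm2.
  by under eq_integral do rewrite /= ger0_norm ?sqr_ge0//.
have /integrableP[_] := h.
by under eq_integral do rewrite /= ger0_norm ?sqr_ge0//.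
Qed.
Lemma isL2_dom f (h : R -> R) : (forall i, cmeas (fun t => f t i 0)) -> rI h ->
  aeT (fun t => vnorm (f t) ^+ 2 <= h t) -> isL2 f.
Proof.
move=> mf hh le; apply/isL2P; split => //.
apply: rI_dom (rmeas_vnorm2 mf) hh _; apply: aeT_sub le => t _.
by rewrite ger0_norm ?sqr_ge0.
Qed.
Lemma cI_dp f g : isL2 f -> isL2 g -> cI (fun t => dp (f t) (g t)).
Proof.
move=> /isL2P[mf hf] /isL2P[mg hg].
apply: (cI_dom (cmeas_dp mf mg) (rID hf hg)).
apply: aeT_all => t _; apply: le_trans (dp_CS _ _) _.
have := sqr_ge0 (vnorm (f t)); have := sqr_ge0 (vnorm (g t)).
have := sqr_ge0 (vnorm (f t) - vnorm (g t)); nra.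
Qed.
Lemma isL2_linsub : linsub (@isL2 R m).
Proof.
split.
  apply: (@isL2_dom _ (fun=> 0)); last by apply: aeT_all => t _; rewrite vnorm0 expr0n.
    by move=> i; under eq_fun do rewrite mxE; exact: cmeas_cst.
  exact: rI_cst.
move=> a f g /isL2P[mf hf] /isL2P[mg hg].
apply: (@isL2_dom _ (fun t => 2 * cabs a ^+ 2 * vnorm (f t) ^+ 2 + 2 * vnorm (g t) ^+ 2)).
- move=> i; under eq_fun do rewrite !mxE.
  by apply: cmeasD => //; apply: cmeasM => //; exact: cmeas_cst.
- by apply: rID; exact: rIZ.
apply: aeT_all => t _.
have := nqD_le2 (dp_hform R m) (f := a *: f t) (g := g t) Logic.I Logic.I.
by rewrite !nq_dp vnormZ exprMn !mulrA.
Qed.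
Lemma ip_hform : hform (@isL2 R m) ip.
Proof.
split; first exact: isL2_linsub.
- move=> a f g h hf hg hh; rewrite ip.unlock.
  rewrite -cintZ; last exact: cI_dp.
  rewrite -cintD; [|exact/cIZ/cI_dp|exact: cI_dp]; congr cint; apply/funext => t.
  exact: (hformL (dp_hform R m)).
- move=> f g hf hg; rewrite ip.unlock -cintJ; last exact: cI_dp.
  by congr cint; apply/funext => t; exact: (hformC (dp_hform R m)).
- move=> f /isL2P[mf hf]; rewrite ip.unlock cintE/=.
  under eq_fun do rewrite dp_diag/=.
  by apply: rint_ge0 => //; apply: aeT_all => t _; rewrite sqr_ge0.
Qed.
Lemma nq_ip f : nq ip f = rint (fun t => vnorm (f t) ^+ 2).
Proof. by rewrite /nq ip.unlock cintE/=; under eq_fun do rewrite dp_diag/=. Qed.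
Lemma l2normE f : l2norm f = nrm ip f.
Proof. by rewrite /l2norm /nrm nq_ip. Qed.

Definition aeq f g := aeT (fun t => f t = g t).
Lemma aeq_refl f : aeq f f. Proof. exact: aeT_all. Qed.
Lemma aeq_sym f g : aeq f g -> aeq g f. Proof. by apply: aeT_sub => t _ ->. Qed.
Lemma aeq_trans g f h : aeq f g -> aeq g h -> aeq f h.
Proof. by apply: aeT_sub2 => t _ -> ->. Qed.
Lemma aeqL (a : C) f g f' g' : aeq f f' -> aeq g g' -> aeq (a *: f + g) (a *: f' + g').
Proof. by apply: aeT_sub2 => t _ h1 h2; rewrite !fctE h1 h2. Qed.
Lemma aeqD f g f' g' : aeq f f' -> aeq g g' -> aeq (f + g) (f' + g').
Proof. by apply: aeT_sub2 => t _ h1 h2; rewrite !fctE h1 h2. Qed.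
Lemma ip_aeql f f' g : isL2 f -> isL2 f' -> isL2 g -> aeq f f' -> ip f g = ip f' g.
Proof.
move=> hf hf' hg h; rewrite ip.unlock.
apply: cint_ae; [exact/cI_meas/cI_dp|exact/cI_meas/cI_dp|].
by apply: aeT_sub h => t _ ->.
Qed.
Lemma ip_aeqr f g g' : isL2 f -> isL2 g -> isL2 g' -> aeq g g' -> ip f g = ip f g'.
Proof.
by move=> hf hg hg' h; rewrite (hformC ip_hform hg hf) (ip_aeql hg hg' hf h) -(hformC ip_hform hg' hf).
Qed.
Lemma nq_aeq f f' : isL2 f -> isL2 f' -> aeq f f' -> nq ip f = nq ip f'.
Proof. by move=> hf hf' h; rewrite /nq (ip_aeql hf hf' hf h) (ip_aeqr hf' hf hf' h). Qed.
Lemma nq_eq0 f : isL2 f -> nq ip f = 0 -> aeT (fun t => f t = 0).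
Proof.
move=> /isL2P[mf hf]; rewrite nq_ip => h.
have := rint_eq0 hf _ h; move=> /(_ (aeT_all (fun t _ => sqr_ge0 _))).
by apply: aeT_sub => t _ /eqP; rewrite sqrf_eq0 => /eqP/vnorm_eq0.
Qed.
Lemma nqB_aeq f g : isL2 f -> isL2 g -> nq ip (f - g) = 0 -> aeq f g.
Proof.
move=> hf hg /nq_eq0 h; have := h (subspB isL2_linsub hf hg).
by apply: aeT_sub => t _; rewrite !fctE => /eqP; rewrite subr_eq0 => /eqP.
Qed.
Lemma isL2_aeq f g : (forall i, cmeas (fun t => g t i 0)) -> isL2 f -> aeq f g -> isL2 g.
Proof.
move=> mg /isL2P[mf hf] h; apply: (isL2_dom mg hf).
by apply: aeT_sub h => t _ ->.
Qed.
End L2.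

(** * Completeness of vector-valued [L^2] *)

Section L2Complete.
Variables (R : realType) (m : nat).
Local Notation C := (complex.complex R).
Local Notation mu := (@lebesgue_measure R).
Local Notation I := (@I01 R).
Local Notation V := (R -> 'cV[C]_m).
Local Notation ip := (@ip R m).
Local Hint Resolve measurable_I01 : core.

Lemma fast_cauchy_cvg (x : nat -> R) (b : R) :
  (forall k, `|x k.+1 - x k| <= b * 2^-1 ^+ k) -> cvgn x.
Proof.
move=> h.
have b0 : 0 <= b by have := le_trans (normr_ge0 _) (h 0%N); rewrite expr0 mulr1.
have cv : cvgn (series (telescope x)).
  apply: normed_cvg.
  apply: (@series_le_cvg _ _ (geometric b 2^-1)).
  - by move=> n; exact: normr_ge0.
  - by move=> n; apply: mulr_ge0 => //; exact: exprn_ge0.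
  - exact: h.
  - apply: is_cvg_geometric_series; rewrite ger0_norm; lra.
have -> : x = (fun n => x 0%N + series (telescope x) n).
  by apply/funext => n; exact: eq_sum_telescope.
by apply: is_cvgD => //; exact: is_cvg_cst.
Qed.

Lemma limn_esup_fin (x : nat -> R) : cvgn x ->
  x n @[n --> \oo] --> fine (limn_esup (fun k => (x k)%:E)).
Proof.
move=> cx; have h : (x n)%:E @[n --> \oo] --> (limn x)%:E by apply: cvg_EFin => //; near=> n.
by rewrite is_cvg_limn_esupE ?(cvg_lim _ h)//; apply/cvg_ex; eexists; exact: h.
Unshelve. all: by end_near. Qed.

Lemma limn_einf_le (u : nat -> \bar R) (c : \bar R) :
  (forall n, (u n <= c)%E) -> (limn_einf u <= c)%E.
Proof.
move=> h; rewrite limn_einf_lim; apply: lime_le; first exact: is_cvg_einfs.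
near=> n; apply: le_trans (h n); apply: ereal_inf_lbound.
by exists n => /=.
Unshelve. all: by end_near. Qed.

Lemma measurable_limn_einf (u : nat -> R -> \bar R) :
  (forall k, measurable_fun (I : set (measurableTypeR R)) (u k)) ->
  measurable_fun (I : set (measurableTypeR R)) (fun t => limn_einf (fun k => u k t)).
Proof.
move=> mu_; have -> : (fun t => limn_einf (fun k => u k t)) =
    (fun t => - limn_esup (fun k => - u k t))%E.
  apply/funext => t; rewrite -limn_einfN; congr limn_einf.
  by apply/funext => k /=; rewrite oppeK.
apply: measurableT_comp => //; apply: measurable_fun_limn_esup => k.
exact: measurableT_comp.
Qed.

Lemma cvg_sum_seq (J : Type) (r : seq J) (u : J -> nat -> R) (l : J -> R) :
  (forall i, u i j @[j --> \oo] --> l i) ->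
  \sum_(i <- r) u i j @[j --> \oo] --> \sum_(i <- r) l i.
Proof.
move=> h; elim: r => [|i r IH].
  by rewrite big_nil; under eq_fun do rewrite big_nil; exact: cvg_cst.
by rewrite big_cons; under eq_fun do rewrite big_cons; exact: cvgD.
Qed.

(** The weights [4^k] against the bounds [8^-k / 2] make the sum of [4^k |v_(k+1) - v_k|^2]
    integrable. Where it is finite the increments are [O(2^-k)], so the sequence converges; Fatou's
    lemma gives the norm estimate. *)
Lemma L2_fast_cvg (v : nat -> V) : (forall k, isL2 (v k)) ->
  (forall k l, (k <= l)%N -> nq ip (v l - v k) <= 8^-1 ^+ k / 2) ->
  exists2 f, isL2 f & (forall k, nq ip (v k - f) <= 8^-1 ^+ k / 2) /\
    aeT (fun t => forall i, Re (v k t i 0) @[k --> \oo] --> Re (f t i 0) /\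
                            Im (v k t i 0) @[k --> \oo] --> Im (f t i 0)).
Proof.
move=> hv hc.
have mv k i : cmeas (fun t => v k t i 0) by case: (hv k).
pose d k t := vnorm (v k.+1 t - v k t) ^+ 2.
have hd k : rI (d k).
  by have /isL2P[] := subspB (@isL2_linsub R m) (hv k.+1) (hv k).
have d0 k t : 0 <= d k t by exact: sqr_ge0.
pose h k t := (4 ^+ k * d k t)%:E.
have mh k : measurable_fun (I : set (measurableTypeR R)) (h k).
  by apply/measurable_EFinP; apply: rmeasM; [exact: rmeas_cst|exact: rI_meas].
have h0 k t : (0 <= h k t)%E by rewrite lee_fin mulr_ge0// exprn_ge0.
have ih k : (\int[mu]_(t in I) h k t <= (1 / (2 ^ (k + 1))%:R)%:E)%E.
  have -> : (\int[mu]_(t in I) h k t)%E = (4 ^+ k * rint (d k))%:E.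
    rewrite -rintZ// /rint /Rintegral fineK//.
    by apply: integrable_fin_num => //; exact: rIZ.
  have := hc k k.+1 (leqnSn k); rewrite nq_ip lee_fin => le.
  apply: (le_trans (ler_wpM2l _ le)); first by rewrite exprn_ge0.
  rewrite mulrA -exprMn natrX addn1 exprS div1r invfM -exprVn.
  by rewrite (_ : 4 * 8^-1 = 2^-1) 1?mulrC//; field.
pose H t := (\sum_(0 <= k <oo) h k t)%E.
have iH : mu.-integrable (I : set (measurableTypeR R)) H.
  apply/integrableP; split.
    by apply: ge0_emeasurable_sum => // k t It _.
  have -> : (\int[mu]_(t in I) `|H t| = \int[mu]_(t in I) H t)%E.
    by apply: eq_integral => t _; rewrite gee0_abs//; apply: nneseries_ge0.
  rewrite integral_nneseries//.
  apply: le_lt_trans (ltry 1).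
  have e := @cvg_geometric_eseries_half R 1 0.
  rewrite expr0 divr1 in e; rewrite -(cvg_lim _ e)//.
  apply: lee_nneseries => [k _ _|k _]; last exact: ih.
  by apply: integral_ge0 => t _; exact: h0.
have bnd : aeT (fun t => exists b, forall k, vnorm (v k.+1 t - v k t) <= b * 2^-1 ^+ k).
  have /aeT_ae := integrable_ae (@measurable_I01 R) iH.
  apply: aeT_sub => t It fH; exists (Num.sqrt (fine (H t))) => k.
  have e1 : 4 ^+ k * d k t <= fine (H t).
    rewrite -lee_fin fineK//.
    have := @nneseries_lim_ge R (h^~ t) xpredT 0 k.+1 (fun n _ _ => h0 n t).
    rewrite big_nat_recr//=; apply: le_trans.
    by rewrite -[leLHS]add0e leeD2r// sume_ge0.
  have fH0 : 0 <= fine (H t) by apply: le_trans e1; rewrite mulr_ge0// exprn_ge0.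
  rewrite -(@ler_pXn2r _ 2)// ?nnegrE ?vnorm_ge0 ?mulr_ge0 ?sqrtr_ge0 ?exprn_ge0//.
  rewrite exprMn (sqr_sqrtr fH0) -[2^-1 ^+ k ^+ 2]exprM mulnC exprM -/(d k t).
  rewrite (_ : 2^-1 ^+ 2 = 4^-1 :> R); last by field.
  by rewrite exprVn ler_pdivlMr ?exprn_gt0// mulrC.
(* Upper limits are measurable everywhere and agree with the limit where it exists; [fine] supplies
   a finite value on the exceptional null set. *)
pose f : V := fun t => \col_i complex.Complex
  (fine (limn_esup (fun k => (Re (v k t i 0))%:E)))
  (fine (limn_esup (fun k => (Im (v k t i 0))%:E))).
have mf i : cmeas (fun t => f t i 0).
  apply/cmeasE; split; under eq_fun do rewrite mxE/=.
    apply: (measurableT_comp (@fine_measurable R setT measurableT)).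
    apply: measurable_fun_limn_esup => k; apply/measurable_EFinP.
    by have /cmeasE[] := mv k i.
  apply: (measurableT_comp (@fine_measurable R setT measurableT)).
  apply: measurable_fun_limn_esup => k; apply/measurable_EFinP.
  by have /cmeasE[] := mv k i.
have cvf : aeT (fun t => forall i, Re (v k t i 0) @[k --> \oo] --> Re (f t i 0) /\
                            Im (v k t i 0) @[k --> \oo] --> Im (f t i 0)).
  apply: aeT_sub bnd => t It [b hb] i.
  have hi k : cabs (v k.+1 t i 0 - v k t i 0) <= b * 2^-1 ^+ k.
    apply: le_trans (hb k); have := cabs_le_vnorm (v k.+1 t - v k t) i.
    by rewrite !mxE.
  rewrite mxE/=; split; apply: limn_esup_fin; apply: (@fast_cauchy_cvg _ b) => k.
    by apply: le_trans (hi k); apply: le_trans (Re_le_cabs _); rewrite !cE.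
  by apply: le_trans (hi k); apply: le_trans (Im_le_cabs _); rewrite !cE.
pose e k j t := (vnorm (v j t - v k t) ^+ 2)%:E.
have me k j : measurable_fun (I : set (measurableTypeR R)) (e k j).
  apply/measurable_EFinP; apply: rI_meas.
  by have /isL2P[] := subspB (@isL2_linsub R m) (hv j) (hv k).
have mfk k i : cmeas (fun t => (f t - v k t) i 0).
  have -> : (fun t => (f t - v k t) i 0) = (fun t => f t i 0 - v k t i 0).
    by apply/funext => t; rewrite !mxE.
  exact: cmeasB.
have lim_e k : aeT (fun t => limn_einf (fun j => e k (j + k)%N t) = (vnorm (f t - v k t) ^+ 2)%:E).
  apply: aeT_sub cvf => t It h1.
  suff h2 : e k (j + k)%N t @[j --> \oo] --> (vnorm (f t - v k t) ^+ 2)%:E.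
    by rewrite is_cvg_limn_einfE ?(cvg_lim _ h2)//; apply/cvg_ex; eexists; exact: h2.
  rewrite (@cvg_shiftn k _ (e k ^~ t)).
  apply: cvg_EFin; first by near=> j.
  rewrite vnorm2 [X in X @ _ --> _](_ : _ =
    (fun j => \sum_i cabs ((v j t - v k t) i 0) ^+ 2)); last first.
    by apply/funext => j; rewrite /= /e/= vnorm2.
  apply: cvg_sum_seq => i; have [r1 r2] := h1 i.
  rewrite [X in X @ _ --> _](_ : _ = (fun j => (Re (v j t i 0) - Re (v k t i 0)) ^+ 2 +
    (Im (v j t i 0) - Im (v k t i 0)) ^+ 2)); last first.
    by apply/funext => j; rewrite cabs2 !mxE !cE.
  have -> : cabs ((f t - v k t) i 0) ^+ 2 = (Re (f t i 0) - Re (v k t i 0)) ^+ 2 +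
    (Im (f t i 0) - Im (v k t i 0)) ^+ 2.
    have -> : (f t - v k t) i 0 = f t i 0 - v k t i 0 by rewrite !mxE.
    by rewrite cabs2 !cE.
  have c1 : Re (v j t i 0) - Re (v k t i 0) @[j --> \oo] --> Re (f t i 0) - Re (v k t i 0).
    by apply: cvgB r1 _; exact: cvg_cst.
  have c2 : Im (v j t i 0) - Im (v k t i 0) @[j --> \oo] --> Im (f t i 0) - Im (v k t i 0).
    by apply: cvgB r2 _; exact: cvg_cst.
  by apply: cvgD; [exact: (cvgM c1 c1)|exact: (cvgM c2 c2)].
have int_e k : (\int[mu]_(t in I) (vnorm (f t - v k t) ^+ 2)%:E <= (8^-1 ^+ k / 2)%:E)%E.
  rewrite (@ae_eq_integral _ _ R mu I (fun t => limn_einf (fun j => e k (j + k)%N t))); first last.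
  - by apply/aeT_ae; apply: aeT_sub (lim_e k) => t _ ->.
  - by apply: measurable_limn_einf => j; exact: me.
  - by apply/measurable_EFinP; exact: rmeas_vnorm2.
  - exact: measurable_I01.
  apply: le_trans (fatou mu (@measurable_I01 R) _ _) _ => //.
    by move=> j t _; rewrite lee_fin sqr_ge0.
  apply: limn_einf_le => j.
  have := hc k (j + k)%N (leq_addl _ _); rewrite nq_ip /rint /Rintegral -lee_fin fineK//.
  apply: integrable_fin_num => //.
  by have /isL2P[] := subspB (@isL2_linsub R m) (hv (j + k)%N) (hv k).
have L2fk k : isL2 (f - v k).
  split; first exact: mfk.
  by apply: le_lt_trans (int_e k) (ltry _).
have L2f : isL2 f by have := subspD (@isL2_linsub R m) (L2fk 0%N) (hv 0%N); rewrite subrK.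
exists f => //; split => // k.
rewrite (nqBC (ip_hform R m))// nq_ip /rint /Rintegral -lee_fin fineK; first exact: int_e.
by have /isL2P[_ h3] := L2fk k; exact: (integrable_fin_num (@measurable_I01 R) h3).
Unshelve. all: by end_near. Qed.

Lemma incr_choice (P : nat -> nat -> Prop) :
  (forall k, exists N, forall p, (N <= p)%N -> P k p) ->
  exists phi : nat -> nat, (forall k, (phi k < phi k.+1)%N) /\ forall k, P k (phi k).
Proof.
move=> /choice[N hN].
pose phi k := (\sum_(j < k.+1) N j + k)%N; exists phi; split => k.
  by rewrite /phi [X in (_ < X + _)%N]big_ord_recr/=; lia.
by apply: hN; rewrite /phi big_ord_recr/=; lia.
Qed.
Lemma incr_le (phi : nat -> nat) : (forall k, (phi k < phi k.+1)%N) ->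
  forall k l, (k <= l)%N -> (phi k <= phi l)%N.
Proof.
move=> h k l; elim: l => [|l IH]; first by rewrite leqn0 => /eqP ->.
by rewrite leq_eqVlt ltnS => /orP[/eqP ->//|/IH/leq_trans]; apply; exact: ltnW.
Qed.
Lemma incr_ge (phi : nat -> nat) : (forall k, (phi k < phi k.+1)%N) ->
  forall k, (k <= phi k)%N.
Proof. by move=> h; elim=> // k IH; exact: leq_ltn_trans IH (h k). Qed.

(** The subsequence converging almost everywhere is recorded because pointwise linear relations have
    to pass to the limit later. *)
Lemma L2_complete_ae (u : nat -> V) : (forall k, isL2 (u k)) ->
  (forall e, 0 < e -> exists N, forall k l, (N <= k)%N -> (N <= l)%N -> nq ip (u k - u l) < e) ->
  exists2 f, isL2 f & (forall e, 0 < e -> exists N, forall k, (N <= k)%N -> nq ip (u k - f) < e) /\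
    exists phi : nat -> nat,
    aeT (fun t => forall i, Re (u (phi k) t i 0) @[k --> \oo] --> Re (f t i 0) /\
                            Im (u (phi k) t i 0) @[k --> \oo] --> Im (f t i 0)).
Proof.
move=> hu hc.
have e0 k : 0 < 8^-1 ^+ k / 2 :> R by rewrite divr_gt0// exprn_gt0// invr_gt0.
have [phi [phiI hphi]] := @incr_choice (fun k N => forall p q, (N <= p)%N -> (N <= q)%N ->
     nq ip (u p - u q) < 8^-1 ^+ k / 2) (fun k => let: ex_intro N hN := hc _ (e0 k) in
     ex_intro _ N (fun p Np k l kp lp => hN _ _ (leq_trans Np kp) (leq_trans Np lp))).
have [||f hf [h1 h2]] := @L2_fast_cvg (u \o phi); first by move=> k; exact: hu.
  by move=> k l kl; apply/ltW/hphi => //; exact: incr_le.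
exists f => //; split; last by exists phi.
move=> e e1; have [N hN] := hc (e / 4) ltac:(lra).
have g : 8^-1 ^+ k @[k --> \oo] --> (0 : R).
  by apply: cvg_expr; rewrite ger0_norm; lra.
have [K _ hK] := cvgr_lt _ g (e / 4) ltac:(lra).
exists N => k Nk.
pose j := maxn N K.
have -> : u k - f = (u k - u (phi j)) + (u (phi j) - f) by rewrite addrA subrK.
apply: le_lt_trans (nqD_le2 (ip_hform R m) _ _) _.
- exact: subspB (@isL2_linsub R m) _ _.
- exact: subspB (@isL2_linsub R m) _ _.
have a1 := hN k (phi j) Nk (leq_trans (leq_maxl N K) (incr_ge phiI _)).
have a2 := h1 j; have a3 := hK j (leq_maxr N K).
by move: a1 a2 a3 => /=; lra.
Qed.
End L2Complete.

(** * Uniqueness of Fourier coefficients *)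

Section FourierUniqueness.
Variable R : realType.
Local Notation C := (complex.complex R).
Local Notation zeta := (@zeta R).

Lemma poly_abs2_int0 (g : R -> C) : cI g ->
  (forall k : int, cint (fun t => g t * zeta t ^ k) = 0) ->
  forall P : {poly C}, cint (fun t => real_complex R (cabs P.[zeta t] ^+ 2) * g t) = 0.
Proof.
move=> hg h0 P.
have hz (k : int) : cI (fun t => g t * zeta t ^ k).
  by apply: cI_unit => //; [exact: cmeas_zetaz|move=> t; exact: cabs_zetaz].
have -> : (fun t => real_complex R (cabs P.[zeta t] ^+ 2) * g t) =
  (fun t => \sum_(j < size P) \sum_(k < size P)
      (P`_j * conjc P`_k) * (g t * zeta t ^ (j%:Z - k%:Z))).
  apply/funext => t; rewrite -mulcJ horner_coef conjc_sum mulr_suml mulr_suml.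
  apply: eq_bigr => j _; rewrite mulr_sumr mulr_suml; apply: eq_bigr => k _.
  by rewrite conjcM zetazM -zetazJ -!exprnP; ring.
rewrite cint_sum; last by move=> j; apply: cI_sum => k; apply: cIZ.
rewrite big1// => j _; rewrite cint_sum; last by move=> k; apply: cIZ.
by rewrite big1// => k _; rewrite cintZ// h0 mulr0.
Qed.

Lemma fourier_Re_ge0 (g : R -> C) : cI g ->
  (forall k : int, cint (fun t => g t * zeta t ^ k) = 0) -> aeT (fun t => 0 <= Re (g t)).
Proof.
move=> hg h0; apply: poly_positivity; first by case: hg.
move=> P; have := poly_abs2_int0 hg h0 P; rewrite cintE => -[e _].
rewrite -[X in X <= _]e; under eq_fun do rewrite ReM Re_real Im_real mul0r subr0.
exact: lexx.
Qed.

(** Positivity of the real part is applied to [g], [-g], [i g] and [-i g]. *)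
Lemma fourier_unique (g : R -> C) : cI g ->
  (forall k : int, cint (fun t => g t * zeta t ^ k) = 0) -> aeT (fun t => g t = 0).
Proof.
move=> hg h0.
have hz (k : int) : cI (fun t => g t * zeta t ^ k).
  by apply: cI_unit => //; [exact: cmeas_zetaz|move=> t; exact: cabs_zetaz].
have key (a : C) : aeT (fun t => 0 <= Re (a * g t)).
  apply: fourier_Re_ge0; first exact: cIZ.
  move=> k; under eq_fun do rewrite -mulrA.
  by rewrite cintZ// h0 mulr0.
apply: aeT_sub2 (aeT_and (key 1) (key (-1))) (aeT_and (key (complex.Complex 0 1)) (key (complex.Complex 0 (-1)))).
move=> t _ [a1 a2] [a3 a4]; move: a1 a2 a3 a4; rewrite mul1r mulN1r ReN !ReM/=.
by move=> a1 a2 a3 a4; apply: complexP => /=; lra.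
Qed.
End FourierUniqueness.

Section FourierL2.
Variables (R : realType) (m : nat).
Local Notation C := (complex.complex R).
Local Notation V := (R -> 'cV[C]_m).
Local Notation ip := (@ip R m).
Local Notation zeta := (@zeta R).
Implicit Types (f g h : V) (k l : int).
Let L2s := @isL2_linsub R m.
Let ipH := @ip_hform R m.

Definition zs k f : V := fun t => zeta t ^ k *: f t.
Definition ek k (v : 'cV[C]_m) : V := fun t => zeta t ^ k *: v.

Lemma zsL k a f g : zs k (a *: f + g) = a *: zs k f + zs k g.
Proof. by apply/funext => t; rewrite /zs !fctE scalerDr !scalerA mulrC. Qed.
Lemma zsD k f g : zs k (f + g) = zs k f + zs k g.
Proof. by apply/funext => t; rewrite /zs !fctE scalerDr. Qed.
Lemma zsB k f g : zs k (f - g) = zs k f - zs k g.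
Proof. by apply/funext => t; rewrite /zs !fctE scalerBr. Qed.
Lemma zs0 f : zs 0 f = f.
Proof. by apply/funext => t; rewrite /zs expr0z scale1r. Qed.
Lemma zsA k l f : zs k (zs l f) = zs (k + l) f.
Proof. by apply/funext => t; rewrite /zs scalerA zetazM. Qed.
Lemma zsK k f : zs k (zs (- k) f) = f.
Proof. by rewrite zsA subrr zs0. Qed.
Lemma zsNK k f : zs (- k) (zs k f) = f.
Proof. by rewrite zsA addNr zs0. Qed.
Lemma zs_ek k l v : zs k (ek l v) = ek (k + l) v.
Proof. by apply/funext => t; rewrite /zs /ek scalerA zetazM. Qed.
Lemma aeq_zs k f g : aeq f g -> aeq (zs k f) (zs k g).
Proof. by apply: aeT_sub => t _; rewrite /zs => ->. Qed.
Lemma ekL k a v w : ek k (a *: v + w) = a *: ek k v + ek k w.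
Proof. by apply/funext => t; rewrite /ek !fctE scalerDr !scalerA mulrC. Qed.

Lemma vnorm_zs k f t : vnorm (zs k f t) = vnorm (f t).
Proof. by rewrite /zs vnormZ cabs_zetaz mul1r. Qed.
Lemma isL2_zs k f : isL2 f -> isL2 (zs k f).
Proof.
move=> /isL2P[mf hf]; apply/isL2P; split.
  move=> i; under eq_fun do rewrite /zs mxE.
  by apply: cmeasM => //; exact: cmeas_zetaz.
by under eq_fun do rewrite vnorm_zs.
Qed.
Lemma isL2_ek k v : isL2 (ek k v).
Proof.
apply/isL2P; split.
  move=> i; under eq_fun do rewrite /ek mxE.
  by apply: cmeasM; [exact: cmeas_zetaz|exact: cmeas_cst].
under eq_fun do rewrite /ek vnormZ cabs_zetaz mul1r.
exact: rI_cst.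
Qed.
Lemma ip_zs k f g : ip (zs k f) (zs k g) = ip f g.
Proof.
rewrite ip.unlock; congr cint; apply/funext => t.
rewrite /zs (hformZl (dp_hform R m))// (hformZr (dp_hform R m))// mulrA mulcJ cabs_zetaz.
by rewrite expr1n mul1r.
Qed.
Lemma nq_zs k f : nq ip (zs k f) = nq ip f. Proof. by rewrite /nq ip_zs. Qed.
Lemma ip_ek k v w : ip (ek k v) (ek k w) = dp v w.
Proof.
have e x : ek k x = zs k (ek 0 x) by rewrite zs_ek addr0.
rewrite !e.
rewrite ip_zs ip.unlock /ek; under eq_fun do rewrite !expr0z !scale1r.
exact: cint_cst.
Qed.
Lemma cI_coord f (i : 'I_m) k : isL2 f -> cI (fun t => f t i 0 * zeta t ^ k).
Proof.
move=> /isL2P[mf hf]; apply: cI_unit; [|exact: cmeas_zetaz|by move=> t; exact: cabs_zetaz].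
apply: (cI_dom (mf i) (rID hf (rI_cst 1))); apply: aeT_all => t _.
have := cabs_le_vnorm (f t) i; have := vnorm_ge0 (f t); move: (vnorm _) => x; nra.
Qed.
Lemma fcoefE f k (i : 'I_m) : fcoef f k i 0 = cint (fun t => f t i 0 * zeta t ^ (- k)).
Proof. by rewrite mxE. Qed.
Lemma fcoef_zs k l f : fcoef (zs k f) l = fcoef f (l - k).
Proof.
apply/matrixP => i j; rewrite ord1 !fcoefE; congr cint; apply/funext => t.
by rewrite /zs mxE opprB zetazM; ring.
Qed.
Lemma fcoef_ek k l v : fcoef (ek k v) l = (l == k)%:R *: v.
Proof.
apply/matrixP => i j; rewrite ord1 fcoefE !mxE; under eq_fun do rewrite /ek mxE mulrAC -zetazM mulrC.
by rewrite cintZ; [rewrite cint_zetaz subr_eq0 eq_sym mulrC|exact: cI_zetaz].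
Qed.
Lemma fcoef0 k : fcoef (0 : V) k = 0.
Proof.
apply/matrixP => i j; rewrite ord1 fcoefE [RHS]mxE -[RHS]cint_cst; congr cint.
by apply/funext => t; rewrite mxE mul0r.
Qed.
(** Identities between coefficients thereby become identities for [ip], to which the theory of forms
    applies. *)
Lemma dp_fcoef f k v : isL2 f -> dp (fcoef f k) v = ip f (ek k v).
Proof.
move=> hf; rewrite ip.unlock /dp [RHS](@cint_sum _ _ _ (fun i t => f t i 0 * conjc (ek k v t i 0))).
  apply: eq_bigr => i _; rewrite fcoefE mulrC -cintZ; last exact: cI_coord.
  congr cint; apply/funext => t; rewrite /ek mxE conjcM zetazJ; ring.
move=> i; have -> : (fun t => f t i 0 * conjc (ek k v t i 0)) =
  (fun t => conjc (v i 0) * (f t i 0 * zeta t ^ (- k))).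
  by apply/funext => t; rewrite /ek mxE conjcM zetazJ; ring.
exact/cIZ/cI_coord.
Qed.
#[local] Opaque fcoef cint isL2 aeT dp.
Lemma fcoefL k a f g : isL2 f -> isL2 g -> fcoef (a *: f + g) k = a *: fcoef f k + fcoef g k.
Proof.
move=> hf hg; apply: dp_eqP => z; have hfg : isL2 (a *: f + g) by apply L2s.
rewrite (hformL (dp_hform R m) a (f := fcoef f k) (g := fcoef g k) (h := z) Logic.I Logic.I Logic.I).
rewrite (dp_fcoef k z hf) (dp_fcoef k z hg) (dp_fcoef k z hfg).
exact: (hformL ipH a hf hg (isL2_ek k z)).
Qed.
Lemma fcoefD k f g : isL2 f -> isL2 g -> fcoef (f + g) k = fcoef f k + fcoef g k.
Proof. by move=> hf hg; rewrite -[f]scale1r fcoefL// !scale1r. Qed.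
Lemma fcoefB k f g : isL2 f -> isL2 g -> fcoef (f - g) k = fcoef f k - fcoef g k.
Proof.
by move=> hf hg; rewrite -scaleN1r addrC fcoefL// scaleN1r addrC.
Qed.
Lemma fcoef_aeq k f g : isL2 f -> isL2 g -> aeq f g -> fcoef f k = fcoef g k.
Proof.
move=> hf hg h; apply: dp_eqP => z; rewrite (dp_fcoef k z hf) (dp_fcoef k z hg).
exact: (ip_aeql hf hg (isL2_ek k z) h).
Qed.
Lemma L2_unique f : isL2 f -> (forall k, fcoef f k = 0) -> aeq f 0.
Proof.
move=> hf h; suff : aeT (fun t => forall i : 'I_m, f t i 0 = 0).
  by apply: aeT_sub => t _ ht; apply/matrixP => i j; rewrite ord1 ht mxE.
apply: aeT_cnt => i; apply: fourier_unique.
  by have := cI_coord i 0 hf; under eq_fun do rewrite expr0z mulr1.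
by move=> k; have := fcoefE f (- k) i; rewrite opprK h mxE.
Qed.

(** [H^2], its complement and [z H^2] are all of this kind, so linearity and completeness are proved
    once for the three. *)
Definition spec_in (P : pred int) f := isL2 f /\ forall k, P k -> fcoef f k = 0.
Lemma spec_linsub P : linsub (spec_in P).
Proof.
split.
  split; first by case: L2s.
  by move=> k _; exact: fcoef0.
move=> a f g [hf cf] [hg cg]; split; first by apply L2s.
by move=> k Pk; rewrite fcoefL// cf// cg// scaler0 addr0.
Qed.
Lemma ip_cvg (u : nat -> V) f g : (forall j, isL2 (u j)) -> isL2 f -> isL2 g ->
  (forall e, 0 < e -> exists N, forall j, (N <= j)%N -> nq ip (u j - f) < e) ->
  (forall j, ip (u j) g = 0) -> ip f g = 0.
Proof.
move=> hu hf hg cv h; apply/eqP; rewrite -cabs_eq0 -sqrf_eq0 eq_le sqr_ge0 andbT.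
apply/ler_addgt0Pl => e e0; rewrite addr0.
have g0 := nq_ge0 ipH hg.
have [N hN] := cv (e / (nq ip g + 1)) ltac:(by rewrite divr_gt0// ltr_wpDl).
have hd := subspB L2s (hu N) hf.
have -> : ip f g = - ip (u N - f) g by rewrite (hformBl ipH (hu N) hf hg) h sub0r opprK.
rewrite cabsN; apply: le_trans (hform_CS ipH hd hg) _.
have := hN N (leqnn N); rewrite ltr_pdivlMr ?ltr_wpDl// => /ltW; apply: le_trans.
by rewrite ler_wpM2l ?lerDl//; exact: (nq_ge0 ipH hd).
Qed.
Lemma spec_complete P : qcomplete (spec_in P) ip.
Proof.
move=> u hu cu; have hu' j : isL2 (u j) by case: (hu j).
have [f hf [cv _]] := L2_complete_ae hu' cu.
exists f => //; split => // k Pk; apply: dp_eqP => z.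
rewrite (hform0l (dp_hform R m) (h := z) Logic.I) (dp_fcoef k z hf).
apply: (ip_cvg hu' hf (isL2_ek k z) cv) => j.
rewrite -(dp_fcoef k z (hu' j)) ((hu j).2 k Pk).
exact: (hform0l (dp_hform R m) (h := z) Logic.I).
Qed.
Lemma H2_linsub : linsub (@H2 R m). Proof. exact: (spec_linsub (fun k => k < 0)). Qed.
Lemma H2minus_linsub : linsub (@H2minus R m).
Proof. exact: (spec_linsub (fun k => 0 <= k)). Qed.
Lemma H2_complete : qcomplete (@H2 R m) ip.
Proof. exact: (@spec_complete (fun k => k < 0)). Qed.
Lemma H2minus_complete : qcomplete (@H2minus R m) ip.
Proof. exact: (@spec_complete (fun k => 0 <= k)). Qed.
Lemma H2_L2 f : H2 f -> isL2 f. Proof. by case. Qed.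
Lemma H2minus_L2 f : H2minus f -> isL2 f. Proof. by case. Qed.
Lemma H2minus_aeq f g : isL2 g -> H2minus f -> aeq f g -> H2minus g.
Proof. by move=> hg [hf h] e; split => // k k0; rewrite -(fcoef_aeq k hf hg e) h. Qed.
Lemma H2_zs k f : 0 <= k -> H2 f -> H2 (zs k f).
Proof.
move=> k0 [hf h]; split; first exact: isL2_zs.
by move=> l l0; rewrite fcoef_zs h//; lia.
Qed.
Lemma H2_zsN1 f : H2 f -> fcoef f 0 = 0 -> H2 (zs (-1) f).
Proof.
move=> [hf h] f0; split; first exact: isL2_zs.
move=> l l0; rewrite fcoef_zs; have [->|l1] := eqVneq l (-1); first by rewrite subrr f0.
by apply: h; lia.
Qed.
Lemma H2minus_zs k f : k <= 0 -> H2minus f -> H2minus (zs k f).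
Proof.
move=> k0 [hf h]; split; first exact: isL2_zs.
by move=> l l0; rewrite fcoef_zs h//; lia.
Qed.
Lemma H2_ek k v : 0 <= k -> H2 (ek k v).
Proof.
move=> k0; split; first exact: isL2_ek.
move=> l l0; rewrite fcoef_ek; have [e|] := eqVneq l k; first lia.
by rewrite scale0r.
Qed.
Lemma H2minus_ek k v : k < 0 -> H2minus (ek k v).
Proof.
move=> k0; split; first exact: isL2_ek.
move=> l l0; rewrite fcoef_ek; have [e|] := eqVneq l k; first lia.
by rewrite scale0r.
Qed.

Lemma Pminus_exists g : isL2 g ->
  exists h, Pminus g h /\ forall p, H2minus p -> ip (g - h) p = 0.
Proof.
move=> hg; have [h hh ho] := projection ipH H2minus_linsub H2minus_L2 H2minus_complete hg.
exists h; split => //; split => // k k0; apply: dp_eqP => z.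
have hL := H2minus_L2 hh; rewrite (dp_fcoef k z hL) (dp_fcoef k z hg); apply/esym/eqP.
rewrite -subr_eq0 -(hformBl ipH hg hL (isL2_ek k z)) ho ?eqxx//.
exact: H2minus_ek.
Qed.
Lemma Pminus_unique g h h' : Pminus g h -> Pminus g h' -> aeq h h'.
Proof.
move=> [[hh h1] h2] [[hh' h1'] h2']; apply: nqB_aeq => //.
have hd := subspB L2s hh hh'.
have : aeq (h - h') 0.
  apply: L2_unique => // k; rewrite fcoefB//.
  have [k0|k0] := ltP k 0; first by rewrite h2// h2'// subrr.
  by rewrite h1// h1'// subrr.
by move=> e; rewrite (nq_aeq hd (proj1 L2s) e) (nq0 ipH).
Qed.
(** The projection of [f] onto [H2minus] has all Fourier coefficients zero, hence vanishes almost
    everywhere, and [f] minus it is orthogonal to [p]. *)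
Lemma ip_H2_H2minus f p : H2 f -> H2minus p -> ip f p = 0.
Proof.
move=> hf hp; have [h [[hh1 hh2] ho]] := Pminus_exists (H2_L2 hf).
have hL := H2minus_L2 hh1.
have e : aeq h 0.
  apply: L2_unique => // k; have [k0|k0] := ltP k 0; first by rewrite hh2// hf.2.
  exact: hh1.2.
have h0 : isL2 (0 : V) by case: L2s.
have hp' := H2minus_L2 hp.
rewrite -(ho p hp) (hformBl ipH (H2_L2 hf) hL hp') (ip_aeql hL h0 hp' e).
by rewrite (hform0l ipH hp') subr0.
Qed.
End FourierL2.

(** One representative of the projection, fixed by choice; its algebraic identities therefore hold
    only up to [aeq]. *)
HB.lock Definition Pm (R : realType) (m : nat) (g : R -> 'cV[complex.complex R]_m) :
  R -> 'cV[complex.complex R]_m :=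
  match pselect (exists h, Pminus g h) with
  | left e => projT1 (cid e)
  | right _ => 0
  end.

Section Projection.
Variables (R : realType) (m : nat).
Local Notation C := (complex.complex R).
Local Notation V := (R -> 'cV[C]_m).
Local Notation ip := (@ip R m).
Implicit Types (f g h : V) (k l : int).
Let L2s := @isL2_linsub R m.
Let ipH := @ip_hform R m.
#[local] Opaque fcoef cint isL2 aeT dp.

Lemma PmP g : isL2 g -> Pminus g (Pm g).
Proof.
move=> /Pminus_exists[h [hh _]]; rewrite Pm.unlock; case: pselect => [e|]; last by case; exists h.
by case: (cid e).
Qed.
Lemma Pm_H2minus g : isL2 g -> H2minus (Pm g). Proof. by move=> /PmP[]. Qed.
Lemma Pm_L2 g : isL2 g -> isL2 (Pm g). Proof. by move=> /PmP[/H2minus_L2]. Qed.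
Lemma fcoef_Pm g k : isL2 g -> k < 0 -> fcoef (Pm g) k = fcoef g k.
Proof. by move=> /PmP[_ h] /h. Qed.
Lemma Pm_unique g h : isL2 g -> Pminus g h -> aeq h (Pm g).
Proof. by move=> /PmP hg hh; exact: Pminus_unique hh hg. Qed.
Lemma Pp_H2 g : isL2 g -> H2 (g - Pm g).
Proof.
move=> hg; have hP := Pm_L2 hg; split; first exact: subspB.
by move=> k k0; rewrite (fcoefB k hg hP) (fcoef_Pm hg k0) subrr.
Qed.
Lemma ip_Pm g p : isL2 g -> H2minus p -> ip g p = ip (Pm g) p.
Proof.
move=> hg hp; have := ip_H2_H2minus (Pp_H2 hg) hp.
rewrite (hformBl ipH hg (Pm_L2 hg) (H2minus_L2 hp)).
by move=> /eqP; rewrite subr_eq0 => /eqP.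
Qed.
Lemma nq_Pm_Pp g : isL2 g -> nq ip g = nq ip (Pm g) + nq ip (g - Pm g).
Proof.
move=> hg; have hP := Pm_L2 hg.
rewrite -{1}(subrK (Pm g) g) (nqD ipH (subspB L2s hg hP) hP).
by rewrite (ip_H2_H2minus (Pp_H2 hg) (Pm_H2minus hg)) /= mulr0 addr0 addrC.
Qed.
Lemma nq_Pm_le g : isL2 g -> nq ip (Pm g) <= nq ip g.
Proof.
move=> hg; rewrite (nq_Pm_Pp hg) lerDl; apply: (nq_ge0 ipH).
exact: (subspB L2s hg (Pm_L2 hg)).
Qed.
Lemma Pm_linear a f g : isL2 f -> isL2 g -> aeq (Pm (a *: f + g)) (a *: Pm f + Pm g).
Proof.
move=> hf hg; have hfg : isL2 (a *: f + g) by apply L2s.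
apply: aeq_sym; apply: (Pm_unique hfg); split.
  exact: (proj2 (@H2minus_linsub R m) a _ _ (Pm_H2minus hf) (Pm_H2minus hg)).
move=> k k0; rewrite (fcoefL k a hf hg) (fcoefL k a (Pm_L2 hf) (Pm_L2 hg)).
by rewrite (fcoef_Pm hf k0) (fcoef_Pm hg k0).
Qed.
Lemma Pm_aeq f g : isL2 f -> isL2 g -> aeq f g -> aeq (Pm f) (Pm g).
Proof.
move=> hf hg e; apply: (Pm_unique hg); split; first exact: Pm_H2minus.
by move=> k k0; rewrite (fcoef_Pm hf k0) (fcoef_aeq k hf hg e).
Qed.
Lemma Pm_eq0 g : H2 g -> aeq (Pm g) 0.
Proof.
move=> hg; apply: aeq_sym; apply: (Pm_unique (H2_L2 hg)); split.
  by case: (@H2minus_linsub R m).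
by move=> k k0; rewrite hg.2// fcoef0.
Qed.
Lemma Pm_id g : H2minus g -> aeq (Pm g) g.
Proof. by move=> hg; apply: aeq_sym; exact: (Pm_unique (H2minus_L2 hg)). Qed.
End Projection.

(** * Products of scalar Hardy functions *)

Section ScalarHardy.
Variable R : realType.
Local Notation C := (complex.complex R).
Local Notation zeta := (@zeta R).
Implicit Types (a b : R -> C) (k : int).

Definition sL2 a := cmeas a /\ rI (fun t => cabs (a t) ^+ 2).
Definition sH2 a := sL2 a /\ forall k, k < 0 -> cint (fun t => a t * zeta t ^ (- k)) = 0.

Definition cv1 a : R -> 'cV[C]_1 := fun t => const_mx (a t).
Lemma vnorm_cv1 a t : vnorm (cv1 a t) ^+ 2 = cabs (a t) ^+ 2.
Proof. by rewrite vnorm2 big_ord1 mxE. Qed.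
Lemma sL2_cv1 a : sL2 a <-> isL2 (cv1 a).
Proof.
rewrite isL2P; split => -[h1 h2]; split.
- by move=> i; under eq_fun do rewrite mxE.
- by under eq_fun do rewrite vnorm_cv1.
- by have := h1 0; under eq_fun do rewrite mxE.
- by move: h2; under eq_fun do rewrite vnorm_cv1.
Qed.
Lemma fcoef_cv1 a k : fcoef (cv1 a) k = const_mx (cint (fun t => a t * zeta t ^ (- k))).
Proof.
apply/matrixP => i j; rewrite !ord1 fcoefE [RHS]mxE; congr cint; apply/funext => t.
by rewrite mxE.
Qed.
Lemma sH2_cv1 a : sH2 a <-> H2 (cv1 a).
Proof.
split => -[/sL2_cv1 h1 h2]; split => // k k0.
  by rewrite fcoef_cv1 h2//; apply/matrixP => i j; rewrite !mxE.
by have := h2 k k0; rewrite fcoef_cv1 => /matrixP/(_ 0 0); rewrite !mxE.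
Qed.
Lemma ip_cv1 a b : ip (cv1 a) (cv1 b) = cint (fun t => a t * conjc (b t)).
Proof.
rewrite ip.unlock; congr cint; apply/funext => t.
by rewrite /dp big_ord1 !mxE.
Qed.
Lemma sL2_cI a k : sL2 a -> cI (fun t => a t * zeta t ^ k).
Proof.
by move=> /sL2_cv1/(cI_coord 0 k); under eq_fun do rewrite mxE.
Qed.
Lemma sL2_cI0 a : sL2 a -> cI a.
Proof. by move=> /(sL2_cI 0); under eq_fun do rewrite expr0z mulr1. Qed.
Lemma sL2J a : sL2 a -> sL2 (fun t => conjc (a t)).
Proof. by move=> [h1 h2]; split; [exact: cmeasJ|under eq_fun do rewrite cabsJ]. Qed.
Lemma sL2_mulz a k : sL2 a -> sL2 (fun t => a t * zeta t ^ k).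
Proof.
move=> [h1 h2]; split; first by apply: cmeasM => //; exact: cmeas_zetaz.
by under eq_fun do rewrite cabsM cabs_zetaz mulr1.
Qed.
Lemma sL2_cst z : sL2 (fun=> z).
Proof. by split; [exact: cmeas_cst|exact: rI_cst]. Qed.
Lemma sL2D a b : sL2 a -> sL2 b -> sL2 (fun t => a t + b t).
Proof.
move=> /sL2_cv1 ha /sL2_cv1 hb; apply/sL2_cv1.
have := subspD (@isL2_linsub R 1) ha hb; congr isL2; apply/funext => t.
by apply/matrixP => i j; rewrite !mxE.
Qed.
Lemma sL2Z z a : sL2 a -> sL2 (fun t => z * a t).
Proof.
move=> /sL2_cv1 ha; apply/sL2_cv1.
have := subspZ z (@isL2_linsub R 1) ha; congr isL2; apply/funext => t.
by apply/matrixP => i j; rewrite !mxE.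
Qed.
Lemma sL2_dom a b : cmeas a -> sL2 b -> aeT (fun t => cabs (a t) <= cabs (b t)) -> sL2 a.
Proof.
move=> ma [_ hb] le; split => //; apply: rI_dom (rmeas_cabs2 ma) hb _.
apply: aeT_sub le => t _ h; rewrite ger0_norm ?sqr_ge0//.
by rewrite ler_pXn2r// nnegrE cabs_ge0.
Qed.
Lemma sL2_mul a b : sL2 a -> sL2 b -> cI (fun t => a t * b t).
Proof.
move=> ha /sL2J hb; have /sL2_cv1 h1 := ha; have /sL2_cv1 h2 := hb.
have := cI_dp h1 h2; rewrite /dp; under eq_fun do rewrite big_ord1 !mxE complex.conjcK.
by [].
Qed.

Lemma sH2_cst z : sH2 (fun=> z).
Proof.
split; first exact: sL2_cst.
move=> k k0; rewrite cintZ ?cint_zetaz; last exact: cI_zetaz.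
by rewrite oppr_eq0 lt_eqF// mulr0.
Qed.
Lemma sH2D a b : sH2 a -> sH2 b -> sH2 (fun t => a t + b t).
Proof.
move=> [ha h1] [hb h2]; split; first exact: sL2D.
move=> k k0; under eq_fun do rewrite mulrDl.
by rewrite cintD ?h1 ?h2 ?addr0//; exact: sL2_cI.
Qed.
Lemma sH2Z z a : sH2 a -> sH2 (fun t => z * a t).
Proof.
move=> [ha h1]; split; first exact: sL2Z.
move=> k k0; under eq_fun do rewrite -mulrA.
by rewrite cintZ ?h1 ?mulr0//; exact: sL2_cI.
Qed.
Lemma sH2_sum (J : Type) (r : seq J) (F : J -> R -> C) :
  (forall j, sH2 (F j)) -> sH2 (fun t => \sum_(j <- r) F j t).
Proof.
move=> h; elim: r => [|j r IH]; first by under eq_fun do rewrite big_nil; exact: sH2_cst.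
by under eq_fun do rewrite big_cons; exact: sH2D.
Qed.
Lemma sH2_mulz a k : 0 <= k -> sH2 a -> sH2 (fun t => a t * zeta t ^ k).
Proof.
move=> k0 [ha h1]; split; first exact: sL2_mulz.
move=> l l0; under eq_fun do rewrite -mulrA -zetazM.
by rewrite (_ : k - l = - (l - k)) ?h1 ?opprB//; lia.
Qed.
Lemma sH2_mulzN1 a : sH2 a -> cint a = 0 -> sH2 (fun t => a t * zeta t ^ (-1)).
Proof.
move=> [ha h1] a0; split; first exact: sL2_mulz.
move=> l l0; under eq_fun do rewrite -mulrA -zetazM.
have [->|l1] := eqVneq l (-1).
  by under eq_fun do rewrite opprK addNr expr0z mulr1.
by rewrite (_ : -1 - l = - (l + 1)) ?h1//; lia.
Qed.

(** The coefficient is the inner product of [b] with [conj(a) z^k], which has only negative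
    coefficients because [k < 0]. *)
Lemma sH2_mul_neg a b k : sH2 a -> sH2 b -> k < 0 ->
  cint (fun t => a t * b t * zeta t ^ (- k)) = 0.
Proof.
move=> [ha h1] hb k0; pose c t := conjc (a t) * zeta t ^ k.
have hc : sL2 c by apply: sL2_mulz; exact: sL2J.
have hm : H2minus (cv1 c).
  split; first exact/sL2_cv1.
  move=> l l0; rewrite fcoef_cv1 (_ : cint _ = 0); first by apply/matrixP => i j; rewrite !mxE.
  have -> : (fun t => c t * zeta t ^ (- l)) = (fun t => conjc (a t * zeta t ^ (- (k - l)))).
    by apply/funext => t; rewrite /c -mulrA -zetazM conjcM zetazJ opprK.
  rewrite cintJ ?h1 ?conjc0//; [|exact: sL2_cI].
  by lia.
have := ip_H2_H2minus ((sH2_cv1 b).1 hb) hm; rewrite ip_cv1 => e.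
rewrite -[RHS]e; congr cint; apply/funext => t.
by rewrite /c conjcM complex.conjcK zetazJ; ring.
Qed.
(** After subtraction of its mean, [a] is [z] times an analytic function, and the product of that
    function with [b] has no coefficient of index [-1]. *)
Lemma sH2_mul0 a b : sH2 a -> sH2 b -> cint (fun t => a t * b t) = cint a * cint b.
Proof.
move=> ha hb; have ha1 := sL2_cI0 ha.1; have hb1 := sL2_cI0 hb.1.
pose a' t := a t + (- cint a).
have ha' : sH2 a' by apply: sH2D => //; exact: sH2_cst.
have a'0 : cint a' = 0.
  by rewrite /a' (cintD ha1 (cI_cst _)) cint_cst subrr.
have hz := sH2_mulzN1 ha' a'0.
have := sH2_mul_neg hz hb (isT : (-1 : int) < 0).
have -> : (fun t => a' t * zeta t ^ (-1) * b t * zeta t ^ (- -1)) =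
  (fun t => a t * b t - cint a * b t).
  apply/funext => t; rewrite opprK expr1z /a'.
  have z : zeta t ^ (-1) * zeta t = 1 by rewrite -{2}(expr1z (zeta t)) -zetazM addNr expr0z.
  transitivity ((a t - cint a) * b t * (zeta t ^ (-1) * zeta t)); first by ring.
  by rewrite z; ring.
rewrite (cintB (sL2_mul ha.1 hb.1) (cIZ _ hb1)) (cintZ _ hb1) => /eqP.
by rewrite subr_eq0 => /eqP.
Qed.
End ScalarHardy.

Section MatrixMul.
Variable R : realType.
Local Notation C := (complex.complex R).
Local Notation zeta := (@zeta R).

Lemma isL2_coordP m (f : R -> 'cV[C]_m) : isL2 f <-> forall i, sL2 (fun t => f t i 0).
Proof.
rewrite isL2P; split.
  move=> [h1 h2] i; split => //; apply: rI_dom (rmeas_cabs2 (h1 i)) h2 _.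
  apply: aeT_all => t _; rewrite ger0_norm ?sqr_ge0// ler_pXn2r ?nnegrE ?cabs_ge0 ?vnorm_ge0//.
  exact: cabs_le_vnorm.
move=> h; split; first by move=> i; case: (h i).
under eq_fun do rewrite vnorm2.
elim: (index_enum _) => [|j r IH]; first by under eq_fun do rewrite big_nil; exact: rI_cst.
by under eq_fun do rewrite big_cons; apply: rID => //; case: (h j).
Qed.
Lemma H2_coordP m (f : R -> 'cV[C]_m) : H2 f <-> forall i, sH2 (fun t => f t i 0).
Proof.
split.
  move=> [/isL2_coordP h1 h2] i; split=> [|k k0]; first exact: h1.
  by rewrite -fcoefE h2// mxE.
move=> h; split; first by apply/isL2_coordP => i; case: (h i).
by move=> k k0; apply/matrixP => i j; rewrite ord1 fcoefE (h i).2// mxE.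
Qed.
Lemma H2mxP m n (F : R -> 'M[C]_(m, n)) : H2mx F <-> forall i j, sH2 (fun t => F t i j).
Proof.
split => h.
  by move=> i j; have /H2_coordP/(_ i) := h j; under eq_fun do rewrite mxE.
by move=> j; apply/H2_coordP => i; under eq_fun do rewrite mxE.
Qed.

Lemma mulf_linear m n (F : R -> 'M[C]_(m, n)) a f g :
  mulf F (a *: f + g) = a *: mulf F f + mulf F g.
Proof. by apply/funext => t; rewrite /mulf !fctE mulmxDr -scalemxAr. Qed.
Lemma mulf_zs m n (F : R -> 'M[C]_(m, n)) k f : mulf F (zs k f) = zs k (mulf F f).
Proof. by apply/funext => t; rewrite /mulf /zs -scalemxAr. Qed.

Lemma Linfty_bound m n (F : R -> 'M[C]_(m, n)) : Linfty F ->
  exists2 K : R, 0 <= K & aeT (fun t => forall x, vnorm (F t *m x) <= K * vnorm x).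
Proof.
move=> [mF [M hM]]; exists (\sum_(i < m) \sum_(j < n) `|M|).
  by apply: sumr_ge0 => i _; apply: sumr_ge0.
apply: aeT_sub hM => t _ h x; apply: le_trans (vnorm_le_sum _) _.
rewrite mulr_suml; apply: ler_sum => i _; rewrite mxE mulr_suml.
apply: le_trans (cabs_sum _ _ _) _; apply: ler_sum => j _.
rewrite cabsM ler_pM ?cabs_ge0 ?cabs_le_vnorm//.
by apply: le_trans (h i j) _; exact: ler_norm.
Qed.
Lemma cmeas_mulf m n (F : R -> 'M[C]_(m, n)) f i : (forall i j, cmeas (fun t => F t i j)) ->
  isL2 f -> cmeas (fun t => mulf F f t i 0).
Proof.
move=> mF /isL2P[mf _]; rewrite /mulf; under eq_fun do rewrite mxE.
by apply: cmeas_sum => j; exact: cmeasM.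
Qed.
Lemma isL2_mulf_bound m n (F : R -> 'M[C]_(m, n)) (K : R) f :
  (forall i j, cmeas (fun t => F t i j)) -> 0 <= K ->
  aeT (fun t => forall x, vnorm (F t *m x) <= K * vnorm x) -> isL2 f ->
  isL2 (mulf F f) /\ nq (@ip R m) (mulf F f) <= K ^+ 2 * nq (@ip R n) f.
Proof.
move=> mF K0 hK hf; have /isL2P[_ hf2] := hf.
have mFf i := cmeas_mulf i mF hf.
have le : aeT (fun t => vnorm (mulf F f t) ^+ 2 <= K ^+ 2 * vnorm (f t) ^+ 2).
  apply: aeT_sub hK => t _ h; rewrite -exprMn ler_pXn2r ?nnegrE ?vnorm_ge0//.
    exact: h.
  by rewrite mulr_ge0// vnorm_ge0.
have hL : isL2 (mulf F f) by apply: (isL2_dom mFf (rIZ (K ^+ 2) hf2)).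
split => //; have /isL2P[_ hL2] := hL.
by rewrite !nq_ip -rintZ//; apply: rint_le => //; exact: rIZ.
Qed.
Lemma isL2_mulf m n (F : R -> 'M[C]_(m, n)) f : Linfty F -> isL2 f -> isL2 (mulf F f).
Proof.
move=> hF hf; have [K K0 hK] := Linfty_bound hF.
by case: (isL2_mulf_bound hF.1 K0 hK hf).
Qed.
Lemma nq_mulf_bound m n (F : R -> 'M[C]_(m, n)) : Linfty F ->
  exists2 K, 0 <= K & forall f, isL2 f -> nq (@ip R m) (mulf F f) <= K * nq (@ip R n) f.
Proof.
move=> hF; have [K K0 hK] := Linfty_bound hF.
exists (K ^+ 2); first exact: sqr_ge0.
by move=> f hf; case: (isL2_mulf_bound hF.1 K0 hK hf).
Qed.
Lemma aeq_mulf m n (F : R -> 'M[C]_(m, n)) f g : aeq f g -> aeq (mulf F f) (mulf F g).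
Proof. by apply: aeT_sub => t _; rewrite /mulf => ->. Qed.

Lemma Linfty_sL2 m n (F : R -> 'M[C]_(m, n)) i j : Linfty F -> sL2 (fun t => F t i j).
Proof.
move=> [mF [M hM]]; apply: (sL2_dom (mF i j) (sL2_cst (real_complex R M))).
apply: aeT_sub hM => t _ /(_ i j) h; rewrite cabs_real.
exact: le_trans h (ler_norm _).
Qed.
Lemma Hinf_sH2 m n (F : R -> 'M[C]_(m, n)) i j : Hinf F -> sH2 (fun t => F t i j).
Proof.
move=> [hF h]; split; first exact: Linfty_sL2.
by move=> k k0; have /matrixP/(_ i j) := h k k0; rewrite !mxE.
Qed.
Lemma sH2_HinfP m n (F : R -> 'M[C]_(m, n)) : Linfty F -> (forall i j, sH2 (fun t => F t i j)) -> Hinf F.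
Proof.
move=> hF h; split => // k k0; apply/matrixP => i j; rewrite !mxE.
by have [_] := h i j; apply.
Qed.
Lemma H2_mulf m n (F : R -> 'M[C]_(m, n)) f : Hinf F -> H2 f -> H2 (mulf F f).
Proof.
move=> hF hf; split; first exact: (isL2_mulf hF.1 (H2_L2 hf)).
have /H2_coordP hf' := hf.
move=> k k0; apply/matrixP => i j; rewrite ord1 fcoefE mxE.
have hij l := sL2_mul (Linfty_sL2 i l hF.1) (hf' l).1.
have -> : (fun t => mulf F f t i 0 * zeta t ^ (- k)) =
   (fun t => \sum_(l < n) F t i l * f t l 0 * zeta t ^ (- k)).
  by apply/funext => t; rewrite /mulf mxE mulr_suml.
rewrite cint_sum; last first.
  by move=> l; apply: cI_unit => //; [exact: cmeas_zetaz|move=> t; exact: cabs_zetaz].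
by rewrite big1// => l _; rewrite sH2_mul_neg//; exact: Hinf_sH2.
Qed.
End MatrixMul.

(** * Essentially coercive forms *)

Section EssentialForm.
Variable R : realType.
Local Notation C := (complex.complex R).
Variable V : lmodType C.
Implicit Types (D Z : V -> Prop) (b q : V -> V -> C) (f g h : V).

(** Sequential version of [q >= delta b] up to a compact form: the compact part becomes negligible
    on the differences along a subsequence. *)
Definition ess_form D b q := exists2 delta : R, 0 < delta & forall u : nat -> V,
  (forall k, D (u k)) -> (exists M, forall k, nq b (u k) <= M) ->
  exists phi : nat -> nat, (forall k, (phi k < phi k.+1)%N) /\
  forall e, 0 < e -> exists N, forall k l, (N <= k)%N -> (N <= l)%N ->
    delta * nq b (u (phi k) - u (phi l)) <= nq q (u (phi k) - u (phi l)) + e.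

Lemma sub_ess_form D Z b q : (forall f, Z f -> D f) -> ess_form D b q -> ess_form Z b q.
Proof. by move=> ZD [d d0 h]; exists d => // u hu; apply: h => k; exact: ZD. Qed.

Definition qnull D q f := D f /\ nq q f = 0.

Lemma small_le0 (x K : R) : (forall e, 0 < e -> x <= K * e) -> x <= 0.
Proof.
move=> h; apply/ler_addgt0Pl => e e0; rewrite addr0.
have K1 : 0 < `|K| + 1 by rewrite ltr_wpDl.
apply: le_trans (h (e / (`|K| + 1)) _) _; first by rewrite divr_gt0.
rewrite mulrA ler_pdivrMr// mulrC ler_wpM2l ?(ltW e0)//.
by apply: le_trans (ler_norm _) _; rewrite lerDl.
Qed.

Section Fixed.
Variables (D : V -> Prop) (b q : V -> V -> C) (K : R).
Hypotheses (hb : hform D b) (hq : hform D q) (cb : qcomplete D b).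
Hypothesis qb : forall f, D f -> nq q f <= K * nq b f.
Hypothesis hess : ess_form D b q.
Let hD := hform_sub hb.
Let N := qnull D q.

Lemma qnull_linsub : linsub N.
Proof.
split; first by split; [case: hD|exact: (nq0 hq)].
move=> a f g [hf f0] [hg g0]; have haf := subspZ a hD hf.
split; first exact: (subspD hD haf hg).
by rewrite (nqD_null hq haf hg g0) (nqZ hq a hf) f0 mulr0.
Qed.
Lemma qnull_sub f : N f -> D f. Proof. by case. Qed.
Lemma qnull_complete : qcomplete N b.
Proof.
move=> u hu cu; have hu' k : D (u k) by case: (hu k).
have [f hf cv] := cb hu' cu; exists f => //; split => //.
apply/eqP; rewrite eq_le (nq_ge0 hq hf) andbT; apply: (@small_le0 _ `|K|) => e e0.
have [n hn] := cv e e0; have := hn n (leqnn n).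
rewrite (nqBC hb (hu' n) hf) => /ltW le; rewrite -(nqB_null hq hf (hu' n) (hu n).2).
have hd := subspB hD hf (hu' n); apply: le_trans (qb hd) _.
apply: (@le_trans _ _ (`|K| * nq b (f - u n))); last by rewrite ler_wpM2l.
by rewrite ler_wpM2r ?ler_norm ?(nq_ge0 hb hd).
Qed.

(** Otherwise there are [b]-unit vectors orthogonal to the null space on which [q] tends to 0. By
    [ess_form] a subsequence is [b]-Cauchy; its limit is null, hence orthogonal to the sequence
    converging to it, which contradicts the unit norms. *)
Lemma ess_coercive : exists2 d : R, 0 < d & forall f, D f ->
  (forall g, N g -> b f g = 0) -> d * nq b f <= nq q f.
Proof.
apply: contrapT => neg.
have bad (k : nat) : exists f, [/\ D f, forall g, N g -> b f g = 0, nq b f = 1 & nq q f < k.+1%:R^-1].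
  apply: contrapT => h; apply: neg; exists k.+1%:R^-1; first by rewrite invr_gt0.
  move=> f hf fo; rewrite leNgt; apply/negP => lt; apply: h.
  have f0 : 0 < nq b f.
    rewrite lt_def (nq_ge0 hb hf) andbT; apply/eqP => e.
    by move: lt; rewrite e mulr0 ltNge (nq_ge0 hq hf).
  have s0 : 0 <= Num.sqrt (nq b f) by exact: sqrtr_ge0.
  pose c := real_complex R (Num.sqrt (nq b f))^-1.
  have c2 : cabs c ^+ 2 = (nq b f)^-1.
    by rewrite cabs_real ger0_norm ?invr_ge0// exprVn sqr_sqrtr// ltW.
  exists (c *: f); split; first exact: (subspZ c hD hf).
  - by move=> g hg; rewrite (hformZl hb c hf (qnull_sub hg)) fo// mulr0.
  - by rewrite (nqZ hb c hf) c2 mulVf// gt_eqF.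
  - by rewrite (nqZ hq c hf) c2 mulrC ltr_pdivrMr.
have [v hv] := choice bad.
have hvD k : D (v k) by case: (hv k).
have [d d0 /(_ v hvD)] := hess.
case; first by exists 1 => k; case: (hv k) => _ _ -> _.
move=> phi [phiI h].
have cau e : 0 < e -> exists n, forall k l, (n <= k)%N -> (n <= l)%N ->
    nq b (v (phi k) - v (phi l)) < e.
  move=> e0; have de0 : 0 < d * e / 8 by rewrite divr_gt0// mulr_gt0.
  have [n1 h1] := h _ de0; have [n2 h2] := inv_small de0.
  exists (maxn n1 n2) => k l; rewrite !geq_max => /andP[k1 k2] /andP[l1 l2].
  have a1 := h1 k l k1 l1.
  have a2 := nqB_le2 hq (hvD (phi k)) (hvD (phi l)).
  have a3 : nq q (v (phi k)) < d * e / 8.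
    have [_ _ _ x] := hv (phi k); apply: lt_trans x (h2 _ _).
    exact: leq_trans k2 (incr_ge phiI k).
  have a4 : nq q (v (phi l)) < d * e / 8.
    have [_ _ _ x] := hv (phi l); apply: lt_trans x (h2 _ _).
    exact: leq_trans l2 (incr_ge phiI l).
  have a5 : 0 < d * e by rewrite mulr_gt0.
  by rewrite -(ltr_pM2l d0); lra.
have [f hf cv] := cb (fun k => hvD (phi k)) cau.
have fq : nq q f <= 0.
  apply: (@small_le0 _ (2 * `|K| + 2)) => e e0.
  have [n1 h1] := cv e e0; have [n2 h2] := inv_small e0.
  pose k := maxn n1 n2; have hk := hvD (phi k).
  have hd := subspB hD hf hk.
  have a1 := h1 k (leq_maxl _ _); rewrite (nqBC hb hk hf) in a1.
  have a2 : nq q (v (phi k)) < e.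
    have [_ _ _ x] := hv (phi k); apply: lt_trans x (h2 _ _).
    exact: leq_trans (leq_maxr _ _) (incr_ge phiI k).
  have a3 := nqD_le2 hq hd hk; rewrite subrK in a3.
  have a4 := qb hd; have a5 := nq_ge0 hb hd.
  have a6 : K * nq b (f - v (phi k)) <= `|K| * e.
    apply: (@le_trans _ _ (`|K| * nq b (f - v (phi k)))).
      by rewrite ler_wpM2r ?ler_norm.
    by rewrite ler_wpM2l// ltW.
  by move: a2 a3 a4 a6; lra.
have fN : N f by split => //; apply/eqP; rewrite eq_le fq (nq_ge0 hq hf).
have f1 : 1 <= 0 :> R.
  apply: (@small_le0 _ 4) => e e0.
  have [n h1] := cv (Num.min e 1) ltac:(by rewrite lt_min e0 ltr01).
  have hk := hvD (phi n); have := h1 n (leqnn n); rewrite lt_min => /andP[a1 _].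
  have [_ fo v1 _] := hv (phi n).
  by have := nq_ge0 hb hf; move: a1; rewrite (nqB hb hk hf) v1 fo//=; lra.
by move: f1; rewrite ler10.
Qed.

Lemma ess_decomp : exists2 d : R, 0 < d & forall f, D f ->
  exists2 m, N m & (forall g, N g -> b (f - m) g = 0) /\ d * nq b (f - m) <= nq q f.
Proof.
have [d d0 h] := ess_coercive; exists d => // f hf.
have [m hm ho] := projection hb qnull_linsub qnull_sub qnull_complete hf.
exists m => //; split => //; apply: le_trans (h _ (subspB hD hf hm.1) ho) _.
by rewrite (nqB_null hq hf hm.1 hm.2).
Qed.

(** [q] does not see null components; once they are removed, coercivity turns a [q]-Cauchy sequence
    into a [b]-Cauchy one. *)
Lemma ess_complete : qcomplete D q.
Proof.
move=> u hu cu; have [d d0 hc] := ess_coercive; have [d' d'0 dec] := ess_decomp.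
have /choice[m hm] k : exists m, N m /\ forall g, N g -> b (u k - m) g = 0.
  by have [m hm [ho _]] := dec _ (hu k); exists m.
have hmD k : D (m k) by case: (hm k) => -[].
have hw k : D (u k - m k) := subspB hD (hu k) (hmD k).
have [|f hf cv] := @cb (fun k => u k - m k) hw.
  move=> e e0; have [n hn] := cu (d * e) ltac:(by rewrite mulr_gt0).
  exists n => k l nk nl; rewrite -(ltr_pM2l d0); apply: le_lt_trans (hn k l nk nl).
  have hkl := subspB hD (hw k) (hw l).
  apply: le_trans (hc _ hkl _) _.
    move=> g hg; rewrite (hformBl hb (hw k) (hw l) hg.1) (hm k).2// (hm l).2//.
    by rewrite subrr.
  have -> : u k - m k - (u l - m l) = (u k - u l) - (m k - m l).
    by rewrite !opprB [LHS]addrACA [RHS]addrACA [- u l + _]addrC.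
  rewrite (nqB_null hq (subspB hD (hu k) (hu l)) (subspB hD (hmD k) (hmD l)))//.
  exact: (subspB qnull_linsub (hm k).1 (hm l).1).2.
exists f => // e e0; have K1 : 0 < `|K| + 1 by rewrite ltr_wpDl.
have [n hn] := cv (e / (`|K| + 1)) ltac:(by rewrite divr_gt0).
exists n => k nk; have := hn k nk; rewrite ltr_pdivlMr// => lt; apply: le_lt_trans lt.
have hd := subspB hD (hw k) hf.
rewrite -(nqB_null hq (subspB hD (hu k) hf) (hmD k) (hm k).1.2).
rewrite addrAC; apply: le_trans (qb hd) _; rewrite mulrC ler_wpM2l ?(nq_ge0 hb hd)//.
by apply: le_trans (ler_norm _) _; rewrite lerDl.
Qed.

Definition onseq (s : seq V) := (forall i, (i < size s)%N -> N s`_i) /\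
  forall i j, (i < size s)%N -> (j < size s)%N -> b s`_i s`_j = (i == j)%:R.

Lemma onseq_rcons s m : onseq s -> N m -> nq b m = 1 ->
  (forall i, (i < size s)%N -> b m s`_i = 0) -> onseq (rcons s m).
Proof.
move=> [h1 h2] hm m1 mo.
have mo' i : (i < size s)%N -> b s`_i m = 0.
  by move=> is_; rewrite (hformC hb hm.1 (h1 i is_).1) mo// conjc0.
split.
  move=> i; rewrite size_rcons ltnS nth_rcons; case: ltngtP => // lt _.
  exact: h1.
move=> i j; rewrite size_rcons !ltnS !nth_rcons => si sj.
have [li|li] := ltnP i (size s); have [lj|lj] := ltnP j (size s).
- exact: h2.
- have -> : j = size s by apply/eqP; rewrite eqn_leq sj.
  by rewrite eqxx mo'// ltn_eqF.
- have -> : i = size s by apply/eqP; rewrite eqn_leq si.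
  by rewrite eqxx mo// gtn_eqF.
- have -> : j = size s by apply/eqP; rewrite eqn_leq sj.
  have -> : i = size s by apply/eqP; rewrite eqn_leq si.
  by rewrite !eqxx (hform_diag hb hm.1) m1.
Qed.

(** An infinite orthonormal sequence of null vectors has squared distances 2 while [q] vanishes on
    its differences, against [ess_form] with [e] equal to the constant of coercivity. The remainder
    of an expansion is only of norm zero, as [b] may be degenerate. *)
Lemma ess_null_findim : exists (d : nat) (e : 'I_d -> V), [/\ forall i, N (e i),
  forall i j, b (e i) (e j) = (i == j)%:R &
  forall m, N m -> nq b (m - \sum_i b m (e i) *: e i) = 0].
Proof.
have [ext|] := pselect (forall s, onseq s -> exists m, [/\ N m, nq b m = 1 &
   forall i, (i < size s)%N -> b m s`_i = 0]); last first.
  move=> /existsNP[s /not_implyP[hs hn]].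
  exists (size s), (fun i => s`_i); split.
  - by move=> i; apply hs.
  - by move=> i j; rewrite hs.2.
  move=> m hm; set w := m - _; apply: contrapT => w0.
  have hsi (i : 'I_(size s)) : N s`_i by apply hs.
  have hsum : N (\sum_(i < size s) b m s`_i *: s`_i).
    by apply: (@subsp_sum _ _ N _ _ _ _ qnull_linsub) => i _; exact: (subspZ _ qnull_linsub (hsi i)).
  have hw : N w := subspB qnull_linsub hm hsum.
  have wo (i : 'I_(size s)) : b w s`_i = 0.
    rewrite /w (hformBl hb hm.1 hsum.1 (hsi i).1) (hform_suml hb) //; last 2 first.
    - by move=> j; exact: (subspZ _ hD (hsi j).1).
    - exact: (hsi i).1.
    rewrite (bigD1 i)//= (hformZl hb _ (hsi i).1 (hsi i).1) hs.2// eqxx mulr1.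
    rewrite big1 ?addr0 ?subrr// => j ji.
    rewrite (hformZl hb _ (hsi j).1 (hsi i).1) hs.2//.
    by rewrite (_ : (_ == _) = false) ?mulr0//; apply/negbTE.
  have w1 : 0 < nq b w by rewrite lt_def (nq_ge0 hb hw.1) andbT; apply/eqP.
  pose c := real_complex R (Num.sqrt (nq b w))^-1.
  apply: hn; exists (c *: w); split.
  - exact: (subspZ c qnull_linsub hw).
  - rewrite (nqZ hb c hw.1) cabs_real ger0_norm ?invr_ge0 ?sqrtr_ge0//.
    by rewrite exprVn sqr_sqrtr ?(ltW w1)// mulVf// gt_eqF.
  - move=> i is_; have e := wo (Ordinal is_); rewrite /= in e.
    by rewrite (hformZl hb c hw.1 (hs.1 i is_).1) e mulr0.
exfalso.
have /choice[next hnext] s : exists m, onseq s -> [/\ N m, nq b m = 1 &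
   forall i, (i < size s)%N -> b m s`_i = 0].
  have [/ext[m hm]|hs] := pselect (onseq s); first by exists m.
  by exists 0.
pose S := fix S k := if k is k'.+1 then rcons (S k') (next (S k')) else [::].
have Ssz k : size (S k) = k by elim: k => //= k IH; rewrite size_rcons IH.
have Son k : onseq (S k).
  elim: k => [|k IH]; first by split.
  by have [a1 a2 a3] := hnext _ IH; apply: onseq_rcons.
pose E k := next (S k).
have Snth j k : (j < k)%N -> (S k)`_j = E j.
  elim: k => // k IH; rewrite ltnS /= nth_rcons Ssz leq_eqVlt => /orP[/eqP ->|lt].
    by rewrite ltnn eqxx.
  by rewrite lt IH.
have hE k : N (E k) by have [] := hnext _ (Son k).
have E1 k : nq b (E k) = 1 by have [] := hnext _ (Son k).
have Eo k j : (j < k)%N -> b (E k) (E j) = 0.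
  move=> jk; have [_ _ h] := hnext _ (Son k).
  by have := h j; rewrite Ssz Snth//; apply.
have [d d0 /(_ E (fun k => (hE k).1))] := hess.
case; first by exists 1 => k; rewrite E1.
move=> phi [phiI h]; have [n /(_ n.+1 n (leqnSn n) (leqnn n))] := h d d0.
have hk := hE (phi n.+1); have hl := hE (phi n).
rewrite (nqB hb hk.1 hl.1) !E1 Eo//= mulr0 subr0.
rewrite (subspB qnull_linsub hk hl).2.
by lra.
Qed.
End Fixed.
End EssentialForm.

(** * Diagonalization, flags and dimension counts *)

Section LinearAlgebra.

Lemma downset_card n (A : {set 'I_n}) :
  (forall i j : 'I_n, (i <= j)%N -> j \in A -> i \in A) ->
  forall i : 'I_n, (i \in A) = (i < #|A|)%N.
Proof.
move=> h i; apply/idP/idP => [iA|iA].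
  have sub : [set j : 'I_n | (j <= i)%N]%SET \subset A.
    by apply/fintype.subsetP => j; rewrite inE => /h; apply.
  apply: leq_trans (subset_leq_card sub).
  rewrite cardE size_filter -sum1_count big_mkcond/=.
  rewrite (eq_bigr (fun j : 'I_n => (if (j < i.+1)%N then 1 else 0)%N)); last first.
    by move=> j _; rewrite inE ltnS.
  rewrite -big_mkcond/=.
  by rewrite -(big_ord_widen n (fun=> 1%N) (ltn_ord i)) sum1_card card_ord.
apply: contraLR iA => iA; rewrite -leqNgt.
have sub : A \subset [set j : 'I_n | (j < i)%N]%SET.
  by apply/fintype.subsetP => j jA; rewrite inE ltnNge; apply: contra iA => /h; apply.
apply: leq_trans (subset_leq_card sub) _.
rewrite cardE size_filter -sum1_count big_mkcond/=.
rewrite (eq_bigr (fun j : 'I_n => (if (j < i)%N then 1 else 0)%N)); last by move=> j _; rewrite inE.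
rewrite -big_mkcond/=.
by rewrite -(big_ord_widen n (fun=> 1%N) (ltnW (ltn_ord i))) sum1_card card_ord.
Qed.

Lemma sort_perm n (f : 'I_n -> int) :
  exists s : 'S_n, forall i j : 'I_n, (i <= j)%N -> (f (s i) <= f (s j))%R.
Proof.
pose le_f := relpre f (fun x y : int => (x <= y)%R).
have tot : total le_f by move=> x y; exact: le_total.
have trans_f : transitive le_f by move=> x y z; exact: le_trans.
pose t := sort_tuple le_f (ord_tuple n).
have pt : perm_eq t (ord_tuple n) by rewrite /t/= perm_sort.
have ut : uniq t by rewrite (perm_uniq pt) val_ord_tuple enum_uniq.
have inj : injective (tnth t) by apply/tuple_uniqP.
exists (perm inj) => i j ij; rewrite !permE.
have so : sorted le_f t by exact: sort_sorted.
have [->//|ij'] := eqVneq i j.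
have lt : (i < j)%N by rewrite ltn_neqAle ij'.
rewrite !(tnth_nth i).
apply: (sorted_ltn_nth trans_f i so) => //; by rewrite inE size_tuple.
Qed.

Variable R : realType.
Local Notation C := (complex.complex R).

Lemma dp_mulmx m n (A : 'M[C]_(m, n)) x y : dp (A *m x) y = dp x (ctr A *m y).
Proof.
rewrite /dp; under eq_bigr do rewrite mxE mulr_suml.
rewrite exchange_big; apply: eq_bigr => j _ /=.
rewrite mxE conjc_sum mulr_sumr; apply: eq_bigr => i _.
by rewrite !mxE conjcM complex.conjcK; ring.
Qed.
Lemma ctrK m n (A : 'M[C]_(m, n)) : ctr (ctr A) = A.
Proof. by apply/matrixP => i j; rewrite !mxE complex.conjcK. Qed.
Lemma ctrM m n p (A : 'M[C]_(m, n)) (B : 'M[C]_(n, p)) : ctr (A *m B) = ctr B *m ctr A.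
Proof.
apply/matrixP => i j; rewrite !mxE conjc_sum; apply: eq_bigr => k _.
by rewrite !mxE conjcM mulrC.
Qed.
Lemma ctr1 n : ctr (1%:M : 'M[C]_n) = 1%:M.
Proof.
apply/matrixP => i j; rewrite !mxE eq_sym; case: (i == j); first exact: conjc1.
exact: conjc0.
Qed.
Lemma ctrD m n (A B : 'M[C]_(m, n)) : ctr (A + B) = ctr A + ctr B.
Proof. by apply/matrixP => i j; rewrite !mxE conjcD. Qed.
Lemma ctrN m n (A : 'M[C]_(m, n)) : ctr (- A) = - ctr A.
Proof. by apply/matrixP => i j; rewrite !mxE conjcN. Qed.

(** Unitary diagonalization followed by scaling with square roots of the eigenvalues. The zero
    eigenvalues are sorted first and scaled by 1 instead, which keeps [X] invertible. *)
Lemma psd_diag n (S : 'M[C]_n) : ctr S = S ->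
  (forall x, 0 <= Re (dp (S *m x) x)) ->
  exists (s : nat) (X : 'M[C]_n), [/\ (s <= n)%N, X \in unitmx &
    forall x, Re (dp (S *m x) x) = \sum_(i < n | (s <= i)%N) cabs ((X *m x) i 0) ^+ 2].
Proof.
move=> hS pos.
have nS : S \is normalmx.
  apply/normalmxP; have -> : (S ^t*)%sesqui = ctr S; last by rewrite hS.
  by apply/matrixP => i j; rewrite !mxE.
have /orthomx_spectralP := nS; set P := spectralmx S; set sp := spectral_diag S.
have uP : P \is unitarymx by exact: spectral_unitarymx.
have Pu : P \in unitmx by exact: unitarymx_unit.
have -> : invmx P = ctr P.
  have -> : ctr P = (P ^t*)%sesqui by apply/matrixP => i j; rewrite !mxE.
  by rewrite invmx_unitary.
move=> SE.
have qE x : dp (S *m x) x = \sum_i sp 0 i * real_complex R (cabs ((P *m x) i 0) ^+ 2).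
  rewrite SE -!mulmxA dp_mulmx ctrK /dp; apply: eq_bigr => i _.
  rewrite mul_diag_mx mxE -mulrA mulcJ//.
have spE (i : 'I_n) : 0 <= Re (sp 0 i).
  have := pos (invmx P *m delta_mx i 0); rewrite qE mulKVmx// (bigD1 i)//= big1 ?addr0.
    by rewrite mxE !eqxx/= cabs1 expr1n mulr1.
  by move=> j ji; rewrite mxE (negPf ji)/= cabs0 expr0n/= mulr0.
have qR x : Re (dp (S *m x) x) = \sum_i Re (sp 0 i) * cabs ((P *m x) i 0) ^+ 2.
  by rewrite qE Re_sum; apply: eq_bigr => i _; rewrite !cE mulr0 subr0.
have [t ht] := @sort_perm n (fun i => (Re (sp 0 i) != 0)%:Z).
pose A := [set i | Re (sp 0 (t i)) == 0]%SET.
have hA : forall i : 'I_n, (i \in A) = (i < #|A|)%N.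
  apply: downset_card => i j ij; rewrite !inE => /eqP hj.
  by have := ht i j ij; rewrite hj eqxx/=; case: eqP.
pose d : 'rV[C]_n := \row_i real_complex R (if Re (sp 0 i) == 0 then 1 else Num.sqrt (Re (sp 0 i))).
pose X := row_perm t (diag_mx d *m P).
exists #|A|, X; split.
- by rewrite -[n in (_ <= n)%N]card_ord max_card.
- rewrite /X row_permE unitmx_mul unitmx_perm unitmx_mul Pu andbT/=.
  rewrite unitmxE det_diag unitfE prodf_seq_neq0; apply/allP => i _ /=.
  rewrite mxE; apply/eqP => -[]/eqP; case: ifPn => [_|h]; first by rewrite oner_eq0.
  by rewrite sqrtr_eq0 leNgt lt_def h spE.
move=> x; rewrite qR (reindex_inj (@perm_inj _ t))/= [RHS]big_mkcond/=.
apply: eq_bigr => i _; rewrite leqNgt -hA inE.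
have -> : (X *m x) i 0 = d 0 (t i) * (P *m x) (t i) 0.
  by rewrite /X row_permE -mulmxA -row_permE mxE -mulmxA mul_diag_mx mxE.
rewrite cabsM exprMn [d 0 _]mxE cabs_real real_normK ?num_real//.
case: eqVneq => [->|h] /=; first by rewrite mul0r.
by rewrite (sqr_sqrtr (spE (t i))).
Qed.

(** For invertible [X] and [s <= n] this is a subspace of dimension [s], in the shape in which
    [psd_diag] delivers the null space of a form. *)
Definition flagged n (X : 'M[C]_n) (s : nat) (x : 'cV[C]_n) :=
  forall i : 'I_n, (s <= i)%N -> (X *m x) i 0 = 0.

(** [X' X^-1] sends the first [s] coordinate vectors into the span of the first [s']; the ranks are
    compared. *)
Lemma flag_dim_le n (X X' : 'M[C]_n) (s s' : nat) : X \in unitmx -> X' \in unitmx ->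
  (s <= n)%N -> (forall x, flagged X s x -> flagged X' s' x) -> (s <= s')%N.
Proof.
move=> uX uX' sn h.
pose W := X' *m invmx X *m (pid_mx s : 'M[C]_n).
have rW : \rank W = s.
  have -> : \rank W = \rank (pid_mx s : 'M[C]_n).
    apply/eqP; rewrite eqn_leq mxrankM_maxr/=.
    have -> : (pid_mx s : 'M[C]_n) = X *m invmx X' *m W.
      by rewrite /W -!mulmxA (mulKmx uX') (mulKVmx uX).
    exact: mxrankM_maxr.
  by rewrite rank_pid_mx.
have eW : W = pid_mx s' *m W.
  apply/matrixP => i j; rewrite [RHS]mxE.
  have [si|si] := leqP s' i.
    rewrite big1 => [|k _]; last by rewrite mxE [(i < s')%N]ltnNge si andbF mul0r.
    have fl : flagged X s (col j (invmx X *m (pid_mx s : 'M[C]_n))).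
      move=> k sk; rewrite colE 2!mulmxA (mulmxV uX) mul1mx -colE !mxE.
      by rewrite [(k < s)%N]ltnNge sk andbF.
    by have := h _ fl i si; rewrite colE !mulmxA -colE mxE.
  rewrite (bigD1 i)//= big1 => [|k ki]; last first.
    by have /negPf e : (i : nat) != k; [rewrite eq_sym|rewrite mxE e mul0r].
  by rewrite [(pid_mx s' : 'M[C]_n) i i]mxE eqxx si mul1r addr0.
rewrite -rW {1}eW; apply: leq_trans (mxrankM_maxl _ _) _.
have [sn'|sn'] := leqP s' n; first by rewrite rank_pid_mx.
by apply: leq_trans (rank_leq_row _) (ltnW sn').
Qed.
End LinearAlgebra.

(** * Convergent subsequences in finite dimension *)

Section BolzanoWeierstrass.
Variable R : realType.
Local Notation C := (complex.complex R).

Lemma freq_choice (P : nat -> nat -> Prop) :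
  (forall k N, exists2 p, (N <= p)%N & P k p) ->
  exists phi : nat -> nat, (forall k, (phi k < phi k.+1)%N) /\ forall k, P k (phi k).
Proof.
move=> h; have /choice[F hF] (kN : nat * nat) : exists p, (kN.2 <= p)%N /\ P kN.1 p.
  by have [p ? ?] := h kN.1 kN.2; exists p.
pose phi := fix phi k := if k is k'.+1 then F (k, (phi k').+1) else F (0, 0)%N.
exists phi; split => k; first by case: (hF (k.+1, (phi k).+1)).
by case: k => [|k]; [case: (hF (0, 0)%N)|case: (hF (k.+1, (phi k).+1))].
Qed.

(** The limit is the upper limit of the sequence, taken as the supremum of the levels exceeded
    infinitely often. *)
Lemma real_BW (x : nat -> R) (M : R) : (forall k, `|x k| <= M) ->
  exists phi : nat -> nat, (forall k, (phi k < phi k.+1)%N) /\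
  exists l, forall e, 0 < e -> exists N, forall k, (N <= k)%N -> `|x (phi k) - l| < e.
Proof.
move=> xM.
pose E : set R := [set y | forall N, exists2 k, (N <= k)%N & y < x k].
have hE : has_sup E.
  split.
    exists (- M - 1) => N; exists N => //.
    by have := xM N; rewrite ler_norml => /andP[]; lra.
  exists M => y /(_ 0%N)[k _ yk]; apply: le_trans (ltW yk) _.
  by have := xM k; rewrite ler_norml => /andP[].
pose l := sup E.
have key (k N : nat) : exists2 p, (N <= p)%N & `|x p - l| < k.+1%:R^-1.
  have e0 : 0 < k.+1%:R^-1 :> R by rewrite invr_gt0.
  move: (k.+1%:R^-1) e0 => e e0.
  have [N0 hN0] : exists N0, forall p, (N0 <= p)%N -> x p <= l + e / 2.
    apply: contrapT => h; have : E (l + e / 2).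
      move=> N0; apply: contrapT => h'; apply: h; exists N0 => p N0p.
      by rewrite leNgt; apply/negP => lt; apply: h'; exists p.
    by move=> /(sup_upper_bound hE); rewrite -/l; lra.
  have e2 : 0 < e / 2 by lra.
  have [y Ey ly] := sup_adherent e2 hE.
  have [p np yp] := Ey (maxn N N0); move: np; rewrite geq_max => /andP[Np N0p].
  exists p => //; rewrite ltr_norml; have := hN0 p N0p; move: ly yp; rewrite -/l.
  by move=> *; apply/andP; split; lra.
have [phi [phiI hphi]] := freq_choice key.
exists phi; split => //; exists l => e /inv_small[N hN]; exists N => k /hN.
exact: lt_trans (hphi k).
Qed.

Lemma multi_BW (J : eqType) (r : seq J) (x : J -> nat -> R) (M : R) :
  (forall j k, `|x j k| <= M) ->
  exists phi : nat -> nat, (forall k, (phi k < phi k.+1)%N) /\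
  forall j, j \in r -> exists l, forall e, 0 < e -> exists N, forall k, (N <= k)%N ->
     `|x j (phi k) - l| < e.
Proof.
move=> xM; elim: r => [|j r [phi [phiI h]]]; first by exists id.
have [psi [psiI [l hl]]] := real_BW (fun k => xM j (phi k)).
exists (phi \o psi); split => [k|i].
  have inc := incr_le phiI; apply: leq_trans (phiI _) (inc _ _ (psiI k)).
rewrite inE => /orP[/eqP ->|/h[l' hl']]; first by exists l.
exists l' => e /hl'[N hN]; exists N => k Nk; apply: hN.
exact: leq_trans Nk (incr_ge psiI k).
Qed.

Lemma vec_BW n (x : nat -> 'cV[C]_n) (M : R) : (forall k, vnorm (x k) <= M) ->
  exists phi : nat -> nat, (forall k, (phi k < phi k.+1)%N) /\
  forall e, 0 < e -> exists N, forall k l, (N <= k)%N -> (N <= l)%N ->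
    vnorm (x (phi k) - x (phi l)) < e.
Proof.
move=> xM.
pose y (j : 'I_n * bool) k := if j.2 then Re (x k j.1 0) else Im (x k j.1 0).
have yM j k : `|y j k| <= M.
  apply: le_trans (xM k); apply: le_trans (cabs_le_vnorm _ j.1).
  by rewrite /y; case: j.2; [exact: Re_le_cabs|exact: Im_le_cabs].
have [phi [phiI h]] := @multi_BW _ (enum {: 'I_n * bool}) y M yM.
have /choice[l hl] (j : 'I_n * bool) : exists l, forall e, 0 < e -> exists N, forall k,
  (N <= k)%N -> `|y j (phi k) - l| < e by apply: h; rewrite mem_enum.
exists phi; split => // e e0.
(* Each of the [n] coordinates contributes at most [2 e'] from each of its two real parts; [n.+1]
   covers [n = 0] and makes the final inequality strict. *)
pose e' := e / (4 * n.+1%:R).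
have e'0 : 0 < e' by rewrite divr_gt0// mulr_gt0// ltr0n.
have /choice[N hN] (j : 'I_n * bool) : exists N, forall k,
  (N <= k)%N -> `|y j (phi k) - l j| < e' by exact: hl.
exists (\max_j N j) => k k' Nk Nk'.
apply: le_lt_trans (vnorm_le_sum _) _.
have b i : cabs ((x (phi k) - x (phi k')) i 0) <= 4 * e'.
  apply: le_trans (cabs_le_ReIm _) _; rewrite !mxE !cE.
  have f b : `|y (i, b) (phi k) - y (i, b) (phi k')| <= 2 * e'.
    have a1 := hN (i, b) k (leq_trans (leq_bigmax (i, b)) Nk).
    have a2 := hN (i, b) k' (leq_trans (leq_bigmax (i, b)) Nk').
    have -> : y (i, b) (phi k) - y (i, b) (phi k') =
      (y (i, b) (phi k) - l (i, b)) - (y (i, b) (phi k') - l (i, b)) by ring.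
    by apply: le_trans (ler_normB _ _) _; lra.
  by have := f true; have := f false; rewrite /y/=; lra.
apply: le_lt_trans (_ : _ <= \sum_(i < n) 4 * e') _; first by apply: ler_sum.
rewrite sumr_const card_ord -[ltLHS]mulr_natr /e'.
have n0 : 0 < n.+1%:R :> R by rewrite ltr0n.
rewrite [ltLHS](_ : _ = e * (n%:R / n.+1%:R)); last by field; rewrite gt_eqF.
rewrite -[ltRHS]mulr1 ltr_pM2l// ltr_pdivrMr// mul1r ltr_nat.
exact: ltnSn.
Qed.
End BolzanoWeierstrass.

(** * One-step extension of Hankel operators *)

Section HankelStep.
Variables (R : realType) (n : nat).
Local Notation C := (complex.complex R).
Local Notation V := (R -> 'cV[C]_n).
Local Notation ip := (@ip R n).
Implicit Types (f g : V) (x y : 'cV[C]_n).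
Let L2s := @isL2_linsub R n.
Let ipH := @ip_hform R n.
Let H2s := @H2_linsub R n.
Let dpH := @dp_hform R n.
Lemma dpE x y : dp x y = \sum_i x i 0 * conjc (y i 0).
Proof. by []. Qed.
#[local] Opaque fcoef cint isL2 aeT dp.

Lemma ip_H2_hform : hform (@H2 R n) ip.
Proof. exact: (sub_hform ipH H2s (@H2_L2 R n)). Qed.

(** The last clause is the Hankel relation [H (z f) = P_-(z H f)]: the shift pushes only the
    coefficient of index [-1] out of [H2minus]. *)
Record hankel (H : V -> V) : Prop := Hankel {
  hankel_m : forall f, H2 f -> H2minus (H f);
  hankel_l : forall a f g, H2 f -> H2 g -> aeq (H (a *: f + g)) (a *: H f + H g);
  hankel_s : forall f, H2 f -> aeq (H (zs 1 f)) (zs 1 (H f) - ek 0 (fcoef (H f) (-1))) }.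

(** The coefficient lost under the shift; by [qf_zs] it measures the failure of [q] to be shift
    invariant. *)
Definition hcoef (H : V -> V) f := fcoef (H f) (-1).

(* [q0] is [|f|^2], possibly weighted by a bounded multiplier; the shift is isometric for it. *)
Variables (q0 : V -> V -> C) (K0 : R).
Hypothesis hq0 : hform (@H2 R n) q0.
Hypothesis q0_bound : forall f, H2 f -> nq q0 f <= K0 * nq ip f.
Hypothesis q0_shift : forall f g, H2 f -> H2 g -> q0 (zs 1 f) (zs 1 g) = q0 f g.

Definition qf (H : V -> V) f g := q0 f g - ip (H f) (H g).
Definition contractive (H : V -> V) := forall f, H2 f -> nq ip (H f) <= nq q0 f.

Lemma nq_qf H f : nq (qf H) f = nq q0 f - nq ip (H f).
Proof. by rewrite /nq /qf ReD ReN. Qed.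

Section WithHankel.
Variable H : V -> V.
Hypothesis hH : hankel H.

Lemma hankel_L2 f : H2 f -> isL2 (H f).
Proof. by move=> /(hankel_m hH)/H2minus_L2. Qed.
Lemma qf_hform : contractive H -> hform (@H2 R n) (qf H).
Proof.
move=> hc; split => //.
- move=> a f g h hf hg hh; rewrite /qf (hformL hq0 a hf hg hh).
  have hL := proj2 L2s a _ _ (hankel_L2 hf) (hankel_L2 hg).
  have hfg := proj2 H2s a _ _ hf hg.
  rewrite (ip_aeql (hankel_L2 hfg) hL (hankel_L2 hh) (hankel_l hH a hf hg)).
  rewrite (hformL ipH a (hankel_L2 hf) (hankel_L2 hg) (hankel_L2 hh)).
  ring.
- move=> f g hf hg; rewrite /qf (hformC hq0 hf hg) conjcD conjcN.
  by rewrite -(hformC ipH (hankel_L2 hf) (hankel_L2 hg)).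
- by move=> f hf; have := hc f hf; have := nq_qf H f; rewrite /nq => ->; rewrite subr_ge0.
Qed.
Lemma hcoefL a f g : H2 f -> H2 g -> hcoef H (a *: f + g) = a *: hcoef H f + hcoef H g.
Proof.
move=> hf hg; have hL := proj2 L2s a _ _ (hankel_L2 hf) (hankel_L2 hg).
have hfg := proj2 H2s a _ _ hf hg.
rewrite /hcoef (fcoef_aeq (-1) (hankel_L2 hfg) hL (hankel_l hH a hf hg)).
exact: (fcoefL (-1) a (hankel_L2 hf) (hankel_L2 hg)).
Qed.
Lemma hcoefB f g : H2 f -> H2 g -> hcoef H (f - g) = hcoef H f - hcoef H g.
Proof.
by move=> hf hg; rewrite -[f - g]addrC -scaleN1r (hcoefL (-1) hg hf) scaleN1r addrC.
Qed.
Lemma hcoef0 : hcoef H 0 = 0.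
Proof.
have h0 : H2 (0 : V) := proj1 H2s.
by have := hcoefB h0 h0; rewrite !subrr.
Qed.
Lemma hcoef_sum (J : Type) (r : seq J) (a : J -> C) (w : J -> V) : (forall j, H2 (w j)) ->
  hcoef H (\sum_(j <- r) a j *: w j) = \sum_(j <- r) a j *: hcoef H (w j).
Proof.
move=> hw; elim: r => [|j r IH]; first by rewrite !big_nil hcoef0.
rewrite !big_cons hcoefL ?IH//.
by apply: (@subsp_sum _ _ (@H2 R n) _ _ _ _ H2s) => i _; exact: (subspZ _ H2s (hw i)).
Qed.
(** [H (z f)] is [z H f] with its constant coefficient [hcoef H f] removed, and [q0] is shift
    invariant. *)
Lemma qf_zs f g : H2 f -> H2 g ->
  qf H (zs 1 f) (zs 1 g) = qf H f g + dp (hcoef H f) (hcoef H g).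
Proof.
move=> hf hg; rewrite /qf (q0_shift hf hg).
have hzf := H2_zs (isT : (0 : int) <= 1) hf; have hzg := H2_zs (isT : (0 : int) <= 1) hg.
set c := hcoef H f; set d := hcoef H g.
have Lf := isL2_zs 1 (hankel_L2 hf); have Lg := isL2_zs 1 (hankel_L2 hg).
have Lc : isL2 (ek 0 c) by exact: isL2_ek.
have Ld : isL2 (ek 0 d) by exact: isL2_ek.
have hL := subspB L2s Lf Lc; have hM := subspB L2s Lg Ld.
rewrite (ip_aeql (hankel_L2 hzf) hL (hankel_L2 hzg) (hankel_s hH hf)).
rewrite (ip_aeqr hL (hankel_L2 hzg) hM (hankel_s hH hg)).
rewrite (hformBl ipH Lf Lc hM) (hformBr ipH Lf Lg Ld) (hformBr ipH Lc Lg Ld).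
rewrite ip_zs ip_ek (hformC ipH Lg Lc) -(dp_fcoef 0 d Lf) -(dp_fcoef 0 c Lg).
rewrite !fcoef_zs !sub0r -/(hcoef H f) -/(hcoef H g) -/c -/d.
rewrite -(hformC dpH (f := d) (g := c) Logic.I Logic.I).
ring.
Qed.
End WithHankel.

Definition zH2 f := H2 f /\ fcoef f 0 = 0.
Lemma zH2E f : zH2 f <-> spec_in (fun k => k <= 0) f.
Proof.
split => [[[hf h] f0]|[hf h]].
  split => // k; rewrite le_eqVlt => /orP[/eqP ->//|]; exact: h.
by split; [split => // k /ltW; exact: h|exact: h].
Qed.
Lemma zH2_linsub : linsub zH2.
Proof.
have [h0 h] := @spec_linsub R n (fun k => k <= 0); split; first exact/zH2E.
by move=> a f g /zH2E hf /zH2E hg; apply/zH2E; exact: h.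
Qed.
Lemma zH2_H2 f : zH2 f -> H2 f. Proof. by case. Qed.
Lemma zH2_complete : qcomplete zH2 ip.
Proof.
move=> u hu cu; have [f hf cv] := @spec_complete R n (fun k => k <= 0) u
  (fun k => (zH2E (u k)).1 (hu k)) cu.
by exists f => //; apply/zH2E.
Qed.
Lemma zs_zH2 f : H2 f -> zH2 (zs 1 f).
Proof.
move=> hf; split; first exact: H2_zs.
by rewrite fcoef_zs; apply hf.
Qed.
Lemma zH2_zsN f : zH2 f -> H2 (zs (-1) f).
Proof. by move=> [hf h]; exact: H2_zsN1. Qed.

Section Step.
Variable H : V -> V.
Hypotheses (hH : hankel H) (hc : contractive H) (hess : ess_form (@H2 R n) ip (qf H)).
Let q := qf H.
Let hq : hform (@H2 R n) q := qf_hform hH hc.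
Let c := hcoef H.

Lemma qf_bound f : H2 f -> nq q f <= K0 * nq ip f.
Proof.
move=> hf; apply: le_trans (q0_bound hf); rewrite nq_qf gerBl.
exact: (nq_ge0 ipH (hankel_L2 hH hf)).
Qed.
Lemma zH2_qcomplete : qcomplete zH2 q.
Proof.
apply: (@ess_complete _ _ zH2 ip q K0).
- exact: (sub_hform ip_H2_hform zH2_linsub zH2_H2).
- exact: (sub_hform hq zH2_linsub zH2_H2).
- exact: zH2_complete.
- by move=> f /zH2_H2; exact: qf_bound.
- exact: (sub_ess_form zH2_H2 hess).
Qed.
Let qzs f g : H2 f -> H2 g -> q (zs 1 f) (zs 1 g) = q f g + dp (c f) (c g).
Proof. exact: qf_zs. Qed.
Lemma nq_zs1 f : H2 f -> nq q (zs 1 f) = nq q f + vnorm (c f) ^+ 2.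
Proof. by move=> hf; rewrite /nq (qzs hf hf) ReD dp_diag. Qed.

(** A constant basis vector minus its [q]-projection onto [z H^2]: this keeps the value at 0 and
    gives orthogonality. *)
Lemma exists_u : exists uu : 'I_n -> V, forall i,
  [/\ H2 (uu i), fcoef (uu i) 0 = delta_mx i 0 & forall g, zH2 g -> q (uu i) g = 0].
Proof.
suff /choice[w hw] : forall i : 'I_n, exists w,
    [/\ H2 w, fcoef w 0 = delta_mx i 0 & forall g, zH2 g -> q w g = 0] by exists w.
move=> i.
have he : H2 (ek 0 (delta_mx i 0) : V) by exact: H2_ek.
have [p hp ho] := projection hq zH2_linsub zH2_H2 zH2_qcomplete he.
exists (ek 0 (delta_mx i 0) - p); split => //; first exact: (subspB H2s he (zH2_H2 hp)).
rewrite (fcoefB 0 (H2_L2 he) (H2_L2 (zH2_H2 hp))) (proj2 hp) fcoef_ek eqxx subr0.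
exact: scale1r.
Qed.
(** The functional [z g |-> c g] is represented by [q] on [z H^2]; it is bounded since
    [q(z g) = q(g) + |c g|^2]. *)
Lemma exists_p : exists pp : 'I_n -> V, forall i, H2 (pp i) /\
  forall g, H2 g -> q (zs 1 g) (zs 1 (pp i)) = c g i 0.
Proof.
suff /choice[w hw] : forall i : 'I_n, exists w, H2 w /\
    forall g, H2 g -> q (zs 1 g) (zs 1 w) = c g i 0 by exists w.
move=> i.
have hqZ := sub_hform hq zH2_linsub zH2_H2.
have [||P hP h] := @riesz_form _ _ zH2 q hqZ (fun g => c (zs (-1) g) i 0) 1 zH2_qcomplete.
- move=> a f g hf hg; rewrite zsL /c (hcoefL hH a (zH2_zsN hf) (zH2_zsN hg)).
  by rewrite mxE [X in X + _]mxE.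
- move=> g hg; rewrite mul1r; have hz := zH2_zsN hg.
  have := nq_zs1 hz; rewrite (zsK 1 g) => ->.
  apply: (@le_trans _ _ (vnorm (c (zs (-1) g)) ^+ 2)).
    by rewrite ler_pXn2r ?nnegrE ?cabs_ge0 ?vnorm_ge0// cabs_le_vnorm.
  by rewrite lerDr (nq_ge0 hq hz).
exists (zs (-1) P); split; first exact: zH2_zsN.
move=> g hg; rewrite (zsK 1 P) -(h _ (zs_zH2 hg)).
by rewrite (zsNK 1 g).
Qed.

Definition lc (w : 'I_n -> V) x : V := \sum_i x i 0 *: w i.
Lemma lcL w a x y : lc w (a *: x + y) = a *: lc w x + lc w y.
Proof.
rewrite /lc scaler_sumr -big_split; apply: eq_bigr => i _ /=.
by rewrite !mxE scalerDl scalerA.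
Qed.
Lemma lc_H2 w x : (forall i, H2 (w i)) -> H2 (lc w x).
Proof.
by move=> hw; apply: (@subsp_sum _ _ (@H2 R n) _ _ _ _ H2s) => i _; exact: (subspZ _ H2s (hw i)).
Qed.
Lemma lc0 w : lc w 0 = 0.
Proof. by rewrite /lc big1// => i _; rewrite mxE scale0r. Qed.
Lemma vec_sum_delta x : \sum_i x i 0 *: (delta_mx i 0 : 'cV[C]_n) = x.
Proof.
apply/matrixP => k l; rewrite ord1 summxE (bigD1 k)//= big1 => [|j jk].
  by rewrite !mxE !eqxx mulr1 addr0.
by rewrite !mxE eq_sym (negPf jk) mulr0.
Qed.
Lemma fcoef_lc w x k : (forall i, H2 (w i)) ->
  fcoef (lc w x) k = \sum_i x i 0 *: fcoef (w i) k.
Proof.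
move=> hw; rewrite /lc; elim: (index_enum _) => [|j r IH]; first by rewrite !big_nil fcoef0.
rewrite !big_cons -IH; apply: fcoefL; first exact: (H2_L2 (hw j)).
by apply: (@subsp_sum _ _ (@isL2 R n) _ _ _ _ L2s) => i _; exact: (subspZ _ L2s (H2_L2 (hw i))).
Qed.
Lemma hcoef_lc w x : (forall i, H2 (w i)) ->
  c (lc w x) = (\matrix_(i, j) c (w j) i 0) *m x.
Proof.
move=> hw; rewrite /c /lc (hcoef_sum hH _ _ hw); apply/matrixP => i k.
rewrite ord1 summxE mxE; apply: eq_bigr => j _.
by rewrite !mxE mulrC.
Qed.

Variables (uu pp : 'I_n -> V).
Hypothesis huu : forall i,
  [/\ H2 (uu i), fcoef (uu i) 0 = delta_mx i 0 & forall g, zH2 g -> q (uu i) g = 0].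
Hypothesis hpp : forall i, H2 (pp i) /\
  forall g, H2 g -> q (zs 1 g) (zs 1 (pp i)) = c g i 0.
Let u := lc uu.
Let p := lc pp.
Let uH i : H2 (uu i). Proof. by case: (huu i). Qed.
Let pH i : H2 (pp i). Proof. by case: (hpp i). Qed.

Lemma fcoef_u x : fcoef (u x) 0 = x.
Proof.
rewrite /u (fcoef_lc x 0 uH) -[RHS]vec_sum_delta; apply: eq_bigr => i _.
by case: (huu i) => _ -> _.
Qed.
Lemma q_u x g : zH2 g -> q (u x) g = 0.
Proof.
move=> hg; rewrite /u /lc (hform_suml hq); last 2 first.
- by move=> i; exact: (subspZ _ H2s (uH i)).
- exact: (zH2_H2 hg).
apply: big1 => i _; rewrite (hformZl hq _ (uH i) (zH2_H2 hg)).
by case: (huu i) => _ _ ->; rewrite ?mulr0.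
Qed.
(** By [Smx_form] and [nq_split], its quadratic form at [x] is the least value of [q] among the
    functions with value [x] at 0. *)
Definition Smx : 'M[C]_n := \matrix_(i, j) q (uu j) (uu i).
Lemma Smx_ctr : ctr Smx = Smx.
Proof. by apply/matrixP => i j; rewrite !mxE -(hformC hq (uH i) (uH j)). Qed.
Lemma Smx_form x : Re (dp (Smx *m x) x) = nq q (u x).
Proof.
rewrite /nq /u {1}/lc (hform_suml hq) //; last 2 first.
- by move=> i; exact: (subspZ _ H2s (uH i)).
- exact: lc_H2.
have -> : dp (Smx *m x) x = \sum_i (\sum_j Smx i j * x j 0) * conjc (x i 0).
  by rewrite dpE; apply: eq_bigr => i _; rewrite mxE.
congr Re.
under eq_bigr do rewrite mulr_suml; rewrite exchange_big; apply: eq_bigr => j _ /=.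
rewrite (hformZl hq _ (uH j) (lc_H2 x uH)) /lc (hform_sumr hq); last 2 first.
- by move=> i; exact: (subspZ _ H2s (uH i)).
- exact: uH.
rewrite mulr_sumr; apply: eq_bigr => i _; rewrite (hformZr hq _ (uH j) (uH i)) mxE.
ring.
Qed.

Definition Cmx : 'M[C]_n := \matrix_(i, j) c (pp j) i 0.
Lemma CmxE i j : Cmx i j = c (pp j) i 0.
Proof. by rewrite /Cmx mxE. Qed.
Definition Amx : 'M[C]_n := 1%:M - Cmx.
(** By the choice of the [pp j], [Cmx] is their Gram matrix for the form [q(z f, z g)]. *)
Lemma Amx_ctr : ctr Amx = Amx.
Proof.
rewrite /Amx ctrD ctrN ctr1; congr (_ - _); apply/matrixP => i j.
have -> : ctr Cmx i j = conjc (Cmx j i) by rewrite /ctr mxE [X in conjc X]mxE.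
rewrite !CmxE -(proj2 (hpp j) _ (pH i)) -(proj2 (hpp i) _ (pH j)).
have z k := H2_zs (isT : (0 : int) <= 1) (pH k).
by rewrite -(hformC hq (z i) (z j)).
Qed.
Lemma c_p y : c (p y) = y - Amx *m y.
Proof. by rewrite /p (hcoef_lc y pH) /Amx mulmxBl mul1mx subKr. Qed.
Lemma zs_p y : zs 1 (p y) = lc (fun i => zs 1 (pp i)) y.
Proof.
rewrite /p /lc; elim: (index_enum _) => [|j r IH].
  by rewrite !big_nil; apply/funext => t; rewrite /zs scaler0.
by rewrite !big_cons zsL IH.
Qed.
Lemma q_zs_p g y : H2 g -> q (zs 1 g) (zs 1 (p y)) = dp (c g) y.
Proof.
move=> hg; have hz := H2_zs (isT : (0 : int) <= 1) hg.
have z k := H2_zs (isT : (0 : int) <= 1) (pH k).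
rewrite zs_p /lc (hform_sumr hq) //; last by move=> i; exact: (subspZ _ H2s (z i)).
rewrite dpE; apply: eq_bigr => i _.
by rewrite (hformZr hq _ hz (z i)) (proj2 (hpp i) _ hg) mulrC.
Qed.
(** From [q(z g, z p y) = <c g, y>], the shift identity for [q] and [c (p y) = y - A y]. *)
Lemma q_p g y : H2 g -> q g (p y) = dp (c g) (Amx *m y).
Proof.
move=> hg; have hp := lc_H2 y pH.
have := q_zs_p y hg; rewrite (qzs hg hp) (c_p y).
rewrite (hformBr dpH (f := c g) (g := y) (h := Amx *m y) Logic.I Logic.I Logic.I) => e.
apply: (@addIr _ (dp (c g) y - dp (c g) (Amx *m y))).
by rewrite e addrC subrK.
Qed.
Lemma Amx_form y : Re (dp (Amx *m y) y) = nq q (p y) + vnorm (Amx *m y) ^+ 2.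
Proof.
rewrite /nq (q_p y (lc_H2 y pH)) (c_p y).
rewrite (hformBl dpH (f := y) (g := Amx *m y) (h := Amx *m y) Logic.I Logic.I Logic.I).
rewrite ReD ReN dp_diag Re_real subrK.
by rewrite (hformC dpH (f := y) (g := Amx *m y) Logic.I Logic.I) ReJ.
Qed.

(* The free parameter [B] is the freedom in the choice of the next Fourier coefficient of the symbol. *)
Variable B : 'M[C]_n.
Definition red f : V := zs (-1) (f - u (fcoef f 0)).
(** The new coefficient. On [z H^2] it is forced by [H' z = H]; on [u(x)] it is free, and the form
    [A (B x)] is what lets [nq_step] complete a square. *)
Definition gstep f := c (red f) + Amx *m (B *m fcoef f 0).
Definition hstep f : V := zs (-1) (H f + ek 0 (gstep f)).

Lemma red_zH2 f : H2 f -> zH2 (f - u (fcoef f 0)).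
Proof.
move=> hf; have hu := lc_H2 (fcoef f 0) uH.
split; first exact: (subspB H2s hf hu).
by rewrite (fcoefB 0 (H2_L2 hf) (H2_L2 hu)) fcoef_u subrr.
Qed.
Lemma red_H2 f : H2 f -> H2 (red f).
Proof. by move=> /red_zH2/zH2_zsN. Qed.
Lemma redK f : zs 1 (red f) + u (fcoef f 0) = f.
Proof. by rewrite /red (zsK 1) subrK. Qed.
Lemma redL a f g : H2 f -> H2 g -> red (a *: f + g) = a *: red f + red g.
Proof.
move=> hf hg; rewrite /red (fcoefL 0 a (H2_L2 hf) (H2_L2 hg)) /u lcL -zsL; congr zs.
by rewrite scalerBr opprD addrACA.
Qed.
Lemma gstepL a f g : H2 f -> H2 g -> gstep (a *: f + g) = a *: gstep f + gstep g.
Proof.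
move=> hf hg; rewrite /gstep (redL a hf hg) /c (hcoefL hH a (red_H2 hf) (red_H2 hg)).
rewrite (fcoefL 0 a (H2_L2 hf) (H2_L2 hg)) !mulmxDr -!scalemxAr scalerDr.
by rewrite addrACA.
Qed.
Lemma red_zs f : H2 f -> red (zs 1 f) = f.
Proof.
move=> hf; have [_ e] := zs_zH2 hf.
by rewrite /red e /u lc0 subr0 (zsNK 1).
Qed.
Lemma gstep_zs f : H2 f -> gstep (zs 1 f) = c f.
Proof.
move=> hf; have [_ e] := zs_zH2 hf.
by rewrite /gstep (red_zs hf) e !mulmx0 addr0.
Qed.
Lemma hstep_zs f : H2 f -> aeq (hstep (zs 1 f)) (H f).
Proof.
move=> hf; rewrite /hstep (gstep_zs hf).
have := aeq_zs (-1) (aeqD (hankel_s hH hf) (aeq_refl (ek 0 (c f)))).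
by rewrite subrK (zsNK 1).
Qed.
Lemma hcoef_hstep f : H2 f -> hcoef hstep f = gstep f.
Proof.
move=> hf; rewrite /hcoef /hstep fcoef_zs subrr.
rewrite (fcoefD 0 (hankel_L2 hH hf) (isL2_ek 0 _)) (proj2 (hankel_m hH hf) 0 (lexx _)).
by rewrite fcoef_ek eqxx scale1r add0r.
Qed.
Lemma hstep_hankel : hankel hstep.
Proof.
split.
- move=> f hf; rewrite /hstep zsD zs_ek addr0.
  apply: (subspD (@H2minus_linsub R n)); last exact: H2minus_ek.
  exact: (H2minus_zs _ (hankel_m hH hf)).
- move=> a f g hf hg; rewrite /hstep (gstepL a hf hg) -zsL ekL.
  apply: aeq_zs; rewrite scalerDr addrACA.
  exact: (aeqD (hankel_l hH a hf hg) (aeq_refl _)).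
- move=> f hf; rewrite -/(hcoef hstep f) (hcoef_hstep hf) {2}/hstep (zsK 1) addrK.
  exact: hstep_zs.
Qed.
Lemma ip_hstep f g : H2 f -> H2 g ->
  ip (hstep f) (hstep g) = ip (H f) (H g) + dp (gstep f) (gstep g).
Proof.
move=> hf hg; rewrite /hstep ip_zs.
have Lf := hankel_L2 hH hf; have Lg := hankel_L2 hH hg.
have Ef : isL2 (ek 0 (gstep f)) by exact: isL2_ek.
have Eg : isL2 (ek 0 (gstep g)) by exact: isL2_ek.
rewrite (hformDl ipH Lf Ef (subspD L2s Lg Eg)) (hformDr ipH Lf Lg Eg) (hformDr ipH Ef Lg Eg).
rewrite ip_ek (hformC ipH Lg Ef) -(dp_fcoef 0 (gstep g) Lf) -(dp_fcoef 0 (gstep f) Lg).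
rewrite (proj2 (hankel_m hH hf) 0 (lexx _)) (proj2 (hankel_m hH hg) 0 (lexx _)).
rewrite !(hform0l dpH (h := _) Logic.I) conjc0; ring.
Qed.
Lemma nq_qf_hstep f : H2 f -> nq (qf hstep) f = nq q f - vnorm (gstep f) ^+ 2.
Proof.
move=> hf; rewrite nq_qf /nq (ip_hstep hf hf) ReD dp_diag Re_real /q /qf ReD ReN.
ring.
Qed.
Lemma nq_split f : H2 f -> nq q f = nq q (zs 1 (red f)) + nq q (u (fcoef f 0)).
Proof.
move=> hf; have hr := zs_zH2 (red_H2 hf); have hu := lc_H2 (fcoef f 0) uH.
rewrite -{1}(redK f) (nqD hq (zH2_H2 hr) hu) (hformC hq hu (zH2_H2 hr)) (q_u _ hr).
by rewrite conjc0 mulr0 addr0.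
Qed.
(** With [r = red f] and [y = B x], the loss [|c r + A y|^2] is expanded and its cross term absorbed
    by [q(r, p y) = <c r, A y>]. Hence [B^* A B <= S] makes the new form nonnegative. *)
Lemma nq_step f : H2 f -> let x := fcoef f 0 in
  nq (qf hstep) f = nq q (red f - p (B *m x)) +
    (Re (dp (Smx *m x) x) - Re (dp (Amx *m (B *m x)) (B *m x))).
Proof.
move=> hf x; set y := B *m x; have hr := red_H2 hf; have hp := lc_H2 y pH.
rewrite (nq_qf_hstep hf) (nq_split hf) (nq_zs1 hr) (Smx_form x) (Amx_form y).
rewrite (nqB hq hr hp) (q_p y hr) -!nq_dp /gstep -/x -/y.
rewrite (nqD dpH (f := c (red f)) (g := Amx *m y) Logic.I Logic.I).
ring.
Qed.
End Step.
End HankelStep.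

Section StepTheorem.
Variables (R : realType) (n : nat).
Local Notation C := (complex.complex R).
Local Notation V := (R -> 'cV[C]_n).
Local Notation ip := (@ip R n).
Implicit Types (f g : V) (x y : 'cV[C]_n).
Let L2s := @isL2_linsub R n.
Let ipH := @ip_hform R n.
Let H2s := @H2_linsub R n.
#[local] Opaque fcoef cint isL2 aeT dp.

(** Every vector is flagged when [s >= n], so [s] is a dimension only together with [s <= n]; that
    bound is carried separately. *)
Definition spdim (q : V -> V -> C) (s : nat) := exists2 X : 'M[C]_n, X \in unitmx &
  forall x, (exists f, [/\ H2 f, fcoef f 0 = x & nq q f = 0]) <-> flagged X s x.

Lemma spdim_unique q s s' : (s <= n)%N -> (s' <= n)%N -> spdim q s -> spdim q s' -> s = s'.
Proof.
move=> sn s'n [X uX hX] [X' uX' hX']; apply/eqP; rewrite eqn_leq.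
apply/andP; split; first by apply: (flag_dim_le uX uX' sn) => x /hX/hX'.
by apply: (flag_dim_le uX' uX s'n) => x /hX'/hX.
Qed.

Lemma flagged_sum (X : 'M[C]_n) s x :
  flagged X s x <-> \sum_(i < n | (s <= i)%N) cabs ((X *m x) i 0) ^+ 2 = 0.
Proof.
split => [h|/eqP]; first by apply: big1 => i si; rewrite h// cabs0 expr0n.
rewrite psumr_eq0 => [/allP h i si|i _]; last exact: sqr_ge0.
by have := h i (mem_index_enum i); rewrite si/= sqrf_eq0 cabs_eq0 => /eqP.
Qed.

Variables (q0 : V -> V -> C) (K0 : R).
Hypothesis hq0 : hform (@H2 R n) q0.
Hypothesis q0_bound : forall f, H2 f -> nq q0 f <= K0 * nq ip f.
Hypothesis q0_shift : forall f g, H2 f -> H2 g -> q0 (zs 1 f) (zs 1 g) = q0 f g.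
Local Notation qf := (qf q0).

Definition state (H : V -> V) :=
  [/\ hankel H, contractive q0 H & ess_form (@H2 R n) ip (qf H)].

Section Fixed.
Variable H : V -> V.
Hypothesis hS : state H.
Let hH : hankel H. Proof. by case: hS. Qed.
Let hc : contractive q0 H. Proof. by case: hS. Qed.
Let hess : ess_form (@H2 R n) ip (qf H). Proof. by case: hS. Qed.
Let q := qf H.
Let hq : hform (@H2 R n) q := qf_hform hq0 hH hc.
Let c := hcoef H.
Let qb f : H2 f -> nq q f <= K0 * nq ip f.
Proof. exact: (@qf_bound _ _ q0 K0 q0_bound H hH). Qed.

Lemma hcoef_null f g : H2 f -> H2 g -> nq ip (f - g) = 0 -> c f = c g.
Proof.
move=> hf hg h; have hd := subspB H2s hf hg.
have h0 : nq ip (H (f - g)) = 0.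
  apply/eqP; rewrite eq_le (nq_ge0 ipH (hankel_L2 hH hd)) andbT.
  by apply: le_trans (hc hd) _; apply: le_trans (q0_bound hd) _; rewrite h mulr0.
have := nq_eq0 (hankel_L2 hH hd) h0 => e.
have e' : c (f - g) = 0.
  rewrite /c /hcoef (fcoef_aeq (-1) (hankel_L2 hH hd) (proj1 L2s) e).
  exact: fcoef0.
by apply/eqP; rewrite -subr_eq0 -(hcoefB hH hf hg) -/c e'.
Qed.

Variables (uu pp : 'I_n -> V).
Hypothesis huu : forall i,
  [/\ H2 (uu i), fcoef (uu i) 0 = delta_mx i 0 & forall g, zH2 g -> q (uu i) g = 0].
Hypothesis hpp : forall i, H2 (pp i) /\
  forall g, H2 g -> q (zs 1 g) (zs 1 (pp i)) = c g i 0.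
Let S := Smx q0 H uu.
Let A := Amx H pp.

Lemma null_value x : (exists f, [/\ H2 f, fcoef f 0 = x & nq q f = 0]) <->
  Re (dp (S *m x) x) = 0.
Proof.
rewrite (Smx_form hq0 hH hc huu x); split.
  move=> [f [hf fx f0]]; have := nq_split hq0 hH hc huu hf; rewrite -/q f0 fx => e.
  have r0 := nq_ge0 hq (zH2_H2 (zs_zH2 (red_H2 huu hf))).
  have u0 : 0 <= nq q (lc uu x) by apply: (nq_ge0 hq); apply: lc_H2 => i; case: (huu i).
  by move: e r0 u0; rewrite -/q; lra.
move=> h; exists (lc uu x); split => //; first by apply: lc_H2 => i; case: (huu i).
exact: (fcoef_u huu).
Qed.

(** Both nullities are compared with ranks of maps on the finite-dimensional null space. Evaluation
    at 0 has rank at most [s]. The coefficient map [c] has rank at least [s'], because [A y = 0]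
    makes [p y] null with [c (p y) = y]. A null function vanishing at 0 is [z g] with [g] null and
    [c g = 0]; so division by [z] embeds the kernel of evaluation into the kernel of [c], and the
    rank of [c] is at most that of evaluation. *)
Lemma nullity_le s s' (X Y : 'M[C]_n) : X \in unitmx -> Y \in unitmx -> (s' <= n)%N ->
  (forall x, Re (dp (S *m x) x) = \sum_(i < n | (s <= i)%N) cabs ((X *m x) i 0) ^+ 2) ->
  (forall y, Re (dp (A *m y) y) = \sum_(i < n | (s' <= i)%N) cabs ((Y *m y) i 0) ^+ 2) ->
  (s' <= s)%N.
Proof.
move=> uX uY s'n hX hY.
have [d [e [he eo ex]]] := ess_null_findim (ip_H2_hform R n) hq hess.
have eH i : H2 (e i) by case: (he i).
(* In the basis [e] of the null space: evaluation at 0, the coefficient [c], and the coordinates of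
   the quotient by [z]. *)
pose evr : 'M[C]_(d, n) := \matrix_(j, i) fcoef (e j) 0 i 0.
pose tau : 'M[C]_(d, n) := \matrix_(j, i) c (e j) i 0.
pose Th : 'M[C]_d := \matrix_(k, j) ip (zs (-1) (e k)) (e j).
pose mm (a : 'rV[C]_d) : V := \sum_k a 0 k *: e k.
have mmN a : qnull (@H2 R n) q (mm a).
  apply: (@subsp_sum _ _ (qnull (@H2 R n) q) _ _ _ _ (qnull_linsub (ip_H2_hform R n) hq)) => k _.
  exact: (subspZ _ (qnull_linsub (ip_H2_hform R n) hq) (he k)).
have mmH a : H2 (mm a) by case: (mmN a).
have ip_mm a j : ip (mm a) (e j) = a 0 j.
  rewrite /mm (hform_suml (ip_H2_hform R n)); last 2 first.
  - by move=> i; exact: (subspZ _ H2s (eH i)).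
  - exact: eH.
  rewrite (bigD1 j)//= (hformZl (ip_H2_hform R n) _ (eH j) (eH j)) eo eqxx mulr1.
  rewrite big1 ?addr0// => i ij.
  by rewrite (hformZl (ip_H2_hform R n) _ (eH i) (eH j)) eo (negPf ij) mulr0.
have ev_mm a : (a *m evr)^T = fcoef (mm a) 0.
  rewrite /mm; have -> : fcoef (\sum_k a 0 k *: e k) 0 = \sum_k a 0 k *: fcoef (e k) 0.
    elim: (index_enum _) => [|j r IH]; first by rewrite !big_nil fcoef0.
    rewrite !big_cons -IH; apply: fcoefL; first exact: (H2_L2 (eH j)).
    by apply: (@subsp_sum _ _ (@isL2 R n) _ _ _ _ L2s) => i _; exact: (subspZ _ L2s (H2_L2 (eH i))).
  apply/matrixP => i k; rewrite ord1 summxE !mxE; apply: eq_bigr => j _.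
  by rewrite [evr j i]mxE [RHS]mxE.
have c_mm a : (a *m tau)^T = c (mm a).
  rewrite /mm /c (hcoef_sum hH _ _ eH); apply/matrixP => i k.
  rewrite ord1 summxE !mxE; apply: eq_bigr => j _.
  by rewrite [tau j i]mxE [RHS]mxE.
have expand f : H2 f -> nq q f = 0 -> c f = (\row_j ip f (e j) *m tau)^T.
  move=> hf f0; rewrite c_mm; apply: hcoef_null => //.
  rewrite -[RHS](ex f (conj hf f0)); congr nq; congr (f - _); apply: eq_bigr => i _.
  by rewrite mxE.
(* In [q(z g) = q(g) + |c g|^2] the left side is 0, so both nonnegative terms vanish. *)
have key a : a *m evr = 0 -> [/\ H2 (zs (-1) (mm a)), nq q (zs (-1) (mm a)) = 0 & c (zs (-1) (mm a)) = 0].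
  move=> a0; have z0 : fcoef (mm a) 0 = 0 by rewrite -ev_mm a0 trmx0.
  have hz : H2 (zs (-1) (mm a)) by exact: H2_zsN1.
  have := nq_zs1 q0_shift hH hz; rewrite (zsK 1) -/q (proj2 (mmN a)) => eq0.
  have n0 := nq_ge0 hq hz; have v0 := sqr_ge0 (vnorm (c (zs (-1) (mm a)))).
  split => //; first by move: eq0 n0 v0; rewrite /c; lra.
  apply: vnorm_eq0; apply/eqP; rewrite -sqrf_eq0; apply/eqP.
  by move: eq0 n0 v0; rewrite /c; lra.
have Th_mm a : a *m Th = \row_j ip (zs (-1) (mm a)) (e j).
  apply/matrixP => i j; rewrite ord1 [RHS]mxE mxE.
  have -> : zs (-1) (mm a) = \sum_k a 0 k *: zs (-1) (e k).
    rewrite /mm; elim: (index_enum _) => [|k r IH].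
      by rewrite !big_nil; apply/funext => t; rewrite /zs scaler0.
    by rewrite !big_cons zsL IH.
  have zL k : isL2 (zs (-1) (e k)) by apply: isL2_zs; exact: (H2_L2 (eH k)).
  rewrite (hform_suml ipH); last 2 first.
  - by move=> k; exact: (subspZ _ L2s (zL k)).
  - exact: (H2_L2 (eH j)).
  by apply: eq_bigr => k _; rewrite (hformZl ipH _ (zL k) (H2_L2 (eH j))) [Th k j]mxE.
have tau0 (a : 'rV[C]_d) : a *m evr = 0 -> a *m Th *m tau = 0.
  move=> a0; have [hz z0 cz] := key a a0; apply: (can_inj (@trmxK _ _ _)); rewrite Th_mm -(expand _ hz z0) cz trmx0//.
have inj (a : 'rV[C]_d) : a *m evr = 0 -> a *m Th = 0 -> a = 0.
  move=> a0 aT; have [hz z0 cz] := key a a0.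
  have zero : nq ip (mm a) = 0.
    have := ex _ (conj hz z0); rewrite big1 ?subr0 ?nq_zs// => j _.
    by have := Th_mm a; rewrite aT => /matrixP/(_ 0 j); rewrite !mxE => <-; rewrite scale0r.
  apply/matrixP => i j; rewrite ord1 mxE -(ip_mm a j).
  exact: (hform_null ipH (H2_L2 (mmH a)) (H2_L2 (eH j)) zero).
have r1 : (\rank tau <= \rank evr)%N.
  have rk : \rank (kermx evr *m Th) = \rank (kermx evr).
    apply/mxrank_injP; apply/eqP/row_matrixP => i; rewrite row0.
    have := row_sub i (kermx evr :&: kermx Th)%MS; rewrite sub_capmx.
    by move=> /andP[/sub_kermxP h1 /sub_kermxP h2]; apply: inj.
  have sub : (kermx evr *m Th <= kermx tau)%MS.
    apply/sub_kermxP/row_matrixP => i; rewrite row0 2!row_mul; apply: tau0.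
    by apply/sub_kermxP; exact: row_sub.
  have := mxrankS sub; rewrite rk !mxrank_ker.
  have := rank_leq_row tau; have := rank_leq_row evr; lia.
have r2 : (\rank evr <= s)%N.
  have eE : evr *m X^T = evr *m X^T *m pid_mx s.
    apply/row_matrixP => j; rewrite !row_mul.
    have re : (row j evr)^T = fcoef (e j) 0.
      by apply/matrixP => i k; rewrite ord1 [LHS]mxE mxE [LHS]mxE.
    have fl : flagged X s (row j evr)^T.
      apply/flagged_sum; rewrite -hX; apply/null_value.
      by exists (e j); split; [exact: eH|rewrite re|case: (he j)].
    apply/matrixP => i k; rewrite ord1 [RHS]mxE.
    have sw l : (row j evr *m X^T) 0 l = (X *m (row j evr)^T) l 0.
      have -> : row j evr *m X^T = (X *m (row j evr)^T)^T by rewrite trmx_mul trmxK.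
      by rewrite [LHS]mxE.
    have [sk|sk] := leqP s k.
      rewrite big1 => [|l _]; first by rewrite sw fl.
      rewrite [(pid_mx s : 'M[C]_n) l k]mxE; case: eqP => [lk|]; last by rewrite mulr0.
      by rewrite lk ltnNge sk mulr0.
    rewrite (bigD1 k)//= big1 => [|l lk].
      by rewrite [(pid_mx s : 'M[C]_n) k k]mxE eqxx sk mulr1 addr0.
    have /negPf lk' : (l : nat) != k by [].
    by rewrite [(pid_mx s : 'M[C]_n) l k]mxE lk' mulr0.
  have [sn|sn] := leqP s n; last by apply: leq_trans (rank_leq_col _) (ltnW sn).
  have -> : \rank evr = \rank (evr *m X^T).
    by rewrite mxrankMfree// row_free_unit unitmx_tr.
  by rewrite eE; apply: leq_trans (mxrankM_maxr _ _) _; rewrite rank_pid_mx.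
have r3 : (s' <= \rank tau)%N.
  pose Y' := pid_mx s' *m (invmx Y)^T : 'M[C]_n.
  have rY : \rank Y' = s'.
    by rewrite /Y' mxrankMfree ?rank_pid_mx// row_free_unit unitmx_tr unitmx_inv.
  rewrite -rY; apply: mxrankS; apply/row_subP => i.
  pose y := (row i Y')^T.
  have fl : flagged Y s' y.
    rewrite /flagged /y /Y' row_mul trmx_mul trmxK mulmxA mulmxV// mul1mx => k sk.
    rewrite mxE [LHS]mxE [LHS]mxE; case: eqP => // ik.
    by rewrite ik ltnNge sk.
  have a0 : Re (dp (A *m y) y) = 0 by rewrite hY; apply/flagged_sum.
  have := Amx_form hq0 q0_shift hH hc hpp y.
  rewrite -/A a0 => e0.
  have hp : H2 (lc pp y) by apply: lc_H2 => k; case: (hpp k).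
  have n0 := nq_ge0 hq hp; have v0 := sqr_ge0 (vnorm (A *m y)).
  have q1 : nq q (lc pp y) = 0 by move: e0 n0 v0; rewrite /q; lra.
  have A1 : A *m y = 0.
    apply: vnorm_eq0; apply/eqP; rewrite -sqrf_eq0; apply/eqP.
    by move: e0 n0 v0; rewrite /q; lra.
  have := c_p hH hpp y; rewrite -/A A1 subr0 => cy.
  have -> : row i Y' = y^T by rewrite trmxK.
  by rewrite -cy -/c (expand _ hp q1) trmxK submxMl.
exact: leq_trans r3 (leq_trans r1 r2).
Qed.
End Fixed.
End StepTheorem.

(** * Extension steps with prescribed dimensions *)

Section Iteration.
Variables (R : realType) (n : nat).
Local Notation C := (complex.complex R).
Local Notation V := (R -> 'cV[C]_n).
Local Notation ip := (@ip R n).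
Implicit Types (f g : V) (x y : 'cV[C]_n).
Let H2s := @H2_linsub R n.
#[local] Opaque fcoef cint isL2 aeT dp.

Variables (q0 : V -> V -> C) (K0 : R).
Hypothesis hq0 : hform (@H2 R n) q0.
Hypothesis q0_bound : forall f, H2 f -> nq q0 f <= K0 * nq ip f.
Hypothesis q0_shift : forall f g, H2 f -> H2 g -> q0 (zs 1 f) (zs 1 g) = q0 f g.
Local Notation qf := (qf q0).
Local Notation state := (state q0).

Lemma spdim_exists H : state H -> exists2 s, (s <= n)%N & spdim (qf H) s.
Proof.
move=> hS; have [hH hc hess] := hS.
have [uu huu] := exists_u hq0 q0_bound hH hc hess.
have [||s [X [sn uX hX]]] := @psd_diag _ _ (Smx q0 H uu).
- exact: (Smx_ctr hq0 hH hc huu).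
- move=> x; rewrite (Smx_form hq0 hH hc huu x); apply: (nq_ge0 (qf_hform hq0 hH hc)).
  by apply: lc_H2 => i; case: (huu i).
exists s => //; exists X => // x.
by rewrite (null_value hq0 hS huu x) flagged_sum hX.
Qed.

(** Positivity is read off [nq_step]. The new form subtracts the square of the finite-rank map
    [gstep]; along a subsequence on which [gstep] converges the same coercivity constant
    survives. *)
Lemma hstep_state H uu pp B : state H ->
  (forall i, [/\ H2 (uu i), fcoef (uu i) 0 = delta_mx i 0 & forall g, zH2 g -> qf H (uu i) g = 0]) ->
  (forall i, H2 (pp i) /\ forall g, H2 g -> qf H (zs 1 g) (zs 1 (pp i)) = hcoef H g i 0) ->
  (forall x, Re (dp (Amx H pp *m (B *m x)) (B *m x)) <= Re (dp (Smx q0 H uu *m x) x)) ->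
  state (hstep H uu pp B).
Proof.
move=> hS huu hpp le; have [hH hc hess] := hS.
have hq := qf_hform hq0 hH hc.
set H' := hstep H uu pp B.
have hH' : hankel H' by exact: (hstep_hankel hH pp huu B).
have pos f : H2 f -> 0 <= nq (qf H') f.
  move=> hf; rewrite (nq_step hq0 q0_shift hH hc huu hpp B hf).
  apply: addr_ge0; last by rewrite subr_ge0; exact: le.
  apply: (nq_ge0 hq); apply: (subspB H2s (red_H2 huu hf)).
  by apply: lc_H2 => i; case: (hpp i).
have hc' : contractive q0 H'.
  by move=> f hf; have := pos f hf; rewrite nq_qf subr_ge0.
split => //.
have [d d0 h] := hess; exists d => // u hu [M hM].
have [phi [phiI h1]] := h u hu (ex_intro _ M hM).
pose x k := gstep H uu pp B (u k).
have gb f : H2 f -> vnorm (gstep H uu pp B f) ^+ 2 <= `|K0| * nq ip f.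
  move=> hf; have := pos f hf; rewrite (nq_qf_hstep q0 hH uu pp B hf) subr_ge0 => h2.
  apply: le_trans h2 _; apply: le_trans (qf_bound q0_bound hH hf) _.
  by rewrite ler_wpM2r ?ler_norm//; exact: (nq_ge0 (ip_H2_hform R n) hf).
have xb k : vnorm (x (phi k)) <= Num.sqrt (`|K0| * M).
  have h2 : `|K0| * nq ip (u (phi k)) <= `|K0| * M by rewrite ler_wpM2l.
  have h3 := le_trans (gb _ (hu (phi k))) h2.
  rewrite -[leLHS]ger0_norm ?vnorm_ge0// -sqrtr_sqr ler_sqrt//.
  exact: le_trans (sqr_ge0 _) h3.
have [psi [psiI h4]] := vec_BW xb.
exists (phi \o psi); split.
  by move=> k; apply: leq_trans (phiI _) (incr_le phiI (psiI k)).
move=> e e0; have e2 : 0 < e / 2 by lra.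
have [N1 hN1] := h1 _ e2.
have se : 0 < Num.sqrt (e / 2) by rewrite sqrtr_gt0.
have [N2 hN2] := h4 _ se.
exists (maxn N1 N2) => k l; rewrite !geq_max => /andP[k1 k2] /andP[l1 l2] /=.
have a1 := hN1 (psi k) (psi l) (leq_trans k1 (incr_ge psiI k)) (leq_trans l1 (incr_ge psiI l)).
have a2 := hN2 k l k2 l2.
have hd := subspB H2s (hu (phi (psi k))) (hu (phi (psi l))).
rewrite (nq_qf_hstep q0 hH uu pp B hd).
have -> : gstep H uu pp B (u (phi (psi k)) - u (phi (psi l))) = x (phi (psi k)) - x (phi (psi l)).
  rewrite -[u (phi (psi k)) - _]addrC -scaleN1r.
  by rewrite (gstepL hH pp huu B (-1) (hu _) (hu _)) scaleN1r addrC.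
have a3 : vnorm (x (phi (psi k)) - x (phi (psi l))) ^+ 2 < e / 2.
  by rewrite -(sqr_sqrtr (ltW e2)) ltr_pXn2r ?nnegrE ?vnorm_ge0 ?sqrtr_ge0.
by move: a1 a3; lra.
Qed.

Lemma step_exists H s s1 : state H -> spdim (qf H) s -> (s <= s1)%N -> (s1 <= n)%N ->
  exists H', [/\ state H', spdim (qf H') s1,
    (exists G, forall f, H' f = zs (-1) (H f + ek 0 (G f))) &
    forall f, H2 f -> aeq (H' (zs 1 f)) (H f)].
Proof.
move=> hS hs ss1 s1n; have [hH hc hess] := hS.
have hq := qf_hform hq0 hH hc.
have [uu huu] := exists_u hq0 q0_bound hH hc hess.
have [pp hpp] := exists_p hq0 q0_bound q0_shift hH hc hess.
have uH i : H2 (uu i) by case: (huu i).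
have pH i : H2 (pp i) by case: (hpp i).
have [||s2 [X [s2n uX hX]]] := @psd_diag _ _ (Smx q0 H uu).
- exact: (Smx_ctr hq0 hH hc huu).
- move=> x; rewrite (Smx_form hq0 hH hc huu x); apply: (nq_ge0 hq).
  exact: lc_H2.
have [||s' [Y [s'n uY hY]]] := @psd_diag _ _ (Amx H pp).
- exact: (Amx_ctr hq0 hH hc hpp).
- move=> y; rewrite (Amx_form hq0 q0_shift hH hc hpp y); apply: addr_ge0; last exact: sqr_ge0.
  by apply: (nq_ge0 hq); exact: lc_H2.
have s's2 := nullity_le hq0 q0_bound q0_shift hS huu hpp uX uY s'n hX hY.
have e2 : s2 = s.
  apply: (spdim_unique s2n (leq_trans ss1 s1n) _ hs); exists X => // x.
  by rewrite (null_value hq0 hS huu x) flagged_sum hX.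
rewrite {}e2 in s2n hX s's2.
(* [B] is chosen so that [B^* A B] is the part of [S] on the coordinates [s <= i < s1]. It can be
   reproduced because [s' <= s] places these coordinates in the positive part of [A]; what remains
   of [S] has nullity [s1]. *)
pose T : 'M[C]_n := diag_mx (\row_i ((s <= i < s1)%N)%:R).
pose B := invmx Y *m T *m X.
have BE x : Re (dp (Amx H pp *m (B *m x)) (B *m x)) =
    \sum_(i < n | (s <= i < s1)%N) cabs ((X *m x) i 0) ^+ 2.
  rewrite hY big_mkcond [RHS]big_mkcond; apply: eq_bigr => i _ /=.
  have -> : Y *m (B *m x) = T *m (X *m x) by rewrite /B -!mulmxA (mulKVmx uY).
  rewrite mul_diag_mx mxE [(\row_i _) 0 i]mxE.
  have [si|si] := leqP s i; last by rewrite mul0r cabs0 expr0n/=; case: ifP.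
  rewrite (leq_trans s's2 si) /=; case: (i < s1)%N; first by rewrite mul1r.
  by rewrite mul0r cabs0 expr0n.
have dE x : Re (dp (Smx q0 H uu *m x) x) - Re (dp (Amx H pp *m (B *m x)) (B *m x)) =
    \sum_(i < n | (s1 <= i)%N) cabs ((X *m x) i 0) ^+ 2.
  rewrite hX BE (bigID (fun i : 'I_n => (i < s1)%N))/=.
  rewrite addrAC subrr add0r; apply: eq_bigl => i.
  rewrite -leqNgt andb_idl//; exact: leq_trans.
have sum0 x : 0 <= \sum_(i < n | (s1 <= i)%N) cabs ((X *m x) i 0) ^+ 2.
  by apply: sumr_ge0 => i _; exact: sqr_ge0.
have le x : Re (dp (Amx H pp *m (B *m x)) (B *m x)) <= Re (dp (Smx q0 H uu *m x) x).
  by rewrite -subr_ge0 dE.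
exists (hstep H uu pp B); split.
- exact: hstep_state.
- exists X => // x; rewrite flagged_sum; split.
    move=> [f [hf fx f0]]; have := nq_step hq0 q0_shift hH hc huu hpp B hf.
    rewrite /= f0 fx dE => e.
    have r0 : 0 <= nq (qf H) (red uu f - lc pp (B *m x)).
      by apply: (nq_ge0 hq); apply: (subspB H2s (red_H2 huu hf)); exact: lc_H2.
    by move: e r0 (sum0 x); lra.
  (* For [f = z p + u] the reduced function is [p (B x)], so the first term of [nq_step]
     vanishes. *)
  move=> h; pose p := lc pp (B *m x); pose u := lc uu x.
  have hp : H2 p by exact: lc_H2.
  have hu : H2 u by exact: lc_H2.
  have hzp := zs_zH2 hp.
  have hf : H2 (zs 1 p + u) by exact: (subspD H2s (zH2_H2 hzp) hu).
  have fx : fcoef (zs 1 p + u) 0 = x.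
    rewrite (fcoefD 0 (H2_L2 (zH2_H2 hzp)) (H2_L2 hu)) (proj2 hzp) add0r.
    exact: (fcoef_u huu).
  exists (zs 1 p + u); split => //.
  rewrite (nq_step hq0 q0_shift hH hc huu hpp B hf) /= fx dE h addr0.
  have -> : red uu (zs 1 p + u) = p by rewrite /red fx addrK (zsNK 1).
  by rewrite subrr (nq0 hq).
- by exists (gstep H uu pp B).
- by move=> f hf; exact: (hstep_zs hH uu pp B hf).
Qed.

Lemma iterate_exists (s_ : nat -> nat) H0 : state H0 -> spdim (qf H0) (s_ 0%N) ->
  (forall i, (s_ i <= s_ i.+1)%N) -> (forall i, (s_ i <= n)%N) ->
  exists (Hs : nat -> V -> V) (G : nat -> V -> 'cV[C]_n), [/\ Hs 0%N = H0,
    forall i, state (Hs i) /\ spdim (qf (Hs i)) (s_ i),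
    forall i f, Hs i.+1 f = zs (-1) (Hs i f + ek 0 (G i f)) &
    forall i f, H2 f -> aeq (Hs i.+1 (zs 1 f)) (Hs i f)].
Proof.
move=> hS0 sp0 mono sn.
pose good i H H' := [/\ state H', spdim (qf H') (s_ i.+1),
    (exists G, forall f, H' f = zs (-1) (H f + ek 0 (G f))) &
    forall f, H2 f -> aeq (H' (zs 1 f)) (H f)].
have /choice[next hnext] (iH : nat * (V -> V)) : exists H',
    state iH.2 -> spdim (qf iH.2) (s_ iH.1) -> good iH.1 iH.2 H'.
  have [[h1 h2]|h] := pselect (state iH.2 /\ spdim (qf iH.2) (s_ iH.1)).
    have [H' hH'] := step_exists h1 h2 (mono _) (sn _); exists H' => _ _; exact: hH'.
  by exists (fun f => f) => h1 h2; exfalso; apply: h.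
pose Hs := fix Hs i := if i is i'.+1 then next (i', Hs i') else H0.
have inv i : state (Hs i) /\ spdim (qf (Hs i)) (s_ i).
  elim: i => [//|i [h1 h2]]; have [a b _ _] := hnext (i, Hs i) h1 h2; split.
    exact: a.
  exact: b.
have /choice[G hG] i : exists G, forall f, Hs i.+1 f = zs (-1) (Hs i f + ek 0 (G f)).
  have [h1 h2] := inv i; have [_ _ h _] := hnext (i, Hs i) h1 h2; exact: h.
exists Hs, G; split => // i.
have [h1 h2] := inv i; have [_ _ _ h] := hnext (i, Hs i) h1 h2; exact: h.
Qed.
End Iteration.

(** * The extension theorem *)

Section VectorBounds.
Variable R : realType.
Local Notation C := (complex.complex R).

Lemma vnorm_mulmx_le m n (M : 'M[C]_(m, n)) x :
  vnorm (M *m x) <= (\sum_i \sum_j cabs (M i j)) * vnorm x.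
Proof.
apply: le_trans (vnorm_le_sum _) _; rewrite mulr_suml; apply: ler_sum => i _.
rewrite mxE mulr_suml; apply: le_trans (cabs_sum _ _ _) _; apply: ler_sum => j _.
by rewrite cabsM ler_wpM2l ?cabs_ge0 ?cabs_le_vnorm.
Qed.

(** A countable family, so that inequalities known almost everywhere for each of its vectors hold
    for all of them off one null set. *)
Definition gauss n (a : {ffun 'I_n -> int * int}) : 'cV[C]_n :=
  \col_i complex.Complex (a i).1%:~R (a i).2%:~R.

Lemma gauss_approx n (x : 'cV[C]_n) : exists a, vnorm (x - gauss a) <= 2 * n%:R.
Proof.
exists [ffun i => (Num.floor (Re (x i 0)), Num.floor (Im (x i 0)))].
apply: le_trans (vnorm_le_sum _) _.
apply: (@le_trans _ _ (\sum_(i < n) 2)); last first.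
  by rewrite sumr_const card_ord mulr_natr.
apply: ler_sum => i _; apply: le_trans (cabs_le_ReIm _) _.
rewrite !mxE ffunE !cE/=.
have f (y : R) : `|y - (Num.floor y)%:~R| <= 1.
  have := floor_itv y => /andP[h1 h2]; rewrite intrD in h2.
  by rewrite ger0_norm ?subr_ge0//; move: h2; rewrite -[1%:~R]/1; lra.
by have := f (Re (x i 0)); have := f (Im (x i 0)); lra.
Qed.

(* Homogeneity reduces the inequality to lattice points up to a bounded error. *)
Lemma lattice_norm_le m p n (M : 'M[C]_(m, n)) (N : 'M[C]_(p, n)) :
  (forall a, vnorm (M *m gauss a) <= vnorm (N *m gauss a)) ->
  forall x, vnorm (M *m x) <= vnorm (N *m x).
Proof.
move=> h x.
set KM := \sum_i \sum_j cabs (M i j); set KN := \sum_i \sum_j cabs (N i j).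
have K0 : 0 <= KM /\ 0 <= KN.
  by split; apply: sumr_ge0 => i _; apply: sumr_ge0 => j _; exact: cabs_ge0.
rewrite -subr_le0; apply: (@small_le0 _ _ ((KM + KN) * (2 * n%:R))) => e e0.
have [k hk] := inv_small e0; have {hk} := hk k (leqnn k).
set b := k.+1%:R; have b0 : 0 < b by rewrite ltr0n.
move=> be; have [a ha] := gauss_approx (real_complex R b *: x).
set r := _ - _ in ha.
have e1 : real_complex R b *: x = r + gauss a by rewrite /r subrK.
have s q (L : 'M[C]_(q, n)) : vnorm (L *m (real_complex R b *: x)) = b * vnorm (L *m x).
  by rewrite -scalemxAr vnormZ cabs_real gtr0_norm.
have h1 : b * vnorm (M *m x) <= vnorm (M *m gauss a) + KM * (2 * n%:R).
  rewrite -s e1 mulmxDr addrC; apply: le_trans (vnormD _ _) _; rewrite lerD2l.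
  by apply: le_trans (vnorm_mulmx_le _ _) _; rewrite ler_wpM2l//; apply K0.
have h2 : vnorm (N *m gauss a) <= b * vnorm (N *m x) + KN * (2 * n%:R).
  have -> : gauss a = real_complex R b *: x - r by rewrite e1 [r + _]addrC addrK.
  rewrite -s mulmxBr; apply: le_trans (vnormD _ _) _; rewrite lerD2l vnormN.
  by apply: le_trans (vnorm_mulmx_le _ _) _; rewrite ler_wpM2l//; apply K0.
have h3 : b * (vnorm (M *m x) - vnorm (N *m x)) <= (KM + KN) * (2 * n%:R).
  by have := h a; rewrite mulrBr mulrDl; lra.
apply: (@le_trans _ _ (b^-1 * ((KM + KN) * (2 * n%:R)))).
  by rewrite -ler_pdivrMl ?invr_gt0// invrK.
rewrite mulrC ler_wpM2l ?(ltW be)// mulr_ge0 ?mulr_ge0//.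
by apply: addr_ge0; apply K0.
Qed.
End VectorBounds.

Section HankelOfSymbol.
Variables (R : realType) (n : nat).
Local Notation C := (complex.complex R).
Local Notation V := (R -> 'cV[C]_n).
Local Notation ip := (@ip R n).
Implicit Types (f g : V) (x y : 'cV[C]_n).
Let L2s := @isL2_linsub R n.
Let ipH := @ip_hform R n.
Let H2s := @H2_linsub R n.
#[local] Opaque fcoef cint isL2 aeT dp.

Lemma Pm_hankel (T : V -> V) : (forall f, H2 f -> isL2 (T f)) ->
  (forall a f g, H2 f -> H2 g -> aeq (T (a *: f + g)) (a *: T f + T g)) ->
  (forall f, H2 f -> aeq (T (zs 1 f)) (zs 1 (T f))) -> hankel (fun f => Pm (T f)).
Proof.
move=> TL Tl Ts; split.
- by move=> f /TL/Pm_H2minus.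
- move=> a f g hf hg; have hfg := proj2 H2s a _ _ hf hg.
  apply: aeq_trans (Pm_linear a (TL _ hf) (TL _ hg)).
  exact: (Pm_aeq (TL _ hfg) (proj2 L2s a _ _ (TL _ hf) (TL _ hg)) (Tl a f g hf hg)).
- move=> f hf; have hz := H2_zs (isT : (0 : int) <= 1) hf.
  have gL := TL _ hf; have PL := Pm_L2 gL.
  apply: aeq_sym; apply: (Pm_unique (TL _ hz)).
  have zL := isL2_zs 1 PL; have eL := isL2_ek 0 (fcoef (Pm (T f)) (-1)).
  split.
    split; first exact: (subspB L2s zL eL).
    move=> k k0; rewrite (fcoefB k zL eL) fcoef_zs fcoef_ek.
    have [->|k1] := eqVneq k 0; first by rewrite sub0r scale1r subrr.
    by rewrite scale0r subr0 (proj2 (Pm_H2minus gL))//; lia.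
  move=> k k0; rewrite (fcoefB k zL eL) fcoef_zs fcoef_ek lt_eqF// scale0r subr0.
  rewrite (fcoef_aeq k (TL _ hz) (isL2_zs 1 gL) (Ts f hf)) fcoef_zs fcoef_Pm//.
  by lia.
Qed.

Lemma mulf_hankel (Phi : R -> 'M[C]_n) : Linfty Phi -> hankel (fun f => Pm (mulf Phi f)).
Proof.
move=> hP; apply: Pm_hankel.
- by move=> f /H2_L2; exact: isL2_mulf.
- by move=> a f g _ _; rewrite mulf_linear; exact: aeq_refl.
- by move=> f _; rewrite mulf_zs; exact: aeq_refl.
Qed.

(** The representing vector is orthogonal to all monomials, so its Fourier coefficients vanish. *)
Lemma H2_functional_ext (l : V -> C) (K : R) :
  (forall a f g, H2 f -> H2 g -> l (a *: f + g) = a * l f + l g) ->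
  (forall f, H2 f -> cabs (l f) ^+ 2 <= K * nq ip f) ->
  (forall (k : nat) x, l (ek k x) = 0) -> forall f, H2 f -> l f = 0.
Proof.
move=> lin bnd l0.
have [p hp h] := riesz_form (ip_H2_hform R n) (@H2_complete R n) lin bnd.
have p0 : aeq p 0.
  apply: (L2_unique (H2_L2 hp)) => k; have [k0|k0] := ltP k 0; first exact: (proj2 hp).
  apply: dp_eqP => x; rewrite (dp_fcoef k x (H2_L2 hp)) (hform0l (dp_hform R n) (h := x) Logic.I).
  have hk : H2 (ek k x) by exact: H2_ek.
  rewrite (hformC ipH (H2_L2 hk) (H2_L2 hp)) -(h _ hk).
  by case: k k0 hk => // k _ _; rewrite l0 conjc0.
move=> f hf; rewrite (h f hf) (ip_aeqr (H2_L2 hf) (H2_L2 hp) (proj1 L2s) p0).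
have f0 := hformC ipH (proj1 L2s) (H2_L2 hf).
by rewrite f0 (hform0l ipH (H2_L2 hf)) conjc0.
Qed.
End HankelOfSymbol.

Section WeightedForm.
Variables (R : realType) (n : nat).
Local Notation C := (complex.complex R).
Local Notation V := (R -> 'cV[C]_n).
Variable A : R -> 'M[C]_n.
Hypothesis hA : Linfty A.
Definition wform (f g : V) := ip (mulf A f) (mulf A g).
Lemma wform_hform : hform (@H2 R n) wform.
Proof.
have L f : H2 f -> isL2 (mulf A f) by move=> /H2_L2; exact: isL2_mulf.
split; first exact: H2_linsub.
- move=> a f g h hf hg hh; rewrite /wform mulf_linear.
  exact: (hformL (ip_hform R n) a (L _ hf) (L _ hg) (L _ hh)).
- by move=> f g hf hg; exact: (hformC (ip_hform R n) (L _ hf) (L _ hg)).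
- by move=> f hf; exact: (nq_ge0 (ip_hform R n) (L _ hf)).
Qed.
Lemma wform_shift f g : wform (zs 1 f) (zs 1 g) = wform f g.
Proof. by rewrite /wform !mulf_zs ip_zs. Qed.
Lemma wform_bound : exists K, forall f, H2 f -> nq wform f <= K * nq (@ip R n) f.
Proof.
have [K _ h] := nq_mulf_bound hA; exists K => f hf.
exact: h (H2_L2 hf).
Qed.
End WeightedForm.

(** * The limit of the iterated extensions as a multiplication operator *)

Section Extension.
Variables (R : realType) (n : nat).
Local Notation C := (complex.complex R).
Local Notation V := (R -> 'cV[C]_n).
Local Notation ip := (@ip R n).
Implicit Types (f g : V) (x y : 'cV[C]_n).
Let L2s := @isL2_linsub R n.
Let ipH := @ip_hform R n.
Let H2s := @H2_linsub R n.
Let dpH := @dp_hform R n.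
#[local] Opaque fcoef cint isL2 aeT dp.

Lemma mono_bounded_cauchy (a : nat -> R) (M : R) : (forall i, a i <= a i.+1) ->
  (forall i, a i <= M) ->
  forall e, 0 < e -> exists N, forall i j, (N <= i)%N -> (i <= j)%N -> a j - a i < e.
Proof.
move=> mono bnd e e0.
pose E : set R := [set a i | i in setT].
have hE : has_sup E by split; [exists (a 0%N), 0%N|exists M => _ [i _ <-]].
have le i j : (i <= j)%N -> a i <= a j.
  elim: j => [|j IH]; first by rewrite leqn0 => /eqP ->.
  by rewrite leq_eqVlt ltnS => /orP[/eqP ->//|/IH h]; exact: le_trans h (mono j).
have [_ [N _ <-] hN] := sup_adherent e0 hE; exists N => i j Ni ij.
have h1 := le _ _ Ni; have h2 : a j <= sup E by apply: sup_upper_bound => //; exists j.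
by move: hN h1 h2; lra.
Qed.

Variables (A : R -> 'M[C]_n) (Phi : R -> 'M[C]_n).
Hypotheses (hA : Linfty A) (hPhi : Linfty Phi).
Let q0 := wform A.
Let hq0 : hform (@H2 R n) q0 := wform_hform hA.
Variables (Hs : nat -> V -> V) (G : nat -> V -> 'cV[C]_n).
Hypothesis Hs0 : Hs 0%N = (fun f => Pm (mulf Phi f)).
Hypothesis hankHs : forall i, hankel (Hs i).
Hypothesis contrHs : forall i, contractive q0 (Hs i).
Hypothesis HsS : forall i f, Hs i.+1 f = zs (-1) (Hs i f + ek 0 (G i f)).
Hypothesis Hsz : forall i f, H2 f -> aeq (Hs i.+1 (zs 1 f)) (Hs i f).

(** With the factor [z^-i] undone, each step adds a single coefficient, that of index [i]. The
    [X i f] are thus truncations of one limit function, which will be the symbol applied to [f]. *)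
Let X (i : nat) f : V := zs i (Hs i f).

Let XS i f : X i.+1 f = X i f + ek i (G i f).
Proof.
rewrite /X HsS zsA (_ : i.+1%:Z + -1 = i%:Z); last by lia.
by rewrite zsD zs_ek addr0.
Qed.
Let XL i f : H2 f -> isL2 (X i f).
Proof. by move=> hf; apply: isL2_zs; exact: (hankel_L2 (hankHs i) hf). Qed.
Let X_coef0 i f (k : int) : H2 f -> i%:Z <= k -> fcoef (X i f) k = 0.
Proof.
move=> hf ik; rewrite /X fcoef_zs; apply (proj2 (hankel_m (hankHs i) hf)); lia.
Qed.
Let X_orth i j f : H2 f -> (i <= j)%N -> ip (X i f) (X j f) = ip (X i f) (X i f).
Proof.
move=> hf; elim: j => [|j IH]; first by rewrite leqn0 => /eqP ->.
rewrite leq_eqVlt ltnS => /orP[/eqP ->//|ij]; rewrite -(IH ij) XS.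
rewrite (hformDr ipH (XL i hf) (XL j hf) (isL2_ek j _)) -(dp_fcoef j _ (XL i hf)).
rewrite (X_coef0 hf); last by lia.
by rewrite (hform0l dpH (h := _) Logic.I) addr0.
Qed.
Let X_dist i j f : H2 f -> (i <= j)%N -> nq ip (X j f - X i f) = nq ip (X j f) - nq ip (X i f).
Proof.
move=> hf ij; rewrite (nqB ipH (XL j hf) (XL i hf)) (hformC ipH (XL i hf) (XL j hf)).
by rewrite (X_orth hf ij) ReJ /nq; lra.
Qed.
Let X_bound i f : H2 f -> nq ip (X i f) <= nq q0 f.
Proof. by move=> hf; rewrite /X nq_zs; exact: contrHs. Qed.

(** The increments are orthogonal and the norms bounded by [q0], so the sequence is Cauchy. The
    membership hypothesis stands inside the existential so that a choice function can be taken on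
    all of [V]. *)
Let X_lim f : exists w, H2 f -> isL2 w /\
  forall e, 0 < e -> exists N, forall i, (N <= i)%N -> nq ip (X i f - w) < e.
Proof.
have [hf|] := pselect (H2 f); last by exists 0.
have mono i : nq ip (X i f) <= nq ip (X i.+1 f).
  rewrite -subr_ge0 -(X_dist hf (leqnSn i)); apply: (nq_ge0 ipH).
  exact: (subspB L2s (XL _ hf) (XL _ hf)).
have cau := mono_bounded_cauchy mono (fun i => X_bound i hf).
have [||w hw [cv _]] := @L2_complete_ae _ _ (X^~ f); first by move=> i; exact: XL.
  move=> e e0; have [N hN] := cau e e0; exists N => i j Ni Nj.
  have [ij|ij] := leqP i j; last first.
    by rewrite (X_dist hf (ltnW ij)); exact: hN Nj (ltnW ij).
  by rewrite (nqBC ipH (XL i hf) (XL j hf)) (X_dist hf ij); exact: hN Ni ij.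
by exists w.
Qed.
Let X_lims : exists Xl : V -> V, forall f, H2 f -> isL2 (Xl f) /\
  forall e, 0 < e -> exists N, forall i, (N <= i)%N -> nq ip (X i f - Xl f) < e.
Proof. by have /choice[w hw] := X_lim; exists w. Qed.
Let Xl := projT1 (cid X_lims).
Let XlP f : H2 f -> isL2 (Xl f) /\
  forall e, 0 < e -> exists N, forall i, (N <= i)%N -> nq ip (X i f - Xl f) < e.
Proof. by move=> hf; rewrite /Xl; case: cid => w /= h; exact: h. Qed.
Let XlL f : H2 f -> isL2 (Xl f). Proof. by move=> /XlP[]. Qed.
Let Xl_coef f i (k : int) : H2 f -> k < i%:Z -> fcoef (Xl f) k = fcoef (X i f) k.
Proof.
move=> hf ki; have hL := XlL hf; have [_ cv] := XlP hf.
have const j : fcoef (X (j + i)%N f) k = fcoef (X i f) k.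
  elim: j => [//|j IH]; rewrite addSn XS (fcoefD k (XL _ hf) (isL2_ek _ _)) IH fcoef_ek.
  have -> : (k == (j + i)%N%:Z) = false by lia.
  rewrite scale0r addr0; reflexivity.
apply: dp_eqP => z; apply/eqP; rewrite -subr_eq0; apply/eqP.
rewrite (dp_fcoef k z hL) (dp_fcoef k z (XL i hf)) -(hformBl ipH hL (XL i hf) (isL2_ek k z)).
have dL j : isL2 (X (j + i)%N f - X i f) by exact: (subspB L2s (XL _ hf) (XL _ hf)).
apply: (ip_cvg dL (subspB L2s hL (XL i hf)) (isL2_ek k z)).
  move=> e e0; have [N hN] := cv e e0; exists N => j Nj.
  rewrite opprB addrA subrK; apply: hN; exact: leq_trans Nj (leq_addr _ _).
move=> j; rewrite (hformBl ipH (XL _ hf) (XL i hf) (isL2_ek k z)).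
by rewrite -!(dp_fcoef k z (XL _ hf)) const subrr.
Qed.
Let Xl_coefH f i (k : int) : H2 f -> k < 0 -> fcoef (Xl f) (k + i%:Z) = fcoef (Hs i f) k.
Proof.
move=> hf k0; rewrite (Xl_coef (i := i) hf); last by lia.
by rewrite /X fcoef_zs addrK.
Qed.
Let Xl_bound f : H2 f -> nq ip (Xl f) <= nq q0 f.
Proof.
move=> hf; have [hL cv] := XlP hf.
have n0 : 0 <= nq q0 f by exact: (nq_ge0 hq0 hf).
suff : nrm ip (Xl f) <= Num.sqrt (nq q0 f).
  by rewrite /nrm ler_sqrt.
apply/ler_addgt0Pl => e e0; have [N hN] := cv (e ^+ 2) (exprn_gt0 2 e0).
have xL := XL N hf; have dL := subspB L2s xL hL.
have -> : Xl f = X N f - (X N f - Xl f) by rewrite subKr.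
apply: le_trans (nrmB ipH xL dL) _; rewrite addrC; apply: lerD.
  have h := hN N (leqnn N).
  by rewrite -[e]ger0_norm ?(ltW e0)// -sqrtr_sqr ler_sqrt ?sqr_ge0// ltW.
by rewrite /nrm ler_sqrt//; exact: X_bound.
Qed.
Let big_i (k : int) : exists i : nat, k < i%:Z.
Proof. by exists (`|k|.+1)%N; lia. Qed.
Let Xl_unique f (w : V) : H2 f -> isL2 w -> (forall k, fcoef (Xl f) k = fcoef w k) -> aeq (Xl f) w.
Proof.
move=> hf hw h; have hL := XlL hf; have hd := subspB L2s hL hw.
apply: (nqB_aeq hL hw).
have e : aeq (Xl f - w) 0.
  by apply: (L2_unique hd) => k; rewrite (fcoefB k hL hw) h subrr.
by rewrite (nq_aeq hd (proj1 L2s) e) (nq0 ipH).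
Qed.
Let Xl_linear a f g : H2 f -> H2 g -> aeq (Xl (a *: f + g)) (a *: Xl f + Xl g).
Proof.
move=> hf hg; have hfg := proj2 H2s a _ _ hf hg.
apply: (Xl_unique hfg (proj2 L2s a _ _ (XlL hf) (XlL hg))) => k.
have [i ki] := big_i k.
rewrite (fcoefL k a (XlL hf) (XlL hg)) (Xl_coef hfg ki) (Xl_coef hf ki) (Xl_coef hg ki).
have hh := hankel_L2 (hankHs i).
rewrite /X !fcoef_zs -(fcoefL _ a (hh _ hf) (hh _ hg)).
apply: fcoef_aeq; [exact: hh|exact: (proj2 L2s a _ _ (hh _ hf) (hh _ hg))|].
exact: (hankel_l (hankHs i)).
Qed.
Let Xl_zs f : H2 f -> aeq (Xl (zs 1 f)) (zs 1 (Xl f)).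
Proof.
move=> hf; have hz := H2_zs (isT : (0 : int) <= 1) hf.
apply: (Xl_unique hz (isL2_zs 1 (XlL hf))) => k; have [i ki] := big_i k.
rewrite (Xl_coef (i := i.+1) hz); last by lia.
rewrite fcoef_zs (Xl_coef (i := i) hf); last by lia.
have hh j := hankel_L2 (hankHs j).
rewrite /X !fcoef_zs (fcoef_aeq _ (hh _ _ hz) (hh _ _ hf) (Hsz i hf)).
by congr fcoef; lia.
Qed.

(** The limit map commutes with polynomials in [zeta], so it can only be multiplication by the
    matrix of its values on constants. Boundedness of [W] has to come before that identity, since
    products with [W] must first be known to be in [L^2]. *)
Let W : R -> 'M[C]_n := fun t => \matrix_(i, j) (Xl (ek 0 (delta_mx j 0))) t i 0.
Let hek (k : nat) x : H2 (ek k x). Proof. exact: H2_ek. Qed.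
Let W_meas i j : cmeas (fun t => W t i j).
Proof.
have /isL2P[h _] := XlL (hek 0 (delta_mx j 0)).
have -> : (fun t => W t i j) = (fun t => Xl (ek 0 (delta_mx j 0)) t i 0).
  by apply/funext => t; rewrite mxE.
exact: h.
Qed.
Let Wc x : V := fun t => W t *m x.
Let Wc_sum x : Wc x = \sum_j x j 0 *: Xl (ek 0 (delta_mx j 0)).
Proof.
apply/funext => t; apply/matrixP => i k.
rewrite ord1 [LHS]mxE fct_sumE summxE; apply: eq_bigr => j _.
have -> : (x j 0 *: Xl (ek 0 (delta_mx j 0))) t = x j 0 *: Xl (ek 0 (delta_mx j 0)) t by [].
by rewrite [RHS]mxE [W t i j]mxE mulrC.
Qed.
Let Wc_L2 x : isL2 (Wc x).
Proof.
rewrite Wc_sum; apply: (@subsp_sum _ _ (@isL2 R n) _ _ _ _ L2s) => j _.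
exact: (subspZ _ L2s (XlL (hek 0 _))).
Qed.
Let Xl_sum (J : Type) (r : seq J) (a : J -> C) (w : J -> V) : (forall j, H2 (w j)) ->
  aeq (Xl (\sum_(j <- r) a j *: w j)) (\sum_(j <- r) a j *: Xl (w j)).
Proof.
move=> hw; have h0 : H2 (0 : V) := proj1 H2s.
elim: r => [|j r IH].
  rewrite !big_nil; have := Xl_linear (-1) h0 h0; rewrite scaler0 addr0 => e.
  by apply: aeT_sub e => t _ ->; rewrite !fctE scaleN1r addNr.
rewrite !big_cons.
have hs : H2 (\sum_(j <- r) a j *: w j).
  by apply: (@subsp_sum _ _ (@H2 R n) _ _ _ _ H2s) => i _; exact: (subspZ _ H2s (hw i)).
apply: aeq_trans (Xl_linear (a j) (hw j) hs) _.
by apply: aeqL => //; exact: aeq_refl.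
Qed.
Let Xl_ek0 x : aeq (Xl (ek 0 x)) (Wc x).
Proof.
rewrite Wc_sum; have := Xl_sum (index_enum 'I_n) (fun j => x j 0) (fun j => hek 0 (delta_mx j 0)).
congr aeq; congr Xl; apply/funext => t; rewrite fct_sumE /ek -[in RHS](vec_sum_delta x).
rewrite scaler_sumr; apply: eq_bigr => j _.
rewrite -[LHS]/(x j 0 *: (zeta t ^ 0 *: (delta_mx j 0 : 'cV[C]_n))) !scalerA mulrC.
reflexivity.
Qed.
Let Xl_ek (k : nat) x : aeq (Xl (ek k x)) (zs k (Wc x)).
Proof.
elim: k => [|k IH]; first by rewrite zs0; exact: Xl_ek0.
have -> : ek k.+1 x = zs 1 (ek k x) :> V by rewrite zs_ek; congr ek; lia.
apply: aeq_trans (Xl_zs (hek k x)) _.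
have := aeq_zs 1 IH; rewrite zsA; congr aeq; congr zs; lia.
Qed.
Let Xl_poly (P : {poly C}) x : exists f, [/\ H2 f, forall t, f t = P.[zeta t] *: x &
  aeq (Xl f) (fun t => P.[zeta t] *: Wc x t)].
Proof.
exists (\sum_(k < size P) P`_k *: ek k x); split.
- by apply: (@subsp_sum _ _ (@H2 R n) _ _ _ _ H2s) => i _; exact: (subspZ _ H2s (hek i x)).
- move=> t; rewrite fct_sumE horner_coef scaler_suml; apply: eq_bigr => k _.
  by rewrite -scalerA.
- apply: aeq_trans (Xl_sum _ _ (fun k : 'I_(size P) => hek k x)) _.
  have h : aeT (fun t => forall k : 'I_(size P), Xl (ek k x) t = zs k (Wc x) t).
    by apply: aeT_cnt => k; exact: Xl_ek.
  apply: aeT_sub h => t _ h; rewrite fct_sumE horner_coef scaler_suml.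
  by apply: eq_bigr => k _; rewrite -scalerA -[zeta t ^+ k *: _]/(zs k (Wc x) t) -h.
Qed.
(** For fixed [x], the norm bound at the functions [P(zeta) x] says that [|A x|^2 - |W x|^2] has a
    nonnegative integral against [|P(zeta)|^2] for every polynomial [P]. *)
Let W_le1 x : aeT (fun t => vnorm (W t *m x) <= vnorm (A t *m x)).
Proof.
have h0 := H2_L2 (hek 0 x); have hAx := isL2_mulf hA h0.
have /isL2P[_ i1] := hAx; have /isL2P[_ i2] := Wc_L2 x.
have e1 t : vnorm (mulf A (ek 0 x) t) = vnorm (A t *m x).
  by rewrite /mulf /ek expr0z scale1r.
have {}i1 : rI (fun t => vnorm (A t *m x) ^+ 2).
  by move: i1; under eq_fun do rewrite e1.
suff : aeT (fun t => 0 <= vnorm (A t *m x) ^+ 2 - vnorm (Wc x t) ^+ 2).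
  by apply: aeT_sub => t _; rewrite subr_ge0 ler_pXn2r ?nnegrE ?vnorm_ge0.
apply: (poly_positivity (rIB i1 i2)).
move=> P; have [f [hf fE XE]] := Xl_poly P x.
have hAf := isL2_mulf hA (H2_L2 hf); have /isL2P[_ j1] := hAf.
have wL : isL2 (fun t => P.[zeta t] *: Wc x t).
  apply: isL2_aeq (XlL hf) XE => i.
  have -> : (fun t => (P.[zeta t] *: Wc x t) i 0) = (fun t => P.[zeta t] * Wc x t i 0).
    by apply/funext => t; rewrite mxE.
  apply: cmeasM; last by have /isL2P[h _] := Wc_L2 x.
  under eq_fun do rewrite horner_coef.
  by apply: cmeas_sum => j; apply: cmeasM; [exact: cmeas_cst|exact/cmeasX/cmeas_zeta].
have /isL2P[_ j2] := wL.
have := Xl_bound hf; rewrite (nq_aeq (XlL hf) wL XE) /q0 /nq /wform -!/(nq _ _) !nq_ip.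
rewrite -subr_ge0 -(rintB j1 j2); congr (_ <= _); congr rint; apply/funext => t.
rewrite /mulf fE -scalemxAr !vnormZ !exprMn; ring.
Qed.
Let W_le : aeT (fun t => forall x, vnorm (W t *m x) <= vnorm (A t *m x)).
Proof.
have h : aeT (fun t => forall a : {ffun 'I_n -> int * int},
    vnorm (W t *m gauss R a) <= vnorm (A t *m gauss R a)).
  by apply: aeT_cnt => a; exact: W_le1.
by apply: aeT_sub h => t _; exact: lattice_norm_le.
Qed.
Let W_Linfty : Linfty W.
Proof.
split; first exact: W_meas.
have [K K0 hK] := Linfty_bound hA; exists K; apply: aeT_sub2 W_le hK => t _ h1 h2 i j.
have -> : W t i j = (W t *m (delta_mx j 0 : 'cV[C]_n)) i 0 by rewrite -colE [RHS]mxE.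
apply: le_trans (cabs_le_vnorm _ _) _; apply: le_trans (h1 _) _; apply: le_trans (h2 _) _.
have -> : vnorm (delta_mx j 0 : 'cV[C]_n) = 1; last by rewrite mulr1.
apply: eq_sqr_ge0; rewrite ?vnorm_ge0// vnorm2 (bigD1 j)//= big1 => [|k kj].
  by rewrite mxE !eqxx cabs1 addr0.
by rewrite mxE (negPf kj) cabs0 expr0n.
Qed.
(** Each Fourier coefficient of the difference is a bounded functional of [f] that vanishes on
    monomials. *)
Let Xl_mulf f : H2 f -> aeq (Xl f) (mulf W f).
Proof.
have [KA _ hKA] := nq_mulf_bound hA; have [KW _ hKW] := nq_mulf_bound W_Linfty.
have ML g : H2 g -> isL2 (mulf W g) by move=> /H2_L2; exact: isL2_mulf.
move=> hf; apply: (Xl_unique hf (ML _ hf)) => k; apply: dp_eqP => z.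
pose l g := ip (Xl g) (ek k z) - ip (mulf W g) (ek k z).
have zL : isL2 (ek k z : V) by exact: isL2_ek.
rewrite (dp_fcoef k z (XlL hf)) (dp_fcoef k z (ML _ hf)).
apply/eqP; rewrite -subr_eq0; apply/eqP; rewrite -/(l f).
apply: (@H2_functional_ext _ _ l ((2 * KA + 2 * KW) * nq ip (ek k z))) => //.
- move=> a g h hg hh; have hgh := proj2 H2s a _ _ hg hh; rewrite /l.
  rewrite (ip_aeql (XlL hgh) (proj2 L2s a _ _ (XlL hg) (XlL hh)) zL (Xl_linear a hg hh)).
  rewrite mulf_linear (hformL ipH a (XlL hg) (XlL hh) zL) (hformL ipH a (ML _ hg) (ML _ hh) zL).
  ring.
- move=> g hg; have gL := XlL hg; have mL := ML _ hg; have dL := subspB L2s gL mL.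
  rewrite /l -(hformBl ipH gL mL zL); apply: le_trans (hform_CS ipH dL zL) _.
  rewrite mulrAC ler_wpM2r ?(nq_ge0 ipH zL)//.
  apply: le_trans (nqB_le2 ipH gL mL) _.
  have b1 : nq ip (Xl g) <= KA * nq ip g := le_trans (Xl_bound hg) (hKA _ (H2_L2 hg)).
  have b2 := hKW _ (H2_L2 hg).
  by move: b1 b2; rewrite mulrDl; lra.
- move=> j x; rewrite /l; have eL := ML _ (hek j x).
  rewrite (ip_aeql (XlL (hek j x)) (isL2_zs j (Wc_L2 x)) zL (Xl_ek j x)).
  suff -> : mulf W (ek j x) = zs j (Wc x) by rewrite subrr.
  by apply/funext => t; rewrite /mulf /ek /zs -scalemxAr.
Qed.

Lemma extension_limit : exists W, [/\ Linfty W,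
  aeT (fun t => forall x, vnorm (W t *m x) <= vnorm (A t *m x)),
  Hinf (fun t => Phi t - W t) &
  forall i f, H2 f -> aeq (Hs i f) (Pm (zs (- i%:Z) (mulf W f)))].
Proof.
have ML g : H2 g -> isL2 (mulf W g) by move=> /H2_L2; exact: isL2_mulf.
have PL g : H2 g -> isL2 (mulf Phi g) by move=> /H2_L2; exact: isL2_mulf.
exists W; split => //.
- apply: sH2_HinfP.
    have eD t i j : (Phi t - W t) i j = Phi t i j - W t i j by rewrite mxE [X in _ + X]mxE.
    split.
      move=> i j; have -> : (fun t => (Phi t - W t) i j) = (fun t => Phi t i j - W t i j).
        by apply/funext => t; rewrite eD.
      exact: (cmeasB (hPhi.1 i j) (W_meas i j)).
    case: hPhi => _ [M1 h1]; case: W_Linfty => _ [M2 h2]; exists (M1 + M2).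
    apply: aeT_sub2 h1 h2 => t _ h1 h2 i j; rewrite eD.
    by apply: le_trans (cabsD _ _) _; rewrite cabsN; apply: lerD.
  move=> i j; pose f := ek 0 (delta_mx j 0) : V; have hf : H2 f := hek 0 _.
  have hd : isL2 (mulf Phi f - mulf W f) := subspB L2s (PL _ hf) (ML _ hf).
  (* The negative coefficients of [W f] are those of [Hs 0 f], hence those of [Phi f]. *)
  have H2d : H2 (mulf Phi f - mulf W f).
    split => // k k0; rewrite (fcoefB k (PL _ hf) (ML _ hf)).
    rewrite -(fcoef_aeq k (XlL hf) (ML _ hf) (Xl_mulf hf)).
    have := Xl_coefH 0 hf k0; rewrite addr0 => ->.
    by rewrite Hs0 (fcoef_Pm (PL _ hf) k0) subrr.
  have /H2_coordP/(_ i) := H2d; congr sH2; apply/funext => t.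
  rewrite !fctE /mulf /f /ek expr0z scale1r -mulmxBl -colE [LHS]mxE.
  by [].
- move=> i f hf; apply: (Pm_unique (isL2_zs _ (ML _ hf))).
  split; first exact: (hankel_m (hankHs i) hf).
  move=> k k0; rewrite fcoef_zs opprK -(fcoef_aeq _ (XlL hf) (ML _ hf) (Xl_mulf hf)).
  by rewrite (Xl_coefH _ hf k0).
Qed.
End Extension.

Section ExtensionTheorem.
Variables (R : realType) (n : nat).
Local Notation C := (complex.complex R).
Local Notation V := (R -> 'cV[C]_n).
Local Notation ip := (@ip R n).
#[local] Opaque fcoef cint isL2 aeT dp.

Lemma eq_spdim (q q' : V -> V -> C) s : (forall f, H2 f -> nq q f = nq q' f) ->
  spdim q s -> spdim q' s.
Proof.
move=> e [X uX h]; exists X => // x; rewrite -h; split.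
  by move=> [f [hf fx f0]]; exists f; split => //; rewrite e.
by move=> [f [hf fx f0]]; exists f; split => //; rewrite -e.
Qed.
Lemma eq_ess_form (q q' : V -> V -> C) : (forall f, H2 f -> nq q f = nq q' f) ->
  ess_form (@H2 R n) ip q -> ess_form (@H2 R n) ip q'.
Proof.
move=> e [d d0 h]; exists d => // u hu hM; have [phi [phiI h1]] := h u hu hM.
exists phi; split => // x x0; have [N hN] := h1 x x0; exists N => k l Nk Nl.
rewrite -e; first exact: hN.
exact: (subspB (@H2_linsub R n) (hu _) (hu _)).
Qed.

Theorem extension (A Phi : R -> 'M[C]_n) (s_ : nat -> nat) : Linfty A -> Linfty Phi ->
  (forall f, H2 f -> nq ip (Pm (mulf Phi f)) <= nq ip (mulf A f)) ->
  ess_form (@H2 R n) ip (qf (wform A) (fun f => Pm (mulf Phi f))) ->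
  spdim (qf (wform A) (fun f => Pm (mulf Phi f))) (s_ 0%N) ->
  (forall i, (s_ i <= s_ i.+1)%N) -> (forall i, (s_ i <= n)%N) ->
  exists W, [/\ Linfty W,
  aeT (fun t => forall x, vnorm (W t *m x) <= vnorm (A t *m x)),
  Hinf (fun t => Phi t - W t) &
  forall i : nat, let q := qf (wform A) (fun f => Pm (zs (- i%:Z) (mulf W f))) in
    spdim q (s_ i) /\ ess_form (@H2 R n) ip q].
Proof.
move=> hA hPhi hc hess sp0 mono sn.
have hq0 := wform_hform hA; have [K hK] := wform_bound hA.
have hS : state (wform A) (fun f => Pm (mulf Phi f)).
  by split => //; exact: mulf_hankel.
have [Hs [G [e0 hs HsS Hsz]]] :=
  iterate_exists hq0 hK (fun f g _ _ => wform_shift A f g) hS sp0 mono sn.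
have hh i : hankel (Hs i) by case: (hs i) => -[].
have hcc i : contractive (wform A) (Hs i) by case: (hs i) => -[].
have [W [h1 h2 h3 h4]] := extension_limit hA hPhi e0 hh hcc HsS Hsz.
exists W; split => // i /=.
have e f : H2 f -> nq (qf (wform A) (Hs i)) f =
    nq (qf (wform A) (fun f => Pm (zs (- i%:Z) (mulf W f)))) f.
  move=> hf; rewrite !nq_qf; congr (_ - _).
  apply: (nq_aeq (hankel_L2 (hh i) hf) _ (h4 i f hf)).
  by apply: Pm_L2; apply: isL2_zs; apply: isL2_mulf => //; exact: H2_L2.
have [[_ _ es] sp] := hs i; split; first exact: (eq_spdim e sp).
exact: (eq_ess_form e es).
Qed.
End ExtensionTheorem.

(** * Pointwise independence of null functions *)

Section Wandering.
Variables (R : realType) (n : nat).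
Local Notation C := (complex.complex R).
Local Notation V := (R -> 'cV[C]_n).
Local Notation ip := (@ip R n).
Local Notation zeta := (@zeta R).
Let L2s := @isL2_linsub R n.
Let ipH := @ip_hform R n.
Let H2s := @H2_linsub R n.
#[local] Opaque fcoef cint isL2 aeT dp.

Lemma unitmx_inj k (M : 'M[C]_k) : (forall x : 'cV[C]_k, M *m x = 0 -> x = 0) -> M \in unitmx.
Proof.
move=> h; rewrite -unitmx_tr -row_free_unit -kermx_eq0; apply/eqP/row_matrixP => i.
rewrite row0; apply: (can_inj (@trmxK _ _ _)); rewrite trmx0; apply: h.
have e : row i (kermx M^T) *m M^T = 0 by apply/sub_kermxP; exact: row_sub.
by rewrite -[LHS]trmxK trmx_mul trmxK e trmx0.
Qed.

Variables (s : nat) (f : 'I_s -> V).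
Hypothesis hf : forall j, H2 (f j).
Hypothesis find : forall a : 'I_s -> C, \sum_j a j *: fcoef (f j) 0 = 0 -> forall j, a j = 0.

Definition pmul (P : {poly C}) (g : V) : V := fun t => P.[zeta t] *: g t.
Lemma pmulE P g : pmul P g = \sum_(k < size P) P`_k *: zs k g.
Proof.
apply/funext => t; rewrite fct_sumE /pmul horner_coef scaler_suml.
by apply: eq_bigr => k _; rewrite -scalerA.
Qed.
Lemma pmul_H2 P g : H2 g -> H2 (pmul P g).
Proof.
move=> hg; rewrite pmulE; apply: (@subsp_sum _ _ (@H2 R n) _ _ _ _ H2s) => k _.
by apply: (subspZ _ H2s); exact: H2_zs.
Qed.
Definition psum (P : 'I_s -> {poly C}) : V := \sum_j pmul (P j) (f j).
Lemma psum_H2 P : H2 (psum P).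
Proof.
by apply: (@subsp_sum _ _ (@H2 R n) _ _ _ _ H2s) => k _; exact: pmul_H2.
Qed.
Lemma psumL a P Q : psum (fun j => a *: P j + Q j) = a *: psum P + psum Q.
Proof.
rewrite /psum scaler_sumr -big_split; apply: eq_bigr => j _.
apply/funext => t /=; rewrite /pmul hornerD hornerZ scalerDl -scalerA.
reflexivity.
Qed.
Lemma psum_X P : psum (fun j => 'X * P j) = zs 1 (psum P).
Proof.
apply/funext => t; rewrite /zs /psum !fct_sumE scaler_sumr; apply: eq_bigr => j _.
by rewrite /pmul hornerM hornerX scalerA.
Qed.

(** The leading [zs 1] restricts the span to the powers [z^k] with [k >= 1]. *)
Definition zspan h := isL2 h /\ forall e, 0 < e -> exists P, nq ip (h - zs 1 (psum P)) < e.
Let zpL P : isL2 (zs 1 (psum P)). Proof. exact: (isL2_zs 1 (H2_L2 (psum_H2 P))). Qed.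
Lemma zspan_zpsum P : zspan (zs 1 (psum P)).
Proof.
by split => // e e0; exists P; rewrite subrr (nq0 ipH).
Qed.
Lemma zspan_linsub : linsub zspan.
Proof.
split.
  split; first exact: (proj1 L2s).
  move=> e e0; exists (fun=> 0).
  have -> : psum (fun=> 0) = 0.
    by apply: big1 => j _; apply/funext => t; rewrite /pmul horner0 scale0r.
  have -> : zs 1 (0 : V) = 0 by apply/funext => t; rewrite /zs scaler0.
  by rewrite subrr (nq0 ipH).
move=> a g h [gL hg] [hL hh]; split; first exact: (proj2 L2s a _ _ gL hL).
move=> e e0; have c0 : 0 <= cabs a ^+ 2 by exact: sqr_ge0.
have [P hP] := hg (e / (4 * (cabs a ^+ 2 + 1))) ltac:(by rewrite divr_gt0// mulr_gt0// ltr_wpDl).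
have [Q hQ] := hh (e / 4) ltac:(by rewrite divr_gt0).
exists (fun j => a *: P j + Q j); rewrite psumL zsL.
have -> : a *: g + h - (a *: zs 1 (psum P) + zs 1 (psum Q)) =
    a *: (g - zs 1 (psum P)) + (h - zs 1 (psum Q)).
  by rewrite scalerBr opprD addrACA.
have d1 := subspB L2s gL (zpL P); have d2 := subspB L2s hL (zpL Q).
apply: le_lt_trans (nqD_le2 ipH (subspZ a L2s d1) d2) _.
rewrite (nqZ ipH a d1).
have : cabs a ^+ 2 * nq ip (g - zs 1 (psum P)) <= e / 4.
  move: hP; rewrite ltr_pdivlMr ?mulr_gt0 ?ltr_wpDl// => /ltW hP.
  have n0 := nq_ge0 ipH d1.
  by move: hP n0 c0; move: (cabs a ^+ 2) (nq ip _) => x y; nra.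
by move: hQ; move: (nq ip (h - _)) (cabs a ^+ 2 * _) => x y; lra.
Qed.
Lemma zspan_L2 h : zspan h -> isL2 h. Proof. by case. Qed.
Lemma zspan_complete : qcomplete zspan ip.
Proof.
move=> u hu cu; have [w hw [cv _]] := L2_complete_ae (fun k => zspan_L2 (hu k)) cu.
exists w => //; split => // e e0.
have [N hN] := cv (e / 4) ltac:(by rewrite divr_gt0).
have [uL hP] := hu N; have [P {}hP] := hP (e / 4) ltac:(by rewrite divr_gt0).
exists P; have -> : w - zs 1 (psum P) = (w - u N) + (u N - zs 1 (psum P)) by rewrite addrA subrK.
have d1 := subspB L2s hw uL; have d2 := subspB L2s uL (zpL P).
apply: le_lt_trans (nqD_le2 ipH d1 d2) _.
have := hN N (leqnn N); rewrite (nqBC ipH uL hw); move: hP.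
by move: (nq ip _) (nq ip _) => x y; lra.
Qed.
Lemma zspan_seq h : zspan h -> exists P : nat -> 'I_s -> {poly C},
  forall e, 0 < e -> exists N, forall k, (N <= k)%N -> nq ip (zs 1 (psum (P k)) - h) < e.
Proof.
move=> [hL hh].
have /choice[P hP] (k : nat) : exists P, nq ip (h - zs 1 (psum P)) < k.+1%:R^-1.
  by apply: hh; rewrite invr_gt0.
exists P => e /inv_small[N hN]; exists N => k /hN; rewrite (nqBC ipH (zpL _) hL).
exact: lt_trans (hP k).
Qed.
Lemma zspan_zH2 h : zspan h -> zH2 h.
Proof.
move=> hh; have [hL _] := hh; have [P hP] := zspan_seq hh.
apply/zH2E; split => // k k0; apply: dp_eqP => z.
rewrite (hform0l (dp_hform R n) (h := z) Logic.I) (dp_fcoef k z hL).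
apply: (ip_cvg (fun j => zpL (P j)) hL (isL2_ek k z) hP) => j.
rewrite -(dp_fcoef k z (zpL _)) fcoef_zs (proj2 (psum_H2 (P j))); last by lia.
exact: (hform0l (dp_hform R n) (h := z) Logic.I).
Qed.
Lemma zspan_zs h : zspan h -> zspan (zs 1 h).
Proof.
move=> [hL hh]; split; first exact: isL2_zs.
move=> e /hh[P hP]; exists (fun j => 'X * P j).
by rewrite psum_X -zsB nq_zs.
Qed.
Lemma zspan_zsX k h : zspan h -> zspan (zs (k : nat) h).
Proof.
move=> hh; elim: k => [|k IH]; first by rewrite zs0.
have -> : zs k.+1 h = zs 1 (zs k h) by rewrite zsA; congr zs; lia.
exact: zspan_zs.
Qed.
Lemma zspan_f j : zspan (zs 1 (f j)).
Proof.
have -> : f j = psum (fun i => if i == j then 1 else 0); last exact: zspan_zpsum.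
apply/funext => t; rewrite /psum fct_sumE (bigD1 j)//= big1 => [|i ij].
  by rewrite eqxx /pmul hornerC scale1r addr0.
by rewrite (negPf ij) /pmul horner0 scale0r.
Qed.
Definition colmx k (g : 'I_k -> V) t : 'M[C]_(n, k) := \matrix_(i, j) g j t i 0.
Lemma colmx_mul k (g : 'I_k -> V) t (b : 'cV[C]_k) : colmx g t *m b = \sum_j b j 0 *: g j t.
Proof.
apply/matrixP => i l; rewrite ord1 summxE mxE; apply: eq_bigr => j _.
by rewrite [colmx g t i j]mxE [RHS]mxE mulrC.
Qed.
(** Polynomial combinations take their values in the column space of [f(t)]. A subsequence converges
    almost everywhere, and the column space is closed, being cut out by its cokernel matrix. *)
Lemma zspan_pointwise h : zspan h -> aeT (fun t => exists b, h t = colmx f t *m b).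
Proof.
move=> hh; have [hL _] := hh; have [P hP] := zspan_seq hh.
have cu e : 0 < e -> exists N, forall k l, (N <= k)%N -> (N <= l)%N ->
    nq ip (zs 1 (psum (P k)) - zs 1 (psum (P l))) < e.
  move=> e0; have [N hN] := hP (e / 4) ltac:(by rewrite divr_gt0).
  exists N => k l Nk Nl.
  have -> : zs 1 (psum (P k)) - zs 1 (psum (P l)) =
     (zs 1 (psum (P k)) - h) - (zs 1 (psum (P l)) - h) by rewrite opprB addrA subrK.
  apply: le_lt_trans (nqB_le2 ipH (subspB L2s (zpL _) hL) (subspB L2s (zpL _) hL)) _.
  by have := hN k Nk; have := hN l Nl; move: (nq ip _) (nq ip _) => x y; lra.
have [w hw [cv [phi hphi]]] := L2_complete_ae (fun k => zpL (P k)) cu.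
have wh : aeq w h.
  apply: (nqB_aeq hw hL); apply/eqP; rewrite eq_le (nq_ge0 ipH (subspB L2s hw hL)) andbT.
  apply: (@small_le0 _ _ 4) => e e0; have [N1 h1] := hP e e0; have [N2 h2] := cv e e0.
  pose k := maxn N1 N2; have a1 := h1 k (leq_maxl _ _); have a2 := h2 k (leq_maxr _ _).
  have -> : w - h = (w - zs 1 (psum (P k))) + (zs 1 (psum (P k)) - h) by rewrite addrA subrK.
  apply: le_trans (nqD_le2 ipH (subspB L2s hw (zpL _)) (subspB L2s (zpL _) hL)) _.
  rewrite (nqBC ipH hw (zpL _)); move: a1 a2; rewrite -/k.
  by move: (nq ip _) (nq ip _) => x y; lra.
apply: aeT_sub2 hphi wh => t _ hlim wt.
pose F := colmx f t.
have uE k : zs 1 (psum (P k)) t = F *m (\col_j (zeta t * (P k j).[zeta t])).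
  rewrite colmx_mul /zs /psum fct_sumE scaler_sumr; apply: eq_bigr => j _.
  by rewrite mxE /pmul expr1z scalerA.
suff : ((h t)^T <= F^T)%MS.
  by move=> /submxP[b hb]; exists b^T; rewrite -[h t]trmxK hb trmx_mul trmxK.
rewrite submxE; apply/eqP/matrixP => i j; rewrite (ord1 i) [RHS]mxE; set K := cokermx F^T.
have E (x : 'cV[C]_n) : (x^T *m K) 0 j = \sum_l x l 0 * K l j.
  by rewrite mxE; apply: eq_bigr => l _; rewrite [x^T 0 l]mxE.
apply/eqP; rewrite -cabs_eq0 eq_le cabs_ge0 andbT.
apply: (@small_le0 _ _ (\sum_l cabs (K l j))) => e e0.
have e2 : 0 < e / 2 by rewrite divr_gt0.
have /choice[N hN] (l : 'I_n) : exists N, forall k, (N <= k)%N ->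
    cabs (w t l 0 - zs 1 (psum (P (phi k))) t l 0) <= e.
  have [r1 r2] := hlim l.
  have [N1 _ h1] := @cvgr_dist_lt _ _ _ _ _ _ _ r1 _ e2.
  have [N2 _ h2] := @cvgr_dist_lt _ _ _ _ _ _ _ r2 _ e2.
  exists (maxn N1 N2) => k; rewrite geq_max => /andP[k1 k2].
  apply: le_trans (cabs_le_ReIm _) _; rewrite !cE.
  by have := h1 k k1; have := h2 k k2; rewrite /=; lra.
pose k := \max_l N l.
have z0 : ((zs 1 (psum (P (phi k))) t)^T *m K) 0 j = 0.
  by rewrite uE trmx_mul -mulmxA mulmx_coker mulmx0 mxE.
rewrite -wt -[X in cabs X]subr0 -z0 !E -sumrB mulr_suml.
apply: le_trans (cabs_sum _ _ _) _; apply: ler_sum => l _.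
rewrite -mulrBl cabsM mulrC ler_wpM2l ?cabs_ge0//.
by apply: hN; exact: leq_bigmax.
Qed.

(* [g j] is [f j] minus its projection on the closed span of the [z^k f_i], [k >= 1]; all nonzero Fourier
   coefficients of the Gram matrix then vanish. *)
Lemma wandering : exists (g : 'I_s -> V) (Gm : 'M[C]_s), [/\ forall j, H2 (g j), Gm \in unitmx,
  aeT (fun t => ctr (colmx g t) *m colmx g t = Gm) &
  aeT (fun t => exists2 c : 'M[C]_s, c \in unitmx & colmx g t = colmx f t *m c)].
Proof.
have /choice[p hp] (j : 'I_s) : exists p, zspan p /\ forall h, zspan h -> ip (f j - p) h = 0.
  have [p ? ?] := projection ipH zspan_linsub zspan_L2 zspan_complete (H2_L2 (hf j)).
  by exists p.
pose g j := f j - p j.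
have pH j : zH2 (p j) by apply: zspan_zH2; case: (hp j).
have gH j : H2 (g j) := subspB H2s (hf j) (zH2_H2 (pH j)).
have gL j : isL2 (g j) := H2_L2 (gH j).
have g0 j : fcoef (g j) 0 = fcoef (f j) 0.
  by rewrite /g (fcoefB 0 (H2_L2 (hf j)) (H2_L2 (zH2_H2 (pH j)))) (proj2 (pH j)) subr0.
have gz j (k : nat) : zspan (zs k.+1 (g j)).
  have -> : zs k.+1 (g j) = zs k (zs 1 (f j)) - zs k (zs 1 (p j)).
    by rewrite -!zsB zsA -/(g j); congr zs; lia.
  apply: (subspB zspan_linsub); apply: zspan_zsX; first exact: zspan_f.
  by apply: zspan_zs; case: (hp j).
have orth i j (k : nat) : ip (g i) (zs k.+1 (g j)) = 0 by exact: (proj2 (hp i) _ (gz j k)).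
pose Gm : 'M[C]_s := \matrix_(i, j) ip (g j) (g i).
have uG : Gm \in unitmx.
  (* A kernel vector yields a combination of the [g j] of norm 0; its value at 0 is the same
     combination of the values of the [f j], which are independent. *)
  apply: unitmx_inj => a ha.
  have aL : isL2 (\sum_j a j 0 *: g j).
    by apply: (@subsp_sum _ _ (@isL2 R n) _ _ _ _ L2s) => j _; exact: (subspZ _ L2s (gL j)).
  have n0 : nq ip (\sum_j a j 0 *: g j) = 0.
    rewrite /nq (hform_sumr ipH); [|by move=> j; exact: (subspZ _ L2s (gL j))|exact: aL].
    rewrite big1 // => i _; rewrite (hformZr ipH _ aL (gL i)).
    have -> : ip (\sum_j a j 0 *: g j) (g i) = (Gm *m a) i 0.
      rewrite (hform_suml ipH); [|by move=> j; exact: (subspZ _ L2s (gL j))|exact: (gL i)].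
      rewrite [RHS]mxE; apply: eq_bigr => j _.
      by rewrite (hformZl ipH _ (gL j) (gL i)) [Gm i j]mxE mulrC.
    by rewrite ha mxE mulr0.
  have e := nq_eq0 aL n0.
  have := fcoef_aeq 0 aL (proj1 L2s) e; rewrite fcoef0.
  have -> : fcoef (\sum_j a j 0 *: g j) 0 = \sum_j a j 0 *: fcoef (f j) 0.
    elim: (index_enum _) => [|j r IH]; first by rewrite !big_nil fcoef0.
    rewrite !big_cons -IH -g0; apply: (fcoefL 0 (a j 0) (gL j)).
    by apply: (@subsp_sum _ _ (@isL2 R n) _ _ _ _ L2s) => i _; exact: (subspZ _ L2s (gL i)).
  by move=> /find h; apply/matrixP => i j; rewrite ord1 h mxE.
have gram : aeT (fun t => ctr (colmx g t) *m colmx g t = Gm).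
  suff : aeT (fun t => forall ij : 'I_s * 'I_s, dp (g ij.2 t) (g ij.1 t) - Gm ij.1 ij.2 = 0).
    apply: aeT_sub => t _ h; apply/matrixP => i j.
    have /eqP := h (i, j); rewrite subr_eq0 => /eqP <-; rewrite mxE dpE.
    by apply: eq_bigr => l _; rewrite [ctr _ i l]mxE !mxE mulrC.
  apply: aeT_cnt => -[i j] /=; have hI := cI_dp (gL j) (gL i).
  apply: fourier_unique; first by apply: (cIB hI); exact: cI_cst.
  move=> k; have ipk : cint (fun t => dp (g j t) (g i t) * zeta t ^ k) = ip (g j) (zs (- k) (g i)).
    rewrite ip.unlock; congr cint; apply/funext => t; rewrite /zs.
    rewrite (hformZr (dp_hform R n) _ (f := g j t) (h := g i t) Logic.I Logic.I).
    by rewrite zetazJ opprK mulrC.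
  have -> : (fun t => (dp (g j t) (g i t) - Gm i j) * zeta t ^ k) =
    (fun t => dp (g j t) (g i t) * zeta t ^ k - Gm i j * zeta t ^ k).
    by apply/funext => t; rewrite mulrBl.
  have hIz : cI (fun t => dp (g j t) (g i t) * zeta t ^ k).
    by apply: (cI_unit hI); [exact: cmeas_zetaz|move=> t; exact: cabs_zetaz].
  rewrite (cintB hIz (cIZ (Gm i j) (cI_zetaz R k))) (cintZ (Gm i j) (cI_zetaz R k)).
  rewrite cint_zetaz ipk; have [->|k0] := eqVneq k 0.
    by rewrite oppr0 zs0 [Gm i j]mxE mulr1 subrr.
  rewrite mulr0 subr0; have [kp|kn] := ltP 0 k.
    rewrite -(ip_zs k) (zsK k) (hformC ipH (gL i) (isL2_zs k (gL j))).
    case: k kp k0 {ipk hIz} => // -[//|k] _ _; rewrite orth; exact: conjc0.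
  case: k kn k0 {ipk hIz} => [[|k]|k] //= _ _; rewrite NegzE opprK.
  exact: orth.
exists g, Gm; split => //.
have hb : aeT (fun t => forall j, exists b, p j t = colmx f t *m b).
  by apply: aeT_cnt => j; apply: zspan_pointwise; case: (hp j).
apply: aeT_sub2 hb gram => t _ hb hG.
have [b {}hb] := choice hb.
pose c : 'M[C]_s := 1%:M - \matrix_(i, j) b j i 0.
have gE : colmx g t = colmx f t *m c.
  have eb : colmx p t = colmx f t *m \matrix_(i, j) b j i 0.
    apply/matrixP => i j; rewrite [LHS]mxE hb [LHS]mxE [RHS]mxE.
    by apply: eq_bigr => l _; congr (_ * _); rewrite [RHS]mxE.
  rewrite /c mulmxBr mulmx1 -eb; apply/matrixP => i j.
  by rewrite [LHS]mxE [RHS]mxE [colmx f t i j]mxE [X in _ = _ + X]mxE [colmx p t i j]mxE /g [LHS]mxE [X in _ + X = _]mxE.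
exists c => //; apply: unitmx_inj => x cx.
have : Gm *m x = 0 by rewrite -hG gE -!mulmxA cx !mulmx0.
by move=> /(congr1 (mulmx (invmx Gm))); rewrite mulKmx// mulmx0.
Qed.
End Wandering.

Local Notation sval := Defs.sval.
(** * Superoptimal singular values *)

Section SingularValues.
Variable R : realType.
Local Notation C := (complex.complex R).
Implicit Types n : nat.

Lemma mxnorm_le n (A : 'M[C]_n) c : 0 <= c -> (forall x, vnorm (A *m x) <= c * vnorm x) ->
  mxnorm A <= c.
Proof. by move=> c0 h; apply: ge_inf; [exists 0 => y []|split]. Qed.

Lemma mxnorm_ge n (A : 'M[C]_n) c : (forall M, 0 <= M ->
  (forall x, vnorm (A *m x) <= M * vnorm x) -> c <= M) -> c <= mxnorm A.
Proof.
move=> h; apply: lb_le_inf => [|M [M0 hM]]; last exact: h.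
exists (\sum_i \sum_j cabs (A i j)); split; last by move=> x; exact: vnorm_mulmx_le.
by apply: sumr_ge0 => i _; apply: sumr_ge0 => j _; exact: cabs_ge0.
Qed.

Lemma vnorm_mxnorm n (A : 'M[C]_n) x : vnorm (A *m x) <= mxnorm A * vnorm x.
Proof.
have := vnorm_ge0 x; rewrite le_eqVlt => /predU1P[/esym x0|x0].
  by rewrite (vnorm_eq0 x0) mulmx0 !vnorm0 mulr0.
by rewrite -ler_pdivrMr//; apply: mxnorm_ge => M M0 hM; rewrite ler_pdivrMr.
Qed.

Lemma mxnorm_ge0 n (A : 'M[C]_n) : 0 <= mxnorm A.
Proof. exact: mxnorm_ge. Qed.

Lemma sval_le n j (A B : 'M[C]_n) : (\rank B <= j)%N -> sval j A <= mxnorm (A - B).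
Proof. by move=> h; apply: ge_inf; [exists 0 => y [D _ <-]; exact: mxnorm_ge0|exists B]. Qed.

Lemma sval_ge n j (A : 'M[C]_n) c :
  (forall B : 'M[C]_n, (\rank B <= j)%N -> c <= mxnorm (A - B)) -> c <= sval j A.
Proof.
move=> h; apply: lb_le_inf => [|y [B hB <-]]; last exact: h.
by exists (mxnorm (A - 0)); exists 0 => //=; rewrite mxrank0.
Qed.

Lemma sval_anti n i j (A : 'M[C]_n) : (i <= j)%N -> sval j A <= sval i A.
Proof. by move=> ij; apply: sval_ge => B hB; apply: sval_le; exact: leq_trans hB ij. Qed.

Lemma sval0E n (A : 'M[C]_n) : sval 0 A = mxnorm A.
Proof.
apply/eqP; rewrite eq_le; apply/andP; split.
  by rewrite -[A in leRHS]subr0; apply: sval_le; rewrite mxrank0.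
by apply: sval_ge => B; rewrite leqn0 mxrank_eq0 => /eqP ->; rewrite subr0.
Qed.

Lemma sval_le1 n j (A : 'M[C]_n) : (forall x, vnorm (A *m x) <= vnorm x) -> sval j A <= 1.
Proof.
move=> h; apply: le_trans (sval_anti A (leq0n j)) _.
by rewrite sval0E; apply: mxnorm_le => // x; rewrite mul1r.
Qed.

Lemma ker_exists m k (M : 'M[C]_(m, k)) : (\rank M < k)%N ->
  exists2 a : 'cV[C]_k, a != 0 & M *m a = 0.
Proof.
move=> rk; have : kermx M^T != 0.
  by rewrite kermx_eq0 -row_leq_rank mxrank_tr -ltnNge.
move=> /rowV0Pn[v /sub_kermxP hv v0]; exists v^T; first by rewrite trmx_eq0.
by apply: (can_inj (@trmxK _ _ _)); rewrite trmx_mul trmxK hv trmx0.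
Qed.

(* A rank-[j] perturbation vanishes somewhere on an isometric subspace of dimension [s > j]. *)
Lemma sval_ge1 n s j (A : 'M[C]_n) (F : 'M[C]_(n, s)) : (j < s)%N ->
  (forall a : 'cV[C]_s, F *m a = 0 -> a = 0) ->
  (forall a : 'cV[C]_s, vnorm (A *m (F *m a)) = vnorm (F *m a)) ->
  1 <= sval j A.
Proof.
move=> js Fi iso; apply: sval_ge => B hB.
have [|a a0 Ba] := @ker_exists _ _ (B *m F).
  by apply: leq_ltn_trans (mxrankM_maxl _ _) _; exact: leq_ltn_trans hB js.
have Fa : 0 < vnorm (F *m a).
  rewrite lt_neqAle vnorm_ge0 andbT eq_sym; apply/eqP => /vnorm_eq0/Fi e.
  by rewrite e eqxx in a0.
apply: mxnorm_ge => M _ /(_ (F *m a)); rewrite mulmxBl [B *m _]mulmxA Ba subr0 iso.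
by rewrite -{1}[vnorm _]mul1r ler_pM2r.
Qed.

Lemma esssupT_le (g : R -> R) (y : \bar R) : aeT (fun t => ((g t)%:E <= y)%E) ->
  (esssupT g <= y)%E.
Proof. by move=> h; exact: ereal_inf_lbound. Qed.

Lemma esssupT_lt (g : R -> R) (y : \bar R) : (esssupT g < y)%E ->
  aeT (fun t => ((g t)%:E < y)%E).
Proof.
move=> /ereal_inf_lt[z hz zy]; apply: aeT_sub hz => t _ h; exact: le_lt_trans h zy.
Qed.

(** The bounds [1 + 1/(k+1)] each hold off a null set, and countably many null sets are
    discarded. *)
Lemma esssupT_le1 (g : R -> R) : (esssupT g <= 1)%E -> aeT (fun t => g t <= 1).
Proof.
move=> h; suff : aeT (fun t => forall k : nat, g t < 1 + k.+1%:R^-1).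
  apply: aeT_sub => t _ hk; apply/ler_addgt0Pl => e e0.
  have [N hN] := inv_small e0.
  by apply: le_trans (ltW (hk N)) _; rewrite addrC lerD2r ltW// hN.
apply: aeT_nat => k.
have : aeT (fun t => ((g t)%:E < (1 + k.+1%:R^-1)%:E)%E).
  by apply: esssupT_lt; apply: le_lt_trans h _; rewrite lte_fin ltrDl invr_gt0.
by apply: aeT_sub => t _; rewrite lte_fin.
Qed.
End SingularValues.

Section NullFunctions.
Variables (R : realType) (n : nat).
Local Notation C := (complex.complex R).
Local Notation V := (R -> 'cV[C]_n).
Local Notation ip := (@ip R n).
Implicit Types (f g m : V) (q : V -> V -> C).
Let L2s := @isL2_linsub R n.
Let ipH := @ip_hform R n.
Let H2s := @H2_linsub R n.
#[local] Opaque fcoef cint isL2 aeT dp.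

Lemma vec_trunc s (sn : (s <= n)%N) (y : 'cV[C]_n) : (forall i : 'I_n, (s <= i)%N -> y i 0 = 0) ->
  y = \sum_(j < s) y (widen_ord sn j) 0 *: delta_mx (widen_ord sn j) 0.
Proof.
move=> h; apply/matrixP => i k; rewrite ord1 summxE.
have [si|is_] := leqP s i.
  rewrite h// big1// => j _; rewrite !mxE.
  have /negPf-> : i != widen_ord sn j.
    by apply/eqP => e; move: si; rewrite e /= leqNgt ltn_ord.
  by rewrite mulr0.
rewrite (bigD1 (Ordinal is_))//= big1 => [|j ji].
  rewrite addr0 !mxE; have -> : widen_ord sn (Ordinal is_) = i by apply/val_inj.
  by rewrite eqxx mulr1.
rewrite !mxE; have /negPf-> : i != widen_ord sn j; last by rewrite mulr0.
by apply: contra ji => /eqP e; apply/eqP/val_inj; rewrite /= e.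
Qed.

Lemma null_basis q s : (s <= n)%N -> spdim q s -> exists f : 'I_s -> V,
  [/\ forall j, H2 (f j), forall j, nq q (f j) = 0,
  forall a : 'I_s -> C, \sum_j a j *: fcoef (f j) 0 = 0 -> forall j, a j = 0 &
  forall m, H2 m -> nq q m = 0 -> exists a : 'I_s -> C, fcoef m 0 = \sum_j a j *: fcoef (f j) 0].
Proof.
move=> sn [X uX hX].
have /choice[f hf] (j : 'I_s) : exists f, [/\ H2 f,
    fcoef f 0 = invmx X *m delta_mx (widen_ord sn j) 0 & nq q f = 0].
  apply/hX => i si; rewrite (mulKVmx uX) mxE.
  have /negPf-> // : i != widen_ord sn j.
  by apply/eqP => e; move: si; rewrite e /= leqNgt ltn_ord.
have sumE (a : 'I_s -> C) : \sum_j a j *: fcoef (f j) 0 =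
    invmx X *m \sum_j a j *: delta_mx (widen_ord sn j) 0.
  rewrite mulmx_sumr; apply: eq_bigr => j _; case: (hf j) => _ -> _.
  by rewrite -scalemxAr.
exists f; split.
- by move=> j; case: (hf j).
- by move=> j; case: (hf j).
- move=> a; rewrite sumE => /(congr1 (mulmx X)); rewrite (mulKVmx uX) mulmx0 => e j.
  have /matrixP/(_ (widen_ord sn j) 0) := e; rewrite summxE [RHS]mxE => <-.
  rewrite (bigD1 j)//= big1 => [|k kj]; first by rewrite !mxE !eqxx mulr1 addr0.
  rewrite !mxE; have /negPf-> : widen_ord sn j != widen_ord sn k; last by rewrite mulr0.
  by apply: contra kj => /eqP e'; apply/eqP/val_inj; exact: (esym (congr1 val e')).
- move=> m hm m0; have fl : flagged X s (fcoef m 0) by apply/hX; exists m.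
  exists (fun j => (X *m fcoef m 0) (widen_ord sn j) 0); rewrite sumE.
  by rewrite -(vec_trunc sn fl) (mulKmx uX).
Qed.

(** By [wandering], an invertible change of columns gives [f(t)] a constant invertible Gram
    matrix. *)
Lemma colmx_inj s (f : 'I_s -> V) : (forall j, H2 (f j)) ->
  (forall a : 'I_s -> C, \sum_j a j *: fcoef (f j) 0 = 0 -> forall j, a j = 0) ->
  aeT (fun t => forall a : 'cV[C]_s, colmx f t *m a = 0 -> a = 0).
Proof.
move=> hf hi; have [g [Gm [_ uG h1 h2]]] := wandering hf hi.
apply: aeT_sub2 h1 h2 => t _ hG [c uc hc] a fa.
have : Gm *m (invmx c *m a) = 0.
  by rewrite -hG -mulmxA hc -[colmx f t *m c *m _]mulmxA (mulKVmx uc) fa mulmx0.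
move=> /(congr1 (mulmx (c *m invmx Gm))); rewrite mulmx0 -mulmxA (mulKmx uG).
by rewrite (mulKVmx uc).
Qed.

(** The defect form: for a contraction its null vectors are those of preserved norm, which therefore
    form a subspace. *)
Definition dform (W : 'M[C]_n) (x y : 'cV[C]_n) := dp x y - dp (W *m x) (W *m y).
Lemma nq_dform W x : nq (dform W) x = vnorm x ^+ 2 - vnorm (W *m x) ^+ 2.
Proof. by rewrite /nq /dform ReD ReN -![Re (dp _ _)]/(nq (@dp R n) _) !nq_dp. Qed.
Lemma dform_hform (W : 'M[C]_n) : (forall x : 'cV[C]_n, vnorm (W *m x) <= vnorm x) ->
  hform (fun _ : 'cV[C]_n => True) (dform W).
Proof.
move=> hW; have dpH := @dp_hform R n; split; first exact: linsubT.
- move=> c x y z _ _ _; rewrite /dform mulmxDr -scalemxAr.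
  rewrite (hformL dpH c Logic.I Logic.I Logic.I) (hformL dpH c Logic.I Logic.I Logic.I).
  ring.
- move=> x y _ _; rewrite /dform conjcD conjcN.
  by rewrite (hformC dpH (g := y) Logic.I Logic.I) (hformC dpH (g := W *m y) Logic.I Logic.I).
- move=> x _; rewrite -/(nq (dform W) x) nq_dform subr_ge0.
  by rewrite ler_pXn2r ?nnegrE ?vnorm_ge0.
Qed.

Lemma isometry_span s (W : 'M[C]_n) (F : 'M[C]_(n, s)) :
  (forall x : 'cV[C]_n, vnorm (W *m x) <= vnorm x) ->
  (forall j, vnorm (W *m col j F) = vnorm (col j F)) ->
  forall a : 'cV[C]_s, vnorm (W *m (F *m a)) = vnorm (F *m a).
Proof.
move=> hW hF a; have N := qnull_linsub (@dp_hform R n) (dform_hform hW).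
have : qnull (fun=> True) (dform W) (F *m a).
  have -> : F *m a = \sum_j a j 0 *: col j F.
    apply/matrixP => i k; rewrite ord1 mxE summxE; apply: eq_bigr => j _.
    by rewrite !mxE mulrC.
  apply: (@subsp_sum _ _ _ _ _ _ _ N) => j _; apply: (subspZ _ N); split => //.
  by rewrite nq_dform hF subrr.
move=> [_]; rewrite nq_dform => /eqP; rewrite subr_eq0 => /eqP e.
by apply: eq_sqr_ge0; rewrite ?vnorm_ge0.
Qed.

Lemma isometry_unitary (W : 'M[C]_n) : (forall x : 'cV[C]_n, vnorm (W *m x) = vnorm x) ->
  ctr W *m W = 1%:M.
Proof.
move=> hW; have dH : hform (fun=> True) (dform W) by apply: dform_hform => x; rewrite hW.
have h (x : 'cV[C]_n) : ctr W *m W *m x = x.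
  apply: dp_eqP => z; rewrite -mulmxA dp_mulmx ctrK; apply/esym/eqP; rewrite -subr_eq0.
  apply/eqP; apply: (hform_null dH (f := x) (g := z) Logic.I Logic.I).
  by rewrite nq_dform hW subrr.
apply/matrixP => i j; have /matrixP/(_ i 0) := h (delta_mx j 0).
by rewrite -colE mxE => ->; rewrite !mxE andbT.
Qed.

Lemma mulfB (F G : R -> 'M[C]_n) f : mulf (fun t => F t - G t) f = mulf F f - mulf G f.
Proof. by apply/funext => t; rewrite /mulf mulmxBl. Qed.

Lemma Pm_mulfB (Phi F : R -> 'M[C]_n) f : Linfty Phi -> Hinf F -> H2 f ->
  aeq (Pm (mulf Phi f)) (Pm (mulf (fun t => Phi t - F t) f)).
Proof.
move=> hPhi hF hf; have h1 := isL2_mulf hPhi (H2_L2 hf); have h2 := H2_mulf hF hf.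
rewrite mulfB; apply: aeq_sym.
have -> : mulf Phi f - mulf F f = (-1) *: mulf F f + mulf Phi f by rewrite scaleN1r addrC.
apply: aeq_trans (Pm_linear (-1) (H2_L2 h2) h1) _.
by apply: aeT_sub (Pm_eq0 h2) => t _ e; rewrite !fctE e scaler0 add0r.
Qed.

Lemma LinftyB (F G : R -> 'M[C]_n) : Linfty F -> Linfty G -> Linfty (fun t => F t - G t).
Proof.
move=> [m1 [K hK]] [m2 [L hL]]; split.
  move=> i j; have -> : (fun t => (F t - G t) i j) = (fun t => F t i j - G t i j).
    by apply/funext => t; rewrite !mxE.
  exact: cmeasB.
exists (K + L); apply: aeT_sub2 hK hL => t _ h1 h2 i j; rewrite !mxE.
by apply: le_trans (cabsD _ _) _; rewrite cabsN lerD.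
Qed.

(** With [W = Phi - F], [|f| = |P_- W f| <= |W f| <= |f|] in [L^2]; equal integrals together with a
    pointwise inequality force pointwise equality. *)
Lemma null_isometry (Phi F : R -> 'M[C]_n) f : Linfty Phi -> Hinf F -> H2 f ->
  nq (qf ip (fun f => Pm (mulf Phi f))) f = 0 ->
  aeT (fun t => forall x, vnorm ((Phi t - F t) *m x) <= vnorm x) ->
  aeT (fun t => vnorm ((Phi t - F t) *m f t) = vnorm (f t)).
Proof.
move=> hPhi hF hf q0 hc; have hL := LinftyB hPhi (proj1 hF).
have WL := isL2_mulf hL (H2_L2 hf); have fL := H2_L2 hf.
have e1 : nq ip f <= nq ip (mulf (fun t => Phi t - F t) f).
  move: q0; rewrite nq_qf => /eqP; rewrite subr_eq0 => /eqP ->.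
  rewrite (nq_aeq (Pm_L2 (isL2_mulf hPhi fL)) (Pm_L2 WL) (Pm_mulfB hPhi hF hf)).
  exact: nq_Pm_le.
have [_ I1] := (proj1 (isL2P _) fL); have [_ I2] := proj1 (isL2P _) WL.
have pos : aeT (fun t => 0 <= vnorm (f t) ^+ 2 - vnorm (mulf (fun t => Phi t - F t) f t) ^+ 2).
  apply: aeT_sub hc => t _ h; rewrite subr_ge0 ler_pXn2r ?nnegrE ?vnorm_ge0//.
  exact: h.
have := rint_eq0 (rIB I1 I2) pos.
rewrite (rintB I1 I2) -!nq_ip => h.
have {}h := h (ltac:(apply/eqP; rewrite subr_eq0 eq_le e1 -subr_ge0 !nq_ip -(rintB I1 I2); exact: (rint_ge0 (rIB I1 I2) pos))).
apply: aeT_sub h => t _ /eqP; rewrite subr_eq0 => /eqP e.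
by apply: eq_sqr_ge0; rewrite ?vnorm_ge0// -e.
Qed.

Lemma wform1 : wform (fun=> 1%:M : 'M[C]_n) = ip.
Proof.
have e f : mulf (fun=> 1%:M) f = f by apply/funext => t; rewrite /mulf mul1mx.
by apply/funext => f; apply/funext => g; rewrite /wform !e.
Qed.

Lemma Linfty_cst (M : 'M[C]_n) : Linfty (fun=> M).
Proof.
split; first by move=> i j; exact: cmeas_cst.
exists (\sum_i \sum_j cabs (M i j)); apply: aeT_all => t _ i j.
rewrite (bigD1 i)//= (bigD1 j)//= -addrA lerDl.
apply: addr_ge0; first by apply: sumr_ge0 => *; exact: cabs_ge0.
by apply: sumr_ge0 => *; apply: sumr_ge0 => *; exact: cabs_ge0.
Qed.

Lemma hankel_contractive (Phi : R -> 'M[C]_n) : Linfty Phi -> hankel_norm_le Phi 1 ->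
  forall f, H2 f -> nq ip (Pm (mulf Phi f)) <= nq ip f.
Proof.
move=> hPhi h f hf; have L := isL2_mulf hPhi (H2_L2 hf).
have := h f hf _ (PmP L); rewrite mul1r !l2normE.
rewrite -(ler_pXn2r (n := 2)) ?nnegrE ?nrm_ge0//.
by rewrite (nrm2 ipH (Pm_L2 L)) (nrm2 ipH (H2_L2 hf)).
Qed.

(** From [|H v| <= c |v| + |K v|], where [K v] is small for differences [v] along a subsequence; the
    coercivity constant is [1 - c^2]. *)
Lemma hankel_ess_form (Phi : R -> 'M[C]_n) : Linfty Phi -> ess_hankel_lt1 Phi ->
  ess_form (@H2 R n) ip (qf ip (fun f => Pm (mulf Phi f))).
Proof.
move=> hPhi [K [[Km Kae Klin Kc] [c0 [c01 hc0]]]].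
(* The given bound [c0] may be negative. *)
pose c := Num.max c0 0; have c1 : c < 1 by rewrite /c gt_max c01 ltr01.
have cp : 0 <= c by rewrite /c le_max lexx orbT.
exists (1 - c ^+ 2); first by rewrite subr_gt0 expr_lt1.
move=> u hu [M hM].
have hM0 : 0 <= M by apply: le_trans (hM 0%N); exact: (nq_ge0 ipH (H2_L2 (hu 0%N))).
have [|phi [phiI hphi]] := Kc u hu.
  by exists (Num.sqrt M) => k; rewrite l2normE /nrm ler_sqrt.
exists phi; split => // e e0.
(* [L] bounds the norm [x] of a difference, and [(c x + d)^2 <= c^2 x^2 + 2 L d + d^2]; the excess
   is at most [e] once [d <= 1] and [d (2 L + 1) <= e]. *)
pose L := 2 * Num.sqrt M; have L0 : 0 <= L by rewrite mulr_ge0// sqrtr_ge0.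
pose d := Num.min 1 (e / (2 * L + 1)).
have den0 : 0 < 2 * L + 1 by lra.
have d0 : 0 < d by rewrite /d lt_min ltr01 divr_gt0.
have [N hN] := hphi d d0; exists N => p q Np Nq.
set v := u (phi p) - u (phi q).
have hv : H2 v := subspB H2s (hu _) (hu _).
have vL := H2_L2 hv; have PL := isL2_mulf hPhi vL.
have KL w : H2 w -> isL2 (K w) by move=> /Km/H2minus_L2.
have HL := Pm_L2 PL.
have kv : nrm ip (K v) < d.
  have := hN p q Np Nq; rewrite l2normE.
  suff -> : nrm ip (K v) = nrm ip (fun t => K (u (phi p)) t - K (u (phi q)) t) by [].
  rewrite /nrm; congr Num.sqrt; apply: (nq_aeq (KL _ hv)).
    exact: (subspB L2s (KL _ (hu (phi p))) (KL _ (hu (phi q)))).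
  have := Klin 1 (-1) _ _ (hu (phi p)) (hu (phi q)).
  have -> : (fun s => 1 *: u (phi p) s + -1 *: u (phi q) s) = v.
    by apply/funext => s; rewrite scale1r scaleN1r.
  by apply: aeT_sub => t _; rewrite scale1r scaleN1r.
have vb : nrm ip v <= L.
  apply: le_trans (nrmB ipH (H2_L2 (hu _)) (H2_L2 (hu _))) _.
  rewrite /L mulrDl mul1r; apply: lerD; rewrite /nrm ler_sqrt//; exact: hM.
have hb : nrm ip (Pm (mulf Phi v)) <= c * nrm ip v + d.
  have := hc0 v hv _ (PmP PL); rewrite !l2normE => h.
  have -> : Pm (mulf Phi v) = (Pm (mulf Phi v) - K v) + K v by rewrite subrK.
  apply: le_trans (nrmD ipH (subspB L2s HL (KL _ hv)) (KL _ hv)) _.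
  apply: lerD; last exact: ltW.
  by apply: le_trans h _; rewrite ler_wpM2r ?nrm_ge0// /c le_max lexx.
rewrite nq_qf -(nrm2 ipH vL) -(nrm2 ipH HL).
have dL : d * (2 * L + 1) <= e.
  by rewrite -ler_pdivlMr// /d ge_min lexx orbT.
have d1 : d <= 1 by rewrite /d ge_min lexx.
have := nrm_ge0 ip v; have := nrm_ge0 ip (Pm (mulf Phi v)).
move: (nrm ip v) (nrm ip (Pm _)) vb hb d0 dL d1 L0 cp c1 => x y.
move: (d) (L) (c) => d' L' c' xL yb d0 dL d1 L0 cp c1 y0 x0.
have : y ^+ 2 <= (c' * x + d') ^+ 2 by rewrite ler_pXn2r// nnegrE; nra.
have : c' * x * d' <= L' * d' by rewrite ler_pM2r//; nra.
nra.
Qed.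

Lemma ess_form_ge (q q' : V -> V -> C) (a : R) : 0 < a ->
  (forall f, H2 f -> a * nq q f <= nq q' f) ->
  ess_form (@H2 R n) ip q -> ess_form (@H2 R n) ip q'.
Proof.
move=> a0 h [d d0 hd]; exists (a * d); first exact: mulr_gt0.
move=> u hu hM; have [phi [phiI hp]] := hd u hu hM; exists phi; split => // e e0.
have [N hN] := hp (e / a) (divr_gt0 e0 a0); exists N => k l Nk Nl.
have h1 := hN k l Nk Nl; have h2 := h _ (subspB H2s (hu (phi k)) (hu (phi l))).
apply: le_trans (lerD h2 (lexx e)).
have -> : e = a * (e / a) by rewrite mulrCA divff ?mulr1// gt_eqF.
by rewrite -mulrDr -mulrA ler_wpM2l// ltW.
Qed.
End NullFunctions.

(** * Projections, and exceptional points on the circle *)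

Section OrthogonalProjection.
Variable R : realType.
Local Notation C := (complex.complex R).

Lemma gram_proj n s (G : 'M[C]_(n, s)) (Gm : 'M[C]_s) : Gm \in unitmx -> ctr G *m G = Gm ->
  let P := G *m invmx Gm *m ctr G in [/\ P *m P = P, ctr P = P & P *m G = G].
Proof.
move=> uG hG P; have PG : P *m G = G by rewrite /P -mulmxA hG mulmxKV.
split => //; first by rewrite {2}/P !mulmxA PG.
have hGc : ctr Gm = Gm by rewrite -hG ctrM ctrK.
have e : ctr (invmx Gm) = invmx Gm.
  have : ctr (invmx Gm) *m Gm = 1%:M by rewrite -{2}hGc -ctrM mulmxV// ctr1.
  by move=> /(congr1 (mulmx^~ (invmx Gm))); rewrite -mulmxA mulmxV// mulmx1 mul1mx.
by rewrite /P !ctrM ctrK e mulmxA.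
Qed.

Lemma proj_pyth n (P : 'M[C]_n) (c : C) (x : 'cV[C]_n) : P *m P = P -> ctr P = P ->
  vnorm (P *m x + c *: (x - P *m x)) ^+ 2 =
  vnorm (P *m x) ^+ 2 + cabs c ^+ 2 * vnorm (x - P *m x) ^+ 2.
Proof.
move=> PP cP; have dpH := @dp_hform R n.
have o : dp (P *m x) (x - P *m x) = 0.
  rewrite dp_mulmx cP mulmxBr mulmxA PP subrr.
  by rewrite -(scale0r (0 : 'cV[C]_n)) (hformZr dpH) // conjc0 mul0r.
rewrite -!nq_dp (nqD dpH Logic.I Logic.I) (nqZ dpH _ Logic.I).
by rewrite (hformZr dpH _ Logic.I Logic.I) o mulr0 mulr0 addr0.
Qed.

Lemma vnorm_delta n (i : 'I_n) : vnorm (delta_mx i 0 : 'cV[C]_n) = 1.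
Proof.
apply: eq_sqr_ge0; rewrite ?vnorm_ge0// expr1n -nq_dp /nq dp_delta mxE !eqxx; reflexivity.
Qed.

Lemma Linfty_contr n (A : R -> 'M[C]_n) : (forall i j, cmeas (fun t => A t i j)) ->
  aeT (fun t => forall x, vnorm (A t *m x) <= vnorm x) -> Linfty A.
Proof.
move=> hm hc; split => //; exists 1; apply: aeT_sub hc => t _ h i j.
have -> : A t i j = (A t *m (delta_mx j 0 : 'cV[C]_n)) i 0 by rewrite -colE mxE.
by apply: le_trans (cabs_le_vnorm _ _) _; apply: le_trans (h _) _; rewrite vnorm_delta.
Qed.

Lemma aeT_zeta_neq (z : C) : aeT (fun t => zeta t != z).
Proof.
have [[t0 [I0 e0]]|no] := pselect (exists t0, @I01 R t0 /\ zeta t0 = z); last first.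
  by apply: aeT_all => t It; apply/eqP => e; apply: no; exists t.
(* Both endpoints of [0, 1] parametrize the same point, whence the exclusion of [t0 + 1] and
   [t0 - 1]. *)
apply: aeT_sub3 (aeT_neq t0) (aeT_neq (t0 + 1)) (aeT_neq (t0 - 1)) => t It n0 n1 n2.
apply/eqP => e; have d : zeta (t - t0) = 1.
  have : zeta (t - t0) * zeta t0 = zeta t by rewrite -zetaD subrK.
  by rewrite e e0 => h; apply: (mulIf (zeta_neq0 t0)); rewrite e0 h mul1r.
have c1 : cos (2 * pi * (t - t0)) = 1 by have := congr1 (@Re R) d.
have a0 : 0 < `|t - t0| by rewrite normr_gt0 subr_eq0; apply/eqP.
have a1 : `|t - t0| < 1 - 0.
  move: It I0; rewrite /I01/= !in_itv/= => /andP[p1 p2] /andP[p3 p4].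
  rewrite subr0 lt_neqAle ler_norml; apply/and3P; split; [|lra|lra].
  apply/eqP; case: (ger0P (t - t0)) => _ h; [apply: n1|apply: n2]; lra.
have := cos_cmp_out (lexx 0) a0 a1.
by rewrite c1 mulr0 cos0 ltxx.
Qed.

Lemma aeT_poly_neq0 (p : {poly C}) : p != 0 -> aeT (fun t => p.[zeta t] != 0).
Proof.
move=> p0; have [r hr] := closed_field_poly_normal p.
suff : aeT (fun t => forall i : 'I_(size r), zeta t != r`_i).
  apply: aeT_sub => t _ h; rewrite hr hornerZ mulf_neq0 ?lead_coef_eq0//.
  rewrite -/(root _ _) root_prod_XsubC; apply/negP => /nthP-/(_ 0)[i ir e].
  by have := h (Ordinal ir); rewrite /= e eqxx.
by apply: aeT_cnt => i; exact: aeT_zeta_neq.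
Qed.

(** The determinant is a polynomial in [zeta t] with value 1 at 0, so it has finitely many roots. *)
Lemma aeT_unit_pencil d (T : 'M[C]_d) : aeT (fun t => (1%:M - zeta t *: T) \in unitmx).
Proof.
pose M : 'M[{poly C}]_d := 1%:M - 'X *: map_mx polyC T.
have ev z : (\det M).[z] = \det (1%:M - z *: T).
  rewrite -[LHS]/(horner_eval z (\det M)) -det_map_mx; congr (\det _).
  have map1 : map_mx (horner_eval z) (1%:M : 'M[{poly C}]_d) = 1%:M by exact: map_mx1.
  rewrite /M map_mxB map1 map_mxZ /= /horner_eval hornerX -map_mx_comp; congr (_ - _ *: _).
  by apply/matrixP => i j; rewrite mxE /= hornerC.
have M0 : \det M != 0.
  apply/eqP => e; have := ev 0; rewrite e horner0 scale0r subr0 det1 => /esym/eqP.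
  by rewrite oner_eq0.
apply: aeT_sub (aeT_poly_neq0 M0) => t _; rewrite ev => h.
by rewrite unitmxE unitfE.
Qed.
End OrthogonalProjection.

(** * Singular values of interpolants *)

Section SuperoptimalValues.
Variables (R : realType) (n : nat).
Local Notation C := (complex.complex R).
Local Notation V := (R -> 'cV[C]_n).
Local Notation ip := (@ip R n).
Implicit Types (f g m : V).
Let L2s := @isL2_linsub R n.
Let ipH := @ip_hform R n.
#[local] Opaque fcoef cint isL2 aeT dp.

Lemma col_colmx k (f : 'I_k -> V) t j : col j (colmx f t) = f j t.
Proof. by apply/matrixP => a b; rewrite 2!mxE ord1. Qed.

Lemma col_mulmx p k l (A : 'M[C]_(p, k)) (B : 'M[C]_(k, l)) j : col j (A *m B) = A *m col j B.
Proof. by rewrite !colE mulmxA. Qed.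

Lemma eq_col p k (A B : 'M[C]_(p, k)) : (forall j, col j A = col j B) -> A = B.
Proof.
by move=> h; apply/matrixP => i j; have /matrixP/(_ i 0) := h j; rewrite 2!mxE.
Qed.

Variables (Phi : R -> 'M[C]_n) (s : nat).
Hypothesis hPhi : Linfty Phi.
Let H f := Pm (mulf Phi f).
Hypothesis hc : forall f, H2 f -> nq ip (H f) <= nq ip f.
Let q := qf ip H.
Hypothesis hess : ess_form (@H2 R n) ip q.
Hypotheses (sn : (s <= n)%N) (sp : spdim q s).

Lemma sval_interpolant_ge1 F j : (j < s)%N -> Hinf F ->
  aeT (fun t => forall x, vnorm ((Phi t - F t) *m x) <= vnorm x) ->
  aeT (fun t => 1 <= sval j (Phi t - F t)).
Proof.
move=> js hF hW; have [f [fH f0 fi _]] := null_basis sn sp.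
have iso : aeT (fun t => forall j, vnorm ((Phi t - F t) *m f j t) = vnorm (f j t)).
  by apply: aeT_cnt => k; exact: (null_isometry hPhi hF (fH k) (f0 k) hW).
apply: aeT_sub3 hW iso (colmx_inj fH fi) => t _ h1 h2 h3.
apply: (@sval_ge1 _ _ s j _ (colmx f t) js h3); apply: isometry_span => // k.
by rewrite col_colmx.
Qed.

Let hH : hankel H. Proof. exact: mulf_hankel. Qed.
Let qH : hform (@H2 R n) q. Proof. exact: (qf_hform (ip_H2_hform R n) hH hc). Qed.
Let q_bound f : H2 f -> nq q f <= 1 * nq ip f.
Proof. by apply: qf_bound => // g _; rewrite mul1r. Qed.

(** Subtracting from a basis element [e_i] of the null space the combination of the [f_j] with the
    same value at 0 leaves [z] times a null function, which is again a combination of the [e_l]. So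
    [e(t) = f(t) a + zeta e(t) T] with constant matrices [a] and [T], and [1 - zeta T] is invertible
    almost everywhere. *)
Lemma null_pointwise (f : 'I_s -> V) : (forall j, H2 (f j)) -> (forall j, nq q (f j) = 0) ->
  (forall m, H2 m -> nq q m = 0 -> exists a : 'I_s -> C, fcoef m 0 = \sum_j a j *: fcoef (f j) 0) ->
  forall m, qnull (@H2 R n) q m -> aeT (fun t => exists b, m t = colmx f t *m b).
Proof.
move=> fH f0 fspan; have N := qnull_linsub (ip_H2_hform R n) qH.
have [d [e [eN eo eb]]] := ess_null_findim (ip_H2_hform R n) qH hess.
have eH i : H2 (e i) by case: (eN i).
have lcH (a : 'I_s -> C) : qnull (@H2 R n) q (\sum_j a j *: f j).
  by apply: (@subsp_sum _ _ _ _ _ _ _ N) => j _; apply: (subspZ _ N); split.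
have fcoef_lin (a : 'I_s -> C) : fcoef (\sum_j a j *: f j) 0 = \sum_j a j *: fcoef (f j) 0.
  elim: (index_enum _) => [|j r IH]; first by rewrite !big_nil fcoef0.
  rewrite !big_cons -IH; apply: (fcoefL 0 (a j) (H2_L2 (fH j))).
  by apply: (@subsp_sum _ _ (@isL2 R n) _ _ _ _ L2s) => i _; exact: (subspZ _ L2s (H2_L2 (fH i))).
have /choice[a ha] i : exists a : 'I_s -> C, fcoef (e i) 0 = \sum_j a j *: fcoef (f j) 0.
  by apply: fspan; case: (eN i).
pose r i := e i - \sum_j a i j *: f j.
have rN i : qnull (@H2 R n) q (r i) by exact: (subspB N (eN i) (lcH _)).
have rz i : zH2 (r i).
  split; first by case: (rN i).
  by rewrite /r (fcoefB 0 (H2_L2 (eH i)) (H2_L2 (proj1 (lcH (a i))))) fcoef_lin ha subrr.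
pose m' i := zs (-1) (r i).
have mH i : H2 (m' i) := zH2_zsN (rz i).
have rE i : r i = zs 1 (m' i) by rewrite /m' (zsK 1).
have mN i : qnull (@H2 R n) q (m' i).
  split => //; have := nq_zs1 (fun f g _ _ => ip_zs 1 f g) hH (mH i).
  rewrite -rE (proj2 (rN i)) => e0.
  have := nq_ge0 qH (mH i); have := sqr_ge0 (vnorm (hcoef H (m' i))).
  move: e0; rewrite -/q; move: (nq q _) (_ ^+ 2) => x y; lra.
pose Tm : 'M[C]_d := \matrix_(l, i) ip (m' i) (e l).
pose Am : 'M[C]_(s, d) := \matrix_(j, i) a i j.
have rel : aeT (fun t => forall i, e i t = \sum_j a i j *: f j t +
    zeta t *: \sum_l ip (m' i) (e l) *: e l t).
  apply: aeT_cnt => i.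
  have sL : isL2 (\sum_l ip (m' i) (e l) *: e l).
    by apply: (@subsp_sum _ _ (@isL2 R n) _ _ _ _ L2s) => l _; exact: (subspZ _ L2s (H2_L2 (eH l))).
  apply: aeT_sub (nqB_aeq (H2_L2 (mH i)) sL (eb _ (mN i))) => t _ h.
  have e1 : e i = \sum_j a i j *: f j + zs 1 (m' i) by rewrite -rE addrC /r subrK.
  have e2 := congr1 (fun u : V => u t) e1; rewrite /= in e2; rewrite e2.
  rewrite -[LHS]/((\sum_j a i j *: f j) t + zs 1 (m' i) t) fct_sumE; congr (_ + _).
  by rewrite /zs expr1z h fct_sumE.
move=> m hm.
have sL : isL2 (\sum_i ip m (e i) *: e i).
  by apply: (@subsp_sum _ _ (@isL2 R n) _ _ _ _ L2s) => l _; exact: (subspZ _ L2s (H2_L2 (eH l))).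
have hm' := nqB_aeq (H2_L2 (proj1 hm)) sL (eb _ hm).
apply: aeT_sub3 rel (aeT_unit_pencil Tm) hm' => t _ h u ->.
have E : colmx e t = colmx f t *m (Am *m invmx (1%:M - zeta t *: Tm)).
  rewrite mulmxA; apply: (can_inj (mulmxK u)); rewrite (mulmxKV u).
  rewrite mulmxBr mulmx1 -scalemxAr; apply/eqP; rewrite subr_eq; apply/eqP.
  apply: eq_col => k; rewrite linearD linearZ /= !col_mulmx !colmx_mul col_colmx h.
  by congr (_ + _ *: _); apply: eq_bigr => j _; rewrite [col k _ j 0]mxE mxE.
exists (Am *m invmx (1%:M - zeta t *: Tm) *m \col_i ip m (e i)).
rewrite mulmxA -E colmx_mul fct_sumE; apply: eq_bigr => i _; by rewrite mxE.
Qed.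

(** [P(t)] projects onto the span of the null functions at [t], so by coercivity [q] dominates
    [d |(1 - P) f|^2]. The norm may then be shrunk by [c < 1] on the complement without losing
    positivity: the weight is [A = P + c(1 - P)]. The resulting [W] satisfies [|W x| <= |A x|],
    hence is within [c] of [W P], whose rank is at most [s]. *)
Lemma strict_interpolant : exists F (c : R), [/\ c < 1, Hinf F,
  aeT (fun t => forall x, vnorm ((Phi t - F t) *m x) <= vnorm x) &
  aeT (fun t => sval s (Phi t - F t) <= c)].
Proof.
have [f [fH f0 fi fspan]] := null_basis sn sp.
have [g [Gm [gH uG hG hgf]]] := wandering fH fi.
pose P t := colmx g t *m invmx Gm *m ctr (colmx g t).
have hP : aeT (fun t => [/\ P t *m P t = P t, ctr (P t) = P t & P t *m colmx g t = colmx g t]).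
  by apply: aeT_sub hG => t _ e; exact: (gram_proj uG e).
have gm i j : cmeas (fun t => colmx g t i j).
  have -> : (fun t => colmx g t i j) = (fun t => g j t i 0) by apply/funext => t; rewrite mxE.
  by have [h _] := proj1 (isL2P _) (H2_L2 (gH j)); exact: h.
have Pm_ i j : cmeas (fun t => P t i j).
  have -> : (fun t => P t i j) = (fun t => \sum_k (\sum_l colmx g t i l * invmx Gm l k) *
      conjc (colmx g t j k)).
    apply/funext => t; rewrite mxE; apply: eq_bigr => k _; rewrite mxE; congr (_ * _).
    by rewrite [LHS]mxE [X in conjc X]mxE.
  apply: cmeas_sum => k; apply: cmeasM; last exact: cmeasJ.
  by apply: cmeas_sum => l; apply: cmeasM => //; exact: cmeas_cst.
have mcP : aeT (fun t => forall x, vnorm ((1%:M - P t) *m x) <= vnorm x).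
  apply: aeT_sub hP => t _ [PP cP _] x; rewrite mulmxBl mul1mx.
  rewrite -(ler_pXn2r (n := 2)) ?nnegrE ?vnorm_ge0//.
  have := proj_pyth 1 x PP cP; rewrite cabs1 expr1n mul1r scale1r addrC subrK => ->.
  by rewrite lerDr sqr_ge0.
have mcm i j : cmeas (fun t => (1%:M - P t) i j).
  have -> : (fun t => (1%:M - P t) i j) = (fun t => (1%:M : 'M[C]_n) i j - P t i j).
    by apply/funext => t; rewrite [LHS]mxE [X in _ + X = _]mxE.
  by apply: cmeasB => //; exact: cmeas_cst.
have mcP1 : aeT (fun t => forall x, vnorm ((1%:M - P t) *m x) <= 1 * vnorm x).
  by apply: aeT_sub mcP => t _ h x; rewrite mul1r.
have LQ := Linfty_contr mcm mcP.
have Pnull m : qnull (@H2 R n) q m -> aeq (mulf (fun t => 1%:M - P t) m) 0.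
  move=> hm; apply: aeT_sub3 hP hgf (null_pointwise fH f0 fspan hm) => t _ [_ _ PG] [c uc hc'] [b hb].
  have -> : mulf (fun t => 1%:M - P t) m t = (1%:M - P t) *m m t by [].
  have e : m t = colmx g t *m (invmx c *m b) by rewrite hb hc' -mulmxA (mulKVmx uc).
  by rewrite e mulmxA mulmxBl mul1mx PG subrr mul0mx.
have [d d0 dec] := ess_decomp (ip_H2_hform R n) qH (@H2_complete R n) q_bound hess.
have defect h : H2 h -> d * nq ip (mulf (fun t => 1%:M - P t) h) <= nq q h.
  move=> hh; have [m hm [_ le]] := dec h hh; apply: le_trans le.
  have hmL := H2_L2 (proj1 hm); have hhL := H2_L2 hh.
  rewrite (ler_pM2l d0); have hd := subspB L2s hhL hmL.
  have [L1 le1] := isL2_mulf_bound mcm (@ler01 R) mcP1 hd.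
  apply: le_trans (le_trans le1 _); last by rewrite expr1n mul1r.
  suff -> : nq ip (mulf (fun t => 1%:M - P t) h) = nq ip (mulf (fun t => 1%:M - P t) (h - m)) by [].
  apply: (nq_aeq (isL2_mulf LQ hhL) L1).
  apply: aeT_sub (Pnull m hm) => t _ e; rewrite /mulf.
  rewrite -[(h - m) t]/(h t - m t) mulmxBr.
  by move: e; rewrite /mulf => ->; rewrite subr0.
(* With [c^2 = 1 - k] one has [|A x|^2 = |x|^2 - k |(1 - P) x|^2]. The bound [d / 2] leaves half of
   [q], and [1/2] keeps [1 - k] positive. *)
pose k := Num.min (d / 2) (2^-1); have k0 : 0 < k by rewrite lt_min; apply/andP; split; lra.
have k1 : k <= 2^-1 by rewrite ge_min lexx orbT.
have kd : k <= d / 2 by rewrite ge_min lexx.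
pose c := Num.sqrt (1 - k); have c2 : c ^+ 2 = 1 - k by apply: sqr_sqrtr; lra.
have c0 : 0 <= c := sqrtr_ge0 _.
have c1 : c < 1 by rewrite -(ltr_pXn2r (n := 2)) ?nnegrE// c2 expr1n; lra.
pose A t := P t + real_complex R c *: (1%:M - P t).
have AE t x : A t *m x = P t *m x + real_complex R c *: (x - P t *m x).
  by rewrite /A mulmxDl -scalemxAl mulmxBl mul1mx.
have An : aeT (fun t => forall x, vnorm (A t *m x) ^+ 2 =
    vnorm x ^+ 2 - k * vnorm ((1%:M - P t) *m x) ^+ 2).
  apply: aeT_sub hP => t _ [PP cP _] x; rewrite AE (proj_pyth _ x PP cP).
  have := proj_pyth 1 x PP cP; rewrite cabs1 expr1n mul1r scale1r [P t *m x + _]addrC subrK => ->.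
  rewrite mulmxBl mul1mx cabs_real (ger0_norm c0) c2.
  move: (_ ^+ 2) (_ ^+ 2) => a b; lra.
have Ac : aeT (fun t => forall x, vnorm (A t *m x) <= vnorm x).
  apply: aeT_sub An => t _ h x; rewrite -(ler_pXn2r (n := 2)) ?nnegrE ?vnorm_ge0// h gerBl.
  by apply: mulr_ge0; [exact: ltW|exact: sqr_ge0].
have Am i j : cmeas (fun t => A t i j).
  have -> : (fun t => A t i j) = (fun t => P t i j + real_complex R c * (1%:M - P t) i j).
    by apply/funext => t; rewrite [LHS]mxE [X in _ + X = _]mxE.
  by apply: cmeasD => //; apply: cmeasM => //; exact: cmeas_cst.
have LA := Linfty_contr Am Ac.
have nqA h : H2 h -> nq ip (mulf A h) = nq ip h - k * nq ip (mulf (fun t => 1%:M - P t) h).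
  move=> hh; have hhL := H2_L2 hh.
  have [_ I1] := proj1 (isL2P _) hhL.
  have [_ I2] := proj1 (isL2P _) (isL2_mulf LQ hhL).
  have [_ I3] := proj1 (isL2P _) (isL2_mulf LA hhL).
  rewrite !nq_ip -(rintZ k I2) -(rintB I1 (rIZ k I2)).
  apply: rint_ae; [exact: (rI_meas I3)|exact: (rI_meas (rIB I1 (rIZ k I2)))|].
  by apply: aeT_sub An => t _ h'; exact: h'.
have qA h : H2 h -> 2^-1 * nq q h <= nq (qf (wform A) H) h.
  move=> hh; have := defect h hh; rewrite 2!nq_qf.
  rewrite [nq (wform A) h](nqA h hh).
  have := nq_ge0 ipH (isL2_mulf LQ (H2_L2 hh)).
  move: (nq ip (mulf _ h)) (nq ip h) (nq ip (H h)) => y x z y0 h1.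
  have : k * y <= d / 2 * y by rewrite ler_wpM2r.
  lra.
have hcA h : H2 h -> nq ip (H h) <= nq ip (mulf A h).
  move=> hh; have := qA h hh; have := nq_ge0 qH hh; rewrite 2!nq_qf -[nq (wform A) h]/(nq ip (mulf A h)).
  move: (nq ip _) (nq ip _) (nq ip _) => x y z; lra.
have hessA : ess_form (@H2 R n) ip (qf (wform A) H).
  by apply: (@ess_form_ge _ _ q _ 2^-1) => //; rewrite invr_gt0.
have [K hK] := wform_bound LA.
have [s0 s0n sp0] := spdim_exists (wform_hform LA) hK (And3 hH hcA hessA).
have [W [LW WA hF _]] := extension (s_ := fun=> s0) LA hPhi hcA hessA sp0 (fun=> leqnn _) (fun=> s0n).
exists (fun t => Phi t - W t), c; split; [exact: c1|exact: hF| |].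
  apply: aeT_sub2 WA Ac => t _ h1 h2 x; rewrite opprB addrC subrK.
  exact: le_trans (h1 x) (h2 x).
apply: aeT_sub3 WA hP mcP => t _ h1 [PP cP _] h2; rewrite opprB addrC subrK.
apply: le_trans (sval_le (B := W t *m P t) _ _) _.
  apply: leq_trans (mxrankM_maxr _ _) _; apply: leq_trans (mxrankM_maxl _ _) _.
  by apply: leq_trans (mxrankM_maxr _ _) _; exact: rank_leq_row.
apply: mxnorm_le => // x; rewrite -{1}[W t]mulmx1 -mulmxBr -mulmxA.
apply: le_trans (h1 _) _; rewrite AE !mulmxA mulmxBr mulmx1 PP subrr mul0mx subr0 add0r.
by rewrite vnormZ cabs_real (ger0_norm c0) ler_wpM2l.
Qed.
End SuperoptimalValues.

Section NumberOfUnitValues.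
Variables (R : realType) (n : nat).
Local Notation C := (complex.complex R).
Local Notation V := (R -> 'cV[C]_n).
Local Notation ip := (@ip R n).
#[local] Opaque fcoef cint isL2 aeT dp.

Variables (Phi : R -> 'M[C]_n) (s : nat).
Hypothesis hPhi : Linfty Phi.
Hypothesis hc : forall f : V, H2 f -> nq ip (Pm (mulf Phi f)) <= nq ip f.
Hypothesis hess : ess_form (@H2 R n) ip (qf ip (fun f => Pm (mulf Phi f))).
Hypotheses (sn : (s <= n)%N) (sp : spdim (qf ip (fun f => Pm (mulf Phi f))) s).

Let ball F := Hinf F /\ aeT (fun t => forall x, vnorm ((Phi t - F t) *m x) <= vnorm x).
Let ess j F := esssupT (fun t => sval j (Phi t - F t)).

Lemma ess0_contr F : (ess 0 F <= 1)%E ->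
  aeT (fun t => forall x, vnorm ((Phi t - F t) *m x) <= vnorm x).
Proof.
move=> /esssupT_le1; apply: aeT_sub => t _; rewrite sval0E => h x.
apply: le_trans (vnorm_mxnorm _ _) _; rewrite -[leRHS]mul1r ler_wpM2r//; exact: vnorm_ge0.
Qed.

Lemma ess_ball F j : (j < s)%N -> ball F -> ess j F = 1%E.
Proof.
move=> js [hF h]; apply/eqP; rewrite eq_le; apply/andP; split.
  by apply: esssupT_le; apply: aeT_sub h => t _ h'; rewrite lee_fin; exact: sval_le1.
rewrite leNgt; apply/negP => /esssupT_lt h1.
have : aeT (fun _ : R => False).
  apply: aeT_sub2 h1 (sval_interpolant_ge1 hPhi sn sp js hF h) => t _.
  by rewrite lte_fin ltNge => /negP.
by move=> /aeT_ex[].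
Qed.

(** At every level below [s] each contractive interpolant has essential supremum exactly 1, so
    minimizing there discards none of them; [strict_interpolant] shows that there is one. *)
Lemma OmegaP_ball j : (j < s)%N -> superopt_sv Phi j = 1%E /\
  forall F, OmegaP Phi j.+1 F <-> ball F.
Proof.
have [F0 [c [_ hF0 cF0 _]]] := strict_interpolant hPhi hc hess sn sp.
have bF0 : ball F0 by [].
have main i : (i < s)%N -> (forall F, ball F -> OmegaP Phi i F) ->
  (forall F, OmegaP Phi i F -> (1 <= ess i F)%E) -> superopt_sv Phi i = 1%E.
  move=> is_ h1 h2; apply/eqP; rewrite eq_le; apply/andP; split.
    by rewrite -(ess_ball is_ bF0); apply: ereal_inf_lbound; exists F0 => //; exact: h1.
  by apply: le_ereal_inf_tmp => y [F hF <-]; exact: h2.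
elim: j => [s0|j IH js].
  have t0 : superopt_sv Phi 0 = 1%E.
    apply: (main 0%N s0) => [F [hF _]|F hF]; [exact: hF|rewrite leNgt; apply/negP => lt].
    have bF : ball F by split; [exact: hF|]; exact: (ess0_contr (ltW lt)).
    by move: lt; rewrite (ess_ball s0 bF) ltxx.
  split; [exact: t0|move=> F; split=> [[hF e]|bF]].
    split; [exact: hF|]; apply: ess0_contr; rewrite /ess e -/(superopt_sv Phi 0) t0; exact: lexx.
  by split; [exact: (proj1 bF)|exact: etrans (ess_ball s0 bF) (esym t0)].
have [_ IH2] := IH (ltnW js).
have t1 : superopt_sv Phi j.+1 = 1%E.
  apply: (main _ js) => F; first by move/IH2.
  by move=> /IH2 bF; rewrite (ess_ball js bF).
split; [exact: t1|move=> F; split=> [[/IH2 bF _]|bF]]; first exact: bF.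
by split; [exact/IH2|exact: etrans (ess_ball js bF) (esym t1)].
Qed.

Lemma superopt_sv_lt : (superopt_sv Phi s < 1)%E.
Proof.
have [F0 [c [c1 hF0 cF0 h]]] := strict_interpolant hPhi hc hess sn sp.
have in0 : OmegaP Phi s F0.
  (* [OmegaP s] is the class of level [s - 1]; for [s = 0] it is all of [Hinf] and [OmegaP_ball]
     does not apply. *)
  have [s0|s0] := posnP s; first by rewrite s0; exact: hF0.
  rewrite -(prednK s0); have js : (s.-1 < s)%N by rewrite prednK.
  by apply (proj2 (OmegaP_ball js)); split; [exact: hF0|exact: cF0].
apply: le_lt_trans (_ : (c%:E < 1)%E); last by rewrite lte_fin.
apply: le_trans (ereal_inf_lbound _) (esssupT_le _); first by exists F0.
by apply: aeT_sub h => t _; rewrite lee_fin.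
Qed.

Lemma OmegaP_mono i j F : (i <= j)%N -> OmegaP Phi j F -> OmegaP Phi i F.
Proof.
elim: j => [|j IH]; first by rewrite leqn0 => /eqP ->.
by rewrite leq_eqVlt => /orP[/eqP -> //|/IH h [/h]].
Qed.

(** An empty class gives the value [+oo]. Otherwise a member minimizes at level [s] with a value
    below 1, and singular values decrease with the level. *)
Lemma superopt_sv_neq1 j : (s <= j)%N -> superopt_sv Phi j != 1%E.
Proof.
rewrite leq_eqVlt => /predU1P[<-|sj]; first by rewrite lt_eqF// superopt_sv_lt.
apply/eqP => e; have : (superopt_sv Phi j < +oo)%E by rewrite e ltry.
move=> /ereal_inf_lt[_ [F hF <-] _].
have [_ eF] := OmegaP_mono sj hF.
suff : (superopt_sv Phi j < 1)%E by rewrite e ltxx.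
apply: le_lt_trans superopt_sv_lt; rewrite /superopt_sv -eF.
apply: le_trans (ereal_inf_lbound _) _; first by exists F.
apply: le_ereal_inf => y h /=; apply: aeT_sub h => t _; apply: le_trans.
by rewrite lee_fin; exact: sval_anti (ltnW sj).
Qed.

Lemma nb_sv_oneE : nb_sv_one Phi = s.
Proof.
rewrite /nb_sv_one -[in iota _ _](subnKC sn) iotaD count_cat add0n.
have /eqP -> : count (fun j => superopt_sv Phi j == 1%E) (iota s (n - s)) == 0%N.
  rewrite -leqn0 leqNgt -has_count; apply/hasPn => j; rewrite mem_iota => /andP[sj _].
  exact: superopt_sv_neq1.
rewrite addn0 -[RHS](size_iota 0); apply/eqP; rewrite -all_count.
by apply/allP => j; rewrite mem_iota add0n => /= js; rewrite (proj1 (OmegaP_ball js)).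
Qed.
End NumberOfUnitValues.

(** * Unitary symbols *)

Section UnitarySymbol.
Variables (R : realType) (n : nat).
Local Notation C := (complex.complex R).
Local Notation V := (R -> 'cV[C]_n).
Local Notation ip := (@ip R n).
Implicit Types (f g h m p : V) (U W : R -> 'M[C]_n).
Let L2s := @isL2_linsub R n.
Let ipH := @ip_hform R n.
Let H2s := @H2_linsub R n.
#[local] Opaque fcoef cint isL2 aeT dp.

Lemma unitary_norm U : unitary_valued U -> aeT (fun t => forall x, vnorm (U t *m x) = vnorm x).
Proof.
move=> [_]; apply: aeT_sub => t _ e x; apply: eq_sqr_ge0; rewrite ?vnorm_ge0//.
by rewrite -!nq_dp /nq dp_mulmx mulmxA e mul1mx.
Qed.

Lemma unitary_Linfty U : unitary_valued U -> Linfty U.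
Proof.
move=> hU; apply: Linfty_contr; first by case: hU.
by apply: aeT_sub (unitary_norm hU) => t _ h x; rewrite h.
Qed.

Lemma unitary_adj U : unitary_valued U -> unitary_valued (ctrf U).
Proof.
move=> [mU hU]; split.
  move=> i j; have -> : (fun t => ctrf U t i j) = (fun t => conjc (U t j i)).
    by apply/funext => t; rewrite mxE [X in conjc X]mxE.
  exact: cmeasJ.
by apply: aeT_sub hU => t _ e; rewrite /ctrf ctrK; exact: mulmx1C.
Qed.

Lemma ip_mulf_adj U f g : ip (mulf U f) g = ip f (mulf (ctrf U) g).
Proof. by rewrite !ip.unlock; congr cint; apply/funext => t; exact: dp_mulmx. Qed.

Lemma adj_mulf U f : unitary_valued U -> aeq (mulf (ctrf U) (mulf U f)) f.
Proof. by move=> [_]; apply: aeT_sub => t _ e; rewrite /mulf mulmxA e mul1mx. Qed.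

Lemma ctrfK U : ctrf (ctrf U) = U.
Proof. by apply/funext => t; exact: ctrK. Qed.

Lemma ip_unitary U f g : unitary_valued U -> isL2 f -> isL2 g ->
  ip (mulf U f) (mulf U g) = ip f g.
Proof.
move=> hU hf hg; rewrite ip_mulf_adj; apply: (ip_aeqr hf _ hg); last exact: adj_mulf.
apply: isL2_mulf; first exact: (unitary_Linfty (unitary_adj hU)).
exact: (isL2_mulf (unitary_Linfty hU)).
Qed.

Lemma ip_Pm_Pp f g : isL2 f -> isL2 g ->
  ip f g = ip (Pm f) (Pm g) + ip (f - Pm f) (g - Pm g).
Proof.
move=> hf hg; have f1 := Pm_L2 hf; have g1 := Pm_L2 hg.
have f2 := H2_L2 (Pp_H2 hf); have g2 := H2_L2 (Pp_H2 hg).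
have o : ip (Pm f) (g - Pm g) = 0.
  by rewrite (hformC ipH g2 f1) (ip_H2_H2minus (Pp_H2 hg) (Pm_H2minus hf)) conjc0.
have e : ip f g = ip f (Pm g) + ip f (g - Pm g).
  by rewrite -(hformDr ipH hf g1 g2) addrC subrK.
rewrite e (ip_Pm hf (Pm_H2minus hg)) (hformBl ipH hf f1 g2) o subr0; reflexivity.
Qed.

Definition toep U f : V := mulf U f - Pm (mulf U f).

Section Fixed.
Variable U : R -> 'M[C]_n.
Hypothesis hU : unitary_valued U.
Let UL f : H2 f -> isL2 (mulf U f).
Proof. by move=> hf; apply: (isL2_mulf (unitary_Linfty hU) (H2_L2 hf)). Qed.
Let q := qf ip (fun f => Pm (mulf U f)).

Lemma toep_H2 f : H2 f -> H2 (toep U f). Proof. by move=> hf; exact: (Pp_H2 (UL hf)). Qed.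

Lemma ip_toep f h : H2 f -> H2 h -> ip (toep U f) h = ip (mulf U f) h.
Proof.
move=> hf hh; have P := Pm_H2minus (UL hf).
rewrite (hformBl ipH (UL hf) (H2minus_L2 P) (H2_L2 hh)).
rewrite (hformC ipH (H2_L2 hh) (H2minus_L2 P)) (ip_H2_H2minus hh P) conjc0 subr0; reflexivity.
Qed.

(** [U] preserves inner products, so removing the anti-analytic part of [U f] leaves the analytic
    one. Null functions of [q] are thus the kernel of the Toeplitz operator. *)
Lemma qf_toep f g : H2 f -> H2 g -> q f g = ip (toep U f) (toep U g).
Proof.
move=> hf hg; rewrite /q /qf -(ip_unitary hU (H2_L2 hf) (H2_L2 hg)).
rewrite (ip_Pm_Pp (UL hf) (UL hg)) addrC addKr; reflexivity.
Qed.

Lemma nq_qf_toep f : H2 f -> nq q f = nq ip (toep U f).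
Proof. by move=> hf; rewrite /nq qf_toep. Qed.

Lemma toep_linear a f g : H2 f -> H2 g ->
  aeq (toep U (a *: f + g)) (a *: toep U f + toep U g).
Proof.
move=> hf hg; rewrite /toep mulf_linear.
apply: aeT_sub (Pm_linear a (UL hf) (UL hg)) => t _ e; move: e.
rewrite !fctE => ->; rewrite scalerBr opprD addrACA; reflexivity.
Qed.

Lemma nq_qf_eq0P f : H2 f -> nq q f = 0 <-> H2minus (mulf U f).
Proof.
move=> hf; rewrite (nq_qf_toep hf); split => h.
  apply: (H2minus_aeq (UL hf) (Pm_H2minus (UL hf))); apply: aeq_sym.
  exact: (nqB_aeq (UL hf) (Pm_L2 (UL hf)) h).
rewrite -(nq0 ipH); apply: (nq_aeq (H2_L2 (toep_H2 hf)) (proj1 L2s)).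
apply: aeT_sub (Pm_id h) => t _ e.
rewrite -[LHS]/(mulf U f t - Pm (mulf U f) t) e subrr; reflexivity.
Qed.

Lemma hU_hankel : hankel (fun f => Pm (mulf U f)).
Proof. exact: (mulf_hankel (unitary_Linfty hU)). Qed.

Lemma hU_contractive : contractive ip (fun f => Pm (mulf U f)).
Proof.
move=> f hf; apply: le_trans (nq_Pm_le (UL hf)) _.
by rewrite /nq (ip_unitary hU (H2_L2 hf) (H2_L2 hf)).
Qed.

Lemma unitary_qH : hform (@H2 R n) q.
Proof. exact: (qf_hform (ip_H2_hform R n) hU_hankel hU_contractive). Qed.

Lemma unitary_q_bound f : H2 f -> nq q f <= 1 * nq ip f.
Proof. by apply: (qf_bound _ hU_hankel) => g _; rewrite mul1r. Qed.

Lemma adj_ker_orth h : H2 h -> (forall f, H2 f -> ip (toep U f) h = 0) ->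
  H2minus (mulf (ctrf U) h).
Proof.
move=> hh ho; have hL := isL2_mulf (unitary_Linfty (unitary_adj hU)) (H2_L2 hh).
split => // k k0; apply: dp_eqP => z; rewrite (dp_fcoef k z hL).
have hz := H2_ek z k0.
rewrite (hformC ipH (H2_L2 hz) hL) -ip_mulf_adj -(ip_toep hz hh) (ho _ hz) conjc0.
rewrite -(scale0r (0 : 'cV[C]_n)) (hformZl (@dp_hform R n) 0 Logic.I Logic.I) mul0r; reflexivity.
Qed.

Hypothesis hess : ess_form (@H2 R n) ip q.

(** The functional [f |-> <T f, g>] is represented by some [p] for the complete form [<T f, T h>].
    Then [g - T p] is orthogonal to the range of [T], that is, in the kernel of the adjoint. *)
Lemma toep_onto : (forall h, H2 h -> H2minus (mulf (ctrf U) h) -> aeq h 0) ->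
  forall g, H2 g -> exists2 p, H2 p & aeq (toep U p) g.
Proof.
move=> inj g hg; have qH := unitary_qH.
have qc := ess_complete (ip_H2_hform R n) qH (@H2_complete R n) unitary_q_bound hess.
have TL f : H2 f -> isL2 (toep U f) by move=> /toep_H2/H2_L2.
have [||p hp he] := @riesz_form _ _ _ _ qH (fun f => ip (toep U f) g) (nq ip g) qc.
- move=> a f1 f2 h1 h2; have h12 := subspD H2s (subspZ a H2s h1) h2.
  have s12 := subspD L2s (subspZ a L2s (TL _ h1)) (TL _ h2).
  rewrite (ip_aeql (TL _ h12) s12 (H2_L2 hg) (toep_linear a h1 h2)).
  exact: (hformL ipH a (TL _ h1) (TL _ h2) (H2_L2 hg)).
- move=> f hf; rewrite (nq_qf_toep hf) mulrC.
  exact: (hform_CS ipH (TL _ hf) (H2_L2 hg)).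
exists p => //; have hd := subspB H2s hg (toep_H2 hp).
have ker : H2minus (mulf (ctrf U) (g - toep U p)).
  apply: (adj_ker_orth hd) => f hf.
  rewrite (hformBr ipH (TL _ hf) (H2_L2 hg) (TL _ hp)) he// (qf_toep hf hp) subrr; reflexivity.
by apply: aeT_sub (inj _ hd ker) => t _ e; apply/esym/eqP; rewrite -subr_eq0; apply/eqP; exact: e.
Qed.

(** Let [T p = g] and remove from [p] its kernel component [m], so that [d |p - m|^2 <= |g|^2]. Then
    [|g|^2 = <p - m, P_+ U^* g>], and Cauchy-Schwarz gives [|P_+ U^* g|^2 >= d |g|^2]. *)
Lemma adj_hankel_bound : (forall g, H2 g -> exists2 p, H2 p & aeq (toep U p) g) ->
  exists2 d : R, 0 < d & forall g, H2 g ->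
    nq ip (Pm (mulf (ctrf U) g)) <= (1 - d) * nq ip g.
Proof.
move=> onto; have qH := unitary_qH.
have [d d0 dec] := ess_decomp (ip_H2_hform R n) qH (@H2_complete R n) unitary_q_bound hess.
exists d => // g hg; have [p hp pg] := onto g hg.
have [m [hm m0] [_ le]] := dec p hp.
have hd := subspB H2s hp hm; have gL := H2_L2 hg.
have hUc := unitary_adj hU; have cL := isL2_mulf (unitary_Linfty hUc) gL.
have TL f : H2 f -> isL2 (toep U f) by move=> /toep_H2/H2_L2.
have qp : nq q p = nq ip g by rewrite (nq_qf_toep hp); exact: (nq_aeq (TL _ hp) gL pg).
have e : ip (p - m) (mulf (ctrf U) g - Pm (mulf (ctrf U) g)) = real_complex R (nq ip g).
  rewrite (hformBr ipH (H2_L2 hd) cL (Pm_L2 cL)) (ip_H2_H2minus hd (Pm_H2minus cL)) subr0.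
  rewrite -ip_mulf_adj -(ip_toep hd hg) -(hform_diag ipH gL).
  rewrite -(ip_aeql (TL _ hp) gL gL pg).
  have -> : p - m = (-1) *: m + p by rewrite scaleN1r addrC.
  have s1 := subspD L2s (subspZ (-1) L2s (TL _ hm)) (TL _ hp).
  have h1 := subspD H2s (subspZ (-1) H2s hm) hp.
  rewrite (ip_aeql (TL _ h1) s1 gL (toep_linear (-1) hm hp)).
  rewrite (hformL ipH _ (TL _ hm) (TL _ hp) gL).
  rewrite (hform_null ipH (TL _ hm) gL) ?mulr0 ?add0r; first reflexivity.
  by rewrite -(nq_qf_toep hm).
have := hform_CS ipH (H2_L2 hd) (H2_L2 (Pp_H2 cL)); rewrite e cabs_real.
have nc : nq ip (mulf (ctrf U) g) = nq ip g by rewrite /nq (ip_unitary hUc gL gL).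
have := nq_Pm_Pp cL; rewrite nc; rewrite qp in le.
have := nq_ge0 ipH gL; have := nq_ge0 ipH (H2_L2 hd); have := nq_ge0 ipH (H2_L2 (Pp_H2 cL)).
move: le; move: (nq ip (p - m)) (nq ip g) (nq ip (Pm _)) (nq ip (_ - Pm _)) => x y z w.
move=> le w0 x0 y0 e1; rewrite ger0_norm// => cs.
have [y00|yp] := eqVneq y 0; first by rewrite y00 in e1 *; lra.
have {}yp : 0 < y by rewrite lt_neqAle eq_sym yp.
suff : d * y <= w by lra.
have : d * y ^+ 2 <= y * w by nra.
by rewrite expr2 mulrCA ler_pM2l.
Qed.
End Fixed.

(** The [n] null functions form a basis at almost every point, and the contraction preserves their
    norms there. *)
Lemma spdim_full_unitary W : Linfty W -> aeT (fun t => forall x, vnorm (W t *m x) <= vnorm x) ->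
  spdim (qf ip (fun f => Pm (mulf W f))) n -> unitary_valued W.
Proof.
move=> LW hW sp; split; first by case: LW.
have [f [fH f0 fi _]] := null_basis (leqnn n) sp.
have h0 : Hinf (fun=> 0 : 'M[C]_n).
  by apply: sH2_HinfP; [exact: Linfty_cst|move=> i j; exact: sH2_cst].
have iso : aeT (fun t => forall j, vnorm (W t *m f j t) = vnorm (f j t)).
  apply: aeT_cnt => j; have := null_isometry LW h0 (fH j) (f0 j).
  have -> : (fun t => forall x, vnorm ((W t - 0) *m x) <= vnorm x) =
     (fun t => forall x, vnorm (W t *m x) <= vnorm x) by apply/funext => t; rewrite subr0.
  by move=> /(_ hW); apply: aeT_sub => t _; rewrite subr0.
apply: aeT_sub3 hW iso (colmx_inj fH fi) => t _ h1 h2 h3.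
apply: isometry_unitary => x; have uf := unitmx_inj h3.
rewrite -[x](mulKVmx uf); apply: isometry_span => // j.
by rewrite col_colmx.
Qed.
End UnitarySymbol.

(** * The adjoint symbol *)

Section AdjointHankel.
Variables (R : realType) (n : nat).
Local Notation C := (complex.complex R).
Local Notation V := (R -> 'cV[C]_n).
Local Notation ip := (@ip R n).
Local Notation zeta := (@zeta R).
Implicit Types (f g h m p : V) (U W : R -> 'M[C]_n).
Let L2s := @isL2_linsub R n.
Let ipH := @ip_hform R n.
Let H2s := @H2_linsub R n.
#[local] Opaque fcoef cint isL2 aeT dp.

Lemma sH2_conj g i : isL2 g -> (forall k, 0 < k -> fcoef g k = 0) ->
  sH2 (fun t => conjc (g t i 0)) /\ cint (fun t => conjc (g t i 0)) = conjc (fcoef g 0 i 0).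
Proof.
move=> gL hg; have sg := proj1 (isL2_coordP g) gL i.
have e (k : int) : cint (fun t => conjc (g t i 0) * zeta t ^ (- k)) = conjc (fcoef g (- k) i 0).
  have -> : (fun t => conjc (g t i 0) * zeta t ^ (- k)) =
      (fun t => conjc (g t i 0 * zeta t ^ (- (- k)))).
    by apply/funext => t; rewrite conjcM zetazJ opprK.
  by rewrite cintJ -?fcoefE//; exact: (cI_coord i _ gL).
split.
  split; first exact: sL2J.
  by move=> k k0; rewrite e hg ?oppr_gt0// mxE conjc0.
have -> : (fun t => conjc (g t i 0)) = (fun t => conjc (g t i 0) * zeta t ^ (- 0)).
  by apply/funext => t; rewrite oppr0 expr0z mulr1.
by rewrite e oppr0.
Qed.

Lemma H2minus_conj p i : H2minus p ->
  sH2 (fun t => conjc (p t i 0)) /\ cint (fun t => conjc (p t i 0)) = 0.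
Proof.
move=> [pL hp]; have [h ->] := sH2_conj i pL (fun k k0 => hp k (ltW k0)).
by split; [exact: h|rewrite hp// mxE conjc0].
Qed.

(** The conjugates of the coordinates of [p] are analytic of mean zero, which is what settles the
    index 0. *)
Lemma dp_analytic h p (k : int) : H2 h -> H2minus p -> k <= 0 ->
  cint (fun t => dp (h t) (p t) * zeta t ^ (- k)) = 0.
Proof.
move=> hh hp k0; have hi i := proj1 (H2_coordP h) hh i.
have pi_ i := H2minus_conj i hp.
have cIi i : cI (fun t => h t i 0 * conjc (p t i 0)).
  by apply: sL2_mul; [case: (hi i)|case: (pi_ i) => -[]].
have -> : (fun t => dp (h t) (p t) * zeta t ^ (- k)) =
    (fun t => \sum_i (h t i 0 * conjc (p t i 0)) * zeta t ^ (- k)).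
  by apply/funext => t; rewrite dpE mulr_suml.
rewrite cint_sum => [|i]; last first.
  by apply: (cI_unit (cIi i)); [exact: cmeas_zetaz|move=> t; exact: cabs_zetaz].
rewrite big1// => i _; have [s0 c0] := pi_ i.
move: k0; rewrite le_eqVlt => /predU1P[->|kn]; last exact: (sH2_mul_neg (hi i) s0 kn).
have -> : (fun t => h t i 0 * conjc (p t i 0) * zeta t ^ (- 0)) =
    (fun t => h t i 0 * conjc (p t i 0)) by apply/funext => t; rewrite oppr0 expr0z mulr1.
by rewrite (sH2_mul0 (hi i) s0) c0 mulr0.
Qed.

(* [<h, W m> = <W^* h, m>] is analytic with zero mean on one side and anti-analytic on the other. *)
Lemma adj_inj W : unitary_valued W -> spdim (qf ip (fun f => Pm (mulf W f))) n ->
  forall h, H2 h -> H2minus (mulf (ctrf W) h) -> aeq h 0.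
Proof.
move=> hW sp h hh hm; have [f [fH f0 fi _]] := null_basis (leqnn n) sp.
have Wf j : H2minus (mulf W (f j)) by apply/(nq_qf_eq0P hW (fH j)).
have z0 : aeT (fun t => forall j, dp (h t) (mulf W (f j) t) = 0).
  apply: aeT_cnt => j; apply: fourier_unique.
    by apply: cI_dp; [exact: H2_L2|exact: (H2minus_L2 (Wf j))].
  move=> k; rewrite -[k]opprK; have [k0|k0] := leP (- k) 0; first exact: dp_analytic.
  have -> : (fun t => dp (h t) (mulf W (f j) t) * zeta t ^ (- - k)) =
      (fun t => conjc (dp (f j t) (mulf (ctrf W) h t) * zeta t ^ (- k))).
    apply/funext => t; rewrite conjcM zetazJ /mulf -dp_mulmx; congr (_ * _).
    exact: (hformC (@dp_hform R n) Logic.I Logic.I).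
  rewrite cintJ; last first.
    have I0 := cI_dp (H2_L2 (fH j)) (H2minus_L2 hm).
    by apply: (cI_unit I0); [exact: cmeas_zetaz|move=> t; exact: cabs_zetaz].
  have k1 : k <= 0 by lia.
  rewrite (dp_analytic (fH j) hm k1) conjc0; reflexivity.
apply: aeT_sub3 z0 (colmx_inj fH fi) (proj2 hW) => t _ e1 /unitmx_inj uf e2.
set y := ctr (W t) *m h t.
have y0 : y = 0.
  apply: vnorm_eq0; apply/eqP; rewrite -sqrf_eq0 -nq_dp /nq; apply/eqP.
  suff -> : dp y y = 0 by [].
  rewrite -{2}[y](mulKVmx uf) colmx_mul (hform_sumr (@dp_hform R n)) // big1 // => j _.
  rewrite (hformZr (@dp_hform R n) _ Logic.I Logic.I) /y dp_mulmx ctrK (e1 j) mulr0; reflexivity.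
by rewrite -[LHS]mul1mx -(mulmx1C e2) -mulmxA -/y y0 mulmx0.
Qed.

Lemma multi_vec_BW (N : nat) (x : nat -> nat -> 'cV[C]_n) (M : R) : (forall l k, vnorm (x l k) <= M) ->
  exists phi : nat -> nat, (forall k, (phi k < phi k.+1)%N) /\
  forall e : R, 0 < e -> exists N0 : nat, forall p q : nat, (N0 <= p)%N -> (N0 <= q)%N ->
    forall l, (l < N)%N -> vnorm (x l (phi p) - x l (phi q)) < e.
Proof.
move=> xM; elim: N => [|N [phi [phiI h]]]; first by exists id; split => // e _; exists 0%N.
have [psi [psiI h']] := vec_BW (fun k => xM N (phi k)).
exists (phi \o psi); split => [k|e e0].
  exact: leq_trans (phiI _) (incr_le phiI (psiI k)).
have [N1 h1] := h e e0; have [N2 h2] := h' e e0; exists (maxn N1 N2) => p q Np Nq l.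
rewrite ltnS leq_eqVlt => /orP[/eqP ->|lN].
  by apply: h2; [move: Np|move: Nq]; rewrite geq_max => /andP[].
by apply: h1 => //; [apply: leq_trans (incr_ge psiI p)|apply: leq_trans (incr_ge psiI q)];
  [move: Np|move: Nq]; rewrite geq_max => /andP[].
Qed.

Lemma vnorm_fcoef f k : isL2 f -> vnorm (fcoef f k) <= nrm ip f.
Proof.
move=> hf; set v := fcoef f k; have := nrmCS ipH hf (isL2_ek k v).
rewrite -(dp_fcoef k v hf) -/v dp_diag cabs_real ger0_norm ?sqr_ge0//.
have -> : nrm ip (ek k v) = vnorm v.
  by rewrite /nrm /nq ip_ek dp_diag Re_real sqrtr_sqr ger0_norm// vnorm_ge0.
have := vnorm_ge0 v; rewrite le_eqVlt => /predU1P[<- _|v0]; first exact: nrm_ge0.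
by rewrite expr2 ler_pM2r.
Qed.

(** The part of [y] that multiplication by [z^-N] carries from nonnegative to negative indices. *)
Definition tail N y : V := \sum_(l < N) ek (l%:Z - N%:Z) (fcoef y l).

Lemma tail_H2minus N y : H2minus (tail N y).
Proof.
apply: (@subsp_sum _ _ (@H2minus R n) _ _ _ _ (@H2minus_linsub R n)) => l _.
apply: H2minus_ek; have := ltn_ord l; lia.
Qed.

Lemma fcoef_tail N y (k : int) : fcoef (tail N y) k =
  \sum_(l < N) (k == l%:Z - N%:Z)%:R *: fcoef y l.
Proof.
rewrite /tail; elim: (index_enum _) => [|l r IH]; first by rewrite !big_nil fcoef0.
rewrite !big_cons -IH -fcoef_ek; apply: fcoefD; first exact: isL2_ek.
by apply: (@subsp_sum _ _ (@isL2 R n) _ _ _ _ L2s) => j _; exact: isL2_ek.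
Qed.

Lemma Pminus_shift N y : isL2 y -> Pminus (zs (- N%:Z) y) (zs (- N%:Z) (Pm y) + tail N y).
Proof.
move=> hy; have hP := Pm_H2minus hy; have t1 := tail_H2minus N y.
have z1 : H2minus (zs (- N%:Z) (Pm y)) by apply: H2minus_zs => //; lia.
split; first exact: (subspD (@H2minus_linsub R n) z1 t1).
move=> k k0; rewrite (fcoefD k (H2minus_L2 z1) (H2minus_L2 t1)) 2!fcoef_zs fcoef_tail opprK.
have [kN|kN] := ltP (k + N%:Z) 0.
  rewrite (fcoef_Pm hy kN) big1 ?addr0// => l _.
  have /negPf-> : k != l%:Z - N%:Z by apply/eqP; have := ltn_ord l; lia.
  by rewrite scale0r.
rewrite (proj2 hP _ kN) add0r.
have [l0 eN] : exists l : nat, k + N%:Z = l%:Z by exists (absz (k + N%:Z)); lia.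
have lt : (l0 < N)%N by lia.
rewrite eN (bigD1 (Ordinal lt))//= big1 => [|l lne]; last first.
  have /negPf-> : k != l%:Z - N%:Z; last by rewrite scale0r.
  apply: contra lne => /eqP e; apply/eqP/val_inj => /=; lia.
by rewrite addr0 -eN addrK eqxx scale1r.
Qed.

Lemma tail_linear N a f g : isL2 f -> isL2 g ->
  tail N (a *: f + g) = a *: tail N f + tail N g.
Proof.
move=> hf hg; rewrite /tail scaler_sumr -big_split; apply: eq_bigr => l _.
by rewrite (fcoefL _ a hf hg) ekL.
Qed.

Lemma nrm_tail N f : isL2 f -> nrm ip (tail N f) <= \sum_(l < N) vnorm (fcoef f l).
Proof.
move=> hf; rewrite /tail; elim: (index_enum _) => [|l r IH].
  by rewrite !big_nil /nrm (nq0 ipH) sqrtr0.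
rewrite !big_cons.
have rL : isL2 (\sum_(j <- r) ek (j%:Z - N%:Z) (fcoef f j)).
  by apply: (@subsp_sum _ _ (@isL2 R n) _ _ _ _ L2s) => j _; exact: isL2_ek.
apply: le_trans (nrmD ipH (isL2_ek _ _) rL) _; apply: lerD => //.
by rewrite /nrm /nq ip_ek dp_diag Re_real sqrtr_sqr ger0_norm// vnorm_ge0.
Qed.

(** By [Pminus_shift], the Hankel operator of [z^-N W] is [z^-N] times that of [W], a strict
    contraction, plus the finite-rank operator given by [tail]. *)
Lemma ess_hankel_shift W (N : nat) (d : R) : Linfty W -> 0 < d ->
  (forall g, H2 g -> nq ip (Pm (mulf W g)) <= (1 - d) * nq ip g) ->
  ess_hankel_lt1 (fun t => zeta t ^ (- N%:Z) *: W t).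
Proof.
move=> LW d0 hd; have WL f : H2 f -> isL2 (mulf W f).
  by move=> /H2_L2; exact: isL2_mulf.
have shiftE f : mulf (fun t => zeta t ^ (- N%:Z) *: W t) f = zs (- N%:Z) (mulf W f).
  by apply/funext => t; rewrite /mulf /zs -scalemxAl.
pose K f := tail N (mulf W f).
exists K; split.
- split.
  + by move=> f _; exact: tail_H2minus.
  + move=> f g hf hg fg; apply: aeT_all => t _; congr (_ t); rewrite /K /tail.
    apply: eq_bigr => l _; congr ek; apply: (fcoef_aeq _ (WL f hf) (WL g hg)).
    exact: aeq_mulf.
  + move=> a b f g hf hg; apply: aeT_all => t _.
    have -> : (fun s => a *: f s + b *: g s) = a *: f + (b *: g + 0).
      by rewrite addr0.
    have W0 : mulf W 0 = 0 by apply/funext => s; rewrite /mulf mulmx0.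
    have bgL := WL _ (subspD H2s (subspZ b H2s hg) (proj1 H2s)).
    have K0 : tail N (0 : V) = 0.
      by rewrite /tail big1// => l _; rewrite fcoef0; apply/funext => s; rewrite /ek scaler0.
    have e1 : K (a *: f + (b *: g + 0)) = a *: K f + K (b *: g + 0).
      rewrite {1}/K (mulf_linear W a f) (tail_linear N a (WL f hf) bgL); reflexivity.
    have e2 : K (b *: g + 0) = b *: K g.
      rewrite {1}/K (mulf_linear W b g) W0 (tail_linear N b (WL g hg) (proj1 L2s)) K0 addr0.
      reflexivity.
    rewrite e1 e2; reflexivity.
  + move=> u hu [M hM].
    have [B B0 hB] := nq_mulf_bound LW.
    pose x l k := fcoef (mulf W (u k)) l%:Z.
    have nW k : nrm ip (mulf W (u k)) <= Num.sqrt B * M.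
      rewrite /nrm; apply: (@le_trans _ _ (Num.sqrt (B * nq ip (u k)))).
        by apply: ler_wsqrtr; exact: hB (H2_L2 (hu k)).
      rewrite sqrtrM// ler_wpM2l ?sqrtr_ge0//; have := hM k; rewrite l2normE; exact.
    have xM l k : vnorm (x l k) <= Num.sqrt B * M.
      exact: le_trans (vnorm_fcoef _ (WL _ (hu k))) (nW k).
    have [phi [phiI h]] := multi_vec_BW N xM; exists phi; split => // e e0.
    have e1 : 0 < e / N.+1%:R by rewrite divr_gt0// ltr0n.
    have [N0 hN0] := h _ e1; exists N0 => p q Np Nq.
    have dL := subspB L2s (WL _ (hu (phi p))) (WL _ (hu (phi q))).
    have -> : (fun t => K (u (phi p)) t - K (u (phi q)) t) =
        tail N (mulf W (u (phi p)) - mulf W (u (phi q))).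
      have -> : mulf W (u (phi p)) - mulf W (u (phi q)) =
          (-1) *: mulf W (u (phi q)) + mulf W (u (phi p)) by rewrite scaleN1r addrC.
      rewrite (tail_linear _ _ (WL _ (hu _)) (WL _ (hu _))) scaleN1r addrC; reflexivity.
    rewrite l2normE; apply: le_lt_trans (nrm_tail N dL) _.
    apply: (@le_lt_trans _ _ (\sum_(l < N) e / N.+1%:R)).
      apply: ler_sum => l _; rewrite (fcoefB _ (WL _ (hu _)) (WL _ (hu _))).
      by apply: ltW; apply: hN0.
    rewrite sumr_const card_ord -[X in X < _]mulr_natr -mulrA gtr_pMr// mulrC ltr_pdivrMr ?ltr0n//.
    by rewrite mul1r ltr_nat.
(* The maximum with 0 guards against [d > 1]. *)
pose c := Num.sqrt (Num.max (1 - d) 0).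
have c2 : c ^+ 2 = Num.max (1 - d) 0 by apply: sqr_sqrtr; rewrite le_max lexx orbT.
have c0 : 0 <= c := sqrtr_ge0 _.
exists c; split.
  by rewrite -(ltr_pXn2r (n := 2)) ?nnegrE// c2 expr1n gt_max; apply/andP; split; lra.
move=> f hf h; rewrite shiftE => hP.
have hy := WL f hf; have hz := H2minus_L2 (Pm_H2minus hy).
have e := Pminus_unique hP (Pminus_shift N hy).
have KL := H2minus_L2 (tail_H2minus N (mulf W f)).
rewrite !l2normE -(ler_pXn2r (n := 2)) ?nnegrE ?nrm_ge0 ?mulr_ge0 ?nrm_ge0//.
have hL := H2minus_L2 (proj1 hP).
rewrite exprMn (nrm2 ipH (H2_L2 hf)) (nrm2 ipH (subspB L2s hL KL)).
rewrite (nq_aeq (subspB L2s hL KL) (isL2_zs (- N%:Z) hz)); last first.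
  apply: aeT_sub e => t _; rewrite -[(h - K f) t]/(h t - K f t) => ->.
  by rewrite [(_ + _) t]/(_ t + _ t) addrK.
rewrite nq_zs c2; apply: le_trans (hd f hf) _.
by rewrite ler_wpM2r ?(nq_ge0 ipH (H2_L2 hf))// le_max lexx.
Qed.
End AdjointHankel.

(** * Wiener-Hopf factorization *)

Section MatrixHardy.
Variables (R : realType).
Local Notation C := (complex.complex R).
Local Notation zeta := (@zeta R).
#[local] Opaque fcoef cint isL2 aeT dp.

Lemma sH2_mul_bounded (a b : R -> C) (M : R) : sH2 a -> sH2 b ->
  aeT (fun t => cabs (b t) <= M) -> sH2 (fun t => a t * b t).
Proof.
move=> ha hb hM; split; last by move=> k k0; exact: sH2_mul_neg.
have m := cmeasM (proj1 (proj1 ha)) (proj1 (proj1 hb)).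
apply: (sL2_dom m (sL2Z (real_complex R `|M|) (proj1 ha))).
apply: aeT_sub hM => t _ h; rewrite !cabsM cabs_real normr_id mulrC ler_wpM2r ?cabs_ge0//.
exact: le_trans h (ler_norm _).
Qed.

Lemma H2mx_mulHinf m n p (A : R -> 'M[C]_(m, n)) (B : R -> 'M[C]_(n, p)) :
  H2mx A -> Hinf B -> H2mx (fun t => A t *m B t).
Proof.
move=> hA hB; have [[_ [M hM]] _] := hB; apply/H2mxP => i j.
have -> : (fun t => (A t *m B t) i j) = (fun t => \sum_k A t i k * B t k j).
  by apply/funext => t; rewrite mxE.
apply: sH2_sum => k; apply: (@sH2_mul_bounded _ _ M).
- exact: (proj1 (H2mxP _) hA i k).
- exact: Hinf_sH2.
- by apply: aeT_sub hM => t _ h; exact: h.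
Qed.

Lemma Hinf_mulH2mx m n p (A : R -> 'M[C]_(m, n)) (B : R -> 'M[C]_(n, p)) :
  Hinf A -> H2mx B -> H2mx (fun t => A t *m B t).
Proof.
move=> hA hB j; have -> : (fun t => col j (A t *m B t)) = mulf A (fun t => col j (B t)).
  by apply/funext => t; rewrite /mulf !colE mulmxA.
exact: (H2_mulf hA (hB j)).
Qed.

Lemma Hinf_cst n (M : 'M[C]_n) : Hinf (fun _ : R => M).
Proof. by apply: sH2_HinfP; [exact: Linfty_cst|move=> i j; exact: sH2_cst]. Qed.

(** For analytic entries the mean is the value at 0. *)
Definition cval m n (F : R -> 'M[C]_(m, n)) : 'M[C]_(m, n) := \matrix_(i, j) cint (fun t => F t i j).

Lemma cval_mul m n p (A : R -> 'M[C]_(m, n)) (B : R -> 'M[C]_(n, p)) : H2mx A -> H2mx B ->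
  cval (fun t => A t *m B t) = cval A *m cval B.
Proof.
move=> /H2mxP hA /H2mxP hB; apply/matrixP => i j; rewrite [LHS]mxE [RHS]mxE.
have -> : (fun t => (A t *m B t) i j) = (fun t => \sum_k A t i k * B t k j).
  by apply/funext => t; rewrite mxE.
rewrite cint_sum => [|k]; last by apply: sL2_mul; [case: (hA i k)|case: (hB k j)].
by apply: eq_bigr => k _; rewrite (sH2_mul0 (hA i k) (hB k j)) [cval A i k]mxE [cval B k j]mxE.
Qed.

Lemma cval_ae m n (A B : R -> 'M[C]_(m, n)) : (forall i j, cmeas (fun t => A t i j)) ->
  (forall i j, cmeas (fun t => B t i j)) -> aeT (fun t => A t = B t) -> cval A = cval B.
Proof.
move=> mA mB e; apply/matrixP => i j; rewrite !mxE; apply: cint_ae => //.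
by apply: aeT_sub e => t _ ->.
Qed.

Lemma cmeas_H2mx_mul m n p (A : R -> 'M[C]_(m, n)) (B : R -> 'M[C]_(n, p)) i j :
  H2mx A -> H2mx B -> cmeas (fun t => (A t *m B t) i j).
Proof.
move=> /H2mxP hA /H2mxP hB.
have -> : (fun t => (A t *m B t) i j) = (fun t => \sum_k A t i k * B t k j).
  by apply/funext => t; rewrite mxE.
by apply: cmeas_sum => k; apply: cmeasM; [case: (hA i k) => -[]|case: (hB k j) => -[]].
Qed.

Lemma cval_inv n (A B : R -> 'M[C]_n) : H2mx A -> H2mx B -> aeT (fun t => A t *m B t = 1%:M) ->
  cval A *m cval B = 1%:M.
Proof.
move=> hA hB e; rewrite -(cval_mul hA hB) (cval_ae (B := fun=> 1%:M) _ _ e).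
- by apply/matrixP => i j; rewrite mxE cint_cst.
- by move=> i j; exact: cmeas_H2mx_mul.
- by move=> i j; exact: cmeas_cst.
Qed.

(* Both sides are of class [H^1], one analytic and the other anti-analytic. *)
Lemma H2mx_mul_cst n (A B A' B' : R -> 'M[C]_n) : H2mx A -> H2mx B -> H2mx A' -> H2mx B' ->
  (forall t, A t *m B t = ctr (A' t *m B' t)) -> aeT (fun t => A t *m B t = cval A *m cval B).
Proof.
move=> hA hB hA' hB' e; rewrite -(cval_mul hA hB).
have prodI (X Y : R -> 'M[C]_n) i j : H2mx X -> H2mx Y -> cI (fun t => (X t *m Y t) i j).
  move=> /H2mxP hX /H2mxP hY.
  have -> : (fun t => (X t *m Y t) i j) = (fun t => \sum_k X t i k * Y t k j).
    by apply/funext => t; rewrite mxE.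
  by apply: cI_sum => k; apply: sL2_mul; [case: (hX i k)|case: (hY k j)].
have neg (X Y : R -> 'M[C]_n) i j (k : int) : H2mx X -> H2mx Y -> k < 0 ->
    cint (fun t => (X t *m Y t) i j * zeta t ^ (- k)) = 0.
  move=> /H2mxP hX /H2mxP hY k0.
  have -> : (fun t => (X t *m Y t) i j * zeta t ^ (- k)) =
      (fun t => \sum_l X t i l * Y t l j * zeta t ^ (- k)).
    by apply/funext => t; rewrite mxE mulr_suml.
  rewrite cint_sum => [|l]; first by rewrite big1// => l _; exact: sH2_mul_neg.
  have I0 : cI (fun t => X t i l * Y t l j) by apply: sL2_mul; [case: (hX i l)|case: (hY l j)].
  by apply: (cI_unit I0); [exact: cmeas_zetaz|move=> t; exact: cabs_zetaz].
suff : aeT (fun t => forall ij : 'I_n * 'I_n, (A t *m B t) ij.1 ij.2 -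
    cval (fun t => A t *m B t) ij.1 ij.2 = 0).
  apply: aeT_sub => t _ h; apply/matrixP => i j.
  by have /eqP := h (i, j); rewrite subr_eq0 => /eqP.
apply: aeT_cnt => -[i j] /=; set z := cval _ i j.
have hI := prodI A B i j hA hB; apply: fourier_unique; first by apply: (cIB hI); exact: cI_cst.
move=> k; have -> : (fun t => ((A t *m B t) i j - z) * zeta t ^ k) =
    (fun t => (A t *m B t) i j * zeta t ^ k - z * zeta t ^ k).
  by apply/funext => t; rewrite mulrBl.
have hIz : cI (fun t => (A t *m B t) i j * zeta t ^ k).
  by apply: (cI_unit hI); [exact: cmeas_zetaz|move=> t; exact: cabs_zetaz].
rewrite (cintB hIz (cIZ z (cI_zetaz R k))) (cintZ z (cI_zetaz R k)) cint_zetaz.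
have [->|k0] := eqVneq k 0.
  have -> : (fun t => (A t *m B t) i j * zeta t ^ 0) = (fun t => (A t *m B t) i j).
    by apply/funext => t; rewrite expr0z mulr1.
  by rewrite mulr1 /z [cval _ i j]mxE subrr.
rewrite mulr0 subr0; have [kp|kn] := ltP 0 k.
  have k1 : - k < 0 by lia.
  by rewrite -[k]opprK; exact: (neg A B i j _ hA hB k1).
have -> : (fun t => (A t *m B t) i j * zeta t ^ k) =
    (fun t => conjc ((A' t *m B' t) j i * zeta t ^ (- k))).
  by apply/funext => t; rewrite e conjcM zetazJ opprK; congr (_ * _); rewrite mxE [X in conjc X]mxE.
have k1 : k < 0 by lia.
have hI' := prodI A' B' j i hA' hB'.
rewrite cintJ; first by rewrite (neg A' B' j i _ hA' hB' k1) conjc0.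
by apply: (cI_unit hI'); [exact: cmeas_zetaz|move=> t; exact: cabs_zetaz].
Qed.
End MatrixHardy.

Section WienerHopfBase.
Variables (R : realType) (n : nat).
Local Notation C := (complex.complex R).
Local Notation V := (R -> 'cV[C]_n).
Local Notation ip := (@ip R n).
Local Notation zeta := (@zeta R).
Implicit Types (f g h m p : V) (U W : R -> 'M[C]_n).
Let L2s := @isL2_linsub R n.
Let H2s := @H2_linsub R n.
#[local] Opaque fcoef cint isL2 aeT dp.

(** [WH_factorization] without the ordering of the indices, which lowering one of them may destroy;
    [factored_sort] restores it. *)
Definition factored U (k : 'I_n -> int) := exists Q1 Q2 Q1i Q2i : R -> 'M[C]_n,
    [/\ H2mx Q1, H2mx Q2, H2mx Q1i & H2mx Q2i] /\
    [/\ aeT (fun t => Q1 t *m Q1i t = 1%:M /\ Q1i t *m Q1 t = 1%:M),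
        aeT (fun t => Q2 t *m Q2i t = 1%:M /\ Q2i t *m Q2 t = 1%:M) &
        aeT (fun t => U t = ctr (Q2 t) *m diag_mx (\row_j (zeta t ^ k j)) *m Q1 t)].

Section Fixed.
Variable U : R -> 'M[C]_n.
Hypothesis hU : unitary_valued U.

Lemma toep_cst p v : H2 p -> aeq (toep U p) (ek 0 v) ->
  (forall k, 0 < k -> fcoef (mulf U p) k = 0) /\ fcoef (mulf U p) 0 = v.
Proof.
move=> hp e; have L := isL2_mulf (unitary_Linfty hU) (H2_L2 hp).
have c (k : int) : 0 <= k -> fcoef (mulf U p) k = (k == 0)%:R *: v.
  move=> k0; have := fcoef_aeq k (H2_L2 (toep_H2 hU hp)) (isL2_ek 0 v) e.
  rewrite fcoef_ek /toep (fcoefB k L (Pm_L2 L)) (proj2 (Pm_H2minus L) k k0) subr0.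
  exact.
by split; [move=> k k0; rewrite c ?ltW// gt_eqF// scale0r|rewrite c// eqxx scale1r].
Qed.

Hypothesis onto : forall g, H2 g -> exists2 p, H2 p & aeq (toep U p) g.

(* The [q j] are the preimages of the constant basis vectors under the Toeplitz operator. *)
Lemma toep_columns : exists q : 'I_n -> V, [/\ forall j, H2 (q j),
  H2mx (fun t => ctr (U t *m colmx q t)), cval (fun t => ctr (U t *m colmx q t)) = 1%:M &
  forall j, (forall k, 0 < k -> fcoef (mulf U (q j)) k = 0) /\
    fcoef (mulf U (q j)) 0 = delta_mx j 0].
Proof.
have /choice[q hq] (j : 'I_n) : exists q, H2 q /\ aeq (toep U q) (ek 0 (delta_mx j 0)).
  by have [p ? ?] := onto (H2_ek (delta_mx j 0) (lexx 0)); exists p.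
have qH j : H2 (q j) by case: (hq j).
have hc j := toep_cst (qH j) (proj2 (hq j)).
have L j := isL2_mulf (unitary_Linfty hU) (H2_L2 (qH j)).
have E i j : (fun t => ctr (U t *m colmx q t) i j) = (fun t => conjc (mulf U (q i) t j 0)).
  apply/funext => t; rewrite mxE [X in conjc X]mxE /mulf -(col_colmx q t i) -col_mulmx.
  by rewrite [in RHS]mxE.
exists q; split => //.
  by apply/H2mxP => i j; rewrite E; case: (sH2_conj j (L i) (proj1 (hc i))).
apply/matrixP => i j; rewrite mxE E (proj2 (sH2_conj j (L i) (proj1 (hc i)))) (proj2 (hc i)).
rewrite !mxE andbT eq_sym; case: (_ == _); [exact: conjc1|exact: conjc0].
Qed.
End Fixed.

(** The Toeplitz operators of [U] and of its adjoint are onto; let [q] and [p] be matrices sent by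
    them to the constant 1. Then [P = (U q)^*] and [Q' = (U^* p)^*] are analytic with value 1 at 0,
    and [Q' q = p^* U q] is both analytic and anti-analytic, hence a constant [D]. As [U q = P^*],
    it remains to invert [q] by [D^-1 Q']. *)
Lemma factor_base U : unitary_valued U ->
  ess_form (@H2 R n) ip (qf ip (fun f => Pm (mulf U f))) ->
  (forall g, H2 g -> exists2 p, H2 p & aeq (toep U p) g) ->
  (forall f, H2 f -> H2minus (mulf U f) -> aeq f 0) ->
  factored U (fun=> 0).
Proof.
move=> hU hess onto inj; have hUc := unitary_adj hU.
have [d d0 hd] := adj_hankel_bound hU hess onto.
(* The Hankel operator of the adjoint is a strict contraction, so its form is coercive and the whole
   sequence serves as subsequence. *)
have hessc : ess_form (@H2 R n) ip (qf ip (fun f => Pm (mulf (ctrf U) f))).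
  exists d => // u hu _; exists id; split => // e e0; exists 0%N => k l _ _.
  have hv := subspB H2s (hu k) (hu l); have := hd _ hv; rewrite nq_qf.
  move: (nq ip _) (nq ip _) => x y; lra.
have ontoc : forall g, H2 g -> exists2 p, H2 p & aeq (toep (ctrf U) p) g.
  by apply: (toep_onto hUc hessc) => h hh; rewrite ctrfK; exact: inj.
have [q [qH PH P1 hq]] := toep_columns hU onto.
have [p [pH QH Q1 _]] := toep_columns hUc ontoc.
set P := (fun t => ctr (U t *m colmx q t)) in PH P1.
set Q' := (fun t => ctr (ctrf U t *m colmx p t)) in QH Q1.
have colH (g : 'I_n -> V) : (forall j, H2 (g j)) -> H2mx (colmx g).
  move=> gH j; have -> : (fun t => col j (colmx g t)) = g j by apply/funext => t; exact: col_colmx.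
  exact: gH.
have qmH := colH q qH; have pmH := colH p pH.
have cst : aeT (fun t => Q' t *m colmx q t = cval (colmx q)).
  rewrite -[cval _]mul1mx -Q1; apply: (H2mx_mul_cst QH qmH PH pmH) => t.
  by rewrite /Q' /P !ctrM !ctrK mulmxA.
set D := cval (colmx q) in cst.
have DE (a : 'cV[C]_n) : D *m a = fcoef (\sum_j a j 0 *: q j) 0.
  have -> : fcoef (\sum_j a j 0 *: q j) 0 = \sum_j a j 0 *: fcoef (q j) 0.
    elim: (index_enum _) => [|j r IH]; first by rewrite !big_nil fcoef0.
    rewrite !big_cons -IH; apply: (fcoefL 0 (a j 0) (H2_L2 (qH j))).
    by apply: (@subsp_sum _ _ (@isL2 R n) _ _ _ _ L2s) => i _; exact: (subspZ _ L2s (H2_L2 (qH i))).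
  apply/matrixP => i k; rewrite (ord1 k) [LHS]mxE summxE; apply: eq_bigr => j _.
  rewrite [RHS]mxE fcoefE mulrC; congr (_ * _); rewrite [LHS]mxE; congr cint.
  by apply/funext => t; rewrite mxE oppr0 expr0z mulr1.
(* If [D a = 0], the combination [h] of the columns of [q] vanishes at 0, while [U h] has analytic
   part [a]. So [z^-1 h] lies in the trivial kernel, and [a = 0]. *)
have uD : D \in unitmx.
  apply: unitmx_inj => a; rewrite DE => a0; set h := \sum_j _ in a0.
  have hH : H2 h.
    by apply: (@subsp_sum _ _ (@H2 R n) _ _ _ _ H2s) => j _; exact: (subspZ _ H2s (qH j)).
  have UL := isL2_mulf (unitary_Linfty hU).
  have Uh k : fcoef (mulf U h) k = \sum_j a j 0 *: fcoef (mulf U (q j)) k.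
    rewrite /h; elim: (index_enum _) => [|j r IH].
      have -> : mulf U (\sum_(i <- [::]) a i 0 *: q i) = 0.
        by apply/funext => t; rewrite /mulf big_nil mulmx0.
      by rewrite big_nil fcoef0.
    rewrite !big_cons -IH mulf_linear; apply: (fcoefL k (a j 0) (UL _ (H2_L2 (qH j)))).
    apply: UL.
    by apply: (@subsp_sum _ _ (@isL2 R n) _ _ _ _ L2s) => i _; exact: (subspZ _ L2s (H2_L2 (qH i))).
  have zH := H2_zsN1 hH a0.
  have z0 : aeq (zs (-1) h) 0.
    apply: (inj _ zH); rewrite mulf_zs; split; first exact: (isL2_zs (-1) (UL _ (H2_L2 hH))).
    move=> k k0; rewrite fcoef_zs opprK Uh big1// => j _.
    rewrite (proj1 (hq j)) ?scaler0//; lia.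
  have h0 : aeq (mulf U h) 0.
    rewrite -[h](zsK 1) mulf_zs; apply: aeT_sub z0 => t _ e.
    rewrite /zs /mulf; move: e; rewrite /zs => ->.
    by rewrite mulmx0 scaler0.
  have := fcoef_aeq 0 (UL _ (H2_L2 hH)) (proj1 L2s) h0; rewrite fcoef0 Uh.
  under eq_bigr => j _ do rewrite (proj2 (hq j)).
  by rewrite vec_sum_delta.
exists (fun t => invmx D *m Q' t), P, (colmx q), (fun t => colmx p t *m ctr (invmx D)).
split.
  split => //; first exact: (Hinf_mulH2mx (Hinf_cst (invmx D)) QH).
  exact: (H2mx_mulHinf pmH (Hinf_cst (ctr (invmx D)))).
have e1 : aeT (fun t => invmx D *m Q' t *m colmx q t = 1%:M).
  by apply: aeT_sub cst => t _ e; rewrite -mulmxA e mulVmx.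
split.
- by apply: aeT_sub e1 => t _ e; split => //; exact: mulmx1C.
- apply: aeT_sub cst => t _ e.
  have e2 : P t *m (colmx p t *m ctr (invmx D)) = 1%:M.
    have -> : P t *m (colmx p t *m ctr (invmx D)) = ctr (invmx D *m (Q' t *m colmx q t)).
      by rewrite /P /Q' !ctrM !ctrK !mulmxA.
    by rewrite e mulVmx// ctr1.
  by split => //; exact: mulmx1C.
- apply: aeT_sub e1 => t _ e; rewrite /P ctrK.
  have -> : diag_mx (\row_j (zeta t ^ (0 : int))) = 1%:M :> 'M[C]_n.
    by apply/matrixP => i j; rewrite !mxE expr0z.
  by rewrite mulmx1 -mulmxA (mulmx1C e) mulmx1.
Qed.
End WienerHopfBase.

(** * Diagonal factors and Blaschke factors *)

Section WienerHopfStep.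
Variables (R : realType) (n : nat).
Local Notation C := (complex.complex R).
Local Notation V := (R -> 'cV[C]_n).
Local Notation zeta := (@zeta R).
Implicit Types (f g h m p : V) (U W : R -> 'M[C]_n).
Let H2s := @H2_linsub R n.
#[local] Opaque fcoef cint isL2 aeT dp.

Definition zdiag (k : 'I_n -> int) t : 'M[C]_n := diag_mx (\row_j (zeta t ^ k j)).

Lemma zdiag_mul k l t : zdiag k t *m zdiag l t = zdiag (fun j => k j + l j) t.
Proof.
apply/matrixP => i j; rewrite /zdiag mul_diag_mx !mxE.
by case: eqP => [->|_]; rewrite ?mulr1n ?mulr0n ?mulr0// zetazM.
Qed.
Lemma zdiag0 t : zdiag (fun=> 0) t = 1%:M.
Proof. by apply/matrixP => i j; rewrite !mxE expr0z. Qed.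
Lemma zdiagK k t : zdiag k t *m zdiag (fun j => - k j) t = 1%:M.
Proof. by rewrite zdiag_mul -(zdiag0 t); congr (zdiag _ t); apply/funext => j; rewrite subrr. Qed.
Lemma zdiagNK k t : zdiag (fun j => - k j) t *m zdiag k t = 1%:M.
Proof. exact: mulmx1C (zdiagK k t). Qed.

Lemma zdiag_conjE k l (E : 'M[C]_n) t a b :
  (zdiag k t *m E *m zdiag l t) a b = zeta t ^ k a * E a b * zeta t ^ l b.
Proof. by rewrite /zdiag mul_mx_diag mul_diag_mx !mxE. Qed.

Section OuterChange.
Variables (k : 'I_n -> int) (E : 'M[C]_n).
Hypothesis hE : forall a b, E a b != 0 -> k a <= k b.
(** Entry [i, j] is [conj(E j i)] times [zeta^(k i - k j)], and [hE] makes the exponent nonnegative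
    wherever the entry is nonzero. *)
Lemma conj_zdiag_Hinf :
  Hinf (fun t => ctr (zdiag k t *m E *m zdiag (fun j => - k j) t)).
Proof.
have e i j t : ctr (zdiag k t *m E *m zdiag (fun j => - k j) t) i j =
    conjc (E j i) * zeta t ^ (k i - k j).
  rewrite mxE [X in conjc X]mxE zdiag_conjE !conjcM !zetazJ opprK addrC zetazM.
  move: (conjc _) (zeta t ^ _) (zeta t ^ _) => x y z; ring.
have s i j : sH2 (fun t => ctr (zdiag k t *m E *m zdiag (fun j => - k j) t) i j).
  under eq_fun do rewrite e.
  have [->|/hE h] := eqVneq (E j i) 0.
    have -> : (fun t => conjc 0 * zeta t ^ (k i - k j)) = (fun=> 0).
      by apply/funext => t; rewrite conjc0 mul0r.
    exact: sH2_cst.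
  by apply: sH2_mulz; [rewrite subr_ge0|exact: sH2_cst].
apply: sH2_HinfP => //; split; first by move=> i j; case: (s i j) => -[].
exists (\sum_i \sum_j cabs (E i j)); apply: aeT_all => t _ i j.
rewrite e cabsM cabsJ cabs_zetaz mulr1 (bigD1 j)//= (bigD1 i)//= -addrA lerDl.
apply: addr_ge0; first by apply: sumr_ge0 => *; exact: cabs_ge0.
by apply: sumr_ge0 => *; apply: sumr_ge0 => *; exact: cabs_ge0.
Qed.
End OuterChange.

Section Blaschke.
Variable v : 'cV[C]_n.
Hypothesis v1 : ctr v *m v = 1%:M.
Definition pv : 'M[C]_n := v *m ctr v.
(** The Blaschke-Potapov factor with its zero at the origin in the direction [v]. *)
Definition bl t : 'M[C]_n := 1%:M - pv + zeta t *: pv.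

Lemma pv2 : pv *m pv = pv.
Proof. by rewrite /pv mulmxA -(mulmxA v) v1 mulmx1. Qed.
Lemma pv_ctr : ctr pv = pv. Proof. by rewrite /pv ctrM ctrK. Qed.
Lemma ctr_bl t : ctr (bl t) = 1%:M - pv + zeta t ^ (-1) *: pv.
Proof.
rewrite /bl !ctrD ctrN ctr1 pv_ctr; congr (_ + _).
apply/matrixP => i j; rewrite mxE [X in conjc X]mxE [X in conjc X]mxE conjcM.
rewrite -[zeta t]expr1z zetazJ [RHS]mxE; congr (_ * _).
by rewrite -[in RHS]pv_ctr [RHS]mxE [X in _ = conjc X]mxE.
Qed.
Lemma bl_ctr t : bl t *m ctr (bl t) = 1%:M.
Proof.
have o : (1%:M - pv) *m pv = 0 by rewrite mulmxBl mul1mx pv2 subrr.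
have o' : pv *m (1%:M - pv) = 0 by rewrite mulmxBr mulmx1 pv2 subrr.
have s : (1%:M - pv) *m (1%:M - pv) = 1%:M - pv by rewrite mulmxBr mulmx1 o subr0.
have d : 1%:M - pv + pv = 1%:M by rewrite subrK.
rewrite ctr_bl /bl; move: (1%:M - pv) o o' s d => c o o' s d.
rewrite mulmxDl !mulmxDr s -!scalemxAl -!scalemxAr o o' !scaler0 addr0 add0r.
by rewrite pv2 scalerA -{1}[zeta t]expr1z -zetazM subrr expr0z scale1r.
Qed.
Lemma bl_entry i j t : bl t i j = (1%:M - pv) i j + pv i j * zeta t ^ 1.
Proof. by rewrite /bl [LHS]mxE [X in _ + X]mxE expr1z mulrC. Qed.
Lemma bl_unitary : unitary_valued bl.
Proof.
split; last by apply: aeT_all => t _; exact: mulmx1C (bl_ctr t).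
move=> i j; under eq_fun do rewrite bl_entry.
by apply: cmeasD; [exact: cmeas_cst|apply: cmeasM; [exact: cmeas_cst|exact: cmeas_zetaz]].
Qed.
Lemma bl_Hinf : Hinf bl.
Proof.
apply: sH2_HinfP; first exact: (unitary_Linfty bl_unitary).
move=> i j; under eq_fun do rewrite bl_entry.
by apply: sH2D; [exact: sH2_cst|apply: sH2_mulz => //; exact: sH2_cst].
Qed.

(** The adjoint factor divides the component along [v] by [z], which is harmless once that component
    vanishes at 0. *)
Lemma bl_adj_H2 f : H2 f -> pv *m fcoef f 0 = 0 -> H2 (mulf (ctrf bl) f).
Proof.
move=> hf h0; have P M : H2 (mulf (fun=> M) f) := H2_mulf (Hinf_cst M) hf.
have -> : mulf (ctrf bl) f = mulf (fun=> 1%:M - pv) f + zs (-1) (mulf (fun=> pv) f).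
  by apply/funext => t; rewrite /mulf /ctrf ctr_bl mulmxDl -scalemxAl.
apply: (subspD H2s); first exact: P.
apply: (H2_zsN1 (P pv)); apply/matrixP => i k; rewrite (ord1 k) fcoefE [RHS]mxE.
have /matrixP/(_ i 0) := h0; rewrite [RHS]mxE => <-; rewrite [RHS]mxE.
have -> : (fun t => mulf (fun=> pv) f t i 0 * zeta t ^ (- 0)) =
    (fun t => \sum_j pv i j * (f t j 0 * zeta t ^ (- 0))).
  by apply/funext => t; rewrite /mulf mxE mulr_suml; apply: eq_bigr => j _; rewrite mulrA.
have I j := cI_coord j (- 0) (H2_L2 hf).
rewrite cint_sum => [|j]; last exact: (cIZ _ (I j)).
by apply: eq_bigr => j _; rewrite (cintZ _ (I j)) -fcoefE.
Qed.
End Blaschke.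
End WienerHopfStep.

Section WienerHopfFactor.
Variables (R : realType) (n : nat).
Local Notation C := (complex.complex R).
Local Notation V := (R -> 'cV[C]_n).
Local Notation zeta := (@zeta R).
Implicit Types (f g h m p : V) (U W : R -> 'M[C]_n).
#[local] Opaque fcoef cint isL2 aeT dp.

Lemma exists_argmax (P : pred 'I_n) (k : 'I_n -> int) j0 : P j0 ->
  exists2 i, P i & forall j, P j -> k j <= k i.
Proof. by move=> h; case: (Order.TotalTheory.arg_maxP k h) => i Pi hi; exists i. Qed.

Lemma cval_cst (M : 'M[C]_n) : cval (fun=> M) = M.
Proof. by apply/matrixP => i j; rewrite mxE cint_cst. Qed.

(** Write [U = Q2^* z^k Q1 bl^*]. The factor [Q1 bl^*] has the polar part [z^-1 w v^*] with
    [w = Q1(0) v]. A constant invertible [F] takes [w] to the basis vector of some index [i], so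
    that one power of [z] in row [i] removes the pole and lowers [k i] by one. The inverse [E] of
    [F], carried across [z^k], joins the left factor. *)
Lemma factor_step U (v : 'cV[C]_n) k : ctr v *m v = 1%:M ->
  factored (fun t => U t *m bl v t) k -> exists k', factored U k'.
Proof.
move=> v1 [Q1 [Q2 [Q1i [Q2i [[hQ1 hQ2 hQ1i hQ2i] [e1 e2 eU]]]]]].
pose w := cval Q1 *m v.
have wv : cval Q1i *m w = v.
  rewrite /w mulmxA (cval_inv hQ1i hQ1) ?mul1mx//.
  by apply: aeT_sub e1 => t _ [].
have [j0 wj0] : exists j, w j 0 != 0.
  apply: contrapT => no; have w0 : w = 0.
    apply/matrixP => j l; rewrite (ord1 l) [RHS]mxE; apply/eqP/negPn/negP => h.
    by apply: no; exists j.
  have /matrixP/(_ 0 0) := v1; rewrite -wv w0 mulmx0 mulmx0 !mxE => /esym/eqP.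
  by rewrite oner_eq0.
(* Among the nonzero coordinates of [w], [i] has the largest index; this keeps the powers in
   [z^k E z^-k] nonpositive, so that its adjoint is analytic and can be absorbed in [Q2]. *)
have [i wi imax] := exists_argmax (P := fun j => w j 0 != 0) k wj0.
pose er : 'rV[C]_n := delta_mx 0 i; pose ei : 'cV[C]_n := delta_mx i 0.
(* [E] is the identity with column [i] replaced by [w], and [F] is its inverse. *)
pose E : 'M[C]_n := 1%:M + (w - ei) *m er.
pose F : 'M[C]_n := 1%:M - (w i 0)^-1 *: ((w - ei) *m er).
have rei : er *m ei = 1%:M by rewrite /er /ei mul_delta_mx; apply/matrixP => a b; rewrite !mxE !ord1.
have rw : er *m w = (w i 0)%:M.
  by rewrite /er -rowE; apply/matrixP => a b; rewrite !mxE !ord1 eqxx mulr1n.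
have Eei : E *m ei = w by rewrite /E mulmxDl mul1mx -mulmxA rei mulmx1 addrC subrK.
have EF : E *m F = 1%:M.
  rewrite /E /F; have ry : er *m (w - ei) = (w i 0 - 1)%:M by rewrite mulmxBr rei rw -raddfB.
  move: (w - ei) ry => y ry; rewrite mulmxBr mulmx1 -scalemxAr mulmxDl mul1mx.
  rewrite -mulmxA [er *m _]mulmxA ry mul_scalar_mx -scalemxAr scalerDr scalerA -scalerDl.
  have -> : (w i 0)^-1 + (w i 0)^-1 * (w i 0 - 1) = 1 by rewrite mulrBr mulVf// mulr1 addrC subrK.
  by rewrite scale1r addrK.
have FE := mulmx1C EF.
have Fw : F *m w = ei by rewrite -Eei mulmxA FE mul1mx.
have yE a b : ((w - ei) *m er) a b = (w a 0 - (a == i)%:R) * (b == i)%:R.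
  by rewrite mxE big_ord1 !mxE !eqxx andbT.
have hE a b : E a b != 0 -> k a <= k b.
  rewrite /E [X in X != 0]mxE yE [(1%:M) a b]mxE; have [->//|ab] := eqVneq a b.
  have [bi|bi] := eqVneq b i; last by rewrite mulr0 addr0 eqxx.
  rewrite bi mulr1 add0r -bi (negPf ab) subr0 => h; rewrite bi; exact: imax.
have hF a b : F a b != 0 -> k a <= k b.
  rewrite /F [X in X != 0]mxE [X in _ + X]mxE [X in _ - X]mxE yE [(1%:M) a b]mxE.
  have [->//|ab] := eqVneq a b.
  have [bi|bi] := eqVneq b i; last by rewrite !mulr0 subr0 eqxx.
  rewrite bi mulr1 add0r -bi (negPf ab) subr0 oppr_eq0 mulf_eq0 negb_or => /andP[_ h].
  by rewrite bi; exact: imax.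
pose d (j : 'I_n) : int := (j == i)%:Z.
have pvv : pv v *m v = v by rewrite /pv -mulmxA v1 mulmx1.
pose Y t := F *m Q1 t; pose Z t := bl v t *m (Q1i t *m E).
have hY : H2mx Y by exact: (Hinf_mulH2mx (Hinf_cst F) hQ1).
have hYp (M : 'M[C]_n) : H2mx (fun t => Y t *m M) by exact: (H2mx_mulHinf hY (Hinf_cst M)).
have hZ : H2mx Z.
  by apply: (Hinf_mulH2mx (bl_Hinf v1)); exact: (H2mx_mulHinf hQ1i (Hinf_cst E)).
(* The residue [F Q1(0) v v^*] lives in row [i] alone. *)
have cY a b : a != i -> cint (fun t => (Y t *m pv v) a b) = 0.
  move=> ai; have -> : cint (fun t => (Y t *m pv v) a b) = cval (fun t => Y t *m pv v) a b.
    by rewrite mxE.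
  have cH (M : 'M[C]_n) : H2mx (fun _ : R => M) by move=> j; apply/H2_coordP => l; exact: sH2_cst.
  rewrite (cval_mul hY (cH _)) (cval_mul (cH _) hQ1) !cval_cst.
  have -> : F *m cval Q1 *m pv v = ei *m ctr v by rewrite /pv mulmxA -[F *m _ *m v]mulmxA -/w Fw.
  rewrite mxE big_ord1 mxE (negPf ai) mul0r; reflexivity.
have blH : H2mx (bl v) by apply/H2mxP => a b; exact: (Hinf_sH2 a b (bl_Hinf v1)).
have cbl : cval (bl v) = 1%:M - pv v.
  apply/matrixP => a b; rewrite mxE; under eq_fun do rewrite bl_entry.
  rewrite (cintD (cI_cst _) (cIZ _ (cI_zetaz R 1))) (cintZ _ (cI_zetaz R 1)) cint_zetaz.
  by rewrite cint_cst mulr0 addr0.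
(* At 0, column [i] of [Z] is [bl(0)] applied to the inverse of [Q1(0)] at [w], that is
   [bl(0) v = 0]; it can therefore be divided by [z]. *)
have cZ a : cint (fun t => Z t a i) = 0.
  have cH (M : 'M[C]_n) : H2mx (fun _ : R => M) by move=> j; apply/H2_coordP => l; exact: sH2_cst.
  have -> : cint (fun t => Z t a i) = cval Z a i by rewrite mxE.
  rewrite (cval_mul blH (H2mx_mulHinf hQ1i (Hinf_cst E))) (cval_mul hQ1i (cH _)) cval_cst cbl.
  have -> : ((1%:M - pv v) *m (cval Q1i *m E)) a i =
      (((1%:M - pv v) *m (cval Q1i *m E)) *m ei) a 0 by rewrite /ei -colE [RHS]mxE.
  by rewrite -!mulmxA Eei wv mulmxBl mul1mx pvv subrr mxE.
exists (fun j => k j - d j).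
exists (fun t => zdiag d t *m (Y t *m ctr (bl v t))),
  (fun t => ctr (zdiag k t *m E *m zdiag (fun j => - k j) t) *m Q2 t),
  (fun t => Z t *m zdiag (fun j => - d j) t),
  (fun t => Q2i t *m ctr (zdiag k t *m F *m zdiag (fun j => - k j) t)).
split; first split.
- apply/H2mxP => a b.
  have -> : (fun t => (zdiag d t *m (Y t *m ctr (bl v t))) a b) =
    (fun t => (Y t *m (1%:M - pv v)) a b * zeta t ^ d a + (Y t *m pv v) a b * zeta t ^ (d a - 1)).
    apply/funext => t; rewrite /zdiag mul_diag_mx mxE [X in X * _]mxE ctr_bl// mulmxDr -scalemxAr.
    rewrite [X in _ * X]mxE [X in _ + X]mxE zetazM.
    move: (zeta t ^ _) (zeta t ^ _) ((_ *m _) a b) ((_ *m _) a b) => x y z z'; ring.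
  have sY M := proj1 (H2mxP _) (hYp M) a b.
  apply: sH2D; first by apply: (sH2_mulz _ (sY _)).
  rewrite /d; have [_|ai] := eqVneq a i; first by apply: (sH2_mulz _ (sY _)).
  by apply: (sH2_mulzN1 (sY _)); exact: cY.
- exact: (Hinf_mulH2mx (conj_zdiag_Hinf hE) hQ2).
- apply/H2mxP => a b.
  have -> : (fun t => (Z t *m zdiag (fun j => - d j) t) a b) = (fun t => Z t a b * zeta t ^ (- d b)).
    by apply/funext => t; rewrite /zdiag mul_mx_diag mxE [X in _ * X]mxE.
  have sZ := proj1 (H2mxP _) hZ a b; rewrite /d; have [bi|bi] := eqVneq b i.
    by apply: (sH2_mulzN1 sZ); rewrite bi; exact: cZ.
  by apply: (sH2_mulz _ sZ).
- exact: (H2mx_mulHinf hQ2i (conj_zdiag_Hinf hF)).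
have bc t := bl_ctr v1 t; have cb t := mulmx1C (bc t).
split.
- apply: aeT_sub e1 => t _ [q1 q2].
  have e : zdiag d t *m (Y t *m ctr (bl v t)) *m (Z t *m zdiag (fun j => - d j) t) = 1%:M.
    rewrite /Y /Z -!mulmxA [ctr _ *m _]mulmxA cb mul1mx [Q1 t *m _]mulmxA q1 mul1mx.
    by rewrite [F *m _]mulmxA FE mul1mx zdiagK.
  by split; [exact: e|exact: mulmx1C e].
- apply: aeT_sub e2 => t _ [q1 q2].
  have e : ctr (zdiag k t *m E *m zdiag (fun j => - k j) t) *m Q2 t *m
      (Q2i t *m ctr (zdiag k t *m F *m zdiag (fun j => - k j) t)) = 1%:M.
    rewrite -mulmxA [Q2 t *m _]mulmxA q1 mul1mx -ctrM.
    rewrite -!mulmxA [zdiag (fun j => - k j) t *m _]mulmxA zdiagNK mul1mx.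
    by rewrite [F *m _]mulmxA FE mul1mx zdiagK ctr1.
  by split; [exact: e|exact: mulmx1C e].
- apply: aeT_sub eU => t _ eU; rewrite -/(zdiag k t) in eU; rewrite -/(zdiag (fun j => k j - d j) t).
  rewrite -[LHS]mulmx1 -(bc t) mulmxA eU ctrM ctrK /Y -!mulmxA.
  have Zd : zdiag (fun j => k j - d j) t *m zdiag d t = zdiag k t.
    by rewrite zdiag_mul; congr (zdiag _ t); apply/funext => j; rewrite subrK.
  rewrite [zdiag (fun j => k j - d j) t *m _]mulmxA Zd.
  rewrite [zdiag (fun j => - k j) t *m _]mulmxA zdiagNK mul1mx [E *m _]mulmxA EF mul1mx.
  reflexivity.
Qed.
End WienerHopfFactor.

(** * Existence by induction on the kernel of the Toeplitz operator *)

Section WienerHopfExistence.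
Variables (R : realType) (n : nat).
Local Notation C := (complex.complex R).
Local Notation V := (R -> 'cV[C]_n).
Local Notation ip := (@ip R n).
Implicit Types (f g h m p : V) (U W : R -> 'M[C]_n).
Let L2s := @isL2_linsub R n.
Let H2s := @H2_linsub R n.
#[local] Opaque fcoef cint isL2 aeT dp.

Definition tker U f := H2 f /\ H2minus (mulf U f).

(** If all kernel functions vanished at 0, [m] could be divided by [z] indefinitely within the
    kernel, and all its coefficients would be 0. *)
Lemma tker_value U m : Linfty U -> tker U m -> ~ aeq m 0 ->
  exists2 p, tker U p & fcoef p 0 != 0.
Proof.
move=> LU hm m0; apply: contrapT => no; apply: m0.
have c0 p : tker U p -> fcoef p 0 = 0.
  by move=> hp; apply/eqP/negPn/negP => h; apply: no; exists p.
have step (k : nat) : tker U (zs (- k%:Z) m).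
  elim: k => [|k IH]; first by rewrite oppr0 zs0.
  have -> : zs (- k.+1%:Z) m = zs (-1) (zs (- k%:Z) m) by rewrite zsA; congr zs; lia.
  split; first exact: (H2_zsN1 (proj1 IH) (c0 _ IH)).
  by rewrite mulf_zs; apply: (H2minus_zs _ (proj2 IH)).
apply: (L2_unique (H2_L2 (proj1 hm))) => k; have [k0|k0] := ltP k 0.
  exact: (proj2 (proj1 hm) k k0).
case: k k0 => // k _; have := c0 _ (step k); rewrite fcoef_zs sub0r opprK; exact.
Qed.

(** A bound on the dimension of the kernel modulo functions vanishing almost everywhere. *)
Definition tkerdim_le U (k : nat) := forall e : 'I_k.+1 -> V, (forall i, tker U (e i)) ->
  exists2 a : 'cV[C]_k.+1, a != 0 & aeq (\sum_i a i 0 *: e i) 0.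

Lemma aeq_sum (J : Type) (r : seq J) (u w : J -> V) : (forall j, aeq (u j) (w j)) ->
  aeq (\sum_(j <- r) u j) (\sum_(j <- r) w j).
Proof.
move=> h; elim: r => [|j r IH]; first by rewrite !big_nil; exact: aeq_refl.
by rewrite !big_cons; exact: aeqD.
Qed.

Lemma tkerdim_exists U : unitary_valued U ->
  ess_form (@H2 R n) ip (qf ip (fun f => Pm (mulf U f))) -> exists k, tkerdim_le U k.
Proof.
move=> hU hess; have qH := unitary_qH hU.
have [d [e [eN eo eb]]] := ess_null_findim (ip_H2_hform R n) qH hess.
exists d => m hm; pose M : 'M[C]_(d, d.+1) := \matrix_(l, i) ip (m i) (e l).
have [|a a0 Ma] := @ker_exists _ _ _ M; first by rewrite ltnS rank_leq_row.
exists a => //.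
have eL l : isL2 (e l) by case: (eN l) => /H2_L2.
have h1 i : aeq (a i 0 *: m i) (a i 0 *: \sum_l ip (m i) (e l) *: e l).
  have mN : qnull (@H2 R n) (qf ip (fun f => Pm (mulf U f))) (m i).
    by split; [case: (hm i)|apply/(nq_qf_eq0P hU (proj1 (hm i))); case: (hm i)].
  have sL : isL2 (\sum_l ip (m i) (e l) *: e l).
    by apply: (@subsp_sum _ _ (@isL2 R n) _ _ _ _ L2s) => l _; exact: (subspZ _ L2s (eL l)).
  apply: aeT_sub (nqB_aeq (H2_L2 (proj1 (hm i))) sL (eb _ mN)) => t _ h.
  by rewrite -[LHS]/(a i 0 *: m i t) h.
apply: aeq_trans (aeq_sum _ h1) _.
suff -> : \sum_i a i 0 *: (\sum_l ip (m i) (e l) *: e l) = 0 by exact: aeq_refl.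
under eq_bigr => i _ do rewrite scaler_sumr.
rewrite exchange_big big1 // => l _.
under eq_bigr => i _ do rewrite scalerA.
rewrite -scaler_suml; have /matrixP/(_ l 0) := Ma; rewrite [RHS]mxE [LHS]mxE.
under eq_bigr => i _ do rewrite [M l i]mxE mulrC.
by move=> ->; rewrite scale0r.
Qed.

Lemma unitary_mul U W : unitary_valued U -> unitary_valued W ->
  unitary_valued (fun t => U t *m W t).
Proof.
move=> [mU hU] [mW hW]; split.
  move=> i j; have -> : (fun t => (U t *m W t) i j) = (fun t => \sum_k U t i k * W t k j).
    by apply/funext => t; rewrite mxE.
  by apply: cmeas_sum => k; exact: cmeasM.
apply: aeT_sub2 hU hW => t _ e1 e2.
by rewrite ctrM -mulmxA [ctr (U t) *m _]mulmxA e1 mul1mx.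
Qed.

Section OneStep.
Variables (U : R -> 'M[C]_n) (m : V).
Hypotheses (hU : unitary_valued U)
  (hess : ess_form (@H2 R n) ip (qf ip (fun f => Pm (mulf U f))))
  (onto : forall g, H2 g -> exists2 p, H2 p & aeq (toep U p) g).
Hypotheses (hm : tker U m) (m0 : fcoef m 0 != 0).
Let x := fcoef m 0.
Let v := real_complex R (vnorm x)^-1 *: x.

Let x0 : 0 < vnorm x.
Proof.
rewrite lt_neqAle vnorm_ge0 andbT eq_sym; apply/eqP => /vnorm_eq0 e.
by move: m0; rewrite -/x e eqxx.
Qed.
Let ctr_dp (y z : 'cV[C]_n) : (ctr y *m z) 0 0 = dp z y.
Proof. by rewrite mxE dpE; apply: eq_bigr => j _; rewrite mxE [X in conjc X]mxE mulrC. Qed.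
Let v1 : ctr v *m v = 1%:M.
Proof.
have nv : vnorm v = 1.
  rewrite /v vnormZ cabs_real ger0_norm ?invr_ge0 ?vnorm_ge0//.
  by apply: mulVf; rewrite gt_eqF.
apply/matrixP => a b; rewrite !ord1 ctr_dp mxE dp_diag nv expr1n; reflexivity.
Qed.
Let vx : dp x v = real_complex R (vnorm x).
Proof.
have xE : x = real_complex R (vnorm x) *: v.
  by rewrite /v scalerA -rmorphM mulfV ?gt_eqF// scale1r.
by rewrite {1}xE (hformZl (@dp_hform R n) _ Logic.I Logic.I) -ctr_dp v1 mxE mulr1.
Qed.
(** Multiplication by the Blaschke factor in the direction of [m(0)] keeps the Toeplitz operator
    onto and takes [m] out of the kernel. *)
Let U' t := U t *m bl v t.
Let mulU' f : mulf U' f = mulf U (mulf (bl v) f).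
Proof. by apply/funext => t; rewrite /mulf mulmxA. Qed.
Let hB := bl_unitary v1.

Let blH f : H2 f -> H2 (mulf (bl v) f). Proof. exact: (H2_mulf (bl_Hinf v1)). Qed.

Let U'_unitary : unitary_valued U'. Proof. exact: (unitary_mul hU hB). Qed.

Let U'_ess : ess_form (@H2 R n) ip (qf ip (fun f => Pm (mulf U' f))).
Proof.
have [d d0 h] := hess; exists d => // u hu [M hM].
have nb f : H2 f -> nq ip (mulf (bl v) f) = nq ip f.
  by move=> hf; rewrite /nq (ip_unitary hB (H2_L2 hf) (H2_L2 hf)).
have [|phi [phiI hp]] := h (fun k => mulf (bl v) (u k)) (fun k => blH (hu k)).
  by exists M => k; rewrite nb.
exists phi; split => // e e0; have [N hN] := hp e e0; exists N => k l Nk Nl.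
have e1 : mulf (bl v) (u (phi k)) - mulf (bl v) (u (phi l)) = mulf (bl v) (u (phi k) - u (phi l)).
  by apply/funext => t; rewrite /mulf mulmxBr.
have hd := subspB H2s (hu (phi k)) (hu (phi l)).
have := hN k l Nk Nl; rewrite e1 (nb _ hd) 2!nq_qf (nb _ hd) mulU'; exact.
Qed.

(** A preimage [f] for [U] is corrected by a multiple of the kernel function [m] until its value at
    0 is orthogonal to [v]; then [bl^* f] is analytic. *)
Let U'_onto g : H2 g -> exists2 p, H2 p & aeq (toep U' p) g.
Proof.
move=> hg; have [f hf fg] := onto hg.
pose c := dp (fcoef f 0) v / dp x v.
have hf1 := subspD H2s (subspZ (- c) H2s (proj1 hm)) hf.
have dvx : dp x v != 0.
  by rewrite vx -(rmorph0 (real_complex R)) (inj_eq (@complexI R)) gt_eqF.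
have k0 : pv v *m fcoef (- c *: m + f) 0 = 0.
  rewrite (fcoefL 0 (- c) (H2_L2 (proj1 hm)) (H2_L2 hf)) -/x /pv -mulmxA.
  suff -> : ctr v *m (- c *: x + fcoef f 0) = 0 by rewrite mulmx0.
  apply/matrixP => a b; rewrite !ord1 ctr_dp (hformL (@dp_hform R n) _ Logic.I Logic.I Logic.I).
  by rewrite /c mulNr divfK// addNr [RHS]mxE.
exists (mulf (ctrf (bl v)) (- c *: m + f)); first exact: (bl_adj_H2 hf1 k0).
have e1 : mulf U' (mulf (ctrf (bl v)) (- c *: m + f)) = mulf U (- c *: m + f).
  rewrite mulU'; congr mulf; apply/funext => t.
  by rewrite /mulf mulmxA /ctrf (bl_ctr v1) mul1mx.
rewrite /toep e1 -/(toep U (- c *: m + f)).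
apply: aeq_trans (toep_linear hU (- c) (proj1 hm) hf) _.
apply: aeT_sub2 fg (Pm_id (proj2 hm)) => t _ e2 e3.
rewrite -[LHS]/(- c *: (mulf U m t - Pm (mulf U m) t) + toep U f t) e3 subrr scaler0 add0r.
exact: e2.
Qed.

(** Kernel functions [e j] of [U'] give [bl e_j] in the kernel of [U]. In a dependence between these
    and [m] the coefficient of [m] is 0, because the values of [bl e_j] at 0 are orthogonal to [v]
    and that of [m] is not. *)
Let U'_kerdim k : tkerdim_le U k.+1 -> tkerdim_le U' k.
Proof.
move=> h e he.
pose e' (i : 'I_k.+2) := if unlift ord0 i is Some j then mulf (bl v) (e j) else m.
have he' i : tker U (e' i).
  rewrite /e'; case: unliftP => [j _|_] //; split; first exact: (blH (proj1 (he j))).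
  by rewrite -mulU'; case: (he j).
have [a a0 ha] := h e' he'.
have eE : \sum_i a i 0 *: e' i = a ord0 0 *: m + mulf (bl v) (\sum_j a (lift ord0 j) 0 *: e j).
  rewrite big_ord_recl; congr (_ + _); first by rewrite /e' unlift_none.
  transitivity (\sum_j a (lift ord0 j) 0 *: mulf (bl v) (e j)).
    by apply: eq_bigr => j _; rewrite /e' liftK.
  apply/funext => t; rewrite /mulf !fct_sumE mulmx_sumr; apply: eq_bigr => j _.
  by rewrite -[(_ *: e j) t]/(_ *: e j t) -scalemxAr.
rewrite eE in ha; set s := \sum_j _ in ha.
have sH : H2 s.
  by apply: (@subsp_sum _ _ (@H2 R n) _ _ _ _ H2s) => j _; exact: (subspZ _ H2s (proj1 (he j))).
have sbH := blH sH.
have a00 : a ord0 0 = 0.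
  have L := subspD L2s (subspZ (a ord0 0) L2s (H2_L2 (proj1 hm))) (H2_L2 sbH).
  have := fcoef_aeq 0 L (proj1 L2s) ha; rewrite fcoef0.
  rewrite (fcoefL 0 _ (H2_L2 (proj1 hm)) (H2_L2 sbH)) -/x => e0.
  have : dp (a ord0 0 *: x + fcoef (mulf (bl v) s) 0) v = 0.
    by rewrite e0 (hform0l (@dp_hform R n) Logic.I).
  rewrite (hformL (@dp_hform R n) _ Logic.I Logic.I Logic.I).
  have -> : dp (fcoef (mulf (bl v) s) 0) v = 0.
    rewrite (dp_fcoef 0 v (H2_L2 sbH)) ip_mulf_adj.
    have -> : mulf (ctrf (bl v)) (ek 0 v) = ek (-1) v.
      apply/funext => t; rewrite /mulf /ctrf /ek ctr_bl expr0z scale1r mulmxDl mulmxBl mul1mx.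
      by rewrite -scalemxAl /pv -mulmxA v1 mulmx1 subrr add0r.
    exact: (ip_H2_H2minus sH (H2minus_ek v (ltac:(done) : (-1 : int) < 0))).
  rewrite addr0 vx => /eqP; rewrite mulf_eq0 => /orP[/eqP //|].
  by rewrite -(rmorph0 (real_complex R)) (inj_eq (@complexI R)) gt_eqF.
exists (\col_j a (lift ord0 j) 0).
  apply/eqP => e0; move/eqP: a0; apply; apply/matrixP => i l; rewrite (ord1 l) [RHS]mxE.
  case: (unliftP ord0 i) => [j ->|-> //].
  by have /matrixP/(_ j 0) := e0; rewrite 2!mxE.
have -> : \sum_i (\col_j a (lift ord0 j) 0) i 0 *: e i = s.
  by apply: eq_bigr => j _; rewrite mxE.
apply: aeT_sub ha => t _; rewrite a00 scale0r add0r => e0.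
rewrite -[LHS]mul1mx -(mulmx1C (bl_ctr v1 t)) -mulmxA.
by move: e0; rewrite /mulf => ->; rewrite mulmx0.
Qed.

Lemma factor_reduce k :
  (forall W, unitary_valued W -> ess_form (@H2 R n) ip (qf ip (fun f => Pm (mulf W f))) ->
    (forall g, H2 g -> exists2 p, H2 p & aeq (toep W p) g) -> tkerdim_le W k ->
    exists k', factored W k') ->
  tkerdim_le U k.+1 -> exists k', factored U k'.
Proof.
move=> IH hk; have [k' hk'] := IH U' U'_unitary U'_ess U'_onto (U'_kerdim hk).
exact: (factor_step v1 hk').
Qed.
End OneStep.

Lemma factor_exists k U : unitary_valued U ->
  ess_form (@H2 R n) ip (qf ip (fun f => Pm (mulf U f))) ->
  (forall g, H2 g -> exists2 p, H2 p & aeq (toep U p) g) ->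
  tkerdim_le U k -> exists k', factored U k'.
Proof.
elim: k U => [|k IH] U hU hess onto hk;
  have [inj|/existsNP[m /not_implyP[hm /not_implyP[hm' m0]]]] :=
    pselect (forall f, H2 f -> H2minus (mulf U f) -> aeq f 0);
  try by exists (fun=> 0); exact: factor_base.
  case: m0; have [a a0 ha] := hk (fun=> m) (fun=> conj hm hm').
  have {}a0 : a ord0 0 != 0.
    apply: contra a0 => /eqP e; apply/eqP/matrixP => i j.
    by rewrite (ord1 i) (ord1 j) [RHS]mxE -e.
  apply: aeT_sub ha => t _; rewrite big_ord1 => /eqP; rewrite scaler_eq0 (negPf a0) => /eqP.
  exact.
have [p hp p0] := tker_value (unitary_Linfty hU) (conj hm hm') m0.
exact: (factor_reduce hU hess onto hp p0 IH hk).
Qed.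
End WienerHopfExistence.

(** * Indices read off from dimensions *)

Section WienerHopfIndices.
Variables (R : realType) (n : nat).
Local Notation C := (complex.complex R).
Local Notation V := (R -> 'cV[C]_n).
Local Notation ip := (@ip R n).
Local Notation zeta := (@zeta R).
Implicit Types (f g h m p : V) (U W : R -> 'M[C]_n).
#[local] Opaque fcoef cint isL2 aeT dp.

Lemma ctrZ (a : C) (A : 'M[C]_n) : ctr (a *: A) = conjc a *: ctr A.
Proof.
apply/matrixP => i j; rewrite mxE [X in conjc X]mxE [X in conjc X]mxE conjcM [RHS]mxE.
by congr (_ * _); rewrite [RHS]mxE [X in _ = conjc X]mxE.
Qed.

Definition ztwist (k : int) U t : 'M[C]_n := zeta t ^ k *: U t.
Lemma mulf_ztwist k U f : mulf (ztwist k U) f = zs k (mulf U f).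
Proof. by apply/funext => t; rewrite /mulf /ztwist /zs -scalemxAl. Qed.
Lemma ztwistK k U : ztwist (- k) (ztwist k U) = U.
Proof.
by apply/funext => t; rewrite /ztwist scalerA -zetazM addNr expr0z scale1r.
Qed.
Lemma ctrf_ztwist k U : ctrf (ztwist k U) = ztwist (- k) (ctrf U).
Proof. by apply/funext => t; rewrite /ctrf /ztwist ctrZ zetazJ. Qed.
Lemma cmeas_ztwist k U i j : (forall i j, cmeas (fun t => U t i j)) ->
  cmeas (fun t => ztwist k U t i j).
Proof.
move=> mU; have -> : (fun t => ztwist k U t i j) = (fun t => zeta t ^ k * U t i j).
  by apply/funext => t; rewrite mxE.
by apply: cmeasM => //; exact: cmeas_zetaz.
Qed.
Lemma unitary_ztwist k U : unitary_valued U -> unitary_valued (ztwist k U).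
Proof.
move=> [mU hU]; split; first by move=> i j; exact: cmeas_ztwist.
apply: aeT_sub hU => t _ e; rewrite /ztwist ctrZ -scalemxAl -scalemxAr scalerA e zetazJ.
by rewrite -zetazM addNr expr0z scale1r.
Qed.

Lemma factored_ztwist U k (l : int) : factored U k -> factored (ztwist l U) (fun j => k j + l).
Proof.
move=> [Q1 [Q2 [Q1i [Q2i [h [e1 e2 eU]]]]]]; exists Q1, Q2, Q1i, Q2i.
split; [exact: h|split; [exact: e1|exact: e2|]].
apply: aeT_sub eU => t _ e; rewrite /ztwist e scalemxAl scalemxAr; congr (_ *m _ *m _).
apply/matrixP => i j; rewrite !mxE zetazM.
by case: (i == j); rewrite ?mulr1n ?mulr0n ?mulr0// mulrC.
Qed.

Lemma factored_sort U k : factored U k ->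
  exists2 k', (forall i j : 'I_n, (i <= j)%N -> k' i <= k' j) & factored U k'.
Proof.
move=> [Q1 [Q2 [Q1i [Q2i [[h1 h2 h1i h2i] [e1 e2 eU]]]]]].
have [s hs] := sort_perm k; exists (fun j => k (s j)) => //.
pose P : 'M[C]_n := perm_mx s.
have cP : ctr P *m P = 1%:M.
  have -> : ctr P = perm_mx s^-1.
    rewrite /P -tr_perm_mx; apply/matrixP => i j; rewrite mxE [X in conjc X]mxE !mxE.
    by case: (_ == _); [exact: conjc1|exact: conjc0].
  by rewrite /P -perm_mxM mulVg perm_mx1.
have Pc := mulmx1C cP.
have PL t : P *m zdiag k t = zdiag (fun j => k (s j)) t *m P.
  apply/matrixP => i j; rewrite /P /zdiag mul_diag_mx -row_permE [LHS]mxE [RHS]mxE.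
  rewrite [LHS]mxE [X in X *+ _]mxE [X in _ = X * _]mxE.
  have -> : perm_mx s i j = (s i == j)%:R :> C by rewrite !mxE.
  by rewrite mulr_natr.
have H (M : 'M[C]_n) Q (hQ : H2mx Q) : H2mx (fun t => M *m Q t) := Hinf_mulH2mx (Hinf_cst M) hQ.
have H' (M : 'M[C]_n) Q (hQ : H2mx Q) : H2mx (fun t => Q t *m M) := H2mx_mulHinf hQ (Hinf_cst M).
exists (fun t => P *m Q1 t), (fun t => P *m Q2 t), (fun t => Q1i t *m ctr P),
  (fun t => Q2i t *m ctr P); split.
  by split; [exact: H|exact: H|exact: H'|exact: H'].
have inv (A B : 'M[C]_n) : A *m B = 1%:M /\ B *m A = 1%:M ->
    P *m A *m (B *m ctr P) = 1%:M /\ B *m ctr P *m (P *m A) = 1%:M.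
  move=> [ab ba]; split; first by rewrite -mulmxA [A *m _]mulmxA ab mul1mx.
  by rewrite -mulmxA [ctr P *m _]mulmxA cP mul1mx.
split; [by apply: aeT_sub e1 => t _; exact: inv|by apply: aeT_sub e2 => t _; exact: inv|].
apply: aeT_sub eU => t _; rewrite -/(zdiag k t) -/(zdiag (fun j => k (s j)) t) => ->.
rewrite ctrM -[ctr (Q2 t) *m ctr P *m _]mulmxA -!mulmxA; congr (_ *m _).
by rewrite [zdiag _ t *m (P *m _)]mulmxA -PL !mulmxA cP mul1mx.
Qed.

(** If [U f] has only negative coefficients, multiplying by the inverse of [Q2^*] shows that
    coordinate [j] of [Q1 f] is [z^(- k j)] times a function with only negative coefficients; for
    [k j >= 0] it has mean zero. Conversely, [f = Q1^-1 c] is null for every constant [c] supported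
    on the negative indices. *)
Lemma factored_spdim U k : unitary_valued U ->
  (forall i j : 'I_n, (i <= j)%N -> k i <= k j) -> factored U k ->
  spdim (qf ip (fun f => Pm (mulf U f))) #|[set j | k j < 0]%SET|.
Proof.
move=> hU mono [Q1 [Q2 [Q1i [Q2i [[h1 h2 h1i h2i] [e1 e2 eU]]]]]].
set A := [set j | k j < 0]%SET; set s := #|A|.
have down (i j : 'I_n) : (i <= j)%N -> j \in A -> i \in A.
  by rewrite !inE => ij; exact: le_lt_trans (mono i j ij).
have sE (j : 'I_n) : (s <= j)%N = (0 <= k j).
  by rewrite leqNgt -(downset_card down) inE -leNgt.
have X1 : cval Q1 *m cval Q1i = 1%:M.
  by apply: (cval_inv h1 h1i); apply: aeT_sub e1 => t _ [].
have X2 := mulmx1C X1.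
exists (cval Q1); first by case/mulmx1_unit: X1.
have cvalE (Q : R -> 'M[C]_n) f : H2mx Q -> H2 f -> forall j, cint (fun t => (Q t *m f t) j 0) = (cval Q *m fcoef f 0) j 0.
  move=> hQ hf j; have fm : H2mx (f : R -> 'M[C]_(n, 1)).
    by move=> l; have -> // : (fun t => col l (f t)) = f; apply/funext => t; apply/matrixP => a b; rewrite mxE !ord1.
  have := cval_mul hQ fm => /matrixP/(_ j 0); rewrite [LHS]mxE => ->.
  have -> // : cval f = fcoef f 0; apply/matrixP => a b; rewrite (ord1 b) mxE fcoefE; congr cint.
  by apply/funext => t; rewrite oppr0 expr0z mulr1.
have UL f : H2 f -> isL2 (mulf U f).
  by move=> hf; exact: (isL2_mulf (unitary_Linfty hU) (H2_L2 hf)).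
move=> x; split => [[f [hf fx /(nq_qf_eq0P hU hf) hm]] j|fl].
  rewrite sE => kj; rewrite -fx -(cvalE Q1 f h1 hf).
  pose y t := conjc (dp (col j (Q2i t)) (mulf U f t) * zeta t ^ (k j)).
  have I0 := cI_dp (H2_L2 (h2i j)) (H2minus_L2 hm).
  have I1 : cI (fun t => dp (col j (Q2i t)) (mulf U f t) * zeta t ^ (k j)).
    by apply: (cI_unit I0); [exact: cmeas_zetaz|move=> t; exact: cabs_zetaz].
  have : cint y = 0.
    rewrite /y (cintJ I1) -[k j]opprK (dp_analytic (h2i j) hm); first exact: conjc0.
    by rewrite oppr_le0.
  move=> <-; apply: cint_ae.
  - have := cmeas_H2mx_mul j 0 h1 (_ : H2mx (f : R -> 'M[C]_(n, 1))); apply.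
    by move=> l; have -> // : (fun t => col l (f t)) = f; apply/funext => t; apply/matrixP => a b; rewrite mxE !ord1.
  - exact: (cmeasJ (cI_meas I1)).
  apply: aeT_sub2 e2 eU => t _ [q1 q2] eU.
  have E : Q1 t *m f t = zdiag (fun j => - k j) t *m (ctr (Q2i t) *m mulf U f t).
    rewrite /mulf eU -/(zdiag k t) -!mulmxA [ctr (Q2i t) *m _]mulmxA -ctrM q1 ctr1 mul1mx.
    by rewrite mulmxA zdiagNK mul1mx.
  rewrite E /zdiag mul_diag_mx mxE [X in X * _]mxE /y conjcM zetazJ mulrC; congr (_ * _).
  rewrite mxE dpE conjc_sum; apply: eq_bigr => l _; rewrite conjcM conjcK [in RHS]mxE mulrC.
  by rewrite mulrC mxE [X in conjc X]mxE.
pose c := cval Q1 *m x.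
have ccH : H2 (fun _ : R => c) by apply/H2_coordP => i; exact: sH2_cst.
pose f := mulf Q1i (fun=> c).
have fH : H2 f.
  have : H2mx (fun t => Q1i t *m (c : 'M[C]_(n, 1))).
    have -> : (fun t => Q1i t *m (c : 'M[C]_(n, 1))) = (fun t => \matrix_(i, j) \sum_l Q1i t i l * c l j).
      by apply/funext => t; apply/matrixP => a b; rewrite !mxE.
    apply/H2mxP => a b; under eq_fun do rewrite mxE.
    apply: sH2_sum => l; under eq_fun do rewrite mulrC.
    by apply: sH2Z; exact: (proj1 (H2mxP _) h1i a l).
  by move=> /(_ 0); have -> // : (fun t => col 0 (Q1i t *m c)) = f; apply/funext => t; apply/matrixP => a b; rewrite mxE !ord1.
exists f; split => //.
  apply/matrixP => j l; rewrite (ord1 l) fcoefE.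
  have -> : (fun t => f t j 0 * zeta t ^ (- 0)) = (fun t => (Q1i t *m c) j 0).
    by apply/funext => t; rewrite oppr0 expr0z mulr1.
  rewrite (cvalE Q1i _ h1i ccH).
  have -> : fcoef (fun _ : R => c) 0 = c.
    have -> : (fun _ : R => c) = ek 0 c by apply/funext => t; rewrite /ek expr0z scale1r.
    by rewrite fcoef_ek eqxx scale1r.
  by rewrite /c mulmxA X2 mul1mx.
apply/(nq_qf_eq0P hU fH); split; first exact: UL.
move=> m m0; apply/matrixP => l b; rewrite (ord1 b) fcoefE [RHS]mxE.
have sQ j := proj1 (H2mxP _) h2 j l.
have sI j := sL2_cI (k j - m) (sL2J (proj1 (sQ j))).
transitivity (cint (fun t => \sum_j c j 0 * (conjc (Q2 t j l) * zeta t ^ (k j - m)))).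
  apply: cint_ae.
  - exact: (cI_meas (cI_coord l _ (UL f fH))).
  - by apply: (cI_meas (cI_sum _ _)) => j; exact: (cIZ _ (sI j)).
  apply: aeT_sub2 e1 eU => t _ [q1 q2] eU.
  have -> : mulf U f t = ctr (Q2 t) *m (zdiag k t *m c).
    by rewrite /f /mulf eU -/(zdiag k t) -!mulmxA [Q1 t *m _]mulmxA q1 mul1mx.
  rewrite mxE mulr_suml; apply: eq_bigr => j _; rewrite /zdiag mul_diag_mx.
  rewrite [X in _ * X * _]mxE [X in _ * (X * _) * _]mxE [X in X * _ * _]mxE [X in conjc X * _ * _]mxE.
  by rewrite zetazM; move: (conjc _) (c j 0) (zeta t ^ _) (zeta t ^ _) => a1 a2 a3 a4; ring.
rewrite cint_sum => [|j]; last exact: (cIZ _ (sI j)).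
rewrite big1// => j _; rewrite (cintZ _ (sI j)).
have [sj|sj] := leqP s j; first by rewrite /c fl// mul0r.
have kj : k j < 0 by rewrite ltNge -sE -ltnNge.
have -> : (fun t => conjc (Q2 t j l) * zeta t ^ (k j - m)) =
    (fun t => conjc (Q2 t j l * zeta t ^ (- (k j - m)))).
  by apply/funext => t; rewrite conjcM zetazJ opprK.
rewrite cintJ; last exact: (sL2_cI _ (proj1 (sQ j))).
rewrite (proj2 (sQ j)); last by lia.
by rewrite conjc0 mulr0.
Qed.
End WienerHopfIndices.

(** * Prescribing the indices *)

Section Assembly.
Variables (R : realType) (n : nat).
Local Notation C := (complex.complex R).
Local Notation V := (R -> 'cV[C]_n).
Local Notation ip := (@ip R n).
#[local] Opaque fcoef cint isL2 aeT dp.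

Definition prescribed (r : nat) (d : 'I_n -> int) (i : int) : {set 'I_n} :=
  [set j : 'I_n | (j < r)%N || (d j < i)]%SET.

Lemma prescribed_down r d i : (forall a b : 'I_n, (r <= a)%N -> (a <= b)%N -> 0 <= d a /\ d a <= d b) ->
  forall a b : 'I_n, (a <= b)%N -> b \in prescribed r d i -> a \in prescribed r d i.
Proof.
move=> hd a b ab; rewrite !inE; have [//|ra] := ltnP a r.
have [_ dab] := hd a b ra ab.
by rewrite ltnNge (leq_trans ra ab)/=; exact: le_lt_trans.
Qed.

(** The counts are known at levels [i >= 0] only, which fixes the nonnegative indices and merely the
    sign of the others. *)
Lemma indices_determined (r : nat) (d k : 'I_n -> int) : (r <= n)%N ->
  (forall a b : 'I_n, (r <= a)%N -> (a <= b)%N -> 0 <= d a /\ d a <= d b) ->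
  (forall a b : 'I_n, (a <= b)%N -> k a <= k b) ->
  (forall i : nat, #|[set j | k j < i%:Z]%SET| = #|prescribed r d i|) ->
  forall j : 'I_n, ((j < r)%N -> k j < 0) /\ ((r <= j)%N -> k j = d j).
Proof.
move=> rn hd hk e j.
have h (i : nat) : (k j < i%:Z) = ((j < r)%N || (d j < i%:Z)).
  have dk (a b : 'I_n) : (a <= b)%N -> b \in [set j | k j < i%:Z]%SET -> a \in [set j | k j < i%:Z]%SET.
    by rewrite !inE => ab; exact: le_lt_trans (hk a b ab).
  have := downset_card dk j; rewrite inE => ->; rewrite e.
  by rewrite -(downset_card (prescribed_down hd)) inE.
split => [jr|rj]; first by rewrite (h 0%N) jr.
have [d0 _] := hd j j rj (leqnn _); move: (h) => h'.
have {}h i : (k j < i%:Z) = (d j < i%:Z) by rewrite h' ltnNge rj.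
have k0 : 0 <= k j by rewrite leNgt h -leNgt.
move: (k j) (d j) k0 d0 h => [a|//] [b|//] _ _ h; congr Posz; apply/eqP; rewrite eqn_leq.
by apply/andP; split; rewrite -ltnS; [have := h b.+1|have := h a.+1]; rewrite !ltz_nat ltnSn;
  [move=> -> | move=> <-].
Qed.

(** The work is done for [W = z^-N U], whose Toeplitz operator is onto. Multiplying back by [z^N]
    raises the indices by [N], and for the adjoint it is the twist by [z^-N] of
    [ess_hankel_shift]. *)
Lemma factorization_of_full U (N : nat) : Linfty U ->
  aeT (fun t => forall x, vnorm (U t *m x) <= vnorm x) ->
  spdim (qf ip (fun f => Pm (zs (- N%:Z) (mulf U f)))) n ->
  ess_form (@H2 R n) ip (qf ip (fun f => Pm (zs (- N%:Z) (mulf U f)))) ->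
  [/\ unitary_valued U, ess_hankel_lt1 (ctrf U) & exists2 k : 'I_n -> int,
    (forall a b : 'I_n, (a <= b)%N -> k a <= k b) & factored U k].
Proof.
move=> LU cU.
have E : (fun f => Pm (zs (- N%:Z) (mulf U f))) = (fun f : V => Pm (mulf (ztwist (- N%:Z) U) f)).
  by apply/funext => f; rewrite mulf_ztwist.
rewrite E; set W := ztwist (- N%:Z) U => sp hess.
have UE : U = ztwist N%:Z W by rewrite /W -{1}[N%:Z]opprK ztwistK.
have cW : aeT (fun t => forall x, vnorm (W t *m x) <= vnorm x).
  apply: aeT_sub cU => t _ h x; rewrite /W /ztwist -scalemxAl vnormZ cabs_zetaz mul1r.
  exact: h.
have LW : Linfty W by apply: Linfty_contr => // i j; apply: cmeas_ztwist; case: LU.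
have hW := spdim_full_unitary LW cW sp.
have onto := toep_onto hW hess (adj_inj hW sp).
have [d d0 hd] := adj_hankel_bound hW hess onto.
have [m hm] := tkerdim_exists hW hess.
have [k0 hk0] := factor_exists hW hess onto hm.
have [k mono hk] := factored_sort hk0.
split.
- by rewrite UE; exact: unitary_ztwist.
- rewrite UE ctrf_ztwist; exact: (ess_hankel_shift N (unitary_Linfty (unitary_adj hW)) d0 hd).
exists (fun j => k j + N%:Z); first by move=> a b ab; rewrite lerD2r mono.
by rewrite UE; exact: factored_ztwist.
Qed.
End Assembly.

Theorem theorem3p3 (R : realType) (n : nat) (Phi : R -> 'M[complex.complex R]_n) :
  Linfty Phi -> hankel_norm_le Phi 1 -> ess_hankel_lt1 Phi ->
  forall d : 'I_n -> int,
    (forall i j : 'I_n, (nb_sv_one Phi <= i)%N -> (i <= j)%N -> 0 <= d i /\ d i <= d j) ->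
    exists U : R -> 'M[complex.complex R]_n,
      [/\ unitary_interpolant Phi U,
          ess_hankel_lt1 (ctrf U) &
          exists k : 'I_n -> int, WH_factorization U k /\
            forall j : 'I_n, ((j < nb_sv_one Phi)%N -> k j < 0) /\
                             ((nb_sv_one Phi <= j)%N -> k j = d j)].
Proof.
move=> hPhi hn he; have hc := hankel_contractive hPhi hn.
have hess := hankel_ess_form hPhi he.
have [r rn sp] := spdim_exists (K0 := 1) (ip_H2_hform R n)
  (fun f _ => eq_ind_r (fun x => _ <= x) (lexx _) (mul1r _))
  (And3 (mulf_hankel hPhi) hc hess).
have -> := nb_sv_oneE hPhi hc hess rn sp; move=> d hd.
pose s_ i := #|prescribed r d i%:Z|.
(* At level 0 only the first [r] indices are counted, since the others have [d j >= 0]. *)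
have s0 : s_ 0%N = r.
  have e (j : 'I_n) : (j < s_ 0%N)%N = (j < r)%N.
    rewrite -(downset_card (prescribed_down (i := 0) hd)) inE.
    have [//|rj] := ltnP j r; rewrite orFb; apply/negbTE; rewrite -leNgt.
    by case: (hd j j rj (leqnn _)).
  have sn : (s_ 0 <= n)%N by rewrite -[n in leqRHS]card_ord max_card.
  have [lt|lt|//] := ltngtP (s_ 0%N) r.
    by have := e (Ordinal (leq_trans lt rn)); rewrite /= lt ltnn.
  by have := e (Ordinal (leq_trans lt sn)); rewrite /= lt ltnn.
have mono i : (s_ i <= s_ i.+1)%N.
  apply: subset_leq_card; apply/fintype.subsetP => j; rewrite !inE => /orP[->//|h].
  by apply/orP; right; apply: lt_trans h _; rewrite ltz_nat.
have sn i : (s_ i <= n)%N by rewrite -[n in leqRHS]card_ord max_card.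
have nq1 f : H2 f -> nq (@ip R n) (Pm (Defs.mulf Phi f)) <=
    nq (@ip R n) (Defs.mulf (fun=> 1%:M) f).
  by rewrite -[leRHS]/(nq (wform (fun=> 1%:M)) f) wform1; exact: hc.
rewrite -s0 in sp; rewrite -[X in qf X](wform1 R n) in sp hess.
have [U [LU cU hF hU]] := extension (Linfty_cst (1%:M : 'M[complex.complex R]_n)) hPhi nq1 hess sp mono sn.
rewrite wform1 in hU.
have {}cU : aeT (fun t => forall x, vnorm (U t *m x) <= vnorm x).
  by apply: aeT_sub cU => t _ h x; apply: le_trans (h x) _; rewrite mul1mx.
(* [N] exceeds every [d j], so that all [n] indices are counted at level [N]. *)
pose N := (\sum_j absz (d j)).+1.
have sN : s_ N = n.
  rewrite /s_ -[RHS]card_ord; apply: eq_card => j; rewrite !inE.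
  apply/orP; right; rewrite /N (bigD1 j)//=; lia.
have [spN esN] := hU N; rewrite sN in spN.
have [uU heU [k kmono hk]] := factorization_of_full LU cU spN esN.
exists U; split; [by split|exact: heU|exists k; split; first by split].
(* The dimension attached to [z^-i U] is computed twice: it is [s_ i] by construction, and by the
   factorization it is the number of [j] with [k j < i]. *)
apply: (indices_determined rn hd kmono) => i.
have [spi _] := hU i.
have uW := unitary_ztwist (- i%:Z) uU.
have mono' (a b : 'I_n) : (a <= b)%N -> k a - i%:Z <= k b - i%:Z.
  by move=> ab; rewrite lerD2r kmono.
have := factored_spdim uW mono' (factored_ztwist (- i%:Z) hk).
have -> : (fun f => Pm (Defs.mulf (ztwist (- i%:Z) U) f)) = (fun f => Pm (zs (- i%:Z) (Defs.mulf U f))).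
  by apply/funext => f; rewrite mulf_ztwist.
have -> : [set j | k j - i%:Z < 0]%SET = [set j | k j < i%:Z]%SET.
  by apply/finset.setP => j; rewrite !inE subr_lt0.
move=> spk; apply: spdim_unique spk spi; last exact: sn.
by rewrite -[n in leqRHS]card_ord max_card.
Qed.
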